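(* Let $d\ge1$ and let $\rho(x)=\beta e^{-\alpha|x|^2}$ on $\mathbb R^d$ with $\alpha,\beta>0$ such that $\int_{\mathbb R^d}\rho\,dx=1$. Then the operator $T_h$ on $L^2(\mathbb R^d,d\nu_h)$ is compact. Let $0=\mu_0<\mu_1\le\mu_2\le\dots$ denote the eigenvalues of $L_\rho$ on $L^2(\mathbb R^d,dx)$ and $1=\lambda_0(h)>\lambda_1(h)\ge\lambda_2(h)\ge\dots$ those of $T_h$ (in decreasing order, counted with multiplicity). Then for every fixed $K\ge0$ there exist $C>0$ and $h_0>0$ such that for all $h\in(0,h_0]$ and all $k=1,\dots,K$, $$\Big|1-\frac{1}{2(d+2)}\mu_kh^2-\lambda_k(h)\Big|\le Ch^4.$$ Moreover, there exists $\delta_0>0$ (and $C>0$, $h_0>0$) such that for all $h\in(0,h_0]$ and all $\lambda\in[0,\delta_0]$, the number $N(\lambda,h)$ of eigenvalues of $T_h$ in $[1-\lambda,1]$ (counted with multiplicity) satisfies $$N(\lambda,h)\le C(1+\lambda h^{-2})^d.$$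
   Context: For $h>0$, $x\in\mathbb R^d$, $B_h(x)$ is the open Euclidean ball of radius $h$ centered at $x$, $\mu=\rho\,dx$, $m_h(x)=\mu(B_h(x))$. The random walk operator is $T_hf(x)=\frac{1}{m_h(x)}\int_{B_h(x)}f(y)\rho(y)\,dy$. The measure $d\nu_h=\frac{m_h(x)\rho(x)}{Z_h}dx$, with $Z_h>0$ chosen so that $\nu_h$ is a probability measure; $T_h$ is self-adjoint on $L^2(\mathbb R^d,d\nu_h)$. $L_\rho=-\sum_{i=1}^d\partial_{x_i}^2+V(x)$ with $V=\frac{\sum_i\partial_{x_i}^2\rho}{\rho}$; for this Gaussian $\rho$, $L_\rho=-\sum_i\partial_{x_i}^2+4\alpha^2|x|^2-2d\alpha$, with discrete spectrum $4\alpha\mathbb N$. *)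

(* Defs.v *)
(* Points of R^d are d-tuples of reals
   (n.-tuple R carries the product (= Borel) sigma-algebra in mathcomp-analysis). *)
From HB Require Import structures.
From mathcomp Require Import all_boot all_order all_algebra.
From mathcomp Require Import all_classical all_reals all_analysis.
Set Implicit Arguments. Unset Strict Implicit. Unset Printing Implicit Defensive.
Import Order.TTheory GRing.Theory Num.Theory.
Local Open Scope classical_set_scope.
Local Open Scope ring_scope.

Section Defs.
Variable R : realType.

(* d-dimensional Lebesgue integral of a nonnegative function, as the iterated
   one-dimensional Lebesgue integral (Tonelli) *)
Fixpoint leb_int (n : nat) : (n.-tuple R -> \bar R) -> \bar R :=
  match n return (n.-tuple R -> \bar R) -> \bar R with
  | 0 => fun f => f [tuple]
  | n'.+1 => fun f =>
      (\int[@lebesgue_measure R]_(x in [set: R])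
          leb_int (fun t : n'.-tuple R => f (cons_tuple x t)))%E
  end.

Variable d : nat.
Notation pt := (d.-tuple R).
Notation fn := (pt -> R).

Definition Rint (f : fn) : R :=
  fine (leb_int (fun x => (Num.max (f x) 0)%:E))
  - fine (leb_int (fun x => (Num.max (- f x) 0)%:E)).

Definition tsub (x y : pt) : pt := [tuple tnth x i - tnth y i | i < d].
Definition tnorm (x : pt) : R := Num.sqrt (\sum_(i < d) tnth x i ^+ 2).

Definition gauss (alpha beta : R) : fn :=
  fun x => beta * expR (- alpha * tnorm x ^+ 2).

Definition mh (rho : fn) (h : R) (x : pt) : R :=
  fine (leb_int (fun y => (if tnorm (tsub y x) < h then rho y else 0)%:E)).

Definition Th (rho : fn) (h : R) (f : fn) : fn :=
  fun x => (mh rho h x)^-1 * Rint (fun y => if tnorm (tsub y x) < h then f y * rho y else 0).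

Definition Zh (rho : fn) (h : R) : R :=
  fine (leb_int (fun x => (mh rho h x * rho x)%:E)).
Definition nu_w (rho : fn) (h : R) : fn :=
  fun x => mh rho h x * rho x / Zh rho h.

Definition L2 (w : fn) (f : fn) : Prop :=
  measurable_fun [set: pt] f /\
  (leb_int (fun x => (w x * f x ^+ 2)%:E) < +oo)%E.
Definition norm2 (w : fn) (f : fn) : R :=
  Num.sqrt (fine (leb_int (fun x => (w x * f x ^+ 2)%:E))).
Definition ae_zero (w : fn) (f : fn) : Prop :=
  leb_int (fun x => (w x * `|f x|)%:E) = 0%E.

Definition compact_op (w : fn) (A : fn -> fn) : Prop :=
  (forall f, L2 w f -> L2 w (A f)) /\
  forall u : nat -> fn, (forall n, L2 w (u n)) ->
    (exists M : R, forall n, norm2 w (u n) <= M) ->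
    exists phi : nat -> nat, (forall n, (phi n < phi n.+1)%N) /\
      forall e : R, 0 < e -> exists N : nat, forall m n, (N <= m)%N -> (N <= n)%N ->
        norm2 w (fun x => A (u (phi m)) x - A (u (phi n)) x) < e.

(* "the eigenvalues of A (on the domain Dom in L^2(w dx)) lying in S, counted
   with multiplicity, are at least n in number": there are n linearly
   independent (modulo a.e. equality) eigenfunctions with eigenvalues in S *)
Definition ev_count_ge (w : fn) (Dom : fn -> Prop) (A : fn -> fn)
    (S : set R) (n : nat) : Prop :=
  exists (f : 'I_n -> fn) (lam : 'I_n -> R),
    (forall i, Dom (f i) /\ S (lam i) /\
       ae_zero w (fun x => A (f i) x - lam i * f i x)) /\
    (forall c : 'I_n -> R, ae_zero w (fun x => \sum_(i < n) c i * f i x) ->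
       forall i, c i = 0).

Definition tshift (x : pt) (i : 'I_d) (s : R) : pt :=
  [tuple (if j == i then tnth x j + s else tnth x j) | j < d].
Definition pd (i : 'I_d) (f : fn) : fn :=
  fun x => derive1 (fun s => f (tshift x i s)) 0.
Definition tcont (f : fn) : Prop :=
  forall x (e : R), 0 < e -> exists del : R, 0 < del /\
    forall y, tnorm (tsub y x) < del -> `|f y - f x| < e.
Definition C2 (f : fn) : Prop :=
  tcont f /\
  (forall i x, derivable (fun s => f (tshift x i s)) 0 1) /\
  (forall i, tcont (pd i f)) /\
  (forall i j x, derivable (fun s => pd j f (tshift x i s)) 0 1) /\
  (forall i j, tcont (pd i (pd j f))).
Definition lap (f : fn) : fn := fun x => \sum_(i < d) pd i (pd i f) x.

Definition Lrho (rho : fn) (f : fn) : fn :=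
  fun x => - lap f x + (lap rho x / rho x) * f x.

(* eigenvalues of T_h on L^2(nu_h), decreasing, with multiplicity:
   lam_k = sup { t | at least k+1 eigenvalues >= t } *)
Definition lamT (rho : fn) (h : R) (k : nat) : R :=
  sup [set t | ev_count_ge (nu_w rho h) (L2 (nu_w rho h)) (Th rho h)
                 [set s | t <= s] k.+1].

(* eigenvalues of L_rho on L^2(dx), increasing, with multiplicity
   (eigenfunctions: C^2 functions in L^2(dx)) *)
Definition muL (rho : fn) (k : nat) : R :=
  inf [set t | ev_count_ge (fun _ => 1) (fun f => L2 (fun _ => 1) f /\ C2 f)
                 (Lrho rho) [set s | s <= t] k.+1].

Definition NT_le (rho : fn) (h lam M : R) : Prop :=
  forall n : nat, ev_count_ge (nu_w rho h) (L2 (nu_w rho h)) (Th rho h)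
                    [set s | 1 - lam <= s <= 1] n -> n%:R <= M.

End Defs.

(* Main.v *)
(** Conjugation by sqrt(vh) * exp(-al |x|^2), where vh(x) is the ball average
    of exp(-al |y|^2) normalized by its value at x, turns T_h into the operator
    a B_h a on L^2(dx), with B_h the convolution with the indicator of the ball
    of radius h and a = vh^(-1/2).  As vh grows at infinity, a decays and this
    operator is compact.
    Lower bounds on the eigenvalues come from quasimodes: a Taylor expansion
    gives B_h psi = tau vh psi + O(h^4) for the Hermite functions psi, with
    tau = 1 - (4 al n) h^2 / (2 (d + 2)).
    Upper bounds compare the form of 1 - B_h with that of a Gaussian convolution
    of much larger width: the indicator of the ball dominates it up to the factor
    of the second moments.  After an IMS localization that Gaussian is the Mehler
    kernel, whose spectrum is explicit, and counting the multi-indices of degree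
    at most n bounds the number of eigenvalues of T_h.
    The eigenvalues of L_rho are found directly: integration by parts against
    cut-off Hermite functions shows that an L^2 eigenfunction of eigenvalue mu is
    orthogonal to the Hermite functions of other eigenvalues, and these are
    complete because the Mehler kernel is an approximate identity. *)
Require Import Defs.
From HB Require Import structures.
From mathcomp Require Import all_boot all_order all_algebra.
From mathcomp Require Import mathcomp_extra real_interval measurable_realfun tvs.
From mathcomp Require Import all_classical all_reals all_analysis.
From mathcomp Require Import ring lra.
Set Implicit Arguments. Unset Strict Implicit. Unset Printing Implicit Defensive.
Import Order.TTheory GRing.Theory Num.Theory.
Import numFieldNormedType.Exports.
Local Open Scope classical_set_scope.
Local Open Scope ring_scope.

(** The order [h^4] comes from the quasimodes alone, for upper as well as lower bounds. The
    comparison of forms only resolves half a level spacing, of order [h^2]; but eigenvectors lying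
    slightly above a level can be completed by the quasimodes of that level, and the crude count of
    the enlarged family then excludes a surplus of them. The obstacle is that the indicator of a
    ball has no explicit spectrum in the presence of the weight. The comparison with a Gaussian uses
    only that [||g - g(. + z)||^2] grows at most quadratically along integer multiples of [z], so no
    regularity of eigenfunctions enters. Its constant is sharp up to a relative error of order
    [h / sigma], [sigma] being the width of the Gaussian. For a fixed level [sigma] does not depend
    on [h]; for the bound on [N(lambda, h)] it is of order [(1 + lambda / h^2)^(-1/2)], and
    [lambda <= delta0] keeps [h] below it. Completeness of the Hermite functions is never an input:
    the Hilbert-Schmidt norm of the Mehler kernel squared equals the sum of the squares of its known
    eigenvalues, so nothing else is left in its spectrum. *)

Ltac lin := intros; lra.

(** * Spectral theory of compact symmetric operators *)

Section SemiInnerProduct.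
Variables (R : realType) (V : lmodType R) (ip : V -> V -> R).
Hypothesis ipC : forall u v, ip u v = ip v u.
Hypothesis ipP : forall a u v w, ip (a *: u + v) w = a * ip u w + ip v w.
Hypothesis ip_ge0 : forall u, 0 <= ip u u.

Lemma ip0l w : ip 0 w = 0.
Proof. by have := ipP (-1) 0 0 w; rewrite scaler0 addr0; lin. Qed.
Lemma ipZl a u w : ip (a *: u) w = a * ip u w.
Proof. by have := ipP a u 0 w; rewrite !addr0 ip0l addr0. Qed.
Lemma ipDl u v w : ip (u + v) w = ip u w + ip v w.
Proof. by have := ipP 1 u v w; rewrite scale1r mul1r. Qed.
Lemma ipBl u v w : ip (u - v) w = ip u w - ip v w.
Proof. by rewrite ipDl -scaleN1r ipZl mulN1r. Qed.
Lemma ip0r w : ip w 0 = 0. Proof. by rewrite ipC ip0l. Qed.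
Lemma ipZr a u w : ip w (a *: u) = a * ip w u.
Proof. by rewrite ipC ipZl ipC. Qed.
Lemma ipDr u v w : ip w (u + v) = ip w u + ip w v.
Proof. by rewrite ipC ipDl !(ipC w). Qed.
Lemma ipBr u v w : ip w (u - v) = ip w u - ip w v.
Proof. by rewrite ipC ipBl !(ipC w). Qed.
Lemma ip_suml (I : Type) (r : seq I) (P : pred I) (F : I -> V) w :
  ip (\sum_(i <- r | P i) F i) w = \sum_(i <- r | P i) ip (F i) w.
Proof. by apply: (big_morph (ip^~ w)); [move=> ? ?; exact: ipDl|exact: ip0l]. Qed.
Lemma ip_sumr (I : Type) (r : seq I) (P : pred I) (F : I -> V) w :
  ip w (\sum_(i <- r | P i) F i) = \sum_(i <- r | P i) ip w (F i).
Proof. by apply: (big_morph (ip w)); [move=> ? ?; exact: ipDr|exact: ip0r]. Qed.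

(** The form is only semidefinite. When [ip u u] vanishes, the square norm of [s u + v] is affine in
    [s] and nonnegative, which forces [ip u v = 0]; otherwise the usual projection argument
    applies. *)
Lemma ip_CS2 u v : ip u v ^+ 2 <= ip u u * ip v v.
Proof.
have [u0|u0] := eqVneq (ip u u) 0.
  have H s : 0 <= 2 * s * ip u v + ip v v.
    have := ip_ge0 (s *: u + v).
    by rewrite ipP ipDr ipDr !ipZr u0 (ipC v u); lin.
  have [w0|w0] := eqVneq (ip u v) 0; first by rewrite w0 u0 mul0r expr0n.
  have := H (- (ip v v + 1) / (2 * ip u v)).
  have -> : 2 * (- (ip v v + 1) / (2 * ip u v)) * ip u v = - (ip v v + 1) by field.
  lin.
have q0 : 0 < ip u u by rewrite lt_def u0 ip_ge0.
have := ip_ge0 (ip u u *: v - ip u v *: u).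
rewrite ipBl !ipBr !ipZl !ipZr (ipC v u).
have -> : ip u u * (ip u u * ip v v) - ip u u * (ip u v * ip u v) -
   (ip u v * (ip u u * ip u v) - ip u v * (ip u v * ip u u)) =
   ip u u * (ip u u * ip v v - ip u v ^+ 2) by ring.
by rewrite pmulr_rge0// subr_ge0.
Qed.

Definition nrm u := Num.sqrt (ip u u).
Lemma nrm_ge0 u : 0 <= nrm u. Proof. exact: sqrtr_ge0. Qed.
Lemma nrm2 u : nrm u ^+ 2 = ip u u. Proof. exact: sqr_sqrtr. Qed.
Lemma nrm_eq0 u : (nrm u == 0) = (ip u u == 0).
Proof. by rewrite -nrm2 sqrf_eq0. Qed.
Lemma ip_CS u v : `|ip u v| <= nrm u * nrm v.
Proof.
rewrite -ler_sqr ?nnegrE ?mulr_ge0 ?nrm_ge0// real_normK ?num_real//.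
by rewrite exprMn !nrm2 ip_CS2.
Qed.
Lemma nrmZ a u : nrm (a *: u) = `|a| * nrm u.
Proof. by rewrite /nrm ipZl ipZr mulrA -expr2 sqrtrM ?sqr_ge0// sqrtr_sqr. Qed.
Lemma nrmN u : nrm (- u) = nrm u.
Proof. by rewrite -scaleN1r nrmZ normrN1 mul1r. Qed.
Lemma nrmD u v : nrm (u + v) <= nrm u + nrm v.
Proof.
rewrite -ler_sqr ?nnegrE ?addr_ge0 ?nrm_ge0// nrm2 ipDl !ipDr (ipC v u) sqrrD !nrm2.
have := ip_CS u v; have := ler_norm (ip u v); lin.
Qed.
Lemma nrmB u v : nrm (u - v) <= nrm u + nrm v.
Proof. by rewrite -(nrmN v); exact: nrmD. Qed.
Lemma ip0_nrm u v : nrm u = 0 -> ip u v = 0.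
Proof.
by move=> u0; have := ip_CS u v; rewrite u0 mul0r normr_le0 => /eqP.
Qed.
Lemma ip_congr0 u u' v : nrm (u - u') = 0 -> ip u v = ip u' v.
Proof. by move=> /(@ip0_nrm _ v); rewrite ipBl; lin. Qed.

Local Notation comb F c := (\sum_i c i *: F i).

Definition orthonormal n (e : 'I_n -> V) :=
  forall i j, ip (e i) (e j) = (i == j)%:R.
(** Independence modulo vectors of zero seminorm: the elements of [V] will be functions, not classes
    modulo a.e. equality, so [nrm u = 0] does not give [u = 0]. *)
Definition independent n (F : 'I_n -> V) :=
  forall c : 'I_n -> R, nrm (\sum_i c i *: F i) = 0 -> forall i, c i = 0.

Lemma orthonormal_coef n (e : 'I_n -> V) (c : 'I_n -> R) i :
  orthonormal e -> ip (\sum_i c i *: e i) (e i) = c i.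
Proof.
move=> oe; rewrite ip_suml (bigD1 i)//= ipZl oe eqxx mulr1.
rewrite big1 ?addr0// => j /negPf ji.
by rewrite ipZl oe ji mulr0.
Qed.
Lemma orthonormal_sqr n (e : 'I_n -> V) (a b : 'I_n -> R) : orthonormal e ->
  ip (\sum_i a i *: e i) (\sum_i b i *: e i) = \sum_i a i * b i.
Proof.
move=> oe; rewrite ip_sumr; apply: eq_bigr => i _.
by rewrite ipZr orthonormal_coef// mulrC.
Qed.
Lemma orthonormal_independent n (e : 'I_n -> V) : orthonormal e -> independent e.
Proof.
by move=> oe c c0 i; rewrite -(orthonormal_coef c i oe) ip0_nrm.
Qed.

Lemma kernel_combination (n N : nat) (L : 'I_n -> 'I_N -> R) : (N < n)%N ->
  exists c : 'I_n -> R, (exists i, c i != 0) /\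
    forall j, \sum_i c i * L i j = 0.
Proof.
move=> Nn; pose M := \matrix_(i < n, j < N) L i j.
have : kermx M != 0.
  rewrite -mxrank_eq0 mxrank_ker subn_eq0 -ltnNge.
  exact: leq_ltn_trans (rank_leq_col _) Nn.
move=> /rowV0Pn[u uM u0].
exists (u 0); split.
  by have /rV0Pn[i ui] := u0; exists i.
move=> j; have /sub_kermxP/matrixP/(_ 0 j) := uM; rewrite !mxE => h.
by rewrite -[RHS]h; apply: eq_bigr => i _; rewrite mxE.
Qed.

Lemma independent_kernel (n N : nat) (F : 'I_n -> V) (l : 'I_N -> V -> R) :
  independent F ->
  (forall j c, l j (\sum_i c i *: F i) = \sum_i c i * l j (F i)) ->
  (N < n)%N ->
  exists c : 'I_n -> R, nrm (comb F c) != 0 /\ forall j, l j (comb F c) = 0.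
Proof.
move=> indF ll Nn.
have [c [[i ci] cL]] := kernel_combination (fun i j => l j (F i)) Nn.
exists c; split; last by move=> j; rewrite ll cL.
by apply: contra ci => /eqP/indF ->.
Qed.

Variable T : V -> V.
Hypothesis TP : forall a u v, T (a *: u + v) = a *: T u + T v.
Hypothesis TC : forall u v, ip (T u) v = ip u (T v).

Lemma opZ a u : T (a *: u) = a *: T u.
Proof.
have T0 : T 0 = 0.
  by have := TP (-1) 0 0; rewrite scaler0 addr0 scaleN1r addNr.
by have := TP a u 0; rewrite T0 !addr0.
Qed.
Lemma opD u v : T (u + v) = T u + T v.
Proof. by have := TP 1 u v; rewrite !scale1r. Qed.
Lemma op0 : T 0 = 0. Proof. by have := opZ 0 0; rewrite !scale0r. Qed.
Lemma opB u v : T (u - v) = T u - T v.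
Proof. by rewrite -scaleN1r opD opZ scaleN1r. Qed.
Lemma op_sum (I : Type) (r : seq I) (P : pred I) (F : I -> V) :
  T (\sum_(i <- r | P i) F i) = \sum_(i <- r | P i) T (F i).
Proof. by apply: (big_morph T); [exact: opD|exact: op0]. Qed.

Definition eigvec (l : R) u := nrm (T u - l *: u) = 0.

Lemma eigvec_ip l u v : eigvec l u -> ip (T u) v = l * ip u v.
Proof. by move=> h; rewrite (ip_congr0 v h) ipZl. Qed.

Lemma eigvec_orth l m u v : eigvec l u -> eigvec m v -> l != m -> ip u v = 0.
Proof.
move=> ul vm lm; have h1 := eigvec_ip v ul.
have h2 : ip (T u) v = m * ip u v by rewrite TC ipC (eigvec_ip u vm) ipC.
have : (l - m) * ip u v = 0 by rewrite mulrBl -h1 -h2 subrr.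
by move/eqP; rewrite mulf_eq0 subr_eq0 (negPf lm)/= => /eqP.
Qed.

(* On the span, [<(T - t) f, f>] is the square norm of the combination with
   coefficients [c_i (lam_i - t)^(1/2)]. *)
Lemma eig_form_ge n (f : 'I_n -> V) (lam : 'I_n -> R) t (c : 'I_n -> R) :
  (forall i, t <= lam i) -> (forall i, eigvec (lam i) (f i)) ->
  t * ip (comb f c) (comb f c) <= ip (T (comb f c)) (comb f c).
Proof.
move=> lt ef; set g := comb f c.
pose s i := Num.sqrt (lam i - t).
have := ip_ge0 (\sum_i (s i * c i) *: f i).
suff -> : ip (\sum_i (s i * c i) *: f i) (\sum_i (s i * c i) *: f i)
    = ip (T g) g - t * ip g g by lin.
rewrite -ipZl -ipBl /g op_sum scaler_sumr -sumrB !ip_suml.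
apply: eq_bigr => i _; rewrite !ip_sumr; apply: eq_bigr => j _.
rewrite !(ipBl, ipZl, ipZr, opZ) (eigvec_ip _ (ef i)).
have [e|ne] := eqVneq (lam i) (lam j); last first.
  by rewrite (eigvec_orth (ef i) (ef j) ne); ring.
have sE : s i * s j = lam i - t.
  by rewrite /s -e -expr2 sqr_sqrtr// subr_ge0.
transitivity (s i * s j * (c i * c j * ip (f i) (f j))); first ring.
by rewrite sE; ring.
Qed.

Hypothesis Tbd : exists2 K, 0 <= K & forall u, nrm (T u) <= K * nrm u.
Hypothesis Tcpt : forall u : nat -> V, (exists M, forall n, nrm (u n) <= M) ->
  exists (phi : nat -> nat) (v : V), (forall n, (phi n < phi n.+1)%N) /\
    forall e : R, 0 < e -> exists N : nat, forall n, (N <= n)%N ->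
      nrm (T (u (phi n)) - v) < e.

(** A maximizing sequence of the Rayleigh quotient on the closed invariant subspace [E] is almost an
    eigenvector for the supremum [M]. Compactness makes [T u_n] converge along a subsequence, hence
    [M u_n] too, and [M >= t > 0] can be divided out. Completeness of [V] is replaced by the limit
    that [Tcpt] supplies. *)
Lemma rayleigh_max (t : R) (E : V -> Prop) :
  0 < t ->
  (forall a u v, E u -> E v -> E (a *: u + v)) -> (forall u, E u -> E (T u)) ->
  (forall (v : V), (forall e : R, 0 < e -> exists2 u, E u & nrm (u - v) < e) -> E v) ->
  (exists u0, [/\ E u0, nrm u0 != 0 & t * ip u0 u0 <= ip (T u0) u0]) ->
  exists e lam, [/\ E e, ip e e = 1, t <= lam & eigvec lam e].
Proof.
move=> t0 EP ET Ecl [u0 [Eu0 nu0 tu0]].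
have [K K0 TK] := Tbd.
have EZ a u : E u -> E (a *: u).
  move=> Eu; have E0 : E 0 by have := EP (-1) u u Eu Eu; rewrite scaleN1r addNr.
  by rewrite -[a *: u]addr0; exact: EP.
pose Q := [set ip (T u) u | u in [set u | E u /\ ip u u = 1]].
have Qub : ubound Q K.
  move=> _ [u [Eu u1] <-].
  apply: le_trans (ler_norm _) _; apply: le_trans (ip_CS _ _) _.
  have nu : nrm u = 1 by rewrite /nrm u1 sqrtr1.
  by have := TK u; rewrite nu !mulr1.
have normalize u : E u -> nrm u != 0 ->
    Q (ip (T u) u / ip u u) .
  move=> Eu nu; exists ((nrm u)^-1 *: u) => /=.
    split; first exact: EZ.
    by rewrite ipZl ipZr mulrA -nrm2 -expr2 -exprMn mulVf ?expr1n.
  by rewrite opZ ipZl ipZr mulrA -expr2 exprVn nrm2 mulrC.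
pose M := sup Q.
have hsQ : has_sup Q by split; [exists (ip (T u0) u0 / ip u0 u0); exact: normalize|exists K].
have q0 u : nrm u != 0 -> 0 < ip u u.
  by move=> nu; rewrite lt_def ip_ge0 -nrm_eq0 nu.
have tM : t <= M.
  apply: (@le_trans _ _ (ip (T u0) u0 / ip u0 u0)).
    by rewrite ler_pdivlMr// q0.
  by apply: sup_upper_bound => //; exact: normalize.
have M0 : 0 < M by exact: lt_le_trans tM.
have formle u : E u -> ip (T u) u <= M * ip u u.
  move=> Eu; have [n0|n0] := eqVneq (nrm u) 0.
    rewrite (ipC _ u) (ip0_nrm (T u) n0).
    by rewrite (ip0_nrm u n0) mulr0.
  rewrite -ler_pdivrMr ?q0//.
  by apply: sup_upper_bound => //; exact: normalize.
have [u uP] : exists u : nat -> V, forall n, [/\ E (u n), ip (u n) (u n) = 1 &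
    M - n.+1%:R^-1 < ip (T (u n)) (u n)].
  have /choice[u uP] : forall n : nat, exists u, [/\ E u, ip u u = 1 &
      M - n.+1%:R^-1 < ip (T u) u].
    move=> n; have e0 : (0 : R) < n.+1%:R^-1 by rewrite invr_gt0.
    by have [_ [u [Eu u1] <-] lt] := sup_adherent e0 hsQ; exists u; split.
  by exists u.
have [r rE] : exists r : nat -> V, forall n, r n = M *: u n - T (u n) by eexists.
have Er n : E (r n).
  have [Eu _ _] := uP n.
  by rewrite rE -scaleN1r addrC; apply: EP; [exact: ET|exact: EZ].
have rle n : ip (r n) (r n) <= (M + K) * n.+1%:R^-1.
  have [Eu u1 lu] := uP n.
  (* Cauchy-Schwarz for the form [M - T] on [E], applied to [u n] and [r n] *)
  pose b x y := M * ip x y - ip (T x) y.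
  have bge x : E x -> 0 <= b x x by move=> /formle; rewrite /b; lin.
  have brr : b (r n) (r n) <= (M + K) * ip (r n) (r n).
    rewrite /b; have := ip_CS (T (r n)) (r n).
    have := ler_norm (- ip (T (r n)) (r n)); rewrite normrN => h1 h2.
    have h3 : nrm (T (r n)) * nrm (r n) <= K * ip (r n) (r n).
      by rewrite -nrm2 expr2 mulrA; apply: ler_wpM2r; [exact: nrm_ge0|exact: TK].
    lin.
  have bur : b (u n) (r n) = ip (r n) (r n).
    by rewrite /b -ipZl -ipBl -rE.
  have buu : b (u n) (u n) <= n.+1%:R^-1 by rewrite /b u1 mulr1 lerBlDr addrC -lerBlDr ltW.
  have key s : 0 <= s ^+ 2 * n.+1%:R^-1 + 2 * s * ip (r n) (r n) + (M + K) * ip (r n) (r n).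
    have := bge (s *: u n + r n) (EP _ _ _ Eu (Er n)).
    have -> : b (s *: u n + r n) (s *: u n + r n) =
      s ^+ 2 * b (u n) (u n) + 2 * s * b (u n) (r n) + b (r n) (r n).
      rewrite /b TP !(ipDl, ipDr, ipZl, ipZr) (ipC (r n) (u n)) (TC (r n) (u n)) (ipC (r n) (T (u n))).
      ring.
    rewrite bur => h; apply: le_trans h _.
    by rewrite lerD// lerD2r ler_wpM2l ?sqr_ge0.
  (* At this [s] the quadratic becomes [(M + K) ((M + K) / (n + 1) - X)], whose sign is the required
     bound on [X]. *)
  have := key (- (M + K)).
  set X := ip (r n) (r n); have X0 : 0 <= X by exact: ip_ge0.
  set i := n.+1%:R^-1.
  have -> : (- (M + K)) ^+ 2 * i + 2 * - (M + K) * X + (M + K) * X =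
    (M + K) * ((M + K) * i - X) by ring.
  by rewrite pmulr_rge0 ?subr_ge0// ltr_wpDr.
have [phi [v [phiS phiv]]] : exists (phi : nat -> nat) (v : V), (forall n, (phi n < phi n.+1)%N) /\
    forall e : R, 0 < e -> exists N : nat, forall n, (N <= n)%N ->
      nrm (T (u (phi n)) - v) < e.
  apply: Tcpt; exists 1 => n; have [_ u1 _] := uP n.
  by rewrite /nrm u1 sqrtr1.
have phige n : (n <= phi n)%N.
  elim: n => // n IH; exact: leq_ltn_trans IH (phiS n).
have rsmall (e : R) : 0 < e -> exists N : nat, forall n, (N <= n)%N -> nrm (r (phi n)) < e.
  move=> e0; have MK : 0 < M + K by exact: ltr_wpDr.
  exists (Num.truncn ((M + K) / e ^+ 2)).+1 => n Nn.
  rewrite -ltr_sqr ?nnegrE ?nrm_ge0 ?ltW// nrm2.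
  apply: le_lt_trans (rle _) _.
  rewrite ltr_pdivrMr//.
  rewrite mulrC -ltr_pdivrMr ?exprn_gt0//.
  apply: (@lt_le_trans _ _ (Num.truncn ((M + K) / e ^+ 2)).+1%:R).
    exact: truncnS_gt.
  by rewrite ler_nat; apply: leq_trans Nn _; apply: leq_trans (phige n) _.
have Muv (e : R) : 0 < e -> exists N : nat, forall n, (N <= n)%N -> nrm (M *: u (phi n) - v) < e.
  move=> e0; have e2 : 0 < e / 2 by lin.
  have [N1 H1] := rsmall _ e2; have [N2 H2] := phiv _ e2.
  exists (maxn N1 N2) => n; rewrite geq_max => /andP[n1 n2].
  have -> : M *: u (phi n) - v = r (phi n) + (T (u (phi n)) - v).
    by rewrite rE addrA subrK.
  have := nrmD (r (phi n)) (T (u (phi n)) - v); have := H1 n n1; have := H2 n n2; lin.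
have small0 (x : R) : (forall e : R, 0 < e -> x < e) -> 0 <= x -> x = 0.
  move=> h x0; apply/eqP; rewrite eq_le x0 andbT.
  by apply/ler_addgt0Pr => e e0; rewrite add0r ltW// h.
have Ev : E v.
  apply: Ecl => e e0; have [N NP] := Muv e e0.
  exists (M *: u (phi N)); last exact: NP.
  by have [Eu _ _] := uP (phi N); exact: EZ.
have nuphi n : nrm (M *: u (phi n)) = M.
  have [_ u1 _] := uP (phi n).
  by rewrite nrmZ /nrm u1 sqrtr1 mulr1 gtr0_norm.
have nv : nrm v = M.
  suff : `|M - nrm v| = 0 by move/eqP; rewrite normr_eq0 subr_eq0 => /eqP.
  apply: small0 => // e e0; have [N NP] := Muv e e0; have {NP} := NP N (leqnn _).
  have h1 := nrmD (M *: u (phi N) - v) v; have h2 := nrmB (M *: u (phi N)) (M *: u (phi N) - v).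
  have e2 (x y : V) : x - (x - y) = y by rewrite opprB addrC subrK.
  move: h1 h2; rewrite subrK e2 nuphi => h1 h2 h3.
  by rewrite ltr_norml; apply/andP; split; lin.
have Tv : eigvec M v.
  apply: small0; last exact: nrm_ge0.
  move=> e e0.
  (* [K + 1] rather than [K], which may be zero. *)
  have [N1 H1] := Muv (e / (2 * (K + 1))) ltac:(by apply: divr_gt0; lin).
  have [N2 H2] := phiv (e / (2 * M)) ltac:(by apply: divr_gt0; lin).
  pose n := maxn N1 N2.
  have {}H1 := H1 n (leq_maxl _ _); have {}H2 := H2 n (leq_maxr _ _).
  have -> : T v - M *: v = M *: (T (u (phi n)) - v) - T (M *: u (phi n) - v).
    by rewrite opB opZ scalerBr opprB [RHS]addrC subrKA.
  apply: le_lt_trans (nrmB _ _) _.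
  rewrite nrmZ gtr0_norm//.
  have h3 : M * nrm (T (u (phi n)) - v) < e / 2.
    have -> : e / 2 = M * (e / (2 * M)) by field; rewrite gt_eqF.
    by rewrite ltr_pM2l.
  have h4 : nrm (T (M *: u (phi n) - v)) <= e / 2.
    apply: le_trans (TK _) _.
    have -> : e / 2 = (K + 1) * (e / (2 * (K + 1))).
      by field; rewrite gt_eqF//; lin.
    by apply: ler_pM => //; [exact: nrm_ge0|lra|exact: ltW].
  lin.
exists (M^-1 *: v), M; split => //; first exact: EZ.
  by rewrite ipZl ipZr -nrm2 nv mulrA -expr2 -exprMn mulVf ?gt_eqF// expr1n.
by rewrite /eigvec opZ scalerA mulrC -scalerA -scalerBr nrmZ Tv mulr0.
Qed.

(** Eigenvectors are found one at a time. The orthogonal complement of the [j < n] previous ones is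
    closed and invariant, and by a dimension count it meets the span of [F] in a non-null vector,
    whose Rayleigh quotient is at least [t]. *)
Theorem minmax_eigvec n (F : 'I_n -> V) (t : R) : 0 < t -> independent F ->
  (forall c, t * ip (comb F c) (comb F c) <= ip (T (comb F c)) (comb F c)) ->
  exists (e : 'I_n -> V) (lam : 'I_n -> R), orthonormal e /\
    forall i, t <= lam i /\ eigvec (lam i) (e i).
Proof.
move=> t0 indF formF.
suff H j : (j <= n)%N -> exists (e : 'I_j -> V) (lam : 'I_j -> R), orthonormal e /\
    forall i, t <= lam i /\ eigvec (lam i) (e i) by exact: H.
elim: j => [_|j IH jn].
  by exists (fun _ => 0), (fun _ => 0); split; case.
have [e [lam [oe eP]]] := IH (ltnW jn).
pose E u := forall i, ip u (e i) = 0.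
have := @rayleigh_max t E t0; case.
- by move=> a u v Eu Ev i; rewrite ipP Eu Ev mulr0 addr0.
- by move=> u Eu i; rewrite TC ipC (eigvec_ip _ (eP i).2) ipC Eu mulr0.
- move=> v vcl i; apply/eqP; rewrite -normr_le0; apply/ler_addgt0Pr => eps eps0.
  have [u Eu uv] := vcl eps eps0; rewrite add0r.
  have -> : ip v (e i) = - ip (u - v) (e i) by rewrite ipBl Eu; ring.
  rewrite normrN; apply: le_trans (ip_CS _ _) _.
  by rewrite {2}/nrm oe eqxx sqrtr1 mulr1 ltW.
- have [c [nf fE]] := @independent_kernel n j F (fun i u => ip u (e i)) indF
    ltac:(by move=> i c; rewrite /= ip_suml; apply: eq_bigr => k _; rewrite ipZl) jn.
  by exists (\sum_i c i *: F i); split.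
move=> e' [lam' [Ee' e'1 tl' ee']].
exists (fun i : 'I_j.+1 => if unlift ord0 i is Some k then e k else e').
exists (fun i : 'I_j.+1 => if unlift ord0 i is Some k then lam k else lam').
split.
  move=> i k; case: (unliftP ord0 i) => [i' ->|->]; case: (unliftP ord0 k) => [k' ->|->].
  - by rewrite oe (inj_eq lift_inj).
  - by rewrite ipC Ee' eq_sym (negPf (neq_lift _ _)).
  - by rewrite Ee' (negPf (neq_lift _ _)).
  - by rewrite e'1 eqxx.
by move=> i; case: unliftP => [i' _|_]//; exact: eP.
Qed.

(** No Gram-Schmidt inside eigenspaces: the form is at least [t] on the span by [eig_form_ge], and
    min-max returns an orthonormal family. *)
Lemma orthonormal_eigvec n (f : 'I_n -> V) (lam : 'I_n -> R) t : 0 < t ->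
  independent f -> (forall i, t <= lam i /\ eigvec (lam i) (f i)) ->
  exists (e : 'I_n -> V) (lam : 'I_n -> R), orthonormal e /\
    forall i, t <= lam i /\ eigvec (lam i) (e i).
Proof.
move=> t0 indf fP; apply: (minmax_eigvec t0 indf) => c.
by apply: (eig_form_ge (lam := lam)) => i; have [] := fP i.
Qed.

(** The margin [2 eps] above [tau] keeps true eigenvectors away from quasimodes: their normalized
    scalar product is at most [eps / (2 eps) = 1/2]. The two families are then jointly independent,
    and the form on their span stays above [tau - 3 eps]. This adds a whole level without losing
    multiplicity. *)
Theorem quasimode_eigvec (N p : nat) (e : 'I_N -> V) (lam : 'I_N -> R)
    (F : 'I_p -> V) (tau eps : R) : 0 < eps -> 0 < tau - 3 * eps ->
  orthonormal e ->
  (forall i, tau + 2 * eps <= lam i /\ eigvec (lam i) (e i)) ->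
  independent F ->
  (forall c, nrm (T (comb F c) - tau *: comb F c) <= eps * nrm (comb F c)) ->
  exists (e' : 'I_(N + p) -> V) (lam' : 'I_(N + p) -> R), orthonormal e' /\
    forall i, tau - 3 * eps <= lam' i /\ eigvec (lam' i) (e' i).
Proof.
move=> eps0 t0 oe eP indF FQ.
pose G (i : 'I_(N + p)) := match fintype.split i with inl k => e k | inr k => F k end.
have GE c : \sum_i c i *: G i = (\sum_(i < N) c (lshift p i) *: e i) +
    (\sum_(i < p) c (rshift N i) *: F i).
  rewrite big_split_ord/=; congr (_ + _); apply: eq_bigr => i _; rewrite /G.
    by rewrite -[lshift p i]/(unsplit (inl i)) unsplitK.
  by rewrite -[rshift N i]/(unsplit (inr i)) unsplitK.
(* [u' = (T - tau)^-1 u] gives [<u, f> = <u', (T - tau) f>] *)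
have cross c c' : `|ip (comb e c) (comb F c')| <= nrm (comb e c) * nrm (comb F c') / 2.
  set u := comb e c; set f := comb F c'.
  pose u' := \sum_(i < N) (c i / (lam i - tau)) *: e i.
  have lt0 i : 2 * eps <= lam i - tau by have [] := eP i; lin.
  have -> : ip u f = ip u' (T f - tau *: f).
    rewrite ipBr ipZr -TC /u' op_sum !ip_suml mulr_sumr -sumrB.
    apply: eq_bigr => i _; rewrite opZ !ipZl (eigvec_ip _ (eP i).2).
    have := lt0 i => h; field; rewrite gt_eqF//; lin.
  have nu' : nrm u' <= nrm u / (2 * eps).
    rewrite -ler_sqr ?nnegrE ?divr_ge0 ?nrm_ge0 ?mulr_ge0//; try lin.
    rewrite expr_div_n !nrm2 ler_pdivlMr ?exprn_gt0 ?mulr_gt0//.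
    rewrite /u /u' !orthonormal_sqr// mulr_suml; apply: ler_sum => i _.
    have := lt0 i => h.
    have -> : c i / (lam i - tau) * (c i / (lam i - tau)) * (2 * eps) ^+ 2 =
      c i * c i * ((2 * eps) / (lam i - tau)) ^+ 2.
      by field; rewrite gt_eqF//; lin.
    rewrite -[leRHS]mulr1; apply: ler_wpM2l; first by rewrite -expr2 sqr_ge0.
    rewrite expr_le1// ?ler_pdivrMr ?divr_ge0//; lin.
  apply: le_trans (ip_CS _ _) _.
  have -> : nrm u * nrm f / 2 = (nrm u / (2 * eps)) * (eps * nrm f) by field; rewrite gt_eqF.
  by apply: ler_pM => //; [exact: nrm_ge0|exact: nrm_ge0|exact: FQ].
have lower c c' : ip (comb e c) (comb e c) + ip (comb F c') (comb F c') <=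
    2 * ip (comb e c + comb F c') (comb e c + comb F c').
  set u := comb e c; set f := comb F c'; rewrite ipDl !ipDr (ipC f u).
  have := cross c c'; rewrite -/u -/f => h; have := ler_norm (- ip u f); rewrite normrN => h'.
  have : 0 <= (nrm u - nrm f) ^+ 2 by exact: sqr_ge0.
  rewrite sqrrB !nrm2; lin.
apply: (@minmax_eigvec (N + p) G) => //.
  move=> c; rewrite GE => /eqP; rewrite nrm_eq0 => /eqP h.
  have := lower (fun i => c (lshift p i)) (fun i => c (rshift N i)); rewrite /= h.
  set u := \sum_(i < N) _; set f := \sum_(i < p) _ => h1.
  have := ip_ge0 u; have := ip_ge0 f => f0 u0.
  have /(orthonormal_independent oe) ce : nrm u = 0 by rewrite /nrm (_ : ip u u = 0) ?sqrtr0//; lin.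
  have /indF cF : nrm f = 0 by rewrite /nrm (_ : ip f f = 0) ?sqrtr0//; lin.
  move=> i; rewrite -(splitK i); case: (fintype.split i) => k /=; [exact: ce|exact: cF].
move=> c; rewrite GE.
set u := \sum_(i < N) _; set f := \sum_(i < p) _.
have h1 := lower (fun i => c (lshift p i)) (fun i => c (rshift N i)); rewrite /= -/u -/f in h1.
have hu : (tau + 2 * eps) * ip u u <= ip (T u) u.
  by apply: (eig_form_ge (lam := lam)) => i; have [] := eP i.
have [r hr TfE] : exists2 r, nrm r <= eps * nrm f & T f = r + tau *: f.
  by exists (T f - tau *: f); [exact: FQ|rewrite subrK].
have -> : ip (T (u + f)) (u + f) = ip (T u) u + 2 * ip u r + ip r f
    + 2 * tau * ip u f + tau * ip f f.
  rewrite opD !(ipDl, ipDr) (TC u f) (ipC (T f) u) TfE !(ipDr, ipDl, ipZl, ipZr); ring.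
rewrite !(ipDl, ipDr) (ipC f u) in h1 *.
have c1 := ip_CS u r; have c2 := ip_CS r f.
have c3 := ler_norm (- ip u r); have c4 := ler_norm (- ip r f); rewrite normrN in c3; rewrite normrN in c4.
have c5 : nrm u * nrm r <= eps * (nrm u * nrm f).
  by rewrite mulrCA; apply: ler_wpM2l => //; exact: nrm_ge0.
have c6 : nrm r * nrm f <= eps * ip f f.
  by rewrite -nrm2 expr2 mulrA; apply: ler_wpM2r => //; exact: nrm_ge0.
(* After the estimates [c1] to [c8], what remains is half of this square plus [3/2 eps nrm u ^ 2];
   this balance fixes the constant 3. *)
have c7 : 0 <= eps * (2 * nrm u - nrm f) ^+ 2 by rewrite mulr_ge0 ?sqr_ge0// ltW.
move: c7; rewrite sqrrB exprMn !nrm2.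
have c8 : eps * (ip u u + ip f f) <= eps * (2 * (ip u u + ip u f + (ip u f + ip f f))).
  by rewrite ler_pM2l.
have := ip_ge0 u; have := ip_ge0 f => f0 u0.
have := mulr_ge0 (ltW eps0) f0; have := mulr_ge0 (ltW eps0) u0.
move: c5 c6 c8 hu; rewrite !mulrDr !mulrDl; lin.
Qed.

End SemiInnerProduct.

(** * Lebesgue measure on tuples *)

Section SigmaFiniteOf.
Context d (T : measurableType d) (R : realType) (m : {measure set T -> \bar R}).
Hypothesis sm : sigma_finite setT m.
Definition sigma_finite_of & sigma_finite setT m : set T -> \bar R := m.
HB.instance Definition _ := Measure.on (sigma_finite_of sm).
HB.instance Definition _ := Measure_isSigmaFinite.Build _ _ _ (sigma_finite_of sm) sm.
Definition sigma_finite_measure_of : {sigma_finite_measure set T -> \bar R} :=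
  sigma_finite_of sm.
End SigmaFiniteOf.

Section Volume.
Variable R : realType.
Notation leb := (@lebesgue_measure R).

Definition vcons n (p : R * n.-tuple R) : n.+1.-tuple R := cons_tuple p.1 p.2.

Lemma measurable_vcons n : measurable_fun [set: R * n.-tuple R] (@vcons n).
Proof. exact: (measurable_cons measurable_fst measurable_snd). Qed.

Lemma measurable_vcons_slice n x :
  measurable_fun [set: n.-tuple R] (fun t : n.-tuple R => vcons (x, t)).
Proof.
by apply: (measurable_cons (f := cst x)); [exact: measurable_cst|exact: measurable_id].
Qed.

Lemma exists_volume n : exists m : {sigma_finite_measure set (n.-tuple R) -> \bar R},
  forall f : n.-tuple R -> \bar R, measurable_fun [set: n.-tuple R] f -> (forall x, 0 <= f x)%E ->
  leb_int f = (\int[m]_x f x)%E.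
Proof.
elim: n => [|n [m mE]].
  exists (@dirac _ (0.-tuple R) [tuple] R) => f mf f0 /=.
  by rewrite integral_dirac//= diracT mul1e.
have mv : measurable_fun [set: R * n.-tuple R] (@vcons n) := @measurable_vcons n.
pose q : {measure set (n.+1.-tuple R) -> \bar R} :=
  measure_function_pushforward__canonical__measure_function_Measure (leb \x m)%E mv.
have sq : sigma_finite setT q.
  have /sigma_finiteP[F [TF ndF Foo]] := sigma_finiteT leb.
  have /sigma_finiteP[G [TG ndG Goo]] := sigma_finiteT m.
  exists (fun k => [set t : n.+1.-tuple R | F k (thead t) /\ G k [tuple of behead t]]).
    apply/esym; rewrite -subTset => t _.
    have : [set: measurableTypeR R] (thead t) by [].
    have : [set: n.-tuple R] [tuple of behead t] by [].
    rewrite TF TG => -[k1 _ Gk] [k2 _ Fk]; exists (maxn k1 k2) => //; split.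
      by move: Fk; exact/subsetPset/ndF/leq_maxr.
    by move: Gk; exact/subsetPset/ndG/leq_maxl.
  move=> k; have [mF Flt] := Foo k; have [mG Glt] := Goo k; split.
    apply: measurableI; rewrite -[X in measurable X]setTI.
      exact: (@measurable_tnth _ R n.+1 ord0).
    exact: measurable_behead.
  rewrite /q/= /pushforward (_ : _ @^-1` _ = F k `*` G k).
    by rewrite product_measure1E// lte_mul_pinfty// ge0_fin_numE.
  have E x (t : n.-tuple R) : [tuple of behead (vcons (x, t))] = t by exact: val_inj.
  by apply/seteqP; split => -[x t] /=; rewrite theadE E.
exists (sigma_finite_measure_of sq) => f mf f0.
transitivity (\int[q]_x f x)%E; last by [].
rewrite ge0_integral_pushforward// preimage_setT (fubini_tonelli1 (m1 := leb) (m2 := m) (f \o @vcons n))//=; last first.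
  exact: measurableT_comp.
apply: eq_integral => x _; rewrite mE//.
exact: (measurableT_comp mf (@measurable_vcons_slice n x)).
Qed.

Definition vol n : {sigma_finite_measure set (n.-tuple R) -> \bar R} :=
  sval (cid (exists_volume n)).

Lemma leb_intE n (f : n.-tuple R -> \bar R) : measurable_fun [set: n.-tuple R] f -> (forall x, 0 <= f x)%E ->
  leb_int f = (\int[vol n]_x f x)%E.
Proof. exact: (svalP (cid (exists_volume n))). Qed.

Lemma vol0_int (f : 0.-tuple R -> \bar R) : measurable_fun [set: 0.-tuple R] f -> (forall x, 0 <= f x)%E ->
  (\int[vol 0]_x f x)%E = f [tuple].
Proof. by move=> mf f0; rewrite -leb_intE. Qed.

Lemma volS_int n (f : n.+1.-tuple R -> \bar R) : measurable_fun [set: n.+1.-tuple R] f -> (forall x, 0 <= f x)%E ->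
  (\int[vol n.+1]_x f x = \int[leb]_x \int[vol n]_t f (vcons (x, t)))%E.
Proof.
move=> mf f0; rewrite -leb_intE//=; apply: eq_integral => x _.
rewrite leb_intE//.
exact: (measurableT_comp mf (@measurable_vcons_slice n x)).
Qed.

Lemma volS_pushforward n A : measurable A ->
  vol n.+1 A = pushforward (leb \x vol n)%E (@vcons n) A.
Proof.
move=> mA; have mv := @measurable_vcons n.
have m1 : measurable_fun setT (EFin \o (\1_A : n.+1.-tuple R -> R)).
  by apply/measurable_EFinP.
have := @volS_int n (EFin \o \1_A) m1 (fun x => ltac:(by rewrite lee_fin)).
rewrite integral_indic// setIT => ->.
rewrite -(fubini_tonelli1 (m1 := leb) (m2 := vol n) (fun p => (EFin \o \1_A) (vcons p)))/=; last 2 first.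
- exact: (measurableT_comp m1 mv).
- by move=> x; rewrite lee_fin.
rewrite /pushforward -(setIT (_ @^-1` _)) -integral_indic//.
by rewrite -[X in measurable X]setTI; exact: mv.
Qed.

Lemma volS_integrable n (f : n.+1.-tuple R -> \bar R) : measurable_fun [set: n.+1.-tuple R] f ->
  (vol n.+1).-integrable setT f <-> (leb \x vol n)%E.-integrable setT (f \o @vcons n).
Proof.
move=> mf; have mv := @measurable_vcons n.
have E : (\int[vol n.+1]_x `|f x| = \int[leb \x vol n]_x `|(f \o @vcons n) x|)%E.
  rewrite volS_int//; last exact: measurableT_comp.
  rewrite -(fubini_tonelli1 (m1 := leb) (m2 := vol n) (fun p => `|f (vcons p)|)%E)//.
  by apply: measurableT_comp => //; exact: measurableT_comp.
split=> /integrableP[_ h]; apply/integrableP; split => //.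
- exact: measurableT_comp.
- by rewrite -E.
- by rewrite E.
Qed.

Lemma volS_intP n (f : n.+1.-tuple R -> \bar R) : (vol n.+1).-integrable setT f ->
  (\int[vol n.+1]_x f x = \int[leb \x vol n]_x (f \o @vcons n) x)%E.
Proof.
move=> fi; have mf := measurable_int _ fi.
have fi' := (volS_integrable mf).1 fi.
have mv := @measurable_vcons n.
pose q : {measure set (n.+1.-tuple R) -> \bar R} :=
  measure_function_pushforward__canonical__measure_function_Measure (leb \x vol n)%E mv.
transitivity (\int[q]_x f x)%E.
  apply: eq_measure_integral => A mA _; exact: volS_pushforward.
by rewrite integral_pushforward.
Qed.

End Volume.

(** Holds without integrability: the integral of a signed function is the difference of those of its
    positive and negative parts, and taking these parts commutes with composition. *)
Lemma int_invariant d (T : measurableType d) (R : realType)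
    (mu : {measure set T -> \bar R}) (phi : T -> T) :
  (forall f : T -> \bar R, measurable_fun setT f -> (forall x, 0 <= f x)%E ->
     (\int[mu]_x f (phi x) = \int[mu]_x f x)%E) ->
  forall f : T -> \bar R, measurable_fun setT f ->
     (\int[mu]_x f (phi x) = \int[mu]_x f x)%E.
Proof.
move=> inv f mf; rewrite -[LHS]/(\int[mu]_x (f \o phi) x)%E.
rewrite [LHS]integralE [RHS]integralE.
under [X in (X - _)%E = _]eq_integral do rewrite funepos_comp/=.
under [X in (_ - X)%E = _]eq_integral do rewrite funeneg_comp/=.
by rewrite !inv//; [exact: measurable_funeneg|exact: measurable_funepos].
Qed.

Section AffineChange.
Variable R : realType.
Notation leb := (@lebesgue_measure R).

Lemma measurable_affine (c a : R) : measurable_fun [set: R] (fun x : R => c * x + a).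
Proof. by apply: measurable_funD => //; exact: mulrl_measurable. Qed.

(** Both sides are measures in [A] that agree on half-open intervals, so uniqueness of Lebesgue
    measure applies. A negative [c] exchanges the closed and open ends, at no cost in length. *)
Lemma affine_preimage_measure (c a : R) (A : set R) : c != 0 -> measurable A ->
  leb A = (`|c|%:E * leb ((fun x : R => c * x + a)%R @^-1` A))%E.
Proof.
move=> c0 mA.
have mf : measurable_fun [set: measurableTypeR R] (fun x : R => c * x + a : measurableTypeR R).
  exact: measurable_affine.
pose q : {measure set (measurableTypeR R) -> \bar R} :=
  measure_function_pushforward__canonical__measure_function_Measure leb mf.
have nc : 0 <= `|c| by [].
rewrite -[RHS]/(mscale (NngNum nc) q A).
apply: lebesgue_measure_unique => // _ [[u v] _ <-] /=.
rewrite /mscale/= /pushforward.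
have cc : `|c| != 0 by rewrite normr_eq0.
have [cp|cn] : 0 < c \/ c < 0 by move: c0; rewrite neq_lt => /orP[]; auto.
- rewrite (_ : _ @^-1` _ = `](u - a) / c, (v - a) / c]%classic); last first.
    apply/seteqP; split => x /=; rewrite !in_itv/= ltr_pdivrMr// ler_pdivlMr//;
    by rewrite mulrC ltrBlDr lerBrDr.
  rewrite !lebesgue_measure_itv/= !lte_fin ltr_pM2r ?invr_gt0// ltrD2r.
  case: ifP => _; last by rewrite mule0.
  rewrite -EFinB -EFinM; congr EFin; rewrite gtr0_norm//; field.
  by rewrite gt_eqF.
- rewrite (_ : _ @^-1` _ = `[(v - a) / c, (u - a) / c[%classic); last first.
    apply/seteqP; split => x /=; rewrite !in_itv/= ltr_ndivlMr// ler_ndivrMr//;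
    by rewrite [_ * c]mulrC ltrBlDr lerBrDr andbC.
  rewrite !lebesgue_measure_itv/= !lte_fin ltr_nM2r ?invr_lt0// ltrD2r.
  case: ifP => _; last by rewrite mule0.
  rewrite -EFinB -EFinM; congr EFin; rewrite ltr0_norm//; field.
  by rewrite lt_eqF.
Qed.

Lemma ge0_int_affine (c a : R) (f : R -> \bar R) : c != 0 ->
  measurable_fun [set: R] f -> (forall x, 0 <= f x)%E ->
  (\int[leb]_x f (c * x + a)%R = (`|c|^-1)%:E * \int[leb]_x f x)%E.
Proof.
move=> c0 mf f0.
have ma : measurable_fun [set: measurableTypeR R] (fun x : R => c * x + a : measurableTypeR R).
  exact: measurable_affine.
have nc : 0 <= `|c|^-1 by rewrite invr_ge0.
transitivity (\int[pushforward leb (fun x : R => (c * x + a)%R : measurableTypeR R)]_x f x)%E.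
  by rewrite ge0_integral_pushforward.
rewrite -(@ge0_integral_mscale _ _ R leb _ measurableT (NngNum nc) f)//.
pose q : {measure set (measurableTypeR R) -> \bar R} :=
  measure_function_pushforward__canonical__measure_function_Measure leb ma.
apply: (@eq_measure_integral _ _ _ _ (mscale (NngNum nc) leb) q) => A mA _.
rewrite [RHS]/= /mscale/= (@affine_preimage_measure c a)// muleA -EFinM mulVf ?mul1e//.
by rewrite normr_eq0.
Qed.

Lemma int_shift (a : R) (f : R -> \bar R) : measurable_fun [set: R] f ->
  (\int[leb]_x f (x + a)%R = \int[leb]_x f x)%E.
Proof.
move=> mf; apply: (@int_invariant _ _ _ leb (fun x => x + a)) => // g mg g0.
have := @ge0_int_affine 1 a g (oner_neq0 _) mg g0.
by rewrite normr1 invr1 mul1e => <-; apply: eq_integral => x _; rewrite mul1r.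
Qed.

Definition vaff n (c a : 'I_n -> R) (x : n.-tuple R) : n.-tuple R :=
  [tuple c i * tnth x i + a i | i < n].

Lemma measurable_vaff n (c a : 'I_n -> R) :
  measurable_fun [set: n.-tuple R] (vaff c a).
Proof.
apply/measurable_fun_tnthP => i.
rewrite (_ : _ \o _ = fun x : n.-tuple R => c i * tnth x i + a i); last first.
  by apply/funext => x /=; rewrite tnth_mktuple.
apply: measurable_funD => //; apply: measurable_funM => //; exact: measurable_tnth.
Qed.

Lemma vaff_vcons n (c a : 'I_n.+1 -> R) x t : vaff c a (vcons (x, t)) =
  vcons (c ord0 * x + a ord0,
    vaff (c \o lift ord0) (a \o lift ord0) t).
Proof.
apply: eq_from_tnth => i; rewrite tnth_mktuple.
have [j ->|->] := unliftP ord0 i; last by rewrite !tnth0.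
by rewrite !tnthS tnth_mktuple.
Qed.

(** Translations, dilations and coordinate flips are all of this diagonal form, so coordinatewise
    substitution covers every change of variables below. *)
Lemma ge0_int_vaff n (c a : 'I_n -> R) (f : n.-tuple R -> \bar R) :
  (forall i, c i != 0) ->
  measurable_fun [set: n.-tuple R] f -> (forall x, 0 <= f x)%E ->
  (\int[vol R n]_x f (vaff c a x) = (\prod_i `|c i|^-1)%:E * \int[vol R n]_x f x)%E.
Proof.
elim: n => [|n IH] in c a f * => c0 mf f0.
  rewrite big_ord0 mul1e !vol0_int//; last exact: measurableT_comp (measurable_vaff _ _).
  by congr f; exact: tuple0.
rewrite volS_int//; last exact: measurableT_comp (measurable_vaff _ _).
under eq_integral do under eq_integral do rewrite vaff_vcons.
have mG : measurable_fun [set: R] (fun x => \int[vol R n]_t f (vcons (x, t)))%E.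
  apply: (measurable_fun_fubini_tonelli_F (m2 := vol R n) (fun p => f (vcons p))) => //.
  exact: (measurableT_comp mf (@measurable_vcons R n)).
have -> : (\int[leb]_x \int[vol R n]_t f
    (vcons ((c ord0 * x + a ord0)%R, vaff (c \o lift ord0) (a \o lift ord0) t)) =
   \int[leb]_x ((\prod_i `|(c \o lift ord0) i|^-1)%R%:E *
      \int[vol R n]_t f (vcons ((c ord0 * x + a ord0)%R, t))))%E.
  apply: eq_integral => x _.
  rewrite (IH _ _ (fun t => f (vcons (c ord0 * x + a ord0, t))))//.
    by move=> i; exact: c0.
  exact: (measurableT_comp mf (@measurable_vcons_slice R n _)).
rewrite ge0_integralZl//; last first.
- by rewrite lee_fin prodr_ge0.
- by move=> x _; exact: integral_ge0.
- by apply: (measurableT_comp mG); exact: measurable_affine.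
rewrite (@ge0_int_affine (c ord0) (a ord0) (fun x => \int[vol R n]_t f (vcons (x, t)))%E)//; last first.
  by move=> x; exact: integral_ge0.
by rewrite muleA -EFinM big_ord_recl mulrC volS_int.
Qed.

Definition vadd n (x y : n.-tuple R) : n.-tuple R := [tuple tnth x i + tnth y i | i < n].
Definition vscale n (s : R) (x : n.-tuple R) : n.-tuple R := [tuple s * tnth x i | i < n].
Definition vflip n (k : 'I_n) (x : n.-tuple R) : n.-tuple R :=
  [tuple (if i == k then - tnth x i else tnth x i) | i < n].

Lemma ge0_int_vadd n (a : n.-tuple R) (f : n.-tuple R -> \bar R) :
  measurable_fun [set: n.-tuple R] f -> (forall x, 0 <= f x)%E ->
  (\int[vol R n]_x f (vadd x a) = \int[vol R n]_x f x)%E.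
Proof.
move=> mf f0; have := @ge0_int_vaff n (fun=> 1) (tnth a) f (fun=> oner_neq0 _) mf f0.
rewrite big1 ?mul1e; last by move=> i _; rewrite normr1 invr1.
move=> <-; apply: eq_integral => x _; congr f.
by apply: eq_from_tnth => i; rewrite !tnth_mktuple mul1r.
Qed.

Lemma int_vadd n (a : n.-tuple R) (f : n.-tuple R -> \bar R) :
  measurable_fun [set: n.-tuple R] f ->
  (\int[vol R n]_x f (vadd x a) = \int[vol R n]_x f x)%E.
Proof.
by apply: (@int_invariant _ _ _ (vol R n) (fun x => vadd x a)) => g; exact: ge0_int_vadd.
Qed.

Lemma ge0_int_vscale n (s : R) (f : n.-tuple R -> \bar R) : s != 0 ->
  measurable_fun [set: n.-tuple R] f -> (forall x, 0 <= f x)%E ->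
  (\int[vol R n]_x f (vscale s x) = (`|s| ^- n)%:E * \int[vol R n]_x f x)%E.
Proof.
move=> s0 mf f0; have := @ge0_int_vaff n (fun=> s) (fun=> 0) f (fun=> s0) mf f0.
rewrite prodr_const card_ord -exprVn => <-; apply: eq_integral => x _; congr f.
by apply: eq_from_tnth => i; rewrite !tnth_mktuple addr0.
Qed.

Lemma ge0_int_vflip n k (f : n.-tuple R -> \bar R) :
  measurable_fun [set: n.-tuple R] f -> (forall x, 0 <= f x)%E ->
  (\int[vol R n]_x f (vflip k x) = \int[vol R n]_x f x)%E.
Proof.
move=> mf f0; pose c i : R := if i == k then -1 else 1.
have c0 i : c i != 0 by rewrite /c; case: ifP => _; rewrite ?oppr_eq0 oner_neq0.
have := @ge0_int_vaff n c (fun=> 0) f c0 mf f0.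
rewrite big1 ?mul1e; last first.
  by move=> i _; rewrite /c; case: ifP => _; rewrite ?normrN normr1 invr1.
move=> <-; apply: eq_integral => x _; congr f.
apply: eq_from_tnth => i; rewrite !tnth_mktuple addr0 /c.
by case: ifP => _; rewrite ?mulN1r ?mul1r.
Qed.

Lemma int_vflip n k (f : n.-tuple R -> \bar R) :
  measurable_fun [set: n.-tuple R] f ->
  (\int[vol R n]_x f (vflip k x) = \int[vol R n]_x f x)%E.
Proof.
by apply: (@int_invariant _ _ _ (vol R n) (vflip k)) => g; exact: ge0_int_vflip.
Qed.

Lemma measurable_prod_tnth n (g : 'I_n -> R -> R) :
  (forall i, measurable_fun [set: R] (g i)) ->
  measurable_fun [set: n.-tuple R] (fun x : n.-tuple R => \prod_i g i (tnth x i)).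
Proof.
move=> mg; apply: (@measurable_prod _ _ _ _ _ (index_enum _) (fun i (x : n.-tuple R) => g i (tnth x i))) => i _.
by apply: measurableT_comp => //; exact: measurable_tnth.
Qed.

Lemma int_prod_tnth n (g : 'I_n -> R -> R) :
  (forall i, leb.-integrable setT (EFin \o g i)) ->
  (vol R n).-integrable setT (fun x => (\prod_i g i (tnth x i))%:E) /\
  (\int[vol R n]_x (\prod_i g i (tnth x i))%:E = (\prod_i \int[leb]_x g i x)%:E)%E.
Proof.
elim: n => [|n IH] in g * => gi.
  have E (x : 0.-tuple R) : (\prod_i g i (tnth x i))%:E = 1%:E by rewrite big_ord0.
  split.
    apply/integrableP; split.
      by apply/measurable_EFinP; apply: measurable_prod_tnth; case.
    under eq_integral do rewrite E.
    by rewrite vol0_int// abse1 ltry.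
  under eq_integral do rewrite E.
  by rewrite vol0_int// big_ord0.
pose G (t : n.-tuple R) := \prod_i g (lift ord0 i) (tnth t i).
have gm i : measurable_fun [set: R] (g i) by have /integrableP[/measurable_EFinP] := gi i.
have [Gi GE] := IH (fun i => g (lift ord0 i)) (fun i => gi _).
have E x t : (\prod_i g i (tnth (vcons (x, t)) i)) = g ord0 x * G t.
  rewrite big_ord_recl tnth0; congr (_ * _); apply: eq_bigr => i _.
  by rewrite tnthS.
have mG : measurable_fun [set: n.-tuple R] G.
  exact: (measurable_prod_tnth (fun i => gm (lift ord0 i))).
have mp : measurable_fun [set: R * n.-tuple R] (fun p => g ord0 p.1 * G p.2).
  apply: measurable_funM; first exact: (measurableT_comp (gm ord0) measurable_fst).
  exact: (measurableT_comp mG measurable_snd).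
have mall : measurable_fun [set: n.+1.-tuple R] (fun x : n.+1.-tuple R => (\prod_i g i (tnth x i))%:E).
  by apply/measurable_EFinP; exact: measurable_prod_tnth.
have pE : (fun x : n.+1.-tuple R => (\prod_i g i (tnth x i))%:E) \o @vcons R n =
    fun p => (g ord0 p.1 * G p.2)%:E.
  by apply/funext => -[x t] /=; rewrite E.
have Gfin : (\int[vol R n]_t `|(G t)%:E| < +oo)%E by have /integrableP[] := Gi.
have g0fin : (\int[leb]_x `|(g ord0 x)%:E| < +oo)%E by have /integrableP[] := gi ord0.
have pint : (leb \x vol R n)%E.-integrable setT (fun p => (g ord0 p.1 * G p.2)%:E).
  apply/integrable12ltyP; first exact/measurable_EFinP.
  under eq_integral => x _.
    under eq_integral do rewrite /= normrM EFinM.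
    rewrite ge0_integralZl//; last first.
      by apply/measurable_EFinP; exact: (measurableT_comp (@normr_measurable R setT) mG).
    over.
  rewrite ge0_integralZr//; last 2 first.
  - by apply/measurable_EFinP; exact: (measurableT_comp (@normr_measurable R setT) (gm ord0)).
  - exact: integral_ge0.
  by rewrite lte_mul_pinfty// ?integral_ge0// ge0_fin_numE ?integral_ge0.
have allint : (vol R n.+1).-integrable setT (fun x => (\prod_i g i (tnth x i))%:E).
  by apply/volS_integrable => //; rewrite pE.
split => //.
rewrite volS_intP// pE -integral12_prod_meas1//.
under eq_integral => x _.
  rewrite /fubini_F/=.
  under eq_integral do rewrite EFinM.
  rewrite integralZl// GE.
  over.
rewrite integralZr//; last exact: gi.
rewrite big_ord_recl EFinM; congr (_ * _)%E.
by rewrite /Rintegral fineK//; apply: integrable_fin_num => //; exact: gi.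
Qed.

End AffineChange.

(** * One-dimensional Hermite functions *)

Section RealDominated.
Context d (T : measurableType d) (R : realType) (mu : {measure set T -> \bar R}).

Lemma dominated_cvg_real (f_ : nat -> T -> R) (f g : T -> R) :
  (forall n, measurable_fun [set: T] (f_ n)) -> measurable_fun [set: T] f ->
  (forall x, f_ ^~ x @ \oo --> f x) -> (forall n x, `|f_ n x| <= g x) ->
  mu.-integrable setT (EFin \o g) ->
  (fun n => \int[mu]_x f_ n x) @ \oo --> \int[mu]_x f x.
Proof.
move=> mf_ mf ff fg gi.
have mf_E n : measurable_fun [set: T] (fun x => (f_ n x)%:E) by exact/measurable_EFinP.
have mfE : measurable_fun [set: T] (fun x => (f x)%:E) by exact/measurable_EFinP.
have ffE : {ae mu, forall x, [set: T] x -> (f_ n x)%:E @[n --> \oo] --> (f x)%:E}.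
  by apply: aeW => x _; apply: cvg_EFin; [exact: nearW|exact: ff].
have fgE : {ae mu, forall x (n : nat), [set: T] x -> (`|(f_ n x)%:E| <= (g x)%:E)%E}.
  by apply: aeW => x n _; rewrite /= lee_fin.
have [fi _] := dominated_convergence measurableT mf_E mfE ffE gi fgE.
rewrite -(@fineK _ (\int[mu]_x (EFin \o f) x)%E); last exact: integrable_fin_num.
by move=> /fine_cvg.
Qed.

Lemma integrable_le_real (f g : T -> R) : measurable_fun [set: T] f ->
  (forall x, `|f x| <= g x) -> mu.-integrable setT (EFin \o g) ->
  mu.-integrable setT (EFin \o f).
Proof.
move=> mf fg; apply: le_integrable => //; first exact/measurable_EFinP.
by move=> x _ /=; rewrite lee_fin (le_trans (fg x))// ler_norm.
Qed.
End RealDominated.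

Section Gaussian1D.
Variable R : realType.
Notation leb := (@lebesgue_measure R).
Implicit Types (a c x y : R) (p q : {poly R}).

Definition gs a x : R := expR (- a * x ^+ 2).

Lemma gs_ge0 a x : 0 <= gs a x. Proof. exact: expR_ge0. Qed.
Lemma gsD a b x : gs (a + b) x = gs a x * gs b x.
Proof. by rewrite /gs opprD mulrDl expRD. Qed.

Lemma measurable_gs a : measurable_fun [set: R] (gs a).
Proof.
apply: measurableT_comp => //; apply: measurable_funM => //.
Qed.

Lemma int_gs a : 0 < a -> (\int[leb]_x (gs a x)%:E = (Num.sqrt (pi / a))%:E)%E.
Proof.
move=> a0; have s0 : 0 < Num.sqrt a by rewrite sqrtr_gt0.
have := @ge0_int_affine R (Num.sqrt a) 0 (fun x => (gauss_fun x)%:E)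
  (lt0r_neq0 s0) ltac:(by apply/measurable_EFinP; exact: measurable_gauss_fun)
  (fun x => ltac:(by rewrite lee_fin gauss_fun_ge0)).
rewrite integralT_gauss -EFinM => H.
transitivity ((`|Num.sqrt a|^-1 * Num.sqrt pi)%R)%:E.
  rewrite -H; apply: eq_integral => x _; congr EFin; rewrite /gauss_fun /gs addr0.
  by rewrite exprMn sqr_sqrtr ?ltW// mulNr.
by rewrite gtr0_norm// sqrtrM ?pi_ge0// sqrtrV ?ltW// mulrC.
Qed.

Lemma integrable_gs a : 0 < a -> leb.-integrable setT (EFin \o gs a).
Proof.
move=> a0; apply/integrableP; split; first by apply/measurable_EFinP; apply: measurable_gs.
under eq_integral do rewrite /= ger0_norm ?gs_ge0//.
by rewrite int_gs// ltry.
Qed.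

(** From [y <= expR y] at [y = |x| / n], raised to the power [n]: [|x|^n <= n^n exp |x|]. *)
Lemma horner_expR_bound p : exists2 K, 0 <= K & forall x, `|p.[x]| <= K * expR `|x|.
Proof.
exists (\sum_(i < size p) `|p`_i| * i%:R ^+ i); first by apply: sumr_ge0 => i _; rewrite mulr_ge0.
move=> x; rewrite horner_coef mulr_suml; apply: le_trans (ler_norm_sum _ _ _) _.
apply: ler_sum => i _; rewrite normrM -mulrA ler_wpM2l// normrX.
case: (nat_of_ord i) => [|n]; first by rewrite !expr0 mul1r -expR0 ler_expR.
have n0 : (0 : R) < n.+1%:R by rewrite ltr0n.
have -> : `|x| ^+ n.+1 = n.+1%:R ^+ n.+1 * (`|x| / n.+1%:R) ^+ n.+1.
  by rewrite -exprMn mulrCA mulfV ?mulr1// gt_eqF.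
rewrite ler_wpM2l ?exprn_ge0//.
have -> : expR `|x| = expR (`|x| / n.+1%:R) ^+ n.+1.
  by rewrite -expRM_natl mulrCA mulfV ?mulr1// gt_eqF.
rewrite lerXn2r ?nnegrE ?divr_ge0 ?expR_ge0//.
have := expR_ge1Dx (`|x| / n.+1%:R); set u := _ / _; lin.
Qed.

(** Completing the square trades half of the Gaussian decay for the linear exponent. *)
Lemma expR_gs_bound c a x : 0 < a ->
  expR (c * `|x|) * gs a x <= expR (c ^+ 2 / (2 * a)) * gs (a / 2) x.
Proof.
move=> a0; rewrite /gs -!expRD ler_expR.
have : 0 <= (a / 2) * (`|x| - c / a) ^+ 2 by rewrite mulr_ge0 ?sqr_ge0// divr_ge0 ?ltW.
rewrite sqrrB real_normK ?num_real//.
have -> : a / 2 * (x ^+ 2 - `|x| * (c / a) *+ 2 + (c / a) ^+ 2) =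
  a / 2 * x ^+ 2 - `|x| * c + c ^+ 2 / (2 * a) by field; rewrite gt_eqF.
lin.
Qed.

Lemma horner_gs_bound p c a : 0 < a ->
  exists2 K, 0 <= K & forall x, `|p.[x]| * expR (c * `|x|) * gs a x <= K * gs (a / 2) x.
Proof.
move=> a0; have [K K0 KP] := horner_expR_bound p.
exists (K * expR ((1 + c) ^+ 2 / (2 * a))); first by rewrite mulr_ge0 ?expR_ge0.
move=> x; rewrite -[leRHS]mulrA; apply: le_trans (ler_wpM2l K0 (@expR_gs_bound (1 + c) a x a0)).
rewrite mulrA ler_wpM2r ?gs_ge0// mulrDl mul1r expRD mulrA.
by rewrite ler_wpM2r ?expR_ge0.
Qed.

Lemma measurable_horner p : measurable_fun [set: R] (horner p).
Proof. by apply: continuous_measurable_fun; exact: continuous_horner. Qed.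

Lemma measurable_expR_abs c : measurable_fun [set: R] (fun x : R => expR (c * `|x|)).
Proof.
apply: measurableT_comp => //; apply: measurable_funM => //.
Qed.

Lemma integrable_horner_exp_gs p c a : 0 < a ->
  leb.-integrable setT (EFin \o (fun x => p.[x] * expR (c * `|x|) * gs a x)).
Proof.
move=> a0; have [K K0 KP] := horner_gs_bound p c a0.
apply: (@integrable_le_real _ _ R leb _ (fun x => K * gs (a / 2) x)).
- apply: measurable_funM; last exact: measurable_gs.
  apply: measurable_funM; [exact: measurable_horner|exact: measurable_expR_abs].
- by move=> x; rewrite 2!normrM (ger0_norm (expR_ge0 _)) (ger0_norm (gs_ge0 _ _)).
- have := @integrableZl _ _ _ leb setT measurableT K _ (@integrable_gs (a / 2) ltac:(lra)).
  by apply: eq_integrable => // x _.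
Qed.

Lemma integrable_horner_gs p a : 0 < a ->
  leb.-integrable setT (EFin \o (fun x => p.[x] * gs a x)).
Proof.
move=> a0; have := integrable_horner_exp_gs p 0 a0.
by apply: eq_integrable => // x _ /=; rewrite mul0r expR0 mulr1.
Qed.

Definition gsint a p : R := \int[leb]_x (p.[x] * gs a x).

Lemma gsintE a p : 0 < a -> (\int[leb]_x (p.[x] * gs a x)%:E = (gsint a p)%:E)%E.
Proof.
move=> a0; rewrite /gsint /Rintegral fineK//.
by apply: integrable_fin_num => //; exact: integrable_horner_gs.
Qed.

Lemma gsintD a p q : 0 < a -> gsint a (p + q) = gsint a p + gsint a q.
Proof.
move=> a0; rewrite /gsint -RintegralD//; last 2 first.
- exact: integrable_horner_gs.
- exact: integrable_horner_gs.
by apply: eq_Rintegral => x _; rewrite hornerD mulrDl.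
Qed.

Lemma gsintZ a c p : 0 < a -> gsint a (c *: p) = c * gsint a p.
Proof.
move=> a0; rewrite /gsint -RintegralZl//; last exact: integrable_horner_gs.
by apply: eq_Rintegral => x _; rewrite hornerZ mulrA.
Qed.

Lemma gsintB a p q : 0 < a -> gsint a (p - q) = gsint a p - gsint a q.
Proof. by move=> a0; rewrite gsintD// -scaleN1r gsintZ// mulN1r. Qed.

Lemma gsint1 a : 0 < a -> gsint a 1 = Num.sqrt (pi / a).
Proof.
move=> a0; apply: EFin_inj; rewrite -gsintE// -int_gs//.
by apply: eq_integral => x _; rewrite hornerC mul1r.
Qed.

Lemma is_derive_horner_gs p a x :
  is_derive x (1 : R) (fun y => p.[y] * gs a y) ((p^`() - (2 * a) *: ('X * p)).[x] * gs a x).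
Proof.
pose q : {poly R} := - a *: 'X^2.
have h1 : is_derive x (1 : R) (gs a) (- (2 * a * x) * gs a x).
  have -> : gs a = expR \o horner q.
    by apply/funext => y; rewrite /gs /q /= !hornerE.
  apply: trigger_derive (is_derive1_comp (is_derive_expR q.[x]) (is_derive_poly q x)) _.
  by rewrite /q /= derivZ derivXn !hornerE /=; ring.
apply: trigger_derive (is_deriveM (is_derive_poly p x) h1) _.
by rewrite !hornerE /GRing.scale/=; ring.
Qed.

Lemma horner_gs_cvg0 p a : 0 < a ->
  (fun n : nat => p.[n.+1%:R] * gs a n.+1%:R) @ \oo --> (0 : R).
Proof.
move=> a0; have [K K0 KP] := horner_gs_bound p 0 a0.
apply/norm_cvg0P.
apply: (@squeeze_cvgr _ _ _ _ (fun=> 0) (fun n => K * (2 / a) * n.+1%:R^-1)); last 2 first.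
- exact: cvg_cst.
- rewrite -[X in _ --> X](mulr0 (K * (2 / a))); apply: cvgM; first exact: cvg_cst.
  exact: cvg_harmonic.
apply: nearW => n; rewrite normr_ge0/=.
have := KP n.+1%:R; rewrite mul0r expR0 mulr1.
rewrite normrM (ger0_norm (gs_ge0 _ _)) => h; apply: le_trans h _.
rewrite -mulrA ler_wpM2l// /gs.
have n1 : (1 : R) <= n.+1%:R by rewrite ler1n.
set u := n.+1%:R in n1 *.
have u0 : 0 < u by lra.
have h1 : a / 2 * u <= expR (a / 2 * u ^+ 2).
  have := expR_ge1Dx (a / 2 * u ^+ 2).
  have : a / 2 * u <= a / 2 * u ^+ 2 by rewrite ler_pM2l ?divr_gt0// expr2 ler_pMr.
  lin.
have -> : 2 / a / u = (a / 2 * u)^-1 by field; rewrite !gt_eqF.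
rewrite mulNr expRN lef_pV2 ?posrE ?expR_gt0//.
by rewrite mulr_gt0 ?divr_gt0.
Qed.

(* [\int f' = 0] for [f = p * gs a] *)
Lemma gsint_ibp a p : 0 < a -> gsint a p^`() = 2 * a * gsint a ('X * p).
Proof.
move=> a0; apply/eqP; rewrite -subr_eq0; apply/eqP.
rewrite -gsintZ// -gsintB//.
set q := p^`() - _.
pose F x := p.[x] * gs a x; pose f x := q.[x] * gs a x.
have dF x : is_derive x (1 : R) F (f x) by exact: is_derive_horner_gs.
have cont (h : {poly R}) : continuous (fun x => h.[x] * gs a x).
  move=> x; apply: differentiable_continuous; apply/derivable1_diffP.
  by have [] := is_derive_horner_gs h a x.
(* Truncation to a growing interval: dominated convergence identifies the limit of the integrals,
   while the fundamental theorem turns them into boundary values that tend to 0. *)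
pose I (n : nat) : set R := `[- n.+1%:R, n.+1%:R]%classic.
have mI n : measurable (I n) by exact: measurable_itv.
pose fn n x := f x * \1_(I n) x.
have mf : measurable_fun [set: R] f.
  by apply: measurable_funM; [exact: measurable_horner|exact: measurable_gs].
have fi : leb.-integrable setT (EFin \o f) by exact: integrable_horner_gs.
have mfn n : measurable_fun [set: R] (fn n).
  by apply: measurable_funM => //; exact: measurable_indic.
have fnb n x : `|fn n x| <= `|f x|.
  rewrite /fn normrM ler_piMr// indicE; case: (_ \in _); rewrite ?normr1 ?normr0//.
have fnc x : fn ^~ x @ \oo --> f x.
  apply: cvg_near_cst; exists (Num.truncn `|x|) => // n /= nx.
  have Inx : I n x.
    rewrite /I/= in_itv/= -ler_norml ltW//.
    by apply: (lt_le_trans (truncnS_gt _)); rewrite ler_nat ltnS.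
  by rewrite /fn indicE mem_set// mulr1.
have H1 := @dominated_cvg_real _ _ R leb fn f (fun x => `|f x|) mfn mf fnc fnb (integrable_norm fi).
have E n : \int[leb]_x fn n x = F n.+1%:R - F (- n.+1%:R).
  apply: EFin_inj; rewrite /Rintegral fineK; last first.
    apply: integrable_fin_num => //; apply: (integrable_le_real _ _ (integrable_norm fi)).
      exact: mfn.
    exact: fnb.
  have -> : (\int[leb]_x (fn n x)%:E = \int[leb]_(x in I n) (f x)%:E)%E.
    rewrite [RHS]integral_mkcond; apply: eq_integral => x _.
    rewrite /fn /restrict indicE; case: ifPn => h; first by rewrite mulr1.
    by rewrite mulr0.
  rewrite EFinB; apply: (@continuous_FTC2 R f F).
  - by rewrite ltrNl; apply: (@lt_trans _ _ 0); rewrite ?oppr_lt0 ?ltr0n.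
  - by apply: continuous_subspaceT; exact: cont.
  - split; first by move=> x _; have [] := dF x.
    + by apply: cvg_at_right_filter; exact: cont.
    + by apply: cvg_at_left_filter; exact: cont.
  - by move=> x _; rewrite derive1E; have [] := dF x.
rewrite (_ : (fun n => _) = fun n => F n.+1%:R - F (- n.+1%:R)) in H1; last first.
  by apply/funext => n; rewrite E.
have H2 : (fun n => F n.+1%:R - F (- n.+1%:R)) @ \oo --> (0 : R).
  rewrite -[X in _ --> X](subr0 0); apply: cvgB; first exact: horner_gs_cvg0.
  have := horner_gs_cvg0 (p \Po (- 'X)) a0.
  rewrite (_ : (fun n : nat => _) = (fun n => F (- n.+1%:R)))//.
  by apply/funext => n; rewrite /F horner_comp !hornerE /gs sqrrN.
exact: (cvg_unique _ H1 H2).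
Qed.

End Gaussian1D.

Section Hermite.
Variables (R : realType) (al : R).
Hypothesis al0 : 0 < al.
Notation leb := (@lebesgue_measure R).
Implicit Types (x y m : R) (p q : {poly R}).

(** Hermite polynomials for the weight [exp (-2 al x^2)]: up to sign, [hpoly n] is the [n]-th
    derivative of this weight divided by the weight. *)
Fixpoint hpoly n : {poly R} :=
  if n is n'.+1 then (4 * al) *: ('X * hpoly n') - (hpoly n')^`() else 1.

Lemma hpolyS n : hpoly n.+1 = (4 * al) *: ('X * hpoly n) - (hpoly n)^`().
Proof. by []. Qed.

(** The two relations support each other: the lowering relation at [n + 1] gives the differential
    equation at [n + 1], which gives the lowering relation at [n + 2]. *)
Lemma hpoly_ode_aux n : (hpoly n.+1)^`() = (4 * al * n.+1%:R) *: hpoly n /\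
  (hpoly n)^`()^`() - (4 * al) *: ('X * (hpoly n)^`()) = - (4 * al * n%:R) *: hpoly n.
Proof.
elim: n => [|n [IH1 IH2]].
  rewrite hpolyS /= !(derivC, deriv0, mulr0, scaler0, subr0, mulr1, oppr0, scale0r).
  by split; rewrite // derivZ derivX.
have IH2' : (hpoly n.+1)^`()^`() - (4 * al) *: ('X * (hpoly n.+1)^`()) = - (4 * al * n.+1%:R) *: hpoly n.+1.
  rewrite IH1 derivZ -scalerAr hpolyS; set c := 4 * al * n.+1%:R.
  by rewrite scaleNr scalerBr opprB !scalerA (mulrC c).
split => //.
rewrite hpolyS derivB derivZ derivM derivX mul1r scalerDr.
have -> : (hpoly n.+1)^`()^`() = (4 * al) *: ('X * (hpoly n.+1)^`()) - (4 * al * n.+1%:R) *: hpoly n.+1.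
  by rewrite -scaleNr -IH2' addrC subrK.
have E (a b c : {poly R}) : a + b - (b - c) = a + c by ring.
rewrite E -scalerDl; congr (_ *: _).
by rewrite -[in RHS]addn1 natrD; ring.
Qed.

Lemma deriv_hpoly n : (hpoly n)^`() = (4 * al * n%:R) *: hpoly n.-1.
Proof.
case: n => [|n]; first by rewrite derivC mulr0 scale0r.
by have [] := hpoly_ode_aux n.
Qed.

Lemma hpoly_ode n :
  (hpoly n)^`()^`() - (4 * al) *: ('X * (hpoly n)^`()) = - (4 * al * n%:R) *: hpoly n.
Proof. by have [] := hpoly_ode_aux n. Qed.

Definition hfun n x := (hpoly n).[x] * gs al x.

Lemma gs2 x : gs al x * gs al x = gs (2 * al) x.
Proof. by rewrite -gsD [2 * al]mulr_natl mulr2n. Qed.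

(** The raising operator [p |-> 4 al x p - p'] is adjoint to differentiation for the weight
    [exp (-2 al x^2)]. *)
Lemma gsint_hpolyS n p : gsint (2 * al) (hpoly n.+1 * p) = gsint (2 * al) (hpoly n * p^`()).
Proof.
have a2 : 0 < 2 * al by rewrite mulr_gt0.
have := gsint_ibp (hpoly n * p) a2; rewrite derivM gsintD// => H.
rewrite hpolyS mulrBl gsintB// -scalerAl gsintZ//.
have -> : 'X * hpoly n * p = 'X * (hpoly n * p) by rewrite mulrA.
have -> : 4 * al * gsint (2 * al) ('X * (hpoly n * p)) = 2 * (2 * al) * gsint (2 * al) ('X * (hpoly n * p)) by ring.
by rewrite -H; ring.
Qed.

Definition hnorm2 n : R := (4 * al) ^+ n * (n`!)%:R * Num.sqrt (pi / (2 * al)).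

Lemma hnorm2_gt0 n : 0 < hnorm2 n.
Proof.
rewrite /hnorm2 !mulr_gt0 ?exprn_gt0 ?mulr_gt0 ?ltr0n ?fact_gt0//.
by rewrite sqrtr_gt0 divr_gt0 ?pi_gt0 ?mulr_gt0.
Qed.

Lemma gsint_hpoly (n m : nat) : gsint (2 * al) (hpoly n * hpoly m) = (n == m)%:R * hnorm2 n.
Proof.
have a2 : 0 < 2 * al by rewrite mulr_gt0.
have h0 k : gsint (2 * al) (hpoly k.+1 * hpoly 0) = 0.
  by rewrite gsint_hpolyS derivC mulr0 -(scale0r 1) gsintZ// mul0r.
elim: n m => [|n IH] [|m].
- by rewrite mulr1 gsint1// eqxx /hnorm2 expr0 fact0 !mul1r.
- by rewrite (mulrC (hpoly 0)) h0 mul0r.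
- by rewrite h0 mul0r.
rewrite gsint_hpolyS deriv_hpoly -scalerAr gsintZ// IH eqSS.
have [->|_] := eqVneq n m; last by rewrite !mul0r mulr0.
by rewrite !mul1r /hnorm2 exprS factS natrM; ring.
Qed.

Lemma measurable_hfun n : measurable_fun [set: R] (hfun n).
Proof. by apply: measurable_funM; [exact: measurable_horner|exact: measurable_gs]. Qed.

Lemma hfun_mul_integrable (n m : nat) : leb.-integrable setT (EFin \o (fun x => hfun n x * hfun m x)).
Proof.
have := @integrable_horner_gs R (hpoly n * hpoly m) (2 * al) ltac:(by rewrite mulr_gt0).
apply: eq_integrable => // x _ /=; congr EFin.
by rewrite hornerM -gs2 /hfun; ring.
Qed.

Lemma hfun_orth (n m : nat) : \int[leb]_x (hfun n x * hfun m x) = (n == m)%:R * hnorm2 n.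
Proof.
rewrite -gsint_hpoly; apply: eq_Rintegral => x _.
by rewrite hornerM -gs2 /hfun; ring.
Qed.

(** The exponential anticipates [vh], which is bounded by a product of such factors; quasimodes are
    Hermite functions times its square root. *)
Lemma hfun_exp_integrable n c : leb.-integrable setT
  (EFin \o (fun x => (hfun n x) ^+ 2 * expR (c * `|x|))).
Proof.
have := @integrable_horner_exp_gs R (hpoly n * hpoly n) c (2 * al) ltac:(by rewrite mulr_gt0).
apply: eq_integrable => // x _ /=; congr EFin.
by rewrite hornerM -gs2 /hfun; ring.
Qed.

End Hermite.

Section Mehler1D.
Variables (R : realType) (al r : R).
Hypotheses (al0 : 0 < al) (r0 : 0 < r) (r1 : r < 1).
Notation leb := (@lebesgue_measure R).
Implicit Types (x y m : R) (p q : {poly R}).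

(* Mehler's kernel in the parameter [r]: precision [mq] of the convolution
   Gaussian, strength [mb] of the confining factor, and [mB = mq + mb + al],
   the precision of the law of [y] given [x] under [mk x y * hfun 0 y]. *)
Definition mq := 2 * al * r / (1 - r ^+ 2).
Definition mb := al * (1 - r) / (1 + r).
Definition mB := 2 * al / (1 - r ^+ 2).
Definition mk x y := Num.sqrt (mB / pi) * expR (- mq * (x - y) ^+ 2 - mb * (x ^+ 2 + y ^+ 2)).

Lemma r2_lt1 : 0 < 1 - r ^+ 2.
Proof. by rewrite subr_gt0 expr_lt1// ltW. Qed.
Lemma r1_neq0 : 1 + r != 0. Proof. by rewrite gt_eqF// addr_gt0. Qed.
Lemma mB_gt0 : 0 < mB. Proof. by rewrite divr_gt0 ?mulr_gt0 ?r2_lt1. Qed.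
Lemma mq_gt0 : 0 < mq. Proof. by rewrite divr_gt0 ?mulr_gt0 ?r2_lt1. Qed.
Lemma mb_gt0 : 0 < mb.
Proof. by rewrite divr_gt0 ?addr_gt0 ?mulr_gt0 ?subr_gt0. Qed.
Lemma mk_ge0 x y : 0 <= mk x y. Proof. by rewrite mulr_ge0 ?expR_ge0. Qed.
Lemma r2E : 1 - r ^+ 2 = (1 - r) * (1 + r). Proof. by ring. Qed.

Lemma measurable_mk : measurable_fun [set: R * R] (fun z => mk z.1 z.2).
Proof.
apply: measurable_funM => //; apply: measurableT_comp => //.
apply: measurable_funB; apply: measurable_funM => //.
  by apply: measurable_funX; exact: measurable_funB.
by apply: measurable_funD; exact: measurable_funX.
Qed.

(* The mean of [h_n (r x + xi)], [xi] a centered Gaussian of precision [mB], is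
   [r ^ n h_n x]: recursion on [n] by Gaussian integration by parts. *)
Lemma gsint_hpoly_comp n x :
  gsint mB (hpoly al n \Po ('X + (r * x)%:P)) = r ^+ n * (hpoly al n).[x] * Num.sqrt (pi / mB).
Proof.
have B0 := mB_gt0; have rn0 := gt_eqF r2_lt1.
set m := r * x; pose c p := p \Po ('X + m%:P).
have cD p : (c p)^`() = c p^`().
  by rewrite /c deriv_comp derivD derivX derivC addr0 mulr1.
suff H k : (k <= n)%N -> gsint mB (c (hpoly al k)) = r ^+ k * (hpoly al k).[x] * Num.sqrt (pi / mB) by exact: H.
elim/ltn_ind: k => -[|k] IH kn.
  by rewrite /c comp_polyC gsint1// expr0 hornerC !mul1r.
have Ik := IH k (ltnSn _) (ltnW kn).
have Idk : r * gsint mB (c (hpoly al k)^`()) = r ^+ k * (hpoly al k)^`().[x] * Num.sqrt (pi / mB).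
  rewrite deriv_hpoly// /c comp_polyZ gsintZ// hornerZ.
  case: k => [|k] in IH Ik kn *; first by rewrite mulr0; ring.
  rewrite -/(c (hpoly al k)) (IH k)//; last exact: ltnW (ltnW kn).
  by rewrite exprS; ring.
have cS : c (hpoly al k.+1) =
    (4 * al) *: ('X * c (hpoly al k) + m%:P * c (hpoly al k)) - c (hpoly al k)^`().
  by rewrite hpolyS /c comp_polyB comp_polyZ comp_polyM comp_polyX (mulrDl 'X).
rewrite cS gsintB// gsintZ// gsintD// hpolyS.
have -> : gsint mB (m%:P * c (hpoly al k)) = m * gsint mB (c (hpoly al k)).
  by rewrite mul_polyC gsintZ.
have -> : gsint mB ('X * c (hpoly al k)) = (1 - r ^+ 2) / (4 * al) * gsint mB (c (hpoly al k)^`()).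
  rewrite -cD gsint_ibp//; rewrite /mB; field.
  by rewrite ?rn0 ?gt_eqF.
rewrite Ik hornerD hornerN hornerZ hornerM hornerX.
transitivity (r * (4 * al * x * (r ^+ k * (hpoly al k).[x] * Num.sqrt (pi / mB)))
   - r * (r * gsint mB (c (hpoly al k)^`()))); first by rewrite /m; field; rewrite gt_eqF.
by rewrite Idk exprS; ring.
Qed.

(** Completing the square with [mB = mq + mb + al]: against the ground state the kernel is a
    Gaussian law in [y] centered at [r x], an Ornstein-Uhlenbeck transition. *)
Lemma mk_hfun0 x y : mk x y * gs al y = gs al x * (Num.sqrt (mB / pi) * gs mB (y - r * x)).
Proof.
rewrite /mk /gs [RHS]mulrCA -[LHS]mulrA; congr (_ * _); rewrite -!expRD; congr expR.
rewrite /mq /mb /mB r2E; field.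
by rewrite r1_neq0 gt_eqF// subr_gt0.
Qed.

Lemma mk_eigen_integrable n x : leb.-integrable setT (EFin \o (fun y => mk x y * hfun al n y)).
Proof.
have B0 := mB_gt0.
pose M := gs al x * Num.sqrt (mB / pi).
have [K K0 KP] := horner_gs_bound (hpoly al n) 0 al0.
have -> : (fun y => mk x y * hfun al n y) = fun y => M * (hpoly al n).[y] * gs mB (y - r * x).
  by apply/funext => y; rewrite /hfun mulrCA mk_hfun0 /M; ring.
apply: (@integrable_le_real _ _ R leb _ (fun y => (expR (- mB * (r * x) ^+ 2)) *
   (`|M * (hpoly al n).[y]| * expR (2 * mB * `|r * x| * `|y|) * gs mB y))).
- apply: measurable_funM; first by apply: measurable_funM => //; exact: measurable_horner.
  apply: (measurableT_comp (@measurable_gs R mB)).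
  exact: measurable_funB.
- move=> y; rewrite normrM (ger0_norm (gs_ge0 _ _)).
  rewrite -[in leRHS]mulrA [leRHS]mulrCA ler_wpM2l//.
  rewrite /gs -!expRD ler_expR.
  have h : r * x * y <= `|r * x| * `|y| by rewrite -normrM ler_norm.
  have : 2 * mB * (r * x * y) <= 2 * mB * (`|r * x| * `|y|).
    by apply: ler_wpM2l => //; apply: mulr_ge0 => //; exact: ltW.
  rewrite sqrrB; move: (r * x) (`|r * x|) (`|y|) mB => u v w b; lin.
have := @integrableZl _ _ _ leb setT measurableT (expR (- mB * (r * x) ^+ 2)) _
  (integrable_norm (integrable_horner_exp_gs (M *: hpoly al n) (2 * mB * `|r * x|) B0)).
apply: eq_integrable => // y _ /=; congr EFin; congr (_ * _).
by rewrite 2!normrM hornerZ (ger0_norm (expR_ge0 _)) (ger0_norm (gs_ge0 _ _)).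
Qed.

Lemma mk_eigen n x : \int[leb]_y (mk x y * hfun al n y) = r ^+ n * hfun al n x.
Proof.
have B0 := mB_gt0.
pose M := gs al x * Num.sqrt (mB / pi).
pose F y := M * ((hpoly al n).[y + r * x] * gs mB y).
have FE y : mk x y * hfun al n y = F (y - r * x).
  by rewrite /hfun mulrCA mk_hfun0 /F /M subrK; ring.
have mF : measurable_fun [set: R] (fun y => (F y)%:E).
  apply/measurable_EFinP; apply: measurable_funM => //; apply: measurable_funM; last exact: measurable_gs.
  apply: (measurableT_comp (measurable_horner _)); exact: measurable_funD.
have intF := int_shift (- (r * x)) mF.
rewrite /Rintegral; under eq_integral do rewrite FE.
rewrite intF /F.
transitivity (fine (M%:E * \int[leb]_y ((hpoly al n \Po ('X + (r * x)%:P)).[y] * gs mB y)%:E)%E).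
  rewrite -integralZl//; last exact: integrable_horner_gs.
  congr fine; apply: eq_integral => y _; rewrite -EFinM; congr EFin.
  by rewrite horner_comp !hornerE.
rewrite gsintE// -EFinM/= gsint_hpoly_comp /M /hfun.
have -> : Num.sqrt (mB / pi) = (Num.sqrt (pi / mB))^-1.
  by rewrite -[mB / pi]invf_div sqrtrV// divr_ge0 ?pi_ge0 ?ltW.
field; rewrite gt_eqF// sqrtr_gt0 divr_gt0 ?pi_gt0//.
Qed.

Definition mk2 x := mB / pi * Num.sqrt (pi / (2 * (mq + mb))) * gs (2 * al ^+ 2 / (mq + mb)) x.

Lemma mqb2 : (mq + mb) ^+ 2 - mq ^+ 2 = al ^+ 2.
Proof.
rewrite /mq /mb r2E; field.
by rewrite r1_neq0 gt_eqF// subr_gt0.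
Qed.

Lemma mk_sq_int x : (\int[leb]_y (mk x y ^+ 2)%:E = (mk2 x)%:E)%E.
Proof.
have q0 := mq_gt0; have b0 := mb_gt0; have B0 := mB_gt0.
have qb0 : 0 < mq + mb by exact: addr_gt0.
pose G y := (gs (2 * (mq + mb)) y)%:E.
have E y : ((mk x y ^+ 2)%:E = (mB / pi * gs (2 * al ^+ 2 / (mq + mb)) x)%:E * G (1 * y - mq / (mq + mb) * x)%R)%E.
  rewrite /G -EFinM; congr EFin.
  have s2 : Num.sqrt (mB / pi) ^+ 2 = mB / pi by rewrite sqr_sqrtr// divr_ge0 ?pi_ge0 ?ltW.
  rewrite /mk exprMn s2 -[RHS]mulrA; congr (_ * _).
  rewrite /gs -expRM_natl -expRD; congr expR.
  rewrite -mqb2; field; rewrite gt_eqF//.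
under eq_integral do rewrite E.
have mG : measurable_fun [set: R] G by apply/measurable_EFinP; exact: measurable_gs.
rewrite ge0_integralZl//; last first.
- by rewrite lee_fin mulr_ge0 ?gs_ge0// divr_ge0 ?pi_ge0// ltW.
- by move=> y _; rewrite lee_fin gs_ge0.
- by apply: (measurableT_comp mG); exact: measurable_affine.
rewrite (@ge0_int_affine _ 1 (- (mq / (mq + mb) * x)) G)//; last by move=> y; rewrite lee_fin gs_ge0.
rewrite normr1 invr1 mul1e /G int_gs ?mulr_gt0// -EFinM; congr EFin.
by rewrite /mk2; ring.
Qed.

(** This squared Hilbert-Schmidt norm is the geometric series of the squares of the eigenvalues
    [r ^ n]: the Hermite functions exhaust the kernel, and this is the source of completeness. *)
Lemma mk2_int : (\int[leb]_x (mk2 x)%:E = ((1 - r ^+ 2)^-1)%:E)%E.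
Proof.
have q0 := mq_gt0; have b0 := mb_gt0; have B0 := mB_gt0.
have qb0 : 0 < mq + mb by exact: addr_gt0.
have a0 : 0 < 2 * al ^+ 2 / (mq + mb) by rewrite divr_gt0 ?mulr_gt0 ?exprn_gt0.
under eq_integral do rewrite EFinM.
rewrite ge0_integralZl//; last first.
- by rewrite lee_fin mulr_ge0 ?sqrtr_ge0// divr_ge0 ?pi_ge0// ltW.
- by move=> y _; rewrite lee_fin gs_ge0.
- by apply/measurable_EFinP; apply: measurable_gs.
rewrite int_gs// -EFinM; congr EFin.
rewrite -[LHS]mulrA.
rewrite -sqrtrM ?divr_ge0 ?pi_ge0 ?mulr_ge0 ?ltW//.
have -> : pi / (2 * (mq + mb)) * (pi / (2 * al ^+ 2 / (mq + mb))) = (pi / (2 * al)) ^+ 2.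
  by field; rewrite !gt_eqF.
rewrite sqrtr_sqr ger0_norm ?divr_ge0 ?pi_ge0 ?mulr_ge0 ?ltW//.
rewrite /mB; have := @pi_gt0 R; move: pi => P P0; field.
by rewrite !gt_eqF ?r2_lt1.
Qed.

End Mehler1D.

(** * Integral operators and the Mehler kernel *)

Lemma quadratic_disc (R : realType) (A B C : R) :
  (forall s, 0 <= s ^+ 2 * A + 2 * s * B + C) -> 0 <= A -> B ^+ 2 <= A * C.
Proof.
move=> H A0; have [A1|A1] := eqVneq A 0.
  have [->|B0] := eqVneq B 0; first by rewrite A1 mul0r expr0n.
  have := H (- (C + 1) / (2 * B)); rewrite A1 mulr0 add0r.
  have -> : 2 * (- (C + 1) / (2 * B)) * B = - (C + 1) by field.
  lin.
have A2 : 0 < A by rewrite lt_def A1 A0.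
have := H (- (B / A)).
have -> : (- (B / A)) ^+ 2 * A + 2 * (- (B / A)) * B + C = (A * C - B ^+ 2) / A.
  by field.
by rewrite pmulr_lge0 ?invr_gt0// subr_ge0.
Qed.

Section SquareIntegrable.
Context d (T : measurableType d) (R : realType) (mu : {measure set T -> \bar R}).
Implicit Types (f g : T -> R).

Definition sqint f := measurable_fun [set: T] f /\
  mu.-integrable setT (EFin \o (fun x => f x ^+ 2)).
Definition ipm f g := \int[mu]_x (f x * g x).

Lemma sqint_dom f g : measurable_fun [set: T] f ->
  (forall x, `|f x| <= `|g x|) -> sqint g -> sqint f.
Proof.
move=> mf fg [mg g2]; split => //.
apply: (integrable_le_real _ _ g2); first exact: measurable_funX.
move=> x; rewrite normrX -[g x ^+ 2]real_normK ?num_real//.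
by rewrite lerXn2r ?nnegrE.
Qed.

Lemma sqint_mul f g : sqint f -> sqint g -> mu.-integrable setT (EFin \o (fun x => f x * g x)).
Proof.
move=> [mf f2] [mg g2].
apply: (@integrable_le_real _ _ _ mu _ (fun x => f x ^+ 2 + g x ^+ 2)).
- exact: measurable_funM.
- move=> x; rewrite normrM.
  have := sqr_ge0 (`|f x| - `|g x|); rewrite sqrrB !real_normK ?num_real//.
  have := sqr_ge0 (f x); have := sqr_ge0 (g x); lin.
- have := integrableD measurableT f2 g2.
  by apply: eq_integrable => // x _.
Qed.

Lemma sqintP a f g : sqint f -> sqint g -> sqint (fun x => a * f x + g x).
Proof.
move=> sf sg; have [mf f2] := sf; have [mg g2] := sg; split.
  by apply: measurable_funD => //; exact: measurable_funM.
have := integrableD measurableT (integrableD measurableT (integrableZl measurableT (a ^+ 2) f2)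
   (integrableZl measurableT (2 * a) (sqint_mul sf sg))) g2.
apply: eq_integrable => // x _ /=; rewrite -EFinM -!EFinD; congr EFin; ring.
Qed.
Lemma sqint0 : sqint (fun=> 0).
Proof.
split; first exact: measurable_cst.
by have := integrable0 mu setT; apply: eq_integrable => // x _ /=; rewrite expr0n.
Qed.
Lemma sqintZ a f : sqint f -> sqint (fun x => a * f x).
Proof.
move=> /(sqintP a) /(_ sqint0).
by rewrite (_ : (fun x => _ + _) = fun x => a * f x)//; apply/funext => x; rewrite addr0.
Qed.
Lemma sqintD f g : sqint f -> sqint g -> sqint (fun x => f x + g x).
Proof.
move=> sf /(sqintP 1 sf).
by rewrite (_ : (fun x => _ + _) = fun x => f x + g x)//; apply/funext => x; rewrite mul1r.
Qed.
Lemma sqintB f g : sqint f -> sqint g -> sqint (fun x => f x - g x).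
Proof.
move=> sf /(sqintZ (-1)) /(sqintD sf).
by rewrite (_ : (fun x => _ + _) = fun x => f x - g x)//; apply/funext => x; rewrite mulN1r.
Qed.
Lemma sqint_sum (I : Type) (s : seq I) (F : I -> T -> R) :
  (forall i, sqint (F i)) -> sqint (fun x => \sum_(i <- s) F i x).
Proof.
move=> sF; elim: s => [|i s IH].
  rewrite (_ : (fun x => _) = fun=> 0); first exact: sqint0.
  by apply/funext => x; rewrite big_nil.
rewrite (_ : (fun x => _) = fun x => F i x + \sum_(j <- s) F j x).
  exact: sqintD.
by apply/funext => x; rewrite big_cons.
Qed.

Lemma ipmC f g : ipm f g = ipm g f.
Proof. by apply: eq_Rintegral => x _; rewrite mulrC. Qed.
Lemma ipmP a f g h : sqint f -> sqint g -> sqint h ->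
  ipm (fun x => a * f x + g x) h = a * ipm f h + ipm g h.
Proof.
move=> sf sg sh; rewrite /ipm -RintegralZl//; last exact: sqint_mul.
rewrite -RintegralD//; last 2 first.
- have := integrableZl measurableT a (sqint_mul sf sh).
  by apply: eq_integrable => // x _.
- exact: sqint_mul.
by apply: eq_Rintegral => x _; ring.
Qed.
Lemma ipm0 h : ipm (fun=> 0) h = 0.
Proof.
rewrite /ipm /Rintegral; under eq_integral do rewrite mul0r.
by rewrite integral0.
Qed.
Lemma ipmZ a f h : sqint f -> sqint h -> ipm (fun x => a * f x) h = a * ipm f h.
Proof.
move=> sf sh; rewrite -[RHS]addr0 -(ipm0 h) -ipmP//; last exact: sqint0.
by apply: eq_Rintegral => x _; rewrite addr0.
Qed.
Lemma ipmD f g h : sqint f -> sqint g -> sqint h ->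
  ipm (fun x => f x + g x) h = ipm f h + ipm g h.
Proof.
move=> sf sg sh; rewrite -[ipm f h]mul1r -ipmP//.
by apply: eq_Rintegral => x _; rewrite mul1r.
Qed.
Lemma ipmB f g h : sqint f -> sqint g -> sqint h ->
  ipm (fun x => f x - g x) h = ipm f h - ipm g h.
Proof.
move=> sf sg sh; rewrite -mulN1r addrC -ipmP//.
by apply: eq_Rintegral => x _; rewrite mulN1r addrC.
Qed.
Lemma ipm_sum (I : Type) (s : seq I) (F : I -> T -> R) h : (forall i, sqint (F i)) -> sqint h ->
  ipm (fun x => \sum_(i <- s) F i x) h = \sum_(i <- s) ipm (F i) h.
Proof.
move=> sF sh; elim: s => [|i s IH].
  rewrite big_nil; transitivity (ipm (fun=> 0) h); last exact: ipm0.
  by apply: eq_Rintegral => x _; rewrite big_nil.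
rewrite big_cons -IH -ipmD//; last exact: sqint_sum.
by apply: eq_Rintegral => x _; rewrite big_cons.
Qed.
Lemma Rintegral_sum (I : Type) (s : seq I) (F : I -> T -> R) :
  (forall i, mu.-integrable setT (EFin \o F i)) ->
  mu.-integrable setT (EFin \o (fun x => \sum_(i <- s) F i x)) /\
  \int[mu]_x (\sum_(i <- s) F i x) = \sum_(i <- s) \int[mu]_x F i x.
Proof.
move=> Fi.
have si s' : mu.-integrable setT (EFin \o (fun x => \sum_(i <- s') F i x)).
  have := @integrable_sum _ _ _ mu setT measurableT _ s' xpredT
    (fun i x => (F i x)%:E) (fun i _ => Fi i).
  by apply: eq_integrable => // x _ /=; rewrite sumEFin.
split => //; elim: s => [|i s IH].
  rewrite big_nil /Rintegral; under eq_integral do rewrite big_nil.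
  by rewrite integral0.
rewrite big_cons -IH -RintegralD//.
by apply: eq_Rintegral => x _; rewrite big_cons.
Qed.

Lemma ipm_ge0 f : 0 <= ipm f f.
Proof. by apply: Rintegral_ge0 => x _; rewrite -expr2 sqr_ge0. Qed.
Lemma ipmE f : sqint f -> ((ipm f f)%:E = \int[mu]_x (f x ^+ 2)%:E)%E.
Proof.
move=> [mf f2]; rewrite /ipm /Rintegral fineK; first by [].
exact: integrable_fin_num.
Qed.
Lemma ipm_CS f g : sqint f -> sqint g -> ipm f g ^+ 2 <= ipm f f * ipm g g.
Proof.
move=> sf sg; apply: quadratic_disc; last exact: ipm_ge0.
move=> s; have := ipm_ge0 (fun x => s * f x + g x).
rewrite ipmP//; last exact: sqintP.
rewrite ![ipm _ (fun x => s * f x + g x)]ipmC !ipmP// (ipmC g f); lin.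
Qed.
Lemma ipm_eq0 f : sqint f -> ipm f f = 0 -> (\int[mu]_x `|f x|%:E = 0)%E.
Proof.
move=> sf f0; have [mf f2] := sf.
have m2 : measurable_fun [set: T] (fun x => (f x ^+ 2)%:E).
  by apply/measurable_EFinP; exact: measurable_funX.
have mE : measurable_fun [set: T] (fun x => (f x)%:E) by exact/measurable_EFinP.
have h : (\int[mu]_x `|(f x ^+ 2)%:E| = 0)%E.
  under eq_integral do rewrite /= ger0_norm ?sqr_ge0//.
  by rewrite -ipmE// f0.
move/(ae_eq_integral_abs mu measurableT m2) : h => h.
apply/(ae_eq_integral_abs mu measurableT mE).
apply: filterS h => x /= h /h; case => /eqP; rewrite sqrf_eq0 => /eqP ->.
by [].
Qed.

End SquareIntegrable.

Section HilbertSchmidt.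
Context d (T : measurableType d) (R : realType) (mu : {sigma_finite_measure set T -> \bar R}).
Notation sq := (sqint mu).
Notation ip := (ipm mu).

Lemma measurable_Rint_snd (k : T * T -> R) : measurable_fun [set: T * T] k ->
  measurable_fun [set: T] (fun x => \int[mu]_y k (x, y)).
Proof.
move=> mk; apply: measurableT_comp => //.
rewrite (_ : (fun x => _) = fun x =>
  (\int[mu]_y ((EFin \o k)^\+ (x, y)) - \int[mu]_y ((EFin \o k)^\- (x, y)))%E); last first.
  by apply/funext => x; rewrite integralE; congr (_ - _)%E; apply: eq_integral => y _; rewrite ?funeposE ?funenegE.
have mEk : measurable_fun [set: T * T] (EFin \o k) by exact/measurable_EFinP.
apply: emeasurable_funB.
  by apply: measurable_fun_fubini_tonelli_F => //; exact: measurable_funepos.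
by apply: measurable_fun_fubini_tonelli_F => //; exact: measurable_funeneg.
Qed.

Variables (k : T * T -> R) (kap : T -> R) (H : R).
Hypothesis mk : measurable_fun [set: T * T] k.
Hypothesis ksq : forall x, sq (fun y => k (x, y)).
Hypothesis kapE : forall x, (ip (fun y => k (x, y)) (fun y => k (x, y))) = kap x.
Hypothesis kapi : mu.-integrable setT (EFin \o kap).
Hypothesis kapH : \int[mu]_x kap x = H.
Variables (I : finType) (e : I -> T -> R) (ev : I -> R).
Hypothesis esq : forall i, sq (e i).
Hypothesis eon : forall i j, (ip (e i) (e j)) = (i == j)%:R.
Hypothesis eeig : forall i x, (ip (fun y => k (x, y)) (e i)) = ev i * e i x.

Definition kint (g : T -> R) x := (ip (fun y => k (x, y)) g).

(** The kernel deprived of finitely many known eigenfunctions; its squared Hilbert-Schmidt norm is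
    [H] minus the sum of the [ev i ^ 2]. *)
Let K0 x y := k (x, y) - \sum_i ev i * e i x * e i y.

Lemma sum_orthonormal_ip (c : I -> R) j :
  (ip (fun y => \sum_i c i * e i y) (e j)) = c j.
Proof.
rewrite ipm_sum//; last by move=> i; exact: sqintZ.
rewrite (bigD1 j)//= ipmZ// eon eqxx mulr1 big1 ?addr0// => i /negPf ij.
by rewrite ipmZ// eon ij mulr0.
Qed.

Lemma bessel g : sq g -> \sum_i (ip (e i) g) ^+ 2 <= (ip g g).
Proof.
move=> sg; pose p y := \sum_i (ip (e i) g) * e i y.
have sp : sq p by apply: sqint_sum => i; exact: sqintZ.
have pg : (ip p g) = \sum_i (ip (e i) g) ^+ 2.
  rewrite ipm_sum//; last by move=> i; exact: sqintZ.
  by apply: eq_bigr => i _; rewrite ipmZ.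
have pp : (ip p p) = \sum_i (ip (e i) g) ^+ 2.
  rewrite {1}/p ipm_sum//; last by move=> i; exact: sqintZ.
  by apply: eq_bigr => i _; rewrite ipmZ// (ipmC mu (e i) p) /p sum_orthonormal_ip.
have := ipm_ge0 mu (fun x => g x - p x).
rewrite ipmB//; last exact: sqintB.
rewrite ![ipm mu _ (fun x => g x - p x)]ipmC !ipmB// (ipmC mu g p) pg pp.
lin.
Qed.

Let K0sq x : sq (K0 x).
Proof. by apply: sqintB => //; apply: sqint_sum => i; exact: sqintZ. Qed.

Let K0norm x : (ip (K0 x) (K0 x)) = kap x - \sum_i (ev i * e i x) ^+ 2.
Proof.
pose p y := \sum_i (ev i * e i x) * e i y.
have sp : sq p by apply: sqint_sum => i; exact: sqintZ.
have kp : (ip (fun y => k (x, y)) p) = \sum_i (ev i * e i x) ^+ 2.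
  rewrite ipmC ipm_sum//; last by move=> i; exact: sqintZ.
  by apply: eq_bigr => i _; rewrite ipmZ// ipmC eeig.
have pp : (ip p p) = \sum_i (ev i * e i x) ^+ 2.
  rewrite {1}/p ipm_sum//; last by move=> i; exact: sqintZ.
  by apply: eq_bigr => i _; rewrite ipmZ// (ipmC mu (e i) p) /p sum_orthonormal_ip.
have -> : K0 x = fun y => k (x, y) - p y by [].
rewrite ipmB//; last exact: sqintB.
rewrite ![ipm mu _ (fun y => k (x, y) - p y)]ipmC !ipmB// (ipmC mu p) kp pp kapE.
ring.
Qed.

Lemma measurable_kint g : measurable_fun [set: T] g -> measurable_fun [set: T] (kint g).
Proof.
move=> mg; apply: (@measurable_Rint_snd (fun z => k z * g z.2)).
by apply: measurable_funM => //; exact: (measurableT_comp mg measurable_snd).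
Qed.

Lemma kint_sq_le g x : sq g -> kint g x ^+ 2 <= kap x * (ip g g).
Proof. by move=> sg; rewrite -kapE; exact: ipm_CS. Qed.

Lemma kint_sq g : sq g -> sq (kint g).
Proof.
move=> sg; have [mg _] := sg; have mkg := measurable_kint mg; split => //.
apply: (@integrable_le_real _ _ _ mu _ (fun x => (ip g g) * kap x)).
- exact: measurable_funX.
- by move=> x; rewrite ger0_norm ?sqr_ge0// mulrC; exact: kint_sq_le.
- have := integrableZl measurableT (ip g g) kapi.
  by apply: eq_integrable => // x _.
Qed.

Let proj g x := \sum_i (ev i * ip (e i) g) * e i x.

Lemma tail_ge0 : 0 <= H - \sum_i ev i ^+ 2 /\ forall g, sq g ->
  `|ip (kint g) g - \sum_i ev i * ip (e i) g ^+ 2| <=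
    ip g g * Num.sqrt (H - \sum_i ev i ^+ 2) /\
  ip (fun x => kint g x - proj g x) (fun x => kint g x - proj g x) <=
    ip g g * (H - \sum_i ev i ^+ 2).
Proof.
have ei2 i : mu.-integrable setT (EFin \o (fun x => (ev i * e i x) ^+ 2)).
  by have [_] := sqintZ (ev i) (esq i).
have [esum_int esumE] := @Rintegral_sum _ _ _ mu _ (index_enum I)
  (fun i x => (ev i * e i x) ^+ 2) ei2.
have ev2 i : \int[mu]_x (ev i * e i x) ^+ 2 = ev i ^+ 2.
  transitivity (ip (fun x => ev i * e i x) (fun x => ev i * e i x)).
    by apply: eq_Rintegral => x _.
  by rewrite ipmZ ?(ipmC _ (e i)) ?ipmZ ?eon ?eqxx ?mulr1//; exact: sqintZ.
have tI : \int[mu]_x (kap x - \sum_i (ev i * e i x) ^+ 2) = H - \sum_i ev i ^+ 2.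
  by rewrite RintegralB// kapH esumE; congr (_ - _); apply: eq_bigr => i _.
have ti : mu.-integrable setT (EFin \o (fun x => kap x - \sum_i (ev i * e i x) ^+ 2)).
  have := integrableB measurableT kapi esum_int.
  by apply: eq_integrable => // x _.
have t0 x : 0 <= kap x - \sum_i (ev i * e i x) ^+ 2 by rewrite -K0norm ipm_ge0.
have D0 : 0 <= H - \sum_i ev i ^+ 2 by rewrite -tI; apply: Rintegral_ge0.
split => // g sg.
pose p := proj g.
have sp : sq p by apply: sqint_sum => i; exact: sqintZ.
have skg := kint_sq sg.
pose r x := kint g x - p x.
have sr : sq r by exact: sqintB.
have rE x : r x = (ip (K0 x) g).
  rewrite /K0 ipmB//; last by apply: sqint_sum => i; exact: sqintZ.
  congr (_ - _); rewrite ipm_sum//; last by move=> i; exact: sqintZ.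
  by apply: eq_bigr => i _; rewrite ipmZ// mulrAC.
have rr : (ip r r) <= (ip g g) * (H - \sum_i ev i ^+ 2).
  rewrite -tI -RintegralZl//.
  have [_ r2] := sr.
  apply: le_Rintegral => //.
    have := integrableZl measurableT (ip g g) ti.
    by apply: eq_integrable => // x _.
  by move=> x _; rewrite -expr2 rE mulrC -K0norm; exact: ipm_CS.
split; last exact: rr.
have -> : (ip (kint g) g) - \sum_i ev i * (ip (e i) g) ^+ 2 = (ip r g).
  rewrite ipmB//; congr (_ - _); rewrite ipm_sum//; last by move=> i; exact: sqintZ.
  by apply: eq_bigr => i _; rewrite ipmZ// -mulrA.
have g0 := ipm_ge0 mu g.
rewrite -ler_sqr ?nnegrE ?mulr_ge0 ?sqrtr_ge0// real_normK ?num_real//.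
rewrite exprMn sqr_sqrtr//; apply: le_trans (ipm_CS sr sg) _.
by rewrite mulrC expr2 -mulrA ler_wpM2l.
Qed.

(** The form splits into the listed eigenfunctions, where Bessel's inequality and the bound [kp] on
    the surviving eigenvalues act, and the remainder of [tail_ge0]. *)
Lemma kint_form_le g (kp : R) : sq g -> (forall i, kp < ev i -> (ip (e i) g) = 0) ->
  0 <= kp -> (ip (kint g) g) <= (kp + Num.sqrt (H - \sum_i ev i ^+ 2)) * (ip g g).
Proof.
move=> sg g0 kp0; have [D0 /(_ _ sg)[+ _]] := tail_ge0.
have S : \sum_i ev i * (ip (e i) g) ^+ 2 <= kp * (ip g g).
  apply: (@le_trans _ _ (kp * \sum_i (ip (e i) g) ^+ 2)).
    rewrite mulr_sumr; apply: ler_sum => i _.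
    have [h|h] := ltP kp (ev i); first by rewrite g0// expr0n !mulr0.
    by rewrite ler_wpM2r ?sqr_ge0.
  by rewrite ler_wpM2l// bessel.
set a := (ip (kint g) g); set b := \sum_i ev i * _ in S *; set s := Num.sqrt _.
have := ler_norm (a - b); rewrite mulrDl (mulrC s); lin.
Qed.

Lemma kint_orth g : sq g -> (forall i, ip (e i) g = 0) ->
  ip (kint g) (kint g) <= ip g g * (H - \sum_i ev i ^+ 2).
Proof.
move=> sg g0; have [D0 /(_ _ sg)[_]] := tail_ge0.
rewrite (_ : (fun x => _) = kint g)//; apply/funext => x.
by rewrite /proj big1 ?subr0// => i _; rewrite g0 mulr0 mul0r.
Qed.

End HilbertSchmidt.

Section MehlerRd.
Variables (R : realType) (d : nat) (al : R).
Hypothesis al0 : 0 < al.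
Notation pt := (d.-tuple R).
Notation leb := (@lebesgue_measure R).
Notation mu := (vol R d).
Notation sq := (sqint (vol R d)).
Notation ip := (ipm (vol R d)).

Definition psi (b : 'I_d -> nat) (x : pt) : R := \prod_i hfun al (b i) (tnth x i).
Definition psi2 (b : 'I_d -> nat) : R := \prod_i hnorm2 al (b i).

Lemma psi2_gt0 b : 0 < psi2 b.
Proof. by apply: prodr_gt0 => i _; exact: hnorm2_gt0. Qed.

Lemma measurable_psi b : measurable_fun [set: pt] (psi b).
Proof. exact: (measurable_prod_tnth (fun i => @measurable_hfun R al (b i))). Qed.

Lemma psi_exp_integrable b c : mu.-integrable setT
  (EFin \o (fun x : pt => psi b x ^+ 2 * \prod_i expR (c * `|tnth x i|))).
Proof.
have [h _] := @int_prod_tnth R d (fun i x => hfun al (b i) x ^+ 2 * expR (c * `|x|))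
  (fun i => hfun_exp_integrable al0 (b i) c).
apply: eq_integrable h => // x _ /=; congr EFin.
by rewrite big_split/= prodrXl.
Qed.

Lemma psi_sq b : sq (psi b).
Proof.
split; first exact: measurable_psi.
have := psi_exp_integrable b 0; apply: eq_integrable => // x _ /=; congr EFin.
by rewrite big1 ?mulr1// => i _; rewrite mul0r expR0.
Qed.

Lemma psi_orth b c : ip (psi b) (psi c) = \prod_i ((b i == c i)%:R * hnorm2 al (b i)).
Proof.
have [_] := @int_prod_tnth R d (fun i x => hfun al (b i) x * hfun al (c i) x)
  (fun i => hfun_mul_integrable al0 (b i) (c i)).
rewrite /ipm /Rintegral => h.
under eq_integral do rewrite /psi -big_split/=.
by rewrite h/=; apply: eq_bigr => i _; exact: hfun_orth.
Qed.

Lemma psi_orth_neq b c : b <> c -> ip (psi b) (psi c) = 0.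
Proof.
move=> bc; rewrite psi_orth; have [i bi] : exists i, b i != c i.
  apply: contrapT => /forallNP h; apply: bc; apply/funext => i.
  by apply/eqP; rewrite -[_ == _]negbK; apply/negP; exact: h.
by rewrite (bigD1 i)//= (negPf bi) mul0r mul0r.
Qed.

Lemma psi_norm b : ip (psi b) (psi b) = psi2 b.
Proof. by rewrite psi_orth; apply: eq_bigr => i _; rewrite eqxx mul1r. Qed.

Section Kernel.
Variable r : R.
Hypotheses (r0 : 0 < r) (r1 : r < 1).

Definition Km (z : pt * pt) : R := \prod_i mk al r (tnth z.1 i) (tnth z.2 i).

Lemma Km_ge0 z : 0 <= Km z.
Proof. by apply: prodr_ge0 => i _; exact: mk_ge0. Qed.

Lemma measurable_Km : measurable_fun [set: pt * pt] Km.
Proof.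
have h := @measurable_prod _ (pt * pt)%type R [set: pt * pt] _ (index_enum _)
  (fun i (z : pt * pt) => mk al r (tnth z.1 i) (tnth z.2 i)).
apply: h => i _.
have m1 : measurable_fun [set: pt * pt] (fun z => tnth z.1 i).
  exact: (measurableT_comp (@measurable_tnth _ R d i) measurable_fst).
have m2 : measurable_fun [set: pt * pt] (fun z => tnth z.2 i).
  exact: (measurableT_comp (@measurable_tnth _ R d i) measurable_snd).
exact: (measurableT_comp (measurable_mk al r) (measurable_fun_pair m1 m2)).
Qed.

Lemma mk_sq_integrable x : leb.-integrable setT (EFin \o (fun y => mk al r x y ^+ 2)).
Proof.
apply/integrableP; split.
  apply/measurable_EFinP; apply: measurable_funX.
  exact: (measurableT_comp (measurable_mk al r) (measurable_pair1 x)).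
under eq_integral do rewrite /= ger0_norm ?sqr_ge0//.
by rewrite mk_sq_int// ltry.
Qed.

Lemma Km_sq x : sq (fun y => Km (x, y)).
Proof.
split; first exact: (measurableT_comp measurable_Km (measurable_pair1 x)).
have [h _] := @int_prod_tnth R d (fun i y => mk al r (tnth x i) y ^+ 2)
  (fun i => mk_sq_integrable _).
by apply: eq_integrable h => // y _ /=; rewrite prodrXl.
Qed.

Definition Kap (x : pt) : R := \prod_i mk2 al r (tnth x i).

Lemma Km_norm x : ip (fun y => Km (x, y)) (fun y => Km (x, y)) = Kap x.
Proof.
have [_] := @int_prod_tnth R d (fun i y => mk al r (tnth x i) y ^+ 2)
  (fun i => mk_sq_integrable _).
rewrite /ipm /Rintegral => h.
under eq_integral do rewrite /Km -big_split/=.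
rewrite h/=; apply: eq_bigr => i _.
by rewrite /Rintegral mk_sq_int.
Qed.

Lemma mk2_ge0 (x : R) : 0 <= mk2 al r x.
Proof.
apply: mulr_ge0; last exact: gs_ge0.
apply: mulr_ge0; last exact: sqrtr_ge0.
apply: mulr_ge0; first exact: ltW (mB_gt0 al0 r0 r1).
by rewrite invr_ge0 pi_ge0.
Qed.

Lemma Kap_int : mu.-integrable setT (EFin \o Kap) /\ \int[mu]_x Kap x = (1 - r ^+ 2)^-1 ^+ d.
Proof.
have ki : leb.-integrable setT (EFin \o mk2 al r).
  apply/integrableP; split.
    by apply/measurable_EFinP; apply: measurable_funM => //; exact: measurable_gs.
  under eq_integral do rewrite /= ger0_norm ?mk2_ge0//.
  by rewrite mk2_int// ltry.
have [h1 h2] := @int_prod_tnth R d (fun i => mk2 al r) (fun i => ki).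
split; first exact: h1.
rewrite /Rintegral h2/= -[in RHS](card_ord d) -prodr_const; apply: eq_bigr => i _.
by rewrite /Rintegral mk2_int.
Qed.

Lemma Km_psi b x : ip (fun y => Km (x, y)) (psi b) = r ^+ (\sum_i b i) * psi b x.
Proof.
have [_] := @int_prod_tnth R d (fun i y => mk al r (tnth x i) y * hfun al (b i) y)
  (fun i => mk_eigen_integrable al0 r0 r1 _ _).
rewrite /ipm /Rintegral => h.
under eq_integral do rewrite /Km /psi -big_split/=.
rewrite h/= -prodrXr -big_split/=.
by apply: eq_bigr => i _; rewrite -[LHS]/(\int[leb]_y (mk al r (tnth x i) y * hfun al (b i) y)) mk_eigen.
Qed.

Definition bval N (b : {ffun 'I_d -> 'I_N}) : 'I_d -> nat := fun i => b i.
Definition ebox N (b : {ffun 'I_d -> 'I_N}) (x : pt) : R :=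
  (Num.sqrt (psi2 (bval b)))^-1 * psi (bval b) x.
Definition evbox N (b : {ffun 'I_d -> 'I_N}) : R := r ^+ (\sum_i bval b i).

Lemma ebox_sq N (b : {ffun 'I_d -> 'I_N}) : sq (ebox b).
Proof. by apply: sqintZ; exact: psi_sq. Qed.

Lemma ebox_on N (b c : {ffun 'I_d -> 'I_N}) : ip (ebox b) (ebox c) = (b == c)%:R.
Proof.
rewrite ipmZ ?(ipmC _ (psi _)) ?ipmZ//; try exact: psi_sq; try exact: ebox_sq.
have [->|bc] := eqVneq b c.
  rewrite psi_norm; have p0 := psi2_gt0 (bval c).
  have s0 : Num.sqrt (psi2 (bval c)) != 0 by rewrite gt_eqF// sqrtr_gt0.
  by rewrite mulrA -expr2 exprVn sqr_sqrtr ?(ltW p0)// mulVf ?gt_eqF.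
rewrite psi_orth_neq ?mulr0// => h; case/eqP: bc; apply/ffunP => i; apply: val_inj.
by have := congr1 (fun f => f i) h.
Qed.

Lemma ebox_eig N (b : {ffun 'I_d -> 'I_N}) x :
  ip (fun y => Km (x, y)) (ebox b) = evbox b * ebox b x.
Proof.
rewrite ipmC ipmZ ?(ipmC _ (psi _)) ?Km_psi; [|exact: psi_sq|exact: Km_sq].
by rewrite /ebox /evbox; ring.
Qed.

Lemma sum_evbox N : \sum_(b : {ffun 'I_d -> 'I_N}) evbox b ^+ 2 =
  ((1 - (r ^+ 2) ^+ N) / (1 - r ^+ 2)) ^+ d.
Proof.
have E : \sum_(j < N) (r ^+ 2) ^+ j = (1 - (r ^+ 2) ^+ N) / (1 - r ^+ 2).
  have h : 1 - r ^+ 2 != 0 by rewrite gt_eqF// r2_lt1.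
  apply: (mulIf h); rewrite divfK//.
  by have e := subrX1 (r ^+ 2) N; rewrite mulrC; apply: oppr_inj; rewrite -mulNr !opprB e.
rewrite -E -[in RHS](card_ord d) -prodr_const bigA_distr_bigA/=.
apply: eq_bigr => b _; rewrite /evbox -prodrXr -prodrXl; apply: eq_bigr => i _.
by rewrite -!exprM mulnC.
Qed.

(** Both terms are powers of geometric sums, so the part of the Hilbert-Schmidt norm missed by a box
    of multi-indices tends to 0 as the box grows. *)
Lemma tail_small (eps : R) : 0 < eps -> exists N,
  (1 - r ^+ 2)^-1 ^+ d - \sum_(b : {ffun 'I_d -> 'I_N}) evbox b ^+ 2 < eps.
Proof.
move=> e0; have r20 := r2_lt1 r0 r1.
have h : (fun N => (1 - r ^+ 2)^-1 ^+ d - ((1 - (r ^+ 2) ^+ N) / (1 - r ^+ 2)) ^+ d) @ \oo --> (0 : R).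
  have -> : (0 : R) = (1 - r ^+ 2)^-1 ^+ d - (1 - r ^+ 2)^-1 ^+ d by rewrite subrr.
  apply: cvgB; first exact: cvg_cst.
  apply: (@cvg_comp _ _ _ (fun N => (1 - (r ^+ 2) ^+ N) / (1 - r ^+ 2)) (fun x => x ^+ d)); last exact: exprn_continuous.
  have h1 : (fun N => 1 - (r ^+ 2) ^+ N) @ \oo --> (1 - 0 : R).
    apply: cvgB; first exact: cvg_cst.
    by apply: cvg_expr; rewrite ger0_norm ?sqr_ge0//; lin.
  have := cvgM h1 (cvg_cst ((1 - r ^+ 2)^-1)); rewrite subr0 mul1r; exact.
have /cvgrPdist_lt/(_ _ e0)[N _ NP] := h.
exists N; rewrite sum_evbox; have := NP N (leqnn _); rewrite /= sub0r normrN.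
by apply: le_lt_trans; exact: ler_norm.
Qed.

Definition mehler (g : pt -> R) := kint mu Km g.

(** Any Hermite function not orthogonal to [g] has degree above [n], hence eigenvalue at most
    [r ^ n.+1]. The box of multi-indices is enlarged until the remainder is below [e]. *)
Lemma mehler_form_le g n : sq g ->
  (forall b : 'I_d -> nat, (\sum_i b i <= n)%N -> ip (psi b) g = 0) ->
  ip (mehler g) g <= r ^+ n.+1 * ip g g.
Proof.
move=> sg g0; have [ki kH] := Kap_int; have g2 := ipm_ge0 mu g.
apply/ler_addgt0Pr => e e0.
(* The added 1 covers a vanishing [ip g g]. *)
pose e1 := (e / (ip g g + 1)).
have e10 : 0 < e1 by rewrite divr_gt0//; lin.
have [N NP] := tail_small (exprn_gt0 2 e10 : 0 < e1 ^+ 2).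
have eg (b : {ffun 'I_d -> 'I_N}) : r ^+ n.+1 < evbox b -> ip (ebox b) g = 0.
  move=> h; rewrite ipmZ ?g0 ?mulr0//; last exact: psi_sq.
  rewrite leqNgt; apply/negP => nb; move: h; rewrite ltNge.
  by rewrite /evbox ler_wiXn2l// ltW.
have := @kint_form_le _ _ R mu Km Kap _ measurable_Km Km_sq Km_norm ki kH _ (@ebox N) (@evbox N)
  (@ebox_sq N) (@ebox_on N) (@ebox_eig N) g (r ^+ n.+1) sg eg (exprn_ge0 _ (ltW r0)).
move=> h; apply: le_trans h _; rewrite mulrDl lerD2l.
have : Num.sqrt ((1 - r ^+ 2)^-1 ^+ d - \sum_(b : {ffun 'I_d -> 'I_N}) evbox b ^+ 2) <= e1.
  by rewrite -[e1]ger0_norm ?(ltW e10)// -sqrtr_sqr; apply: ler_wsqrtr; exact: ltW.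
move=> /(fun h => ler_wpM2r g2 h) h; apply: le_trans h _.
rewrite /e1 mulrAC ler_pdivrMr; last by lin.
by rewrite ler_wpM2l ?(ltW e0)//; lin.
Qed.

(** Such a [g] only sees the remainder kernels, whose norms are arbitrarily small. *)
Lemma mehler_orth g : sq g -> (forall b : 'I_d -> nat, ip (psi b) g = 0) ->
  ip (mehler g) (mehler g) = 0.
Proof.
move=> sg g0; have [ki kH] := Kap_int; have g2 := ipm_ge0 mu g.
apply/eqP; rewrite eq_le ipm_ge0 andbT; apply/ler_addgt0Pr => e e0; rewrite add0r.
have e10 : 0 < e / (ip g g + 1) by rewrite divr_gt0//; lin.
have [N NP] := tail_small e10.
have eg (b : {ffun 'I_d -> 'I_N}) : ip (ebox b) g = 0.
  by rewrite ipmZ ?g0 ?mulr0//; exact: psi_sq.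
have := @kint_orth _ _ R mu Km Kap _ measurable_Km Km_sq Km_norm ki kH _ (@ebox N) (@evbox N)
  (@ebox_sq N) (@ebox_on N) (@ebox_eig N) g sg eg.
move=> h; apply: le_trans h _; apply: le_trans (ler_wpM2l g2 (ltW NP)) _.
rewrite mulrCA ger_pMr// ler_pdivrMr; lin.
Qed.

Lemma mehler_sq g : sq g -> sq (mehler g).
Proof.
move=> sg; have [ki kH] := Kap_int.
exact: (kint_sq measurable_Km Km_sq Km_norm ki sg).
Qed.

End Kernel.
End MehlerRd.

(** * Moments of the ball *)

Section Mixture.
Variable R : realType.
Notation leb := (@lebesgue_measure R).
Implicit Types (t a : R).

(* [w] is the density on the radii [t] for which the Gaussian [exp (- |z|^2 / 2)]
   is the mixture of the indicators of the balls [|z| < t]. *)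
Definition wrad t : R := Num.max t 0 * gs (1 / 2) t.

Lemma wrad_ge0 t : 0 <= wrad t.
Proof. by rewrite mulr_ge0 ?gs_ge0// le_max lexx orbT. Qed.
Lemma measurable_wrad : measurable_fun [set: R] wrad.
Proof.
apply: measurable_funM; last exact: measurable_gs.
by apply: measurable_maxr.
Qed.

Lemma wrad_tail a : 0 <= a ->
  (\int[leb]_t (wrad t * (a < t)%R%:R)%:E = (expR (- (a ^+ 2 / 2)))%:E)%E.
Proof.
move=> a0.
transitivity (\int[leb]_(t in `]a, +oo[%classic) (t * gs (1 / 2) t)%:E)%E.
  rewrite [RHS]integral_mkcond; apply: eq_integral => t _.
  rewrite /restrict; case: ifPn => [|].
    rewrite inE/= in_itv/= andbT => at0; rewrite at0 mulr1 /wrad.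
    by rewrite (max_l (ltW (le_lt_trans a0 at0))).
  rewrite notin_setE/= in_itv/= andbT => /negP/negPf ->; by rewrite mulr0.
pose F (t : R) := - gs (1 / 2) t.
have dF x : is_derive x (1 : R) F (x * gs (1 / 2) x).
  have := is_derive_horner_gs (-1)%:P (1 / 2) x.
  rewrite derivC sub0r => h.
  rewrite (_ : F = fun y => (-1)%:P.[y] * gs (1 / 2) y); last first.
    by apply/funext => y; rewrite hornerC mulN1r.
  by apply: trigger_derive h _; rewrite hornerN hornerZ hornerM hornerX hornerC; field.
have cf : continuous (fun x : R => x * gs (1 / 2) x).
  move=> x; apply: differentiable_continuous; apply/derivable1_diffP.
  have [+ _] := is_derive_horner_gs 'X (1 / 2) x.
  by rewrite (_ : (fun y => _) = (fun x : R => x * gs (1 / 2) x))//; apply/funext => y; rewrite hornerX.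
have cF : continuous F.
  by move=> x; apply: differentiable_continuous; apply/derivable1_diffP; have [] := dF x.
rewrite integral_itv_obnd_cbnd; last first.
  apply/measurable_EFinP; apply: measurable_funTS; exact: continuous_measurable_fun.
rewrite (@ge0_continuous_FTC2y R _ F a 0).
- by rewrite /F -EFinB opprK add0r /gs; congr (expR _)%:E; field.
- by move=> x ax; rewrite mulr_ge0 ?gs_ge0// (le_trans a0).
- by apply: continuous_subspaceT.
- rewrite -[X in _ --> X]oppr0; apply: cvgN.
  have -> : gs (1 / 2) = (@gauss_fun R) \o (fun x => x * (Num.sqrt 2)^-1).
    apply/funext => x; rewrite /gs /gauss_fun /=; congr expR.
    by rewrite exprMn exprVn sqr_sqrtr//; field.
  apply: (@cvg_comp _ _ _ (fun x : R => x * (Num.sqrt 2)^-1) (@gauss_fun R) _ (pinfty_nbhs R));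
    last exact: cvg_gauss_fun.
  apply: gt0_cvgMly; last exact: cvg_id.
  by rewrite invr_gt0 sqrtr_gt0.
- by move=> x _; have [] := dF x.
- by apply: cvg_at_right_filter; exact: cF.
- by move=> x _; rewrite derive1E; have [] := dF x.
Qed.

Section Generic.
Context dZ (Z : measurableType dZ) (mu : {sigma_finite_measure set Z -> \bar R}).
Variables (N : Z -> R).
Hypotheses (mN : measurable_fun [set: Z] N) (N0 : forall z, 0 <= N z).

Definition bint (phi : Z -> \bar R) t := (\int[mu]_z ((N z < t)%R%:R%:E * phi z))%E.

Lemma measurable_lt_indic d (T : measurableType d) (f g : T -> R) :
  measurable_fun [set: T] f -> measurable_fun [set: T] g ->
  measurable_fun [set: T] (fun x => (f x < g x)%R%:R : R).
Proof.
move=> mf mg; rewrite (_ : (fun x => _) = (fun x => if f x < g x then 1 else 0)); last first.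
  by apply/funext => x; case: (_ < _).
by apply: measurable_fun_ifT => //; exact: measurable_fun_ltr.
Qed.

Lemma bint_ge0 phi t : (forall z, 0 <= phi z)%E -> (0 <= bint phi t)%E.
Proof. by move=> p0; apply: integral_ge0 => z _; rewrite mule_ge0// lee_fin. Qed.

(** Layer cake: [exp (- N^2 / 2)] is the integral of [wrad t] over [t > N], and Tonelli exchanges
    the integrals. *)
Lemma mixture (phi : Z -> \bar R) : measurable_fun [set: Z] phi -> (forall z, 0 <= phi z)%E ->
  (\int[mu]_z ((expR (- (N z ^+ 2 / 2)))%:E * phi z) = \int[leb]_t ((wrad t)%:E * bint phi t))%E.
Proof.
move=> mphi phi0.
pose f (p : R * Z) := ((wrad p.1 * (N p.2 < p.1)%R%:R)%:E * phi p.2)%E.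
have mw : measurable_fun [set: R * Z] (fun p : R * Z => wrad p.1).
  exact: (measurableT_comp measurable_wrad measurable_fst).
have mNp : measurable_fun [set: R * Z] (fun p : R * Z => N p.2).
  exact: (measurableT_comp mN measurable_snd).
have mf : measurable_fun [set: R * Z] f.
  apply: emeasurable_funM.
    apply/measurable_EFinP; apply: measurable_funM => //; exact: measurable_lt_indic.
  exact: (measurableT_comp mphi measurable_snd).
have f0 p : (0 <= f p)%E by rewrite mule_ge0// lee_fin mulr_ge0// wrad_ge0.
have := fubini_tonelli (m1 := leb) (m2 := mu) f mf f0.
rewrite /f /= => E.
transitivity (\int[mu]_z \int[leb]_t ((wrad t * (N z < t)%R%:R)%:E * phi z))%E.
  apply: eq_integral => z _; rewrite ge0_integralZr//.
  - by rewrite wrad_tail.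
  - apply/measurable_EFinP; apply: measurable_funM; first exact: measurable_wrad.
    exact: measurable_lt_indic.
  - by move=> t _; rewrite lee_fin mulr_ge0// wrad_ge0.
rewrite -E; apply: eq_integral => t _; rewrite /bint -ge0_integralZl//.
- by apply: eq_integral => z _; rewrite EFinM muleA.
- apply: emeasurable_funM => //; apply/measurable_EFinP; exact: measurable_lt_indic.
- by move=> z _; rewrite mule_ge0// lee_fin.
- by rewrite lee_fin wrad_ge0.
Qed.

End Generic.

Lemma wrad_poly_integrable (p : {poly R}) :
  leb.-integrable setT (EFin \o (fun t => wrad t * p.[t])).
Proof.
have a0 : (0 : R) < 1 / 2 by lra.
apply: (@integrable_le_real _ _ R leb _ (fun t => `|('X * p).[t] * gs (1 / 2) t|)).
- by apply: measurable_funM; [exact: measurable_wrad|exact: measurable_horner].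
- move=> t; rewrite hornerM hornerX !normrM mulrAC ler_wpM2r ?normr_ge0// ler_wpM2r ?normr_ge0//.
  by rewrite ger0_norm ?le_max ?lexx ?orbT// ge_max ler_norm normr_ge0.
- exact: integrable_norm (integrable_horner_gs _ a0).
Qed.

Definition wmom (p : {poly R}) : R := \int[leb]_t (wrad t * p.[t]).

Lemma wmomE p : (\int[leb]_t (wrad t * p.[t])%:E = (wmom p)%:E)%E.
Proof.
rewrite /wmom /Rintegral fineK//.
by apply: integrable_fin_num => //; exact: wrad_poly_integrable.
Qed.

Lemma int_pow_halfball (m : nat) (t : R) : 0 < t ->
  (\int[leb]_u ((`|u| < t)%R%:R%:E * (Num.max u 0 ^+ m.+1)%:E) = (t ^+ m.+2 / m.+2%:R)%:E)%E.
Proof.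
move=> t0.
transitivity (\int[leb]_(u in `[0%R, t]%classic) (u ^+ m.+1)%:E)%E.
  rewrite -integral_itv_bndo_bndc; last first.
    by apply/measurable_EFinP; apply: measurable_funTS; exact: exprn_measurable.
  rewrite [RHS]integral_mkcond; apply: eq_integral => u _; rewrite /restrict -EFinM.
  case: ifPn => [|].
    rewrite inE/= in_itv/= => /andP[u0 ut]; rewrite ger0_norm// ut mul1r.
    by rewrite max_l.
  rewrite notin_setE/= in_itv/= => /negP; rewrite negb_and -ltNge -leNgt => /orP[u0|tu].
    by rewrite max_r ?ltW// expr0n mulr0.
  by rewrite ltNge (le_trans tu (ler_norm _)) mul0r.
pose q : {poly R} := m.+2%:R^-1 *: 'X^(m.+2).
have dq x : q^`().[x] = x ^+ m.+1.
  by rewrite /q derivZ derivXn hornerZ hornerMn hornerXn -(mulr_natl (x ^+ _)) mulKf// pnatr_eq0.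
rewrite (@continuous_FTC2 R _ (horner q) 0 t)//.
- rewrite -EFinB /q !hornerZ !hornerXn expr0n mulr0 subr0; congr EFin; by rewrite mulrC.
- apply: continuous_subspaceT => x; exact: exprn_continuous.
- split; first by move=> x _; exact: derivable_horner.
  + by apply: cvg_at_right_filter; exact: continuous_horner.
  + by apply: cvg_at_left_filter; exact: continuous_horner.
- by move=> x _; rewrite -derivE dq.
Qed.

(** The mixture formula on the line, applied to the positive part of [u] to the power [m + 1],
    replaces an integration by parts. *)
Lemma wmom_rec m : wmom 'X^(m.+2) = m.+2%:R * wmom 'X^m.
Proof.
have mphi : measurable_fun [set: R] (fun u : R => (Num.max u 0 ^+ m.+1)%:E).
  apply/measurable_EFinP; apply: measurable_funX; exact: measurable_maxr.
have phi0 (u : R) : (0 <= (Num.max u 0 ^+ m.+1)%:E)%E.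
  by rewrite lee_fin exprn_ge0// le_max lexx orbT.
have mn : measurable_fun [set: R] (fun u : R => `|u|) by exact: normr_measurable.
have : (\int[leb]_u ((expR (- (`|u| ^+ 2 / 2)))%:E * (Num.max u 0 ^+ m.+1)%:E) =
   \int[leb]_t ((wrad t)%:E * \int[leb]_u ((`|u| < t)%R%:R%:E * (Num.max u 0 ^+ m.+1)%:E)))%E.
  exact: (@mixture _ _ leb (fun u : R => `|u|) mn (fun u => normr_ge0 u) _ mphi phi0).
have -> : (\int[leb]_u ((expR (- (`|u| ^+ 2 / 2)))%:E * (Num.max u 0 ^+ m.+1)%:E) = (wmom 'X^m)%:E)%E.
  rewrite -wmomE; apply: eq_integral => u _; rewrite -EFinM; congr EFin.
  have E : Num.max u 0 ^+ m.+1 = Num.max u 0 * u ^+ m.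
    by rewrite exprS; case: (lerP 0 u) => u0 //; rewrite !mul0r.
  have Ee : - (1 / 2) * u ^+ 2 = - (u ^+ 2 / 2) by field.
  by rewrite hornerXn /wrad /gs real_normK ?num_real// E Ee; ring.
have -> : (\int[leb]_t ((wrad t)%:E * \int[leb]_u ((`|u| < t)%R%:R%:E * (Num.max u 0 ^+ m.+1)%:E)) =
    (wmom (m.+2%:R^-1 *: 'X^(m.+2)))%:E)%E.
  rewrite -wmomE; apply: eq_integral => t _.
  have [t0|t0] := ltP 0 t; last by rewrite /wrad max_r// !mul0r mul0e.
  by rewrite int_pow_halfball// -EFinM hornerZ hornerXn (mulrC (t ^+ _)).
move=> [->]; rewrite /wmom.
have -> : \int[leb]_t (wrad t * (m.+2%:R^-1 *: 'X^(m.+2)).[t]) = m.+2%:R^-1 * wmom 'X^(m.+2).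
  rewrite /wmom -RintegralZl//; last exact: wrad_poly_integrable.
  by apply: eq_Rintegral => t _; rewrite hornerZ; ring.
by rewrite mulVKf// pnatr_eq0.
Qed.

End Mixture.

Section EuclideanBalls.
Variables (R : realType) (d : nat).
Notation pt := (d.-tuple R).
Notation leb := (@lebesgue_measure R).
Notation mu := (vol R d).
Implicit Types (x y z : pt) (s t : R).

Lemma tnorm_ge0 x : 0 <= tnorm x. Proof. exact: sqrtr_ge0. Qed.
Lemma tnorm_sqr x : tnorm x ^+ 2 = \sum_i tnth x i ^+ 2.
Proof. by rewrite sqr_sqrtr//; apply: sumr_ge0 => i _; exact: sqr_ge0. Qed.

Lemma measurable_tnth_fun i : measurable_fun [set: pt] (fun x : pt => tnth x i).
Proof. exact: measurable_tnth. Qed.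

Lemma measurable_tnorm : measurable_fun [set: pt] (@tnorm R d).
Proof.
have ms : measurable_fun [set: pt] (fun x : pt => \sum_i tnth x i ^+ 2).
  apply: (@measurable_sum _ _ _ _ _ (index_enum _) (fun i (x : pt) => tnth x i ^+ 2)) => i.
  by apply: measurable_funX; exact: measurable_tnth_fun.
have -> : @tnorm R d = (fun u : R => Num.sqrt u) \o (fun x : pt => \sum_i tnth x i ^+ 2) by [].
by apply: measurableT_comp => //; apply: continuous_measurable_fun; exact: sqrt_continuous.
Qed.

Lemma tnorm_vscale s x : tnorm (vscale s x) = `|s| * tnorm x.
Proof.
rewrite /tnorm; under eq_bigr do rewrite tnth_mktuple exprMn.
by rewrite -mulr_sumr sqrtrM ?sqr_ge0// sqrtr_sqr.
Qed.

Lemma sum_CS (a b : 'I_d -> R) :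
  (\sum_i a i * b i) ^+ 2 <= (\sum_i a i ^+ 2) * (\sum_i b i ^+ 2).
Proof.
apply: quadratic_disc => [s|]; last by apply: sumr_ge0 => i _; exact: sqr_ge0.
rewrite !mulr_sumr -!big_split/=; apply: sumr_ge0 => i _.
by have := sqr_ge0 (s * a i + b i); rewrite sqrrD exprMn; lin.
Qed.

Lemma tnormD x y : tnorm (vadd x y) <= tnorm x + tnorm y.
Proof.
rewrite -ler_sqr ?nnegrE ?addr_ge0 ?tnorm_ge0// sqrrD !tnorm_sqr.
under eq_bigr do rewrite tnth_mktuple sqrrD.
rewrite !big_split/=.
have h : \sum_i tnth x i * tnth y i <= tnorm x * tnorm y.
  apply: le_trans (ler_norm _) _; rewrite -ler_sqr ?nnegrE ?mulr_ge0 ?tnorm_ge0//.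
  by rewrite real_normK ?num_real// exprMn !tnorm_sqr sum_CS.
by rewrite mulr2n lerD2r lerD2l lerD.
Qed.

Lemma tsubE x y : tsub x y = vadd x (vscale (-1) y).
Proof. by apply: eq_from_tnth => i; rewrite !tnth_mktuple mulN1r. Qed.
Lemma tsub_vadd x y : tsub (vadd x y) y = x.
Proof. by apply: eq_from_tnth => i; rewrite !tnth_mktuple addrK. Qed.
Lemma vadd_tsub x y : vadd (tsub x y) y = x.
Proof. by apply: eq_from_tnth => i; rewrite !tnth_mktuple subrK. Qed.
Lemma vaddC x y : vadd x y = vadd y x.
Proof. by apply: eq_from_tnth => i; rewrite !tnth_mktuple addrC. Qed.
Lemma vaddA x y z : vadd x (vadd y z) = vadd (vadd x y) z.
Proof. by apply: eq_from_tnth => i; rewrite !tnth_mktuple addrA. Qed.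
Lemma tnorm_tsubC x y : tnorm (tsub x y) = tnorm (tsub y x).
Proof.
have -> : tsub x y = vscale (-1) (tsub y x).
  by apply: eq_from_tnth => i; rewrite !tnth_mktuple mulN1r opprB.
by rewrite tnorm_vscale normrN1 mul1r.
Qed.
Lemma tnorm_vflip k x : tnorm (vflip k x) = tnorm x.
Proof.
rewrite /tnorm; congr Num.sqrt; apply: eq_bigr => i _; rewrite tnth_mktuple.
by case: ifP => _ //; rewrite sqrrN.
Qed.
Lemma abs_tnth_le x i : `|tnth x i| <= tnorm x.
Proof.
rewrite -ler_sqr ?nnegrE ?tnorm_ge0// real_normK ?num_real// tnorm_sqr (bigD1 i)//= lerDl.
by apply: sumr_ge0 => j _; exact: sqr_ge0.
Qed.
Lemma measurable_vadd_fun (T : Type) : measurable_fun [set: pt * pt] (fun p : pt * pt => vadd p.1 p.2).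
Proof.
apply/measurable_fun_tnthP => i.
rewrite (_ : _ \o _ = fun p : pt * pt => tnth p.1 i + tnth p.2 i); last first.
  by apply/funext => p /=; rewrite tnth_mktuple.
apply: measurable_funD.
  exact: (measurableT_comp (measurable_tnth_fun i) measurable_fst).
exact: (measurableT_comp (measurable_tnth_fun i) measurable_snd).
Qed.
Lemma measurable_tsub_fun : measurable_fun [set: pt * pt] (fun p : pt * pt => tsub p.2 p.1).
Proof.
apply/measurable_fun_tnthP => i.
rewrite (_ : _ \o _ = fun p : pt * pt => tnth p.2 i - tnth p.1 i); last first.
  by apply/funext => p /=; rewrite tnth_mktuple.
apply: measurable_funB.
  exact: (measurableT_comp (measurable_tnth_fun i) measurable_snd).
exact: (measurableT_comp (measurable_tnth_fun i) measurable_fst).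
Qed.
Lemma measurable_vscale s : measurable_fun [set: pt] (vscale s : pt -> pt).
Proof.
rewrite (_ : vscale s = vaff (fun=> s) (fun=> 0)); first exact: measurable_vaff.
by apply/funext => x; apply: eq_from_tnth => i; rewrite !tnth_mktuple addr0.
Qed.
Lemma measurable_vflip k : measurable_fun [set: pt] (vflip k : pt -> pt).
Proof.
rewrite (_ : vflip k = vaff (fun i => if i == k then -1 else 1) (fun=> 0)); first exact: measurable_vaff.
apply/funext => x; apply: eq_from_tnth => i; rewrite !tnth_mktuple addr0.
by case: ifP => _; rewrite ?mulN1r ?mul1r.
Qed.

Notation ball_int := (bint mu (@tnorm R d)).

Lemma measurable_ball_indic t : measurable_fun [set: pt] (fun z : pt => (tnorm z < t)%R%:R : R).
Proof. by apply: measurable_lt_indic => //; exact: measurable_tnorm. Qed.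

Lemma bint_scale (phi : pt -> \bar R) s t : 0 < s ->
  measurable_fun [set: pt] phi -> (forall z, 0 <= phi z)%E ->
  ball_int phi (s * t) = ((s ^+ d)%:E * ball_int (phi \o vscale s) t)%E.
Proof.
move=> s0 mphi phi0.
pose f z : \bar R := ((tnorm z < s * t)%R%:R%:E * phi z)%E.
have mf : measurable_fun [set: pt] f.
  by apply: emeasurable_funM => //; apply/measurable_EFinP; exact: measurable_ball_indic.
have f0 z : (0 <= f z)%E by rewrite mule_ge0// lee_fin.
have := @ge0_int_vscale R d s f (lt0r_neq0 s0) mf f0.
rewrite (gtr0_norm s0) => h.
have -> : ball_int (phi \o vscale s) t = (\int[mu]_x f (vscale s x))%E.
  apply: eq_integral => z _; rewrite /f /= tnorm_vscale gtr0_norm//.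
  by rewrite (ltr_pM2l s0).
by rewrite h muleA -EFinM mulfV ?mul1e// gt_eqF// exprn_gt0.
Qed.

Lemma bint_le (phi : pt -> \bar R) s t : s <= t ->
  measurable_fun [set: pt] phi -> (forall z, 0 <= phi z)%E ->
  (ball_int phi s <= ball_int phi t)%E.
Proof.
move=> st mphi phi0; apply: ge0_le_integral => //.
- by move=> z _; rewrite mule_ge0// lee_fin.
- by apply: emeasurable_funM => //; apply/measurable_EFinP; exact: measurable_ball_indic.
- by apply: emeasurable_funM => //; apply/measurable_EFinP; exact: measurable_ball_indic.
- move=> z _; apply: lee_wpmul2r => //; rewrite lee_fin ler_nat.
  by have [h|] := ltP (tnorm z) s; rewrite // (lt_le_trans h st).
Qed.

(* [z |-> phi z] grows at most quadratically along integer multiples, so the ball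
   of radius [t] is compared with that of radius [t / n <= eta]. *)
Lemma bint_growth (phi : pt -> \bar R) t eta : 0 < t -> 0 < eta ->
  measurable_fun [set: pt] phi -> (forall z, 0 <= phi z)%E ->
  (forall (n : nat) z, phi (vscale n.+1%:R z) <= (n.+1%:R ^+ 2)%:E * phi z)%E ->
  (ball_int phi t <= ((t / eta + 1) ^+ d.+2)%:E * ball_int phi eta)%E.
Proof.
move=> t0 e0 mphi phi0 gr.
pose n := Num.truncn (t / eta); pose c : R := n.+1%:R.
have c0 : 0 < c by rewrite ltr0n.
have te0 : 0 <= t / eta by rewrite divr_ge0 ?ltW.
have cle : c <= t / eta + 1 by rewrite /c -addn1 natrD lerD2r truncn_le.
have tc : t / c <= eta.
  by rewrite ler_pdivrMr// mulrC -ler_pdivrMr// ltW// truncnS_gt.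
have -> : t = c * (t / c) by field; rewrite gt_eqF.
rewrite bint_scale// (mulrC c) divfK ?gt_eqF//.
have mphic : measurable_fun [set: pt] (phi \o vscale c).
  exact: (measurableT_comp mphi (measurable_vscale c)).
apply: (@le_trans _ _ ((c ^+ d)%:E * ((c ^+ 2)%:E * ball_int phi eta))%E).
  apply: lee_wpmul2l; first by rewrite lee_fin exprn_ge0 ?ltW.
  apply: (le_trans (bint_le tc mphic _)); first by move=> z; exact: phi0.
  rewrite /bint -ge0_integralZl//; last first.
  - by rewrite lee_fin sqr_ge0.
  - by move=> z _; rewrite mule_ge0// lee_fin.
  - by apply: emeasurable_funM => //; apply/measurable_EFinP; exact: measurable_ball_indic.
  apply: ge0_le_integral => //.
  - by move=> z _; apply: mule_ge0; [rewrite lee_fin|exact: phi0].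
  - by apply: emeasurable_funM => //; apply/measurable_EFinP; exact: measurable_ball_indic.
  - apply: emeasurable_funM => //; apply: emeasurable_funM => //.
    by apply/measurable_EFinP; exact: measurable_ball_indic.
  - move=> z _; rewrite muleCA; apply: lee_wpmul2l; first by rewrite lee_fin.
    exact: gr.
rewrite muleA -EFinM -exprD addn2; apply: lee_wpmul2r; first exact: bint_ge0.
by rewrite lee_fin lerXn2r ?nnegrE ?(ltW c0)// addr_ge0.
Qed.

Definition gtot : R := Num.sqrt (2 * pi) ^+ d.
Lemma gtot_gt0 : 0 < gtot.
Proof. by rewrite exprn_gt0// sqrtr_gt0 mulr_gt0 ?pi_gt0. Qed.

Lemma gauss_prod (a : R) z : \prod_i gs a (tnth z i) = expR (- (a * tnorm z ^+ 2)).
Proof.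
rewrite tnorm_sqr mulr_sumr -sumrN expR_sum; apply: eq_bigr => i _.
by rewrite /gs mulNr.
Qed.

Let half0 : (0 : R) < 1 / 2. Proof. by rewrite divr_gt0. Qed.

Lemma gauss_half z : expR (- (tnorm z ^+ 2 / 2)) = \prod_i gs (1 / 2) (tnth z i).
Proof. by rewrite gauss_prod; congr (expR (- _)); rewrite mulrC mul1r. Qed.

Lemma measurable_gauss_half : measurable_fun [set: pt] (fun z : pt => expR (- (tnorm z ^+ 2 / 2))).
Proof.
rewrite (_ : (fun z => _) = fun z : pt => \prod_i gs (1 / 2) (tnth z i)).
  by apply: (measurable_prod_tnth (fun i => @measurable_gs R (1 / 2))).
by apply/funext => z; rewrite gauss_half.
Qed.

Lemma gauss_total : (\int[mu]_z (expR (- (tnorm z ^+ 2 / 2)))%:E = gtot%:E)%E.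
Proof.
have [_ h] := @int_prod_tnth R d (fun i => gs (1 / 2)) (fun i => integrable_gs half0).
under eq_integral do rewrite gauss_half.
rewrite h; congr EFin; rewrite prodr_const card_ord /Rintegral int_gs//=.
by congr (Num.sqrt _ ^+ _); field.
Qed.

Lemma gauss_moment k :
  (\int[mu]_z (expR (- (tnorm z ^+ 2 / 2)) * tnth z k ^+ 2)%:E = gtot%:E)%E.
Proof.
pose g i (u : R) := (if i == k then u ^+ 2 else 1) * gs (1 / 2) u.
have gi i : leb.-integrable setT (EFin \o g i).
  have := @integrable_horner_gs R (if i == k then 'X^2 else 1) (1 / 2) half0.
  apply: eq_integrable => // u _ /=; rewrite /g; congr (_ * _)%:E.
  by case: ifP => _; rewrite ?hornerXn ?hornerC.
have gE i : \int[leb]_u g i u = Num.sqrt (2 * pi).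
  transitivity (gsint (1 / 2) (if i == k then 'X^2 else 1 : {poly R})).
    apply: eq_Rintegral => u _; rewrite /g; congr (_ * _).
    by case: ifP => _; rewrite ?hornerXn ?hornerC.
  have e : pi / (1 / 2) = 2 * pi :> R by field.
  case: ifP => _; last by rewrite gsint1// e.
  have := gsint_ibp 'X half0; rewrite derivX gsint1// e -expr2 => ->.
  by field.
have [_ h] := @int_prod_tnth R d g gi.
transitivity (\int[mu]_x (\prod_i g i (tnth x i))%:E)%E.
  apply: eq_integral => z _; congr EFin; rewrite gauss_half /g big_split/= mulrC; congr (_ * _).
  rewrite (bigD1 k)//= eqxx big1 ?mulr1// => i /negPf ik; by rewrite ik.
rewrite h; congr EFin; under eq_bigr do rewrite gE.
by rewrite prodr_const card_ord.
Qed.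

(* Both the volume of the unit ball and its second moments follow from the
   corresponding Gaussian integrals through the mixture formula. *)
Lemma hom_moment (phi : pt -> R) (k : nat) (G : R) :
  measurable_fun [set: pt] phi -> (forall z, 0 <= phi z) ->
  (forall s z, 0 < s -> phi (vscale s z) = s ^+ k * phi z) ->
  (\int[mu]_z (expR (- (tnorm z ^+ 2 / 2)) * phi z)%:E = G%:E)%E ->
  exists2 m : R, G = m * wmom 'X^(d + k) &
    forall t, 0 < t -> ball_int (EFin \o phi) t = (t ^+ (d + k) * m)%:E.
Proof.
move=> mphi phi0 hom GE.
have mphiE : measurable_fun [set: pt] (EFin \o phi) by exact/measurable_EFinP.
have phi0E z : (0 <= (EFin \o phi) z)%E by rewrite lee_fin.
(* On the unit ball [exp (1/2) exp (- |z|^2 / 2)] is at least 1, so the Gaussian integral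
   dominates. *)
have b1fin : ball_int (EFin \o phi) 1 \is a fin_num.
  rewrite ge0_fin_numE ?bint_ge0//.
  apply: (@le_lt_trans _ _ (\int[mu]_z ((expR (1 / 2))%:E * (expR (- (tnorm z ^+ 2 / 2)) * phi z)%:E))%E).
    apply: ge0_le_integral => //.
    - by move=> z _; rewrite mule_ge0// lee_fin.
    - by apply: emeasurable_funM => //; apply/measurable_EFinP; exact: measurable_ball_indic.
    - apply: emeasurable_funM => //; apply/measurable_EFinP.
      by apply: measurable_funM => //; exact: measurable_gauss_half.
    - move=> z _; rewrite /= -!EFinM lee_fin mulrA ler_wpM2r// -expRD.
      have [h|h] := ltP (tnorm z) 1; last by rewrite expR_ge0.
      apply: (@le_trans _ _ (expR 0)); first by rewrite expR0.
      rewrite ler_expR; have : tnorm z ^+ 2 <= 1 by rewrite expr_le1 ?tnorm_ge0 ?ltW.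
      lin.
  rewrite ge0_integralZl ?GE -?EFinM ?ltry ?lee_fin ?expR_ge0//.
  - by apply/measurable_EFinP; apply: measurable_funM => //; exact: measurable_gauss_half.
  - by move=> z _; rewrite lee_fin mulr_ge0 ?expR_ge0.
pose m := fine (ball_int (EFin \o phi) 1).
have bE t : 0 < t -> ball_int (EFin \o phi) t = (t ^+ (d + k) * m)%:E.
  move=> t0; rewrite -[in LHS](mulr1 t) bint_scale// exprD -mulrA EFinM; congr (_ * _)%E.
  rewrite EFinM /m fineK// /bint -ge0_integralZl//; last first.
  - by rewrite lee_fin exprn_ge0 ?ltW.
  - by move=> z _; rewrite mule_ge0// lee_fin.
  - by apply: emeasurable_funM => //; apply/measurable_EFinP; exact: measurable_ball_indic.
  by apply: eq_integral => z _; rewrite /= hom// -!EFinM; congr EFin; ring.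
exists m => //.
apply: EFin_inj; rewrite -GE.
transitivity (\int[mu]_z ((expR (- (tnorm z ^+ 2 / 2)))%:E * (EFin \o phi) z))%E.
  by apply: eq_integral => z _; rewrite EFinM.
rewrite (mixture mu measurable_tnorm tnorm_ge0 mphiE phi0E).
transitivity (\int[leb]_t (m%:E * (wrad t * ('X^(d + k)).[t])%:E))%E.
  apply: eq_integral => t _; have [t0|t0] := ltP 0 t; last by rewrite /wrad max_r// !mul0r mul0e mule0.
  by rewrite bE// -!EFinM hornerXn; congr EFin; ring.
have wi := wrad_poly_integrable ('X^(d + k) : {poly R}).
by rewrite integralZl// wmomE -EFinM.
Qed.

Definition bvol1 : R := fine (ball_int (fun=> 1%E) 1).

Lemma bvol_aux : gtot = bvol1 * wmom 'X^d /\
  forall t, 0 < t -> ball_int (fun=> 1%E) t = (t ^+ d * bvol1)%:E.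
Proof.
have [] := @hom_moment (fun=> 1) 0 gtot (measurable_cst _) (fun=> ler01) ltac:(by move=> s z _; rewrite mulr1) _.
  by rewrite -gauss_total; apply: eq_integral => z _; rewrite mulr1.
rewrite addn0 => m Gm bE.
have mE : bvol1 = m.
  by rewrite /bvol1 -[ball_int _ _]/(ball_int (EFin \o (fun=> 1)) 1) bE//= expr1n mul1r.
by rewrite mE; split.
Qed.

Lemma bvolE t : 0 < t -> ball_int (fun=> 1%E) t = (t ^+ d * bvol1)%:E.
Proof. by have [_] := bvol_aux; apply. Qed.

Lemma bvol1_gt0 : 0 < bvol1.
Proof.
have [G _] := bvol_aux; have := gtot_gt0; rewrite G => h.
have b0 : 0 <= bvol1 by apply: fine_ge0; exact: bint_ge0.
rewrite lt_def b0 andbT; apply: contraTneq h => ->; by rewrite mul0r ltxx.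
Qed.

Lemma wmom_gt0 : 0 < wmom ('X^d : {poly R}).
Proof.
have [G _] := bvol_aux; have := gtot_gt0; rewrite G pmulr_rgt0//; exact: bvol1_gt0.
Qed.

(** Origin of the factor [d + 2]: the Gaussian has the same total mass and second moment [gtot],
    while the moments of order [d + 2] and [d] of the radii have ratio [d + 2] by [wmom_rec]. *)
Lemma ball_moment k t : 0 < t ->
  ball_int (fun z => (tnth z k ^+ 2)%:E) t = (t ^+ d.+2 * (bvol1 / d.+2%:R))%:E.
Proof.
move=> t0.
have [] := @hom_moment (fun z : pt => tnth z k ^+ 2) 2 gtot
  ltac:(by apply: measurable_funX; exact: measurable_tnth_fun) (fun=> sqr_ge0 _)
  ltac:(by move=> s z _ /=; rewrite tnth_mktuple exprMn) (gauss_moment k).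
rewrite addn2 => m Gm bE.
rewrite -[LHS]/(ball_int (EFin \o (fun z : pt => tnth z k ^+ 2)) t) bE//.
have [G _] := bvol_aux; have w0 := wmom_gt0.
move: Gm; rewrite G wmom_rec => Gm; congr (_ * _)%:E.
have dn : d.+2%:R != 0 :> R by rewrite pnatr_eq0.
apply: (mulIf (lt0r_neq0 w0)); move: d.+2%:R dn Gm => n n0 Gm.
by rewrite (mulrAC bvol1) Gm; field.
Qed.

(** Convexity in [eta], compared with the chord over [[0, 1]]; the excess over the leading power is
    thus linear in [eta]. *)
Lemma pow_convex (t eta : R) (m : nat) : 0 <= t -> 0 <= eta <= 1 ->
  (t + eta) ^+ m <= t ^+ m + eta * ((t + 1) ^+ m - t ^+ m).
Proof.
move=> t0 /andP[e0 e1]; elim: m => [|m IH]; first by rewrite !expr0 subrr mulr0 addr0.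
rewrite exprS; apply: (le_trans (ler_wpM2l (addr_ge0 t0 e0) IH)).
rewrite !exprS; set D := (t + 1) ^+ m - t ^+ m.
have -> : (t + 1) ^+ m = t ^+ m + D by rewrite /D; ring.
have D0 : 0 <= D by rewrite /D subr_ge0 lerXn2r ?nnegrE ?lerDl ?addr_ge0//.
have : 0 <= eta * (1 - eta) * D by apply: mulr_ge0 => //; rewrite mulr_ge0 ?subr_ge0.
set T := t ^+ m; lin.
Qed.

(** The Gaussian mixes balls of all radii [t]; each is compared with the ball of radius [eta] by
    [bint_growth], and the moment of order [d + 2] of the radii gives the leading constant. A
    homogeneous quadratic [phi] shows it to be exact apart from the factor [1 + C * eta]. *)
Lemma gauss_ball_le : exists2 C : R, 0 <= C &
  forall (eta : R) (phi : pt -> \bar R), 0 < eta <= 1 ->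
  measurable_fun [set: pt] phi -> (forall z, 0 <= phi z)%E ->
  (forall (n : nat) z, phi (vscale n.+1%:R z) <= (n.+1%:R ^+ 2)%:E * phi z)%E ->
  (\int[mu]_z ((expR (- (tnorm z ^+ 2 / 2)))%:E * phi z) <=
   (gtot * d.+2%:R * (1 + C * eta) / (eta ^+ d.+2 * bvol1))%:E * ball_int phi eta)%E.
Proof.
have [G _] := bvol_aux; have w0 := wmom_gt0; have b0 := bvol1_gt0; have g0 := gtot_gt0.
pose pD : {poly R} := ('X + 1%:P) ^+ d.+2 - 'X^(d.+2).
have pDE t : pD.[t] = (t + 1) ^+ d.+2 - t ^+ d.+2.
  by rewrite /pD hornerD hornerN horner_exp hornerD hornerX hornerC hornerXn.
have D0 : 0 <= wmom pD.
  apply: Rintegral_ge0 => t _; rewrite pDE /wrad.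
  case: (lerP 0 t) => t0; last by rewrite !mul0r.
  by rewrite !mulr_ge0 ?gs_ge0// subr_ge0 lerXn2r ?nnegrE ?lerDl ?addr_ge0//.
have dn : 0 < d.+2%:R :> R by rewrite ltr0n.
exists (wmom pD * bvol1 / (d.+2%:R * gtot)).
  by rewrite divr_ge0 ?mulr_ge0 ?(ltW b0) ?(ltW g0).
move=> eta phi /andP[e0 e1] mphi phi0 gr.
rewrite (mixture mu measurable_tnorm tnorm_ge0 mphi phi0).
pose pe : {poly R} := eta ^- d.+2 *: ('X^(d.+2) + eta *: pD).
have peE t : pe.[t] = eta ^- d.+2 * (t ^+ d.+2 + eta * ((t + 1) ^+ d.+2 - t ^+ d.+2)).
  by rewrite /pe hornerZ hornerD hornerXn hornerZ pDE.
have mb : measurable_fun [set: R] (fun t => ball_int phi t).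
  apply: (measurable_fun_fubini_tonelli_F (m2 := mu)
    (fun p : R * pt => ((tnorm p.2 < p.1)%R%:R%:E * phi p.2)%E)) => [|p].
    apply: emeasurable_funM; last exact: (measurableT_comp mphi measurable_snd).
    apply/measurable_EFinP; apply: measurable_lt_indic => //.
    exact: (measurableT_comp measurable_tnorm measurable_snd).
  by rewrite mule_ge0// lee_fin.
have pe0 t : 0 <= t -> 0 <= pe.[t].
  move=> t0; rewrite peE mulr_ge0 ?invr_ge0 ?exprn_ge0 ?(ltW e0)// addr_ge0 ?exprn_ge0// mulr_ge0 ?(ltW e0)//.
  by rewrite subr_ge0 lerXn2r ?nnegrE ?lerDl ?addr_ge0//.
have wpe0 t : 0 <= wrad t * pe.[t].
  rewrite /wrad; case: (lerP 0 t) => t0; last by rewrite !mul0r.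
  by rewrite !mulr_ge0 ?gs_ge0 ?pe0.
have bb0 t : (0 <= ball_int phi t)%E by exact: bint_ge0.
apply: (@le_trans _ _ (\int[leb]_t ((wrad t * pe.[t])%:E * ball_int phi eta))%E).
  apply: ge0_le_integral => //.
  - by move=> t _; rewrite mule_ge0// lee_fin wrad_ge0.
  - by apply: emeasurable_funM => //; apply/measurable_EFinP; exact: measurable_wrad.
  - apply: emeasurable_funM => //; apply/measurable_EFinP.
    by apply: measurable_funM; [exact: measurable_wrad|exact: measurable_horner].
  - move=> t _; have [t0|t0] := ltP 0 t; last by rewrite /wrad max_r// !mul0r !mul0e.
    rewrite (EFinM (wrad t)) -muleA; apply: lee_wpmul2l; first by rewrite lee_fin wrad_ge0.
    apply: (le_trans (bint_growth t0 e0 mphi phi0 gr)); apply: lee_wpmul2r => //.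
    rewrite lee_fin peE.
    have -> : t / eta + 1 = eta^-1 * (t + eta) by field; rewrite gt_eqF.
    rewrite exprMn exprVn ler_wpM2l ?invr_ge0 ?exprn_ge0 ?(ltW e0)//.
    by apply: pow_convex; rewrite ltW.
rewrite ge0_integralZr//; last 2 first.
- by apply/measurable_EFinP; apply: measurable_funM; [exact: measurable_wrad|exact: measurable_horner].
- by move=> t _; rewrite lee_fin.
apply: lee_wpmul2r => //; rewrite wmomE lee_fin le_eqVlt; apply/orP; left; apply/eqP.
have wl (a b : R) (p q : {poly R}) : wmom (a *: p + b *: q) = a * wmom p + b * wmom q.
  rewrite /wmom -!RintegralZl//; try exact: wrad_poly_integrable.
  rewrite -RintegralD//.
  - by apply: eq_Rintegral => t _; rewrite hornerD !hornerZ; ring.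
  - have := wrad_poly_integrable (a *: p); apply: eq_integrable => // t _ /=.
    by rewrite hornerZ; congr EFin; ring.
  - have := wrad_poly_integrable (b *: q); apply: eq_integrable => // t _ /=.
    by rewrite hornerZ; congr EFin; ring.
have -> : pe = eta ^- d.+2 *: 'X^(d.+2) + (eta ^- d.+2 * eta) *: pD.
  by rewrite /pe scalerDr scalerA.
rewrite wl wmom_rec G.
have en : eta ^+ d.+2 != 0 by rewrite gt_eqF// exprn_gt0.
move: (eta ^+ d.+2) en => X X0; move: (wmom pD) (wmom 'X^d) w0 bvol1 b0 d.+2%:R dn {G g0} => P W W0 b b0 n n0.
by field; rewrite X0 !gt_eqF.
Qed.

End EuclideanBalls.

(** * Dirichlet forms of convolution kernels *)

Section KernelForm.
Context d (T : measurableType d) (R : realType) (mu : {sigma_finite_measure set T -> \bar R}).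
Notation sq := (sqint mu).
Notation ip := (ipm mu).
Implicit Types (k : T * T -> R) (g : T -> R).

(** Boundedness makes the slices square integrable, constant mass gives a bounded operator by
    Schur's test, and symmetry with constant mass gives a Dirichlet form. *)
Record sym_kernel k (M : R) := SymKernel {
  sk_meas : measurable_fun [set: T * T] k;
  sk_ge0 : forall z, 0 <= k z;
  sk_bound : exists2 K, 0 <= K & forall z, k z <= K;
  sk_sym : forall x y, k (x, y) = k (y, x);
  sk_mass : forall x, (\int[mu]_y (k (x, y))%:E = M%:E)%E }.

Section OneKernel.
Variables (k : T * T -> R) (M : R).
Hypothesis sk : sym_kernel k M.
Let mk := sk_meas sk.
Let k0 := sk_ge0 sk.

Lemma sk_meas_slice x : measurable_fun [set: T] (fun y => k (x, y)).
Proof. exact: (measurableT_comp mk (measurable_pair1 x)). Qed.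

Lemma sk_int x : mu.-integrable setT (EFin \o (fun y => k (x, y))).
Proof.
apply/integrableP; split; first by apply/measurable_EFinP; exact: sk_meas_slice.
under eq_integral do rewrite /= ger0_norm ?k0//.
by rewrite (sk_mass sk) ltry.
Qed.

Lemma sk_massR x : \int[mu]_y k (x, y) = M.
Proof. by rewrite /Rintegral (sk_mass sk). Qed.

Lemma sk_sq x : sq (fun y => k (x, y)).
Proof.
have [K K0 kK] := sk_bound sk; split; first exact: sk_meas_slice.
apply: (@integrable_le_real _ _ _ mu _ (fun y => K * k (x, y))).
- by apply: measurable_funX; exact: sk_meas_slice.
- by move=> y; rewrite ger0_norm ?sqr_ge0// expr2 ler_wpM2r.
- have := integrableZl measurableT K (sk_int x); by apply: eq_integrable => // y _.
Qed.

Lemma sk_mul_int g x : sq g -> mu.-integrable setT (EFin \o (fun y => k (x, y) * g y)).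
Proof. by move=> sg; apply: sqint_mul => //; exact: sk_sq. Qed.

Lemma sk_sqr_int g x : sq g -> mu.-integrable setT (EFin \o (fun y => k (x, y) * g y ^+ 2)).
Proof.
move=> sg; have [K K0 kK] := sk_bound sk; have [mg g2] := sg.
apply: (@integrable_le_real _ _ _ mu _ (fun y => K * g y ^+ 2)).
- by apply: measurable_funM; [exact: sk_meas_slice|exact: measurable_funX].
- move=> y; rewrite ger0_norm; first by exact: (ler_wpM2r (sqr_ge0 _) (kK _)).
  by rewrite mulr_ge0// sqr_ge0.
- have := integrableZl measurableT K g2; by apply: eq_integrable => // y _.
Qed.

Definition ksqr g x := \int[mu]_y (k (x, y) * g y ^+ 2).

Lemma ksqr_ge0 g x : 0 <= ksqr g x.
Proof. by apply: Rintegral_ge0 => y _; rewrite mulr_ge0 ?sqr_ge0. Qed.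

Lemma ksqrE g x : sq g -> (\int[mu]_y (k (x, y) * g y ^+ 2)%:E = (ksqr g x)%:E)%E.
Proof.
move=> sg; rewrite /ksqr /Rintegral fineK//.
by apply: integrable_fin_num => //; exact: sk_sqr_int.
Qed.

Lemma ksqr_total g : sq g -> mu.-integrable setT (EFin \o ksqr g) /\
  \int[mu]_x ksqr g x = M * ip g g.
Proof.
move=> sg; have [mg g2] := sg.
pose f (p : T * T) := (k p * g p.2 ^+ 2)%:E.
have mf : measurable_fun [set: T * T] f.
  apply/measurable_EFinP; apply: measurable_funM => //; apply: measurable_funX.
  exact: (measurableT_comp mg measurable_snd).
have f0 p : (0 <= f p)%E by rewrite lee_fin mulr_ge0 ?sqr_ge0.
have M0 : 0 <= M \/ (forall x : T, False).
  have [[x _]|h] := pselect (exists x : T, True); last by right => x; apply: h; exists x.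
  by left; rewrite -(sk_massR x); apply: Rintegral_ge0.
have tot : (\int[mu]_x (ksqr g x)%:E = (M * ip g g)%:E)%E.
  transitivity (\int[mu]_x \int[mu]_y f (x, y))%E.
    by apply: eq_integral => x _; rewrite -ksqrE.
  rewrite fubini_tonelli//.
  transitivity (\int[mu]_y (M%:E * (g y ^+ 2)%:E))%E.
    apply: eq_integral => y _; rewrite /f /=.
    under eq_integral do rewrite EFinM.
    rewrite ge0_integralZr//; last 3 first.
    - by apply/measurable_EFinP; exact: (measurableT_comp mk (measurable_pair2 y)).
    - by move=> x _; rewrite lee_fin.
    - by rewrite lee_fin sqr_ge0.
    by congr (_ * _)%E; rewrite -(sk_mass sk y); apply: eq_integral => x _; rewrite (sk_sym sk).
  by rewrite integralZl// -ipmE// -EFinM.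
have mks : measurable_fun [set: T] (ksqr g).
  apply: (@measurable_Rint_snd _ _ _ mu (fun p => k p * g p.2 ^+ 2)).
  by apply/measurable_EFinP.
split; last by rewrite /Rintegral tot.
apply/integrableP; split; first exact/measurable_EFinP.
under eq_integral do rewrite /= ger0_norm ?ksqr_ge0//.
by rewrite tot ltry.
Qed.

Lemma measurable_kint_sk g : measurable_fun [set: T] g -> measurable_fun [set: T] (kint mu k g).
Proof. exact: measurable_kint. Qed.

(** Schur's test: Cauchy-Schwarz after splitting [k] into two square roots. *)
Lemma kint_sqr_le g x : sq g -> kint mu k g x ^+ 2 <= M * ksqr g x.
Proof.
move=> sg; have [mg _] := sg.
have ms : measurable_fun [set: T] (fun y => Num.sqrt (k (x, y))).
  apply: (measurableT_comp (f := fun u : R => Num.sqrt u)); last exact: sk_meas_slice.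
  by apply: continuous_measurable_fun; exact: sqrt_continuous.
have ss y : Num.sqrt (k (x, y)) ^+ 2 = k (x, y) by rewrite sqr_sqrtr.
have s1 : sq (fun y => Num.sqrt (k (x, y))).
  split => //; have := sk_int x; apply: eq_integrable => // y _ /=; by rewrite ss.
have s2 : sq (fun y => Num.sqrt (k (x, y)) * g y).
  split; first exact: measurable_funM.
  by have := sk_sqr_int x sg; apply: eq_integrable => // y _ /=; rewrite exprMn ss.
have := ipm_CS s1 s2.
have -> : ip (fun y => Num.sqrt (k (x, y))) (fun y => Num.sqrt (k (x, y))) = M.
  by rewrite -(sk_massR x); apply: eq_Rintegral => y _; rewrite -expr2 ss.
have -> : ip (fun y => Num.sqrt (k (x, y)) * g y) (fun y => Num.sqrt (k (x, y)) * g y) = ksqr g x.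
  by apply: eq_Rintegral => y _; rewrite -expr2 exprMn ss.
suff -> : ip (fun y => Num.sqrt (k (x, y))) (fun y => Num.sqrt (k (x, y)) * g y) = kint mu k g x by [].
by apply: eq_Rintegral => y _; rewrite mulrA -expr2 ss.
Qed.

Lemma kint_sk_sq g : sq g -> sq (kint mu k g) /\ ip (kint mu k g) (kint mu k g) <= M ^+ 2 * ip g g.
Proof.
move=> sg; have [mg _] := sg; have [ki kE] := ksqr_total sg.
have Mi : mu.-integrable setT (EFin \o (fun x => M * ksqr g x)).
  by have := integrableZl measurableT M ki; apply: eq_integrable => // x _.
have mkg := measurable_kint_sk mg.
have s : sq (kint mu k g).
  split => //; apply: (integrable_le_real _ _ Mi); first exact: measurable_funX.
  by move=> x; rewrite ger0_norm ?sqr_ge0// kint_sqr_le.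
split => //; rewrite expr2 -mulrA -kE -RintegralZl//.
have [_ s2] := s.
by apply: le_Rintegral => // x _; rewrite -expr2 kint_sqr_le.
Qed.

(** Fubini's theorem; the integrability it requires is dominated by [k (x, y)] times
    [g' x ^ 2 + g y ^ 2]. *)
Lemma kint_sym g g' : sq g -> sq g' -> ip (kint mu k g) g' = ip g (kint mu k g').
Proof.
move=> sg sg'; have [mg g2] := sg; have [mg' g2'] := sg'.
pose f (p : T * T) := (g' p.1 * (k p * g p.2))%:E.
have mf : measurable_fun [set: T * T] f.
  apply/measurable_EFinP; apply: measurable_funM.
    exact: (measurableT_comp mg' measurable_fst).
  apply: measurable_funM => //; exact: (measurableT_comp mg measurable_snd).
have [ki kE] := ksqr_total sg.
have fi : (mu \x mu)%E.-integrable setT f.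
  apply/integrable12ltyP => //.
  have bnd : mu.-integrable setT (EFin \o (fun x => M * g' x ^+ 2 + ksqr g x)).
    have := integrableD measurableT (integrableZl measurableT M g2') ki.
    by apply: eq_integrable => // x _.
  have /integrableP[_] := bnd; apply: le_lt_trans; apply: ge0_le_integral => //.
  - by move=> x _; apply: integral_ge0.
  - apply: (measurable_fun_fubini_tonelli_F (m2 := mu) (fun p => `|f p|%E)) => //.
    exact: measurableT_comp.
  - by apply: measurableT_comp => //; exact: measurable_int bnd.
  move=> x _; apply: (@le_trans _ _ (\int[mu]_y (k (x, y) * (g' x ^+ 2 + g y ^+ 2))%:E)%E).
    apply: ge0_le_integral => //.
    - apply: measurableT_comp => //; exact: (measurableT_comp mf (measurable_pair1 x)).
    - apply/measurable_EFinP; apply: measurable_funM; first exact: sk_meas_slice.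
      by apply: measurable_funD => //; exact: measurable_funX.
    - move=> y _; rewrite /f lee_fin /= mulrCA normrM ger0_norm// ler_wpM2l// normrM.
      have := sqr_ge0 (`|g' x| - `|g y|); rewrite sqrrB !real_normK ?num_real//.
      have := sqr_ge0 (g' x); have := sqr_ge0 (g y); lin.
  rewrite (_ : (fun y => _) = fun y => ((g' x ^+ 2)%:E * (k (x, y))%:E + (k (x, y) * g y ^+ 2)%:E)%E); last first.
    by apply/funext => y; rewrite -EFinM -EFinD; congr EFin; ring.
  rewrite ge0_integralD//; last 4 first.
  - by move=> y _; rewrite mule_ge0// lee_fin// sqr_ge0.
  - by apply: emeasurable_funM => //; apply/measurable_EFinP; exact: sk_meas_slice.
  - by move=> y _; rewrite lee_fin mulr_ge0 ?sqr_ge0.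
  - by have /integrableP[] := sk_sqr_int x sg.
  rewrite integralZl//; last exact: sk_int.
  rewrite (sk_mass sk) ksqrE// -EFinM -EFinD lee_fin /= (mulrC M) ler_norm//.
have := Fubini fi; rewrite /f/=.
have E1 x : (\int[mu]_y (g' x * (k (x, y) * g y))%:E = (kint mu k g x * g' x)%:E)%E.
  under eq_integral do rewrite EFinM.
  have i1 := sk_mul_int x sg.
  rewrite integralZl// mulrC EFinM; congr (_ * _)%E.
  by rewrite /kint /ipm /Rintegral fineK//; apply: integrable_fin_num.
have E2 y : (\int[mu]_x (g' x * (k (x, y) * g y))%:E = (g y * kint mu k g' y)%:E)%E.
  have i1 := sk_mul_int y sg'.
  transitivity (\int[mu]_x ((g y)%:E * (k (y, x) * g' x)%:E))%E.
    by apply: eq_integral => x _; rewrite -EFinM (sk_sym sk); congr EFin; ring.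
  rewrite integralZl// EFinM; congr (_ * _)%E.
  by rewrite /kint /ipm /Rintegral fineK//; apply: integrable_fin_num.
under eq_integral do rewrite E1; under [X in _ = X -> _]eq_integral do rewrite E2.
by rewrite /ipm /Rintegral => ->.
Qed.

(** The square is expanded: each diagonal term contributes [M * ip g g], by the mass in [y] for one
    and by symmetry for the other. *)
Lemma dirichlet_identity g : sq g ->
  (\int[mu]_x \int[mu]_y (k (x, y) * (g x - g y) ^+ 2)%:E =
   (2 * (M * ip g g - ip (kint mu k g) g))%:E)%E.
Proof.
move=> sg; have [mg g2] := sg; have [ki kE] := ksqr_total sg.
have [skg _] := kint_sk_sq sg.
transitivity (\int[mu]_x (M * g x ^+ 2 + ksqr g x - 2 * (kint mu k g x * g x))%:E)%E.
  apply: eq_integral => x _.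
  have i1 : mu.-integrable setT (EFin \o (fun y => g x ^+ 2 * k (x, y))).
    by have := integrableZl measurableT (g x ^+ 2) (sk_int x); apply: eq_integrable => // y _.
  have i2 := sk_sqr_int x sg.
  have i3 : mu.-integrable setT (EFin \o (fun y => 2 * g x * (k (x, y) * g y))).
    by have := integrableZl measurableT (2 * g x) (sk_mul_int x sg); apply: eq_integrable => // y _.
  have i12 : mu.-integrable setT (EFin \o (fun y => g x ^+ 2 * k (x, y) + k (x, y) * g y ^+ 2)).
    by have := integrableD measurableT i1 i2; apply: eq_integrable => // y _.
  have i123 : mu.-integrable setT (EFin \o (fun y => g x ^+ 2 * k (x, y) + k (x, y) * g y ^+ 2 - 2 * g x * (k (x, y) * g y))).
    by have := integrableB measurableT i12 i3; apply: eq_integrable => // y _.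
  transitivity (\int[mu]_y (g x ^+ 2 * k (x, y) + k (x, y) * g y ^+ 2 - 2 * g x * (k (x, y) * g y))%:E)%E.
    by apply: eq_integral => y _; congr EFin; ring.
  rewrite -(@fineK _ (\int[mu]_y _)%E); last exact: (integrable_fin_num measurableT i123).
  congr EFin; rewrite -[LHS]/(\int[mu]_y (g x ^+ 2 * k (x, y) + k (x, y) * g y ^+ 2 - 2 * g x * (k (x, y) * g y))).
  rewrite RintegralB// RintegralD// !RintegralZl//; [|exact: sk_mul_int|exact: sk_int].
  by rewrite sk_massR /kint /ipm /ksqr; ring.
have i1 : mu.-integrable setT (EFin \o (fun x => M * g x ^+ 2)).
  by have := integrableZl measurableT M g2; apply: eq_integrable => // y _.
have i12 : mu.-integrable setT (EFin \o (fun x => M * g x ^+ 2 + ksqr g x)).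
  by have := integrableD measurableT i1 ki; apply: eq_integrable => // y _.
have i3 : mu.-integrable setT (EFin \o (fun x => 2 * (kint mu k g x * g x))).
  by have := integrableZl measurableT 2 (sqint_mul skg sg); apply: eq_integrable => // y _.
have i123 : mu.-integrable setT (EFin \o (fun x => M * g x ^+ 2 + ksqr g x - 2 * (kint mu k g x * g x))).
  by have := integrableB measurableT i12 i3; apply: eq_integrable => // y _.
rewrite -(@fineK _ (\int[mu]_x _)%E); last exact: (integrable_fin_num measurableT i123).
congr EFin; rewrite -[LHS]/(\int[mu]_x (M * g x ^+ 2 + ksqr g x - 2 * (kint mu k g x * g x))).
rewrite RintegralB// RintegralD// !RintegralZl// ?kE; last exact: sqint_mul.
rewrite /ipm; under eq_Rintegral do rewrite expr2.
ring.
Qed.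

End OneKernel.

(* IMS localization with the partition of unity [cos theta ^ 2 + sin theta ^ 2 = 1] *)
Lemma ims_localization k (M : R) (de : T * T -> R) (MJ : R) (th : T -> R) g :
  sym_kernel k M -> sym_kernel (fun z => k z * de z) MJ ->
  measurable_fun [set: T] th ->
  (forall x y, (th x - th y) ^+ 2 <= de (x, y)) -> sq g ->
  ip (kint mu k g) g <=
    ip (kint mu k (fun x => cos (th x) * g x)) (fun x => cos (th x) * g x) +
    ip (kint mu k (fun x => sin (th x) * g x)) (fun x => sin (th x) * g x) +
    MJ / 2 * ip g g.
Proof.
move=> sk sJ mth hde sg; have [mg g2] := sg.
have mc : measurable_fun [set: T] (fun x => cos (th x)).
  by apply: (measurableT_comp _ mth); apply: continuous_measurable_fun; exact: continuous_cos.
have ms : measurable_fun [set: T] (fun x => sin (th x)).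
  by apply: (measurableT_comp _ mth); apply: continuous_measurable_fun; exact: continuous_sin.
pose gc x := cos (th x) * g x; pose gs x := sin (th x) * g x.
have sgc : sq gc.
  apply: (sqint_dom _ _ sg); first exact: measurable_funM.
  by move=> x; rewrite normrM ler_piMl// cos_max.
have sgs : sq gs.
  apply: (sqint_dom _ _ sg); first exact: measurable_funM.
  by move=> x; rewrite normrM ler_piMl// sin_max.
have [skg _] := kint_sk_sq sk sg; have [skc _] := kint_sk_sq sk sgc; have [sks _] := kint_sk_sq sk sgs.
have [Ji JE] := ksqr_total sJ sg.
have c1 (u : R) : 1 - cos u <= u ^+ 2 / 2.
  have -> : u = (u / 2) *+ 2 by rewrite -mulr_natr divfK.
  rewrite cos_mulr2n cos2sin2.
  suff : sin (u / 2) ^+ 2 <= (u / 2) ^+ 2 by rewrite -[(u / 2) *+ 2]mulr_natr exprMn; lin.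
  have sle (v : R) : 0 <= v -> sin v <= v.
    rewrite le_eqVlt => /orP[/eqP <-|v0]; first by rewrite sin0.
    have [|c _] := @MVT R sin cos 0 v v0 (fun x _ => is_derive_sin x).
      by apply: continuous_subspaceT; exact: continuous_sin.
    rewrite sin0 !subr0 => ->; rewrite ler_piMl ?(ltW v0)//; exact: le_trans (ler_norm _) (cos_max _).
  have sle' (v : R) : 0 <= v -> - v <= sin v.
    rewrite le_eqVlt => /orP[/eqP <-|v0]; first by rewrite sin0 oppr0.
    have [|c _] := @MVT R sin cos 0 v v0 (fun x _ => is_derive_sin x).
      by apply: continuous_subspaceT; exact: continuous_sin.
    rewrite sin0 !subr0 => ->; rewrite -mulN1r ler_wpM2r ?(ltW v0)//.
    by have := cos_max c; rewrite ler_norml => /andP[].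
  rewrite -[sin _ ^+ 2]real_normK ?num_real// -[(u / 2) ^+ 2]real_normK ?num_real//.
  rewrite lerXn2r ?nnegrE//.
  have [v0|v0] := leP 0 (u / 2).
    by rewrite (ger0_norm v0) ler_norml sle' ?sle.
  by rewrite (ltr0_norm v0) -normrN -sinN ler_norml sle' ?sle ?oppr_ge0 ?ltW.
have pw x : kint mu k g x * g x - kint mu k gc x * gc x - kint mu k gs x * gs x <=
    (MJ * g x ^+ 2 + ksqr (fun z => k z * de z) g x) / 4.
  have i1 := sk_mul_int sk x sg; have i2 := sk_mul_int sk x sgc; have i3 := sk_mul_int sk x sgs.
  have z1 (F : T -> R) (a : R) : mu.-integrable setT (EFin \o F) -> mu.-integrable setT (EFin \o (fun y => a * F y)).
    by move=> /(integrableZl measurableT a); apply: eq_integrable => // y _.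
  have zB (F G : T -> R) : mu.-integrable setT (EFin \o F) -> mu.-integrable setT (EFin \o G) ->
      mu.-integrable setT (EFin \o (fun y => F y - G y)).
    by move=> h1 h2; have := integrableB measurableT h1 h2; apply: eq_integrable => // y _.
  have zD (F G : T -> R) : mu.-integrable setT (EFin \o F) -> mu.-integrable setT (EFin \o G) ->
      mu.-integrable setT (EFin \o (fun y => F y + G y)).
    by move=> h1 h2; have := integrableD measurableT h1 h2; apply: eq_integrable => // y _.
  have -> : kint mu k g x * g x - kint mu k gc x * gc x - kint mu k gs x * gs x =
     \int[mu]_y (g x * (k (x, y) * g y) - gc x * (k (x, y) * gc y) - gs x * (k (x, y) * gs y)).
    rewrite RintegralB//; [|by apply: zB; exact: z1|exact: z1].
    rewrite RintegralB//; [|exact: z1|exact: z1].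
    by rewrite !RintegralZl// /kint /ipm; ring.
  have -> : (MJ * g x ^+ 2 + ksqr (fun z => k z * de z) g x) / 4 =
     \int[mu]_y (4^-1 * (g x ^+ 2 * (k (x, y) * de (x, y)) + k (x, y) * de (x, y) * g y ^+ 2)).
    have j1 := sk_int sJ x; have j2 := sk_sqr_int sJ x sg.
    rewrite RintegralZl//; last by apply: zD => //; exact: z1.
    rewrite RintegralD//; last exact: z1.
    by rewrite RintegralZl// (sk_massR sJ) /ksqr; ring.
  apply: le_Rintegral => //.
  - by apply: (zB); [apply: (zB)|]; exact: (z1).
  - by apply: (z1); apply: (zD); [apply: (z1); exact: (sk_int sJ)|exact: (sk_sqr_int sJ)].
  move=> y _; rewrite /gc /gs.
  (* By the subtraction formula the localization error only sees [1 - cos (th x - th y)], hence the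
     squared increment of [th]. *)
  have -> : g x * (k (x, y) * g y) - cos (th x) * g x * (k (x, y) * (cos (th y) * g y)) -
    sin (th x) * g x * (k (x, y) * (sin (th y) * g y)) = k (x, y) * ((g x * g y) * (1 - cos (th x - th y))).
    by rewrite cosB; ring.
  have -> : 4^-1 * (g x ^+ 2 * (k (x, y) * de (x, y)) + k (x, y) * de (x, y) * g y ^+ 2) =
    k (x, y) * (((g x ^+ 2 + g y ^+ 2) / 2) * (de (x, y) / 2)) by field.
  rewrite ler_wpM2l ?(sk_ge0 sk)//.
  have h1 : 0 <= 1 - cos (th x - th y).
    by rewrite subr_ge0; exact: le_trans (ler_norm _) (cos_max _).
  have h2 : 1 - cos (th x - th y) <= de (x, y) / 2.
    by apply: le_trans (c1 _) _; rewrite ler_pM2r.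
  have h3 : g x * g y <= (g x ^+ 2 + g y ^+ 2) / 2.
    by have := sqr_ge0 (g x - g y); rewrite sqrrB; lin.
  have h4 : 0 <= (g x ^+ 2 + g y ^+ 2) / 2.
    by have := sqr_ge0 (g x); have := sqr_ge0 (g y); lin.
  apply: le_trans (ler_wpM2r h1 h3) _; exact: ler_wpM2l.
have : ip (kint mu k g) g - ip (kint mu k gc) gc - ip (kint mu k gs) gs <= MJ / 2 * ip g g.
  have -> : MJ / 2 * ip g g = \int[mu]_x ((MJ * g x ^+ 2 + ksqr (fun z => k z * de z) g x) / 4).
    transitivity ((MJ * ip g g + MJ * ip g g) / 4); first by field.
    rewrite -[in X in _ + X]JE.
    have j1 : mu.-integrable setT (EFin \o (fun x => MJ * g x ^+ 2)).
      by have := integrableZl measurableT MJ g2; apply: eq_integrable => // y _.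
    rewrite RintegralZr//; last first.
      by have := integrableD measurableT j1 Ji; apply: eq_integrable => // y _.
    rewrite RintegralD//; congr ((_ + _) / _).
    by rewrite RintegralZl// /ipm; under [in RHS]eq_Rintegral do rewrite expr2.
  have e1 := sqint_mul skg sg; have e2 := sqint_mul skc sgc; have e3 := sqint_mul sks sgs.
  have e12 : mu.-integrable setT (EFin \o (fun x => kint mu k g x * g x - kint mu k gc x * gc x)).
    by have := integrableB measurableT e1 e2; apply: eq_integrable => // y _.
  rewrite /ipm -RintegralB// -RintegralB//.
  apply: le_Rintegral => //.
    by have := integrableB measurableT e12 e3; apply: eq_integrable => // y _.
  have j1 := integrableD measurableT (integrableZl measurableT MJ g2) Ji.
  have := integrableZl measurableT 4^-1 j1.
  by apply: eq_integrable => // y _ /=; 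
  by rewrite -[LHS]/((4^-1 * (MJ * g y ^+ 2 + ksqr (fun z => k z * de z) g y))%:E) mulrC.
rewrite -/gc -/gs; lin.
Qed.

End KernelForm.

Section TranslationKernels.
Variables (R : realType) (d : nat).
Notation pt := (d.-tuple R).
Notation leb := (@lebesgue_measure R).
Notation mu := (vol R d).
Notation sq := (sqint (vol R d)).
Notation ip := (ipm (vol R d)).
Notation ball_int := (bint mu (@tnorm R d)).
Implicit Types (x y z : pt) (g : pt -> R).

Definition nker (k0 : R -> R) (p : pt * pt) : R := k0 (tnorm (tsub p.2 p.1)).

Lemma measurable_nker k0 : measurable_fun [set: R] k0 -> measurable_fun [set: pt * pt] (nker k0).
Proof.
move=> mk0.
have h := measurableT_comp (@measurable_tnorm R d) (@measurable_tsub_fun R d).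
exact: (measurableT_comp mk0 h).
Qed.

Lemma measurable_vadd_r x : measurable_fun [set: pt] (fun z : pt => vadd z x).
Proof.
have h := @measurable_vadd_fun R d pt.
exact: (measurableT_comp h (measurable_pair2 x)).
Qed.

Lemma int_tsub (F : pt -> \bar R) x : measurable_fun [set: pt] F -> (forall z, 0 <= F z)%E ->
  (\int[mu]_y F (tsub y x) = \int[mu]_y F y)%E.
Proof.
move=> mF F0; under eq_integral do rewrite tsubE.
exact: ge0_int_vadd.
Qed.

Lemma measurable_knorm (k0 : R -> R) : measurable_fun [set: R] k0 ->
  measurable_fun [set: pt] (fun z : pt => k0 (tnorm z)).
Proof. by move=> mk0; exact: (measurableT_comp mk0 (@measurable_tnorm R d)). Qed.

Lemma nker_sym_kernel (k0 : R -> R) (M : R) : measurable_fun [set: R] k0 ->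
  (forall t, 0 <= k0 t) -> (exists2 K, 0 <= K & forall t, k0 t <= K) ->
  (\int[mu]_z (k0 (tnorm z))%:E = M%:E)%E -> sym_kernel mu (nker k0) M.
Proof.
move=> mk0 k0p [K K0 kK] kM; split.
- exact: measurable_nker.
- by move=> z; exact: k0p.
- by exists K => // z; exact: kK.
- by move=> x y; rewrite /nker/= tnorm_tsubC.
- move=> x; rewrite -kM -(@int_tsub (fun z => (k0 (tnorm z))%:E) x)//.
    by apply/measurable_EFinP; exact: measurable_knorm.
  by move=> z; rewrite lee_fin.
Qed.

(** The squared [L^2] modulus of continuity; the Dirichlet form of a translation kernel is its
    integral against the kernel. *)
Definition tdiff g z : \bar R := (\int[mu]_x ((g x - g (vadd x z)) ^+ 2)%:E)%E.

Lemma tdiff_ge0 g z : (0 <= tdiff g z)%E.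
Proof. by apply: integral_ge0 => x _; rewrite lee_fin sqr_ge0. Qed.

Lemma measurable_tdiff_fun g : measurable_fun [set: pt] g ->
  measurable_fun [set: pt * pt] (fun p : pt * pt => (g p.2 - g (vadd p.2 p.1)) ^+ 2).
Proof.
move=> mg; apply: measurable_funX; apply: measurable_funB.
  exact: (measurableT_comp mg measurable_snd).
have h := @measurable_vadd_fun R d pt.
have e : measurable_fun [set: pt * pt] (fun p : pt * pt => (p.2, p.1)).
  by apply: measurable_fun_pair; [exact: measurable_snd|exact: measurable_fst].
exact: (measurableT_comp mg (measurableT_comp h e)).
Qed.

Lemma measurable_tdiff g : measurable_fun [set: pt] g -> measurable_fun [set: pt] (tdiff g).
Proof.
move=> mg; have := measurable_tdiff_fun mg => /measurable_EFinP h.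
apply: (@measurable_fun_fubini_tonelli_F _ _ _ _ _ mu _ h).
by move=> p; rewrite lee_fin sqr_ge0.
Qed.

Lemma nker_dirichlet (k0 : R -> R) g : measurable_fun [set: R] k0 -> (forall t, 0 <= k0 t) ->
  measurable_fun [set: pt] g ->
  (\int[mu]_x \int[mu]_y (nker k0 (x, y) * (g x - g y) ^+ 2)%:E =
   \int[mu]_z ((k0 (tnorm z))%:E * tdiff g z))%E.
Proof.
move=> mk0 k0p mg.
pose f (p : pt * pt) := (k0 (tnorm p.2) * (g p.1 - g (vadd p.1 p.2)) ^+ 2)%:E.
have mf : measurable_fun [set: pt * pt] f.
  apply/measurable_EFinP; apply: measurable_funM.
    exact: (measurableT_comp (measurable_knorm mk0) measurable_snd).
  apply: measurable_funX; apply: measurable_funB.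
    exact: (measurableT_comp mg measurable_fst).
  exact: (measurableT_comp mg (@measurable_vadd_fun R d pt)).
have f0 p : (0 <= f p)%E by rewrite lee_fin mulr_ge0// sqr_ge0.
transitivity (\int[mu]_x \int[mu]_z f (x, z))%E.
  apply: eq_integral => x _.
  rewrite -(@ge0_int_vadd R d x (fun y => (nker k0 (x, y) * (g x - g y) ^+ 2)%:E)).
  - by apply: eq_integral => z _; rewrite /f /nker/= tsub_vadd (vaddC x z).
  - apply/measurable_EFinP; apply: measurable_funM.
      exact: (measurableT_comp (measurable_nker mk0) (measurable_pair1 x)).
    by apply: measurable_funX; exact: measurable_funB.
  - by move=> y; rewrite lee_fin mulr_ge0 ?sqr_ge0//; exact: k0p.
rewrite fubini_tonelli//; apply: eq_integral => z _; rewrite /f/=.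
under eq_integral do rewrite EFinM.
rewrite ge0_integralZl//; last 1 first.
- by rewrite lee_fin.
- apply/measurable_EFinP; apply: measurable_funX; apply: measurable_funB => //.
  exact: (measurableT_comp mg (measurable_vadd_r z)).
- by move=> x _; rewrite lee_fin sqr_ge0.
Qed.

Lemma vscale_succ n z : vscale n.+1%:R z = vadd (vscale n%:R z) z.
Proof. by apply: eq_from_tnth => i; rewrite !tnth_mktuple -natr1 mulrDl mul1r. Qed.

(** The increment by [(n + 1) z] telescopes into [n + 1] translates of the increment by [z], and
    Cauchy-Schwarz costs one more factor [n + 1]. This is the growth hypothesis of
    [gauss_ball_le]. *)
Lemma tdiff_growth g (n : nat) z : measurable_fun [set: pt] g ->
  (tdiff g (vscale n.+1%:R z) <= (n.+1%:R ^+ 2)%:E * tdiff g z)%E.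
Proof.
move=> mg.
pose a (j : nat) x := g (vadd x (vscale j%:R z)) - g (vadd x (vscale j.+1%:R z)).
have ma j : measurable_fun [set: pt] (a j).
  by apply: measurable_funB; apply: (measurableT_comp mg); exact: measurable_vadd_r.
have z0 x : vadd x (vscale 0 z) = x.
  by apply: eq_from_tnth => i; rewrite !tnth_mktuple mul0r addr0.
have tel x : g x - g (vadd x (vscale n.+1%:R z)) = \sum_(j < n.+1) a j x.
  rewrite -[LHS]opprB -{2}(z0 x) -(telescope_sumr (fun j => g (vadd x (vscale j%:R z))) (leq0n n.+1)).
  by rewrite big_mkord -sumrN; apply: eq_bigr => j _; rewrite opprB.
have int_a (j : nat) : (\int[mu]_x ((a j x) ^+ 2)%:E = tdiff g z)%E.
  rewrite /tdiff -(@ge0_int_vadd R d (vscale j%:R z) (fun x => ((g x - g (vadd x z)) ^+ 2)%:E)).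
  - by apply: eq_integral => x _; rewrite /a vscale_succ vaddA.
  - apply/measurable_EFinP; apply: measurable_funX; apply: measurable_funB => //.
    by apply: (measurableT_comp mg); exact: measurable_vadd_r.
  - by move=> x; rewrite lee_fin sqr_ge0.
apply: (@le_trans _ _ (\int[mu]_x (n.+1%:R%:E * \sum_(j < n.+1) ((a j x) ^+ 2)%:E))%E).
  apply: ge0_le_integral => //.
  - by move=> x _; rewrite lee_fin sqr_ge0.
  - apply/measurable_EFinP; apply: measurable_funX; apply: measurable_funB => //.
    by apply: (measurableT_comp mg); exact: measurable_vadd_r.
  - apply: emeasurable_funM => //; apply: emeasurable_sum => j.
    by apply/measurable_EFinP; exact: measurable_funX.
  - move=> x _; rewrite sumEFin -EFinM lee_fin tel.
    have := @sum_CS R n.+1 (fun=> 1) (fun j => a j x).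
    under eq_bigr do rewrite mul1r.
    by rewrite expr1n sumr_const card_ord.
rewrite ge0_integralZl//; last 2 first.
- by apply: emeasurable_sum => j; apply/measurable_EFinP; exact: measurable_funX.
- by move=> x _; apply: sume_ge0 => j _; rewrite lee_fin sqr_ge0.
rewrite ge0_integral_sum//; last 2 first.
- by move=> j; apply/measurable_EFinP; exact: measurable_funX.
- by move=> j x _; rewrite lee_fin sqr_ge0.
under eq_bigr do rewrite int_a.
rewrite expr2 EFinM -muleA; apply: lee_wpmul2l; first by rewrite lee_fin.
suff h (m : nat) (e : \bar R) : (0 <= e)%E -> (\sum_(i < m) e = m%:R%:E * e)%E.
  by rewrite h//; exact: tdiff_ge0.
move=> e0; elim: m => [|m IH]; first by rewrite big_ord0 mul0e.
by rewrite big_ord_recr/= IH -natr1 EFinD ge0_muleDl ?lee_fin// mul1e.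
Qed.

Definition bker (h : R) : R -> R := fun t => (t < h)%R%:R.
Definition bv (h : R) : R := h ^+ d * bvol1 R d.

Lemma bv_gt0 h : 0 < h -> 0 < bv h.
Proof. by move=> h0; rewrite mulr_gt0 ?exprn_gt0 ?bvol1_gt0. Qed.

Lemma bker_sym_kernel h : 0 < h -> sym_kernel mu (nker (bker h)) (bv h).
Proof.
move=> h0; apply: nker_sym_kernel.
- exact: measurable_lt_indic.
- by move=> t; rewrite /bker ler0n.
- by exists 1 => // t; rewrite /bker lern1 leq_b1.
- rewrite -bvolE//; apply: eq_integral => z _; by rewrite mule1.
Qed.

Definition gker (s : R) : R -> R := fun t => (s ^+ d * gtot R d)^-1 * expR (- (t ^+ 2 / (2 * s ^+ 2))).

Lemma measurable_gker s : measurable_fun [set: R] (gker s).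
Proof.
apply: measurable_funM => //; apply: measurableT_comp => //; apply: measurableT_comp => //.
by apply: measurable_funM => //; exact: measurable_funX.
Qed.

Section Gauss.
Variable s : R.
Hypothesis s0 : 0 < s.

Lemma gkc_gt0 : 0 < (s ^+ d * gtot R d)^-1.
Proof. by rewrite invr_gt0; apply: mulr_gt0; [exact: exprn_gt0|exact: gtot_gt0]. Qed.

Lemma gker_ge0 t : 0 <= gker s t.
Proof. by rewrite mulr_ge0 ?expR_ge0// ltW// gkc_gt0. Qed.

(* the change of variables [z = s w] *)
Lemma gker_int (phi : pt -> \bar R) : measurable_fun [set: pt] phi -> (forall z, 0 <= phi z)%E ->
  (\int[mu]_z ((gker s (tnorm z))%:E * phi z) =
   ((gtot R d)^-1)%:E * \int[mu]_w ((expR (- (tnorm w ^+ 2 / 2)))%:E * phi (vscale s w)))%E.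
Proof.
move=> mphi phi0.
pose F z := ((gker s (tnorm z))%:E * phi z)%E.
have mF : measurable_fun [set: pt] F.
  by apply: emeasurable_funM => //; apply/measurable_EFinP; exact: measurable_knorm (measurable_gker s).
have F0 z : (0 <= F z)%E by rewrite mule_ge0// lee_fin gker_ge0.
have sd : 0 < s ^+ d by rewrite exprn_gt0.
have := @ge0_int_vscale R d s F (lt0r_neq0 s0) mF F0.
rewrite (gtr0_norm s0) => /(congr1 (fun e => (s ^+ d)%:E * e)%E).
rewrite muleA -EFinM mulfV ?(gt_eqF sd)// mul1e => <-.
have mphis : measurable_fun [set: pt] (fun w : pt => phi (vscale s w)).
  exact: (measurableT_comp mphi (@measurable_vscale R d s)).
rewrite (_ : (fun x => F (vscale s x)) = fun w : pt =>
   (((s ^+ d * gtot R d)^-1)%:E * ((expR (- (tnorm w ^+ 2 / 2)))%:E * phi (vscale s w)))%E); last first.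
  apply/funext => w; rewrite /F muleA -EFinM; congr (_%:E * _)%E.
  rewrite /gker tnorm_vscale (gtr0_norm s0); congr (_ * expR (- _)).
  by have h := lt0r_neq0 s0; rewrite exprMn; field.
rewrite ge0_integralZl//; last 3 first.
- apply: emeasurable_funM => //; apply/measurable_EFinP; exact: measurable_gauss_half.
- by move=> w _; rewrite mule_ge0// lee_fin expR_ge0.
- by rewrite lee_fin ltW// gkc_gt0.
rewrite muleA -EFinM; congr (_%:E * _)%E.
by rewrite invfM mulrA divff ?mul1r// (gt_eqF sd).
Qed.

Lemma gker_sym_kernel : sym_kernel mu (nker (gker s)) 1.
Proof.
apply: nker_sym_kernel.
- exact: measurable_gker.
- exact: gker_ge0.
- exists ((s ^+ d * gtot R d)^-1); first by rewrite ltW// gkc_gt0.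
  move=> t; rewrite ger_pMr ?gkc_gt0// -expR0 ler_expR oppr_le0.
  by rewrite divr_ge0 ?sqr_ge0// mulr_ge0// sqr_ge0.
have := @gker_int (fun=> 1%E) (measurable_cst _) (fun=> lee01).
under eq_integral do rewrite mule1.
under [in RHS]eq_integral do rewrite mule1.
by rewrite gauss_total -EFinM mulVf ?gt_eqF ?gtot_gt0.
Qed.

Lemma gker_moment_kernel (c : R) : 0 <= c ->
  sym_kernel mu (fun p => nker (gker s) p * (c * tnorm (tsub p.2 p.1) ^+ 2)) (c * d%:R * s ^+ 2).
Proof.
move=> c0.
have -> : (fun p : pt * pt => nker (gker s) p * (c * tnorm (tsub p.2 p.1) ^+ 2)) =
   nker (fun t => gker s t * (c * t ^+ 2)) by [].
have mt : measurable_fun [set: R] (fun t : R => c * t ^+ 2).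
  by apply: measurable_funM => //; exact: measurable_funX.
apply: nker_sym_kernel.
- by apply: measurable_funM => //; exact: measurable_gker.
- by move=> t; rewrite mulr_ge0 ?gker_ge0// mulr_ge0 ?sqr_ge0.
- exists ((s ^+ d * gtot R d)^-1 * (c * (2 * s ^+ 2))).
    by rewrite mulr_ge0 ?(ltW gkc_gt0)// mulr_ge0// mulr_ge0// sqr_ge0.
  move=> t; rewrite /gker -mulrA ler_wpM2l ?(ltW gkc_gt0)// mulrCA ler_wpM2l//.
  have s2 : 0 < 2 * s ^+ 2 by rewrite mulr_gt0// exprn_gt0.
  rewrite expRN mulrC ler_pdivrMr ?expR_gt0// -ler_pdivrMl// mulrC.
  by apply: le_trans (expR_ge1Dx _); rewrite lerDr.
under eq_integral do rewrite EFinM.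
rewrite (@gker_int (fun z => (c * tnorm z ^+ 2)%:E)); last 2 first.
- by apply/measurable_EFinP; exact: (measurable_knorm mt).
- by move=> z; rewrite lee_fin mulr_ge0 ?sqr_ge0.
under eq_integral => w _.
  rewrite -EFinM tnorm_vscale (gtr0_norm s0) exprMn tnorm_sqr.
  rewrite (_ : expR _ * _ = \sum_(k < d) (c * s ^+ 2) * (expR (- (tnorm w ^+ 2 / 2)) * tnth w k ^+ 2)); last first.
    by rewrite -mulr_sumr -mulr_sumr tnorm_sqr; ring.
  rewrite -sumEFin.
  over.
have mk k : measurable_fun [set: pt] (fun w : pt => expR (- (tnorm w ^+ 2 / 2)) * tnth w k ^+ 2).
  apply: measurable_funM; first exact: measurable_gauss_half.
  by apply: measurable_funX; exact: measurable_tnth_fun.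
have cs : 0 <= c * s ^+ 2 by rewrite mulr_ge0// sqr_ge0.
rewrite ge0_integral_sum//; last 2 first.
- by move=> k; apply/measurable_EFinP; apply: measurable_funM => //; exact: mk.
- by move=> k w _; rewrite lee_fin mulr_ge0// mulr_ge0 ?expR_ge0 ?sqr_ge0.
rewrite (eq_bigr (fun=> (c * s ^+ 2 * gtot R d)%:E)); last first.
  move=> k _; under eq_integral do rewrite EFinM.
  rewrite ge0_integralZl//; last 2 first.
  - by apply/measurable_EFinP; exact: mk.
  - by move=> w _; rewrite lee_fin mulr_ge0 ?expR_ge0 ?sqr_ge0.
  by rewrite gauss_moment.
rewrite sumEFin sumr_const card_ord -EFinM; congr EFin.
have := lt0r_neq0 (gtot_gt0 R d); rewrite -mulr_natl => h; field.
by [].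
Qed.

End Gauss.

(** [gauss_ball_le] at [eta = h / s] with [phi] a rescaled [tdiff g]. The leading constant
    [(d + 2) (s / h)^2] is the ratio of the variances [d s^2] of the Gaussian and [d h^2 / (d + 2)]
    of the uniform law on the ball. *)
Lemma gauss_ball_form : exists2 C : R, 0 <= C & forall (h s : R) g, 0 < h -> h <= s -> sq g ->
  ip g g - ip (kint mu (nker (gker s)) g) g <=
  (d%:R + 2) * (1 + C * (h / s)) / (h / s) ^+ 2 *
  (ip g g - ip (kint mu (nker (bker h)) g) g / bv h).
Proof.
have [C C0 HC] := gauss_ball_le R d; exists C => // h s g h0 hs sg.
have s0 : 0 < s := lt_le_trans h0 hs; have [mg _] := sg.
have e0 : 0 < h / s by rewrite divr_gt0.
have e1 : 0 < h / s <= 1 by rewrite e0/= ler_pdivrMr// mul1r.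
have d1 := dirichlet_identity (gker_sym_kernel s0) sg.
have d2 := dirichlet_identity (bker_sym_kernel h0) sg.
rewrite nker_dirichlet// in d1; [|exact: measurable_gker|exact: gker_ge0].
have mbk : measurable_fun [set: R] (bker h) by exact: measurable_lt_indic.
have bk0 t : 0 <= bker h t by rewrite /bker ler0n.
rewrite (nker_dirichlet mbk bk0 mg) in d2.
rewrite (gker_int s0) in d1; [|exact: measurable_tdiff|exact: tdiff_ge0].
have mD : measurable_fun [set: pt] (fun w : pt => tdiff g (vscale s w)).
  by have := measurableT_comp (measurable_tdiff mg) (@measurable_vscale R d s).
have gr (n : nat) z : (tdiff g (vscale s (vscale n.+1%:R z)) <= (n.+1%:R ^+ 2)%:E * tdiff g (vscale s z))%E.
  have -> : vscale s (vscale n.+1%:R z) = vscale n.+1%:R (vscale s z).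
    by apply: eq_from_tnth => i; rewrite !tnth_mktuple mulrCA.
  exact: tdiff_growth.
have := HC (h / s) (fun w => tdiff g (vscale s w)) e1 mD (fun w => tdiff_ge0 g _) gr.
have bs := @bint_scale R d (tdiff g) s (h / s) s0 (measurable_tdiff mg) (tdiff_ge0 g).
rewrite mulrC divfK ?gt_eqF// in bs.
have {}bs : ball_int (fun w => tdiff g (vscale s w)) (h / s) = (((s ^+ d)^-1)%:E * ball_int (tdiff g) h)%E.
  by rewrite bs muleA -EFinM mulVf ?mul1e// gt_eqF// exprn_gt0.
rewrite bs.
rewrite -[ball_int (tdiff g) h]/(\int[mu]_z ((bker h (tnorm z))%:E * tdiff g z))%E d2.
have g0 := gtot_gt0 R d.
have gi : (0 <= ((gtot R d)^-1)%:E)%E by rewrite lee_fin invr_ge0 ltW.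
move=> /(lee_wpmul2l gi).
rewrite d1 -!EFinM lee_fin mul1r => H.
have b1 := bvol1_gt0 R d.
have hd : 0 < h ^+ d by rewrite exprn_gt0.
have sd : 0 < s ^+ d by rewrite exprn_gt0.
rewrite -(ler_pM2l (_ : 0 < 2))//; apply: le_trans H _.
rewrite le_eqVlt; apply/orP; left; apply/eqP.
have -> : d.+2%:R = d%:R + 2 :> R by rewrite -!natr1; ring.
rewrite /bv !expr_div_n !exprS.
move: (bvol1 R d) b1 (gtot R d) g0 (h ^+ d) hd (s ^+ d) sd => b b0 G G0 H H0 S S0.
by field; rewrite !gt_eqF.
Qed.

End TranslationKernels.

Section LocalizedForm.
Variables (R : realType) (d : nat) (al r : R).
Hypotheses (al0 : 0 < al) (r0 : 0 < r) (r1 : r < 1).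
Notation pt := (d.-tuple R).
Notation mu := (vol R d).
Notation sq := (sqint (vol R d)).
Notation ip := (ipm (vol R d)).
Notation q := (mq al r).
Notation b := (mb al r).

(* the width for which the Gaussian kernel is the Mehler kernel up to the factors [expR (b |x|^2)] *)
Definition mwidth : R := Num.sqrt (2 * q)^-1.

Lemma mwidth_gt0 : 0 < mwidth.
Proof. by rewrite sqrtr_gt0 invr_gt0 mulr_gt0 ?mq_gt0. Qed.

Lemma mwidth_sqr : mwidth ^+ 2 = (2 * q)^-1.
Proof. by rewrite sqr_sqrtr// ltW// invr_gt0 mulr_gt0 ?mq_gt0. Qed.

Lemma gker_Km (x y : pt) : nker (gker d mwidth) (x, y) =
  Num.sqrt r ^+ d * (expR (b * tnorm x ^+ 2) * expR (b * tnorm y ^+ 2) * Km al r (x, y)).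
Proof.
have q0 := mq_gt0 al0 r0 r1; have B0 := mB_gt0 al0 r0 r1; have p0 := @pi_gt0 R.
have s0 := mwidth_gt0.
rewrite /Km /nker /gker /= /mk big_split/= prodr_const card_ord -expR_sum.
have -> : (mwidth ^+ d * gtot R d)^-1 = Num.sqrt r ^+ d * Num.sqrt (mB al r / pi) ^+ d.
  rewrite /gtot -!exprMn -exprVn; congr (_ ^+ d).
  have q20 : 0 < (2 * q)^-1 by rewrite invr_gt0 mulr_gt0.
  have p20 : 0 < 2 * pi :> R by rewrite mulr_gt0.
  have E1 : mwidth * Num.sqrt (2 * pi) = Num.sqrt ((2 * q)^-1 * (2 * pi)) by rewrite [RHS]sqrtrM ?(ltW q20).
  have E2 : Num.sqrt r * Num.sqrt (mB al r / pi) = Num.sqrt (r * (mB al r / pi)) by rewrite [RHS]sqrtrM ?(ltW r0).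
  rewrite E1 E2 -sqrtrV; last by rewrite mulr_ge0 ?(ltW q20) ?(ltW p20).
  congr Num.sqrt.
  by rewrite /mq /mB; move: (1 - r ^+ 2) (r2_lt1 r0 r1) pi p0 => U U0 P P0; field; rewrite !gt_eqF.
set S := \sum_(i < d) _.
suff -> : expR (- (tnorm (tsub y x) ^+ 2 / (2 * mwidth ^+ 2))) =
    expR (b * tnorm x ^+ 2) * expR (b * tnorm y ^+ 2) * expR S by ring.
rewrite -!expRD; congr expR; rewrite {}/S.
rewrite mwidth_sqr !tnorm_sqr.
have -> : \sum_(i < d) (- q * (tnth x i - tnth y i) ^+ 2 - b * (tnth x i ^+ 2 + tnth y i ^+ 2)) =
  - q * \sum_(i < d) tnth (tsub y x) i ^+ 2 - b * (\sum_(i < d) tnth x i ^+ 2 + \sum_(i < d) tnth y i ^+ 2).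
  rewrite -big_split/= !mulr_sumr -sumrB; apply: eq_bigr => i _; rewrite tnth_mktuple; ring.
move: (\sum_(i < d) _) (\sum_(i < d) _) (\sum_(i < d) _) => X Y Z; move: q q0 => Q Q0.
by field; rewrite gt_eqF.
Qed.

Variable Rr : R.
Hypothesis Rr0 : 0 < Rr.
Definition tht (x : pt) : R := Num.min (tnorm x / Rr) (pi / 2).

Lemma measurable_tht : measurable_fun [set: pt] tht.
Proof.
apply: measurable_minr => //; apply: measurable_funM => //; exact: measurable_tnorm.
Qed.

Lemma tnorm_lip (x y : pt) : `|tnorm x - tnorm y| <= tnorm (tsub y x).
Proof.
have h1 := tnormD (tsub y x) x; rewrite vadd_tsub in h1.
have h2 := tnormD (tsub x y) y; rewrite vadd_tsub tnorm_tsubC in h2.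
by rewrite ler_norml; apply/andP; split; lra.
Qed.

Lemma tht_lip (x y : pt) : (tht x - tht y) ^+ 2 <= Rr ^- 2 * tnorm (tsub y x) ^+ 2.
Proof.
have -> : Rr ^- 2 * tnorm (tsub y x) ^+ 2 = (tnorm (tsub y x) / Rr) ^+ 2 by rewrite expr_div_n mulrC.
rewrite -[leLHS]real_normK ?num_real// lerXn2r// ?nnegrE//.
  by rewrite divr_ge0 ?tnorm_ge0// ltW.
have minlip (u v p : R) : `|Num.min u p - Num.min v p| <= `|u - v|.
  have h1 := ler_norm (u - v); have h2 := ler_norm (v - u); rewrite distrC in h2.
  rewrite ler_norml /Order.min; case: (ltP u p) => h3; case: (ltP v p) => h4; apply/andP; split; lra.
apply: le_trans (minlip _ _ _) _.
by rewrite -mulrBl normrM (gtr0_norm (_ : 0 < Rr^-1)) ?invr_gt0// ler_pM2r ?invr_gt0// tnorm_lip.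
Qed.

Lemma tht_cos0 x : Rr * (pi / 2) <= tnorm x -> cos (tht x) = 0.
Proof.
move=> h; rewrite /tht (min_idPr _) ?cos_pihalf//.
by rewrite ler_pdivlMr// mulrC.
Qed.

(** The Gaussian kernel is Mehler's kernel between two growing factors, here absorbed into the
    function. Square integrability survives because [cos (tht x)] vanishes beyond the radius
    [Rr * (pi / 2)]. *)
Definition cutg (g : pt -> R) (x : pt) : R := expR (b * tnorm x ^+ 2) * (cos (tht x) * g x).

Lemma measurable_cos_tht : measurable_fun [set: pt] (fun x => cos (tht x)).
Proof.
apply: (measurableT_comp _ measurable_tht); apply: continuous_measurable_fun; exact: continuous_cos.
Qed.

Lemma measurable_sin_tht : measurable_fun [set: pt] (fun x => sin (tht x)).
Proof.
apply: (measurableT_comp _ measurable_tht); apply: continuous_measurable_fun; exact: continuous_sin.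
Qed.

Lemma cutg_sq g : sq g -> sq (cutg g).
Proof.
move=> sg; have [mg _] := sg.
apply: (@sqint_dom _ _ _ mu _ (fun x => expR (b * (Rr * (pi / 2)) ^+ 2) * g x)).
- apply: measurable_funM; last by apply: measurable_funM => //; exact: measurable_cos_tht.
  apply: measurableT_comp => //; apply: measurable_funM => //; apply: measurable_funX; exact: measurable_tnorm.
- move=> x; rewrite /cutg !normrM !(ger0_norm (expR_ge0 _)).
  have [h|h] := leP (Rr * (pi / 2)) (tnorm x).
    by rewrite (tht_cos0 h) normr0 mul0r mulr0 mulr_ge0 ?expR_ge0.
  apply: ler_pM; rewrite ?expR_ge0 ?mulr_ge0//.
    rewrite ler_expR ler_wpM2l ?(ltW (mb_gt0 al0 r0 r1))//.
    have hR : 0 <= Rr * (pi / 2) by exact: le_trans (tnorm_ge0 x) (ltW h).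
    by rewrite lerXn2r ?nnegrE ?tnorm_ge0 ?(ltW h).
  by rewrite ler_piMl// cos_max.
exact: sqintZ.
Qed.

Lemma sym_kernel_form_le k M g : sym_kernel mu k M -> sq g -> ip (kint mu k g) g <= M * ip g g.
Proof.
move=> sk sg; have := dirichlet_identity sk sg => e.
rewrite -subr_ge0 -(@pmulr_rge0 _ 2)// -lee_fin -e.
apply: integral_ge0 => x _; apply: integral_ge0 => y _.
by rewrite lee_fin mulr_ge0 ?sqr_ge0//; exact: sk_ge0 sk _.
Qed.

Lemma mehler_localized g n : sq g ->
  (forall c : 'I_d -> nat, (\sum_i c i <= n)%N -> ip (psi al c) (cutg g) = 0) ->
  ip (kint mu (nker (gker d mwidth)) (fun x => cos (tht x) * g x)) (fun x => cos (tht x) * g x) <=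
  Num.sqrt r ^+ d * r ^+ n.+1 * ip (cutg g) (cutg g).
Proof.
move=> sg g0; have sG := cutg_sq sg; have [mg _] := sg.
have skm := mehler_sq al0 r0 r1 sG.
have e x : kint mu (nker (gker d mwidth)) (fun x => cos (tht x) * g x) x =
    Num.sqrt r ^+ d * (expR (b * tnorm x ^+ 2) * mehler al r (cutg g) x).
  rewrite mulrA /mehler /kint /ipm -RintegralZl//; last first.
    by apply: sqint_mul => //; exact: Km_sq.
  by apply: eq_Rintegral => y _; rewrite gker_Km /cutg; ring.
have -> : ip (kint mu (nker (gker d mwidth)) (fun x => cos (tht x) * g x)) (fun x => cos (tht x) * g x) =
    Num.sqrt r ^+ d * ip (mehler al r (cutg g)) (cutg g).
  rewrite /ipm -RintegralZl//; last exact: sqint_mul.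
  by apply: eq_Rintegral => x _; rewrite e /cutg; ring.
rewrite -mulrA ler_wpM2l ?exprn_ge0 ?sqrtr_ge0//.
exact: mehler_form_le.
Qed.

Variables (C h vt : R).
Hypothesis HC : forall (s : R) g, h <= s -> sq g ->
  ip g g - ip (kint mu (nker (gker d s)) g) g <=
  (d%:R + 2) * (1 + C * (h / s)) / (h / s) ^+ 2 *
  (ip g g - ip (kint mu (nker (bker h)) g) g / bv d h).
Hypotheses (h0 : 0 < h) (hs : h <= mwidth) (vt0 : 0 <= vt).
Hypothesis vt1 : vt * ((d%:R + 2) * (1 + C * (h / mwidth)) / (h / mwidth) ^+ 2) <= 1.

(** Reduces a spectral estimate to a pointwise inequality. After localization the cosine part is
    bounded by the Mehler form, damped by [r ^ n.+1] thanks to orthogonality, and the sine part by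
    its full mass. The factor [vt], at most the inverse of the comparison constant, carries the
    Gaussian deficit over to the ball. *)
Theorem form_gap (w : pt -> R) (lam e0 : R) g n : sq g ->
  mu.-integrable setT (EFin \o (fun x => w x * g x ^+ 2)) ->
  (forall c : 'I_d -> nat, (\sum_i c i <= n)%N -> ip (psi al c) (cutg g) = 0) ->
  (forall x, e0 <= lam * w x - 1 + vt * (cos (tht x) ^+ 2 *
      (1 - Num.sqrt r ^+ d * r ^+ n.+1 * expR (2 * b * tnorm x ^+ 2)) - d%:R * mwidth ^+ 2 / (2 * Rr ^+ 2))) ->
  e0 * ip g g <= lam * (\int[mu]_x (w x * g x ^+ 2)) - ip (kint mu (nker (bker h)) g) g / bv d h.
Proof.
move=> sg wi g0 pw; have [mg g2] := sg.
have s0 := mwidth_gt0.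
have R2 : 0 <= Rr ^- 2 by rewrite invr_ge0 sqr_ge0.
have sk1 := @gker_sym_kernel R d _ s0.
have sk2 := @gker_moment_kernel R d _ s0 (Rr ^- 2) R2.
have ims := ims_localization sk1 sk2 measurable_tht tht_lip sg.
have sc : sq (fun x => cos (tht x) * g x).
  apply: (sqint_dom _ _ sg); first by apply: measurable_funM => //; exact: measurable_cos_tht.
  by move=> x; rewrite normrM ler_piMl// cos_max.
have ss : sq (fun x => sin (tht x) * g x).
  apply: (sqint_dom _ _ sg); first by apply: measurable_funM => //; exact: measurable_sin_tht.
  by move=> x; rewrite normrM ler_piMl// sin_max.
have ml := mehler_localized sg g0.
have sl := sym_kernel_form_le sk1 ss.
have sG := cutg_sq sg.
have cs : ip (fun x => cos (tht x) * g x) (fun x => cos (tht x) * g x) +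
          ip (fun x => sin (tht x) * g x) (fun x => sin (tht x) * g x) = ip g g.
  rewrite /ipm -RintegralD//; [|exact: sqint_mul|exact: sqint_mul].
  by apply: eq_Rintegral => x _; have := cos2Dsin2 (tht x) => /(congr1 (fun u => u * (g x * g x))); rewrite mul1r => <-; ring.
have cmp := HC hs sg.
set A := ip g g in ims ml sl cs cmp *.
set Cc := ip (fun x => cos (tht x) * g x) _ in cs.
set Ss := ip (fun x => sin (tht x) * g x) _ in cs sl.
set Gg := ip (cutg g) _ in ml.
set Kg := ip (kint mu (nker (gker d mwidth)) g) g in ims cmp.
set Sg := ip (kint mu (nker (bker h)) g) g / bv d h in cmp *.
pose Q := Cc - Num.sqrt r ^+ d * r ^+ n.+1 * Gg - d%:R * mwidth ^+ 2 / (2 * Rr ^+ 2) * A.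
have QK : Q <= A - Kg.
  rewrite /Q.
  have -> : d%:R * mwidth ^+ 2 / (2 * Rr ^+ 2) * A = Rr ^- 2 * d%:R * mwidth ^+ 2 / 2 * A.
    by have hR := lt0r_neq0 Rr0; field.
  by move: ims ml sl cs; lin.
have QS : vt * Q <= A - Sg.
  apply: le_trans (ler_wpM2l vt0 (le_trans QK cmp)) _; rewrite (mulrA vt).
  apply: ler_piMl vt1; rewrite subr_ge0 ler_pdivrMr ?bv_gt0// mulrC.
  exact: sym_kernel_form_le (bker_sym_kernel d h0) sg.
have Zi (F : pt -> R) (a : R) : mu.-integrable setT (EFin \o F) -> mu.-integrable setT (EFin \o (fun x => a * F x)).
  by move=> /(integrableZl measurableT a); apply: eq_integrable => // x _.
have Di (F G : pt -> R) : mu.-integrable setT (EFin \o F) -> mu.-integrable setT (EFin \o G) ->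
    mu.-integrable setT (EFin \o (fun x => F x + G x)).
  by move=> i1 i2; have := integrableD measurableT i1 i2; apply: eq_integrable => // x _.
have iA := sqint_mul sg sg; have iC := sqint_mul sc sc; have iG := sqint_mul sG sG.
pose D0 := d%:R * mwidth ^+ 2 / (2 * Rr ^+ 2).
pose N0 := Num.sqrt r ^+ d * r ^+ n.+1.
have main : e0 * A <= lam * (\int[mu]_x (w x * g x ^+ 2)) - A + vt * Q.
  have -> : lam * (\int[mu]_x (w x * g x ^+ 2)) - A + vt * Q =
     lam * (\int[mu]_x (w x * g x ^+ 2)) + (- (1 + vt * D0) * A + (vt * Cc + (- (vt * N0)) * Gg)).
    by rewrite /Q /D0 /N0; ring.
  rewrite /A /Cc /Gg /ipm -!RintegralZl// -!RintegralD//; try by do ?[exact: Zi|apply: (Di)].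
  apply: le_Rintegral => //; first exact: Zi.
    by do ?[exact: Zi|apply: (Di)].
  move=> x _; have := pw x => /(fun h => ler_wpM2r (sqr_ge0 (g x)) h).
  rewrite expr2 => hx; apply: le_trans hx _; rewrite le_eqVlt; apply/orP; left; apply/eqP.
  rewrite /cutg /D0 /N0.
  have -> : expR (2 * b * tnorm x ^+ 2) = expR (b * tnorm x ^+ 2) * expR (b * tnorm x ^+ 2).
    by rewrite -expRD; congr expR; ring.
  ring.
apply: le_trans main _; lin.
Qed.

End LocalizedForm.

(** * The normalized ball average *)

(** [expR u + expR (- u) - 2] is the square of [2 sinh (u / 2)], and [sinh t >= t] for [t >= 0]. *)
Lemma cosh_ge (R : realType) (u : R) : 2 + u ^+ 2 <= expR u + expR (- u).
Proof.
have sinh_ge (t : R) : 0 <= t -> 2 * t <= expR t - expR (- t).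
  rewrite le_eqVlt => /orP[/eqP <-|t0]; first by rewrite oppr0 mulr0 subrr.
  pose f := fun x : R => expR x - expR (- x).
  have df (x : R) : is_derive x (1 : R) f (expR x + expR (- x)).
    have h1 : is_derive x (1 : R) (expR \o horner (- 'X : {poly R})) (- expR (- x)).
      apply: trigger_derive (is_derive1_comp (is_derive_expR (- 'X : {poly R}).[x]) (is_derive_poly (- 'X : {poly R}) x)) _.
      by rewrite derivN derivX !hornerE /=; ring.
    have -> : f = expR \- (expR \o horner (- 'X : {poly R})) by apply/funext => y; rewrite /f /= !hornerE.
    by apply: trigger_derive (is_deriveB (is_derive_expR x) h1) _; ring.
  have [|c _] := @MVT R f (fun x => expR x + expR (- x)) 0 t t0 (fun x _ => df x).
    apply: continuous_subspaceT => x; apply: differentiable_continuous; apply/derivable1_diffP.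
    by have [] := df x.
  rewrite /f oppr0 subrr !subr0 => e.
  have : 0 <= (expR c + expR (- c) - 2) * t.
    by rewrite mulr_ge0 ?(ltW t0)//; have := expR_ge1Dx c; have := expR_ge1Dx (- c); lin.
  by move: e; lin.
have -> : expR u + expR (- u) = 2 + (expR (u / 2) - expR (- (u / 2))) ^+ 2.
  have {1}-> : u = u / 2 + u / 2 by field.
  have {1}-> : - u = - (u / 2) + - (u / 2) by field.
  have e1 : expR (u / 2) * expR (- (u / 2)) = 1 by rewrite -expRD subrr expR0.
  by rewrite !expRD; ring: e1.
rewrite lerD2l; have [h|h] := leP 0 (u / 2).
  have := sinh_ge _ h; rewrite (_ : 2 * (u / 2) = u); last by field.
  move=> h1; rewrite lerXn2r ?nnegrE//; first by lra.
  by apply: le_trans h1; lra.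
have h' : 0 <= - (u / 2) by lra.
have := sinh_ge _ h'; rewrite opprK (_ : 2 * - (u / 2) = - u); last by field.
move=> h1; rewrite -sqrrN -[leRHS]sqrrN opprB lerXn2r ?nnegrE//; first by lra.
by apply: le_trans h1; lra.
Qed.

Section Weight.
Variables (R : realType) (d : nat) (al : R).
Hypothesis al0 : 0 < al.
Notation pt := (d.-tuple R).
Notation mu := (vol R d).
Notation sq := (sqint (vol R d)).
Notation ip := (ipm (vol R d)).
Implicit Types x z : pt.

Definition gam x : R := expR (- al * tnorm x ^+ 2).
Definition ballop (h : R) (g : pt -> R) : pt -> R := kint mu (nker (bker h)) g.
(** The integral over the ball, not the mean: at a fixed point it is [vh / bv d h] that tends to 1
    as [h] tends to 0. *)
Definition vh h x : R := ballop h gam x / gam x.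
Definition dot x z : R := \sum_i tnth x i * tnth z i.

Lemma gam_gt0 x : 0 < gam x. Proof. exact: expR_gt0. Qed.

Lemma psi0E : psi al (fun=> 0%N) = gam.
Proof.
apply/funext => x; rewrite /psi /gam; under eq_bigr do rewrite /hfun /= hornerC mul1r.
by rewrite gauss_prod mulNr.
Qed.

Lemma gam_sq : sq gam. Proof. by rewrite -psi0E; exact: psi_sq. Qed.

Lemma measurable_gam : measurable_fun [set: pt] gam.
Proof. by have [] := gam_sq. Qed.

Lemma measurable_ballop h g : measurable_fun [set: pt] g -> measurable_fun [set: pt] (ballop h g).
Proof. by apply: measurable_kint; apply: measurable_nker; exact: measurable_lt_indic. Qed.

Lemma measurable_vh h : measurable_fun [set: pt] (vh h).
Proof.
have -> : vh h = fun x => ballop h gam x * expR (al * tnorm x ^+ 2).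
  by apply/funext => x; rewrite /vh /gam mulNr expRN invrK.
apply: measurable_funM; first exact: measurable_ballop measurable_gam.
apply: measurableT_comp => //; apply: measurable_funM => //; apply: measurable_funX.
exact: measurable_tnorm.
Qed.

Lemma tnormD_sqr x z : tnorm (vadd z x) ^+ 2 = tnorm z ^+ 2 + 2 * dot x z + tnorm x ^+ 2.
Proof.
rewrite !tnorm_sqr mulr_sumr -!big_split/=; apply: eq_bigr => i _.
by rewrite tnth_mktuple; ring.
Qed.

Lemma measurable_dot x : measurable_fun [set: pt] (dot x).
Proof. by apply: measurable_sum => i; apply: measurable_funM => //; exact: measurable_tnth_fun. Qed.

Lemma dotN x z : dot x (vscale (-1) z) = - dot x z.
Proof. by rewrite /dot -sumrN; apply: eq_bigr => i _; rewrite tnth_mktuple; ring. Qed.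

Lemma dot_le x z : `|dot x z| <= (\sum_i `|tnth x i|) * tnorm z.
Proof.
rewrite mulr_suml; apply: le_trans (ler_norm_sum _ _ _) _; apply: ler_sum => i _.
by rewrite normrM ler_wpM2l// abs_tnth_le.
Qed.

Section Ball.
Variable h : R.
Hypothesis h0 : 0 < h.
Notation B := (fun z : pt => bker h (tnorm z)).

Lemma ball_indic_ge0 z : 0 <= B z. Proof. by rewrite /bker ler0n. Qed.

Lemma measurable_B : measurable_fun [set: pt] B.
Proof.
have mb : measurable_fun [set: R] (bker h) by exact: measurable_lt_indic.
exact: (@measurable_knorm R d _ mb).
Qed.

Lemma ball_indic_int : (\int[mu]_z (B z)%:E = (bv d h)%:E)%E.
Proof. by rewrite -bvolE//; apply: eq_integral => z _; rewrite mule1. Qed.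

Lemma ball_integrable (F : pt -> R) (K : R) : measurable_fun [set: pt] F ->
  (forall z, tnorm z < h -> `|F z| <= K) ->
  mu.-integrable setT (EFin \o (fun z => B z * F z)).
Proof.
move=> mF FK.
have Bi : mu.-integrable setT (EFin \o B).
  apply/integrableP; split; first by apply/measurable_EFinP; exact: measurable_B.
  under eq_integral do rewrite /= ger0_norm ?ball_indic_ge0//.
  by rewrite ball_indic_int ltry.
apply: (@integrable_le_real _ _ _ mu _ (fun z => K * B z)).
- by apply: measurable_funM => //; exact: measurable_B.
- move=> z; rewrite normrM (ger0_norm (ball_indic_ge0 z)) /bker.
  by case: ltP => hz; rewrite ?mul1r ?mulr1 ?mul0r ?mulr0 ?FK.
- by have := integrableZl measurableT K Bi; apply: eq_integrable => // z _.
Qed.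

Lemma ball_coord_integrable i j : mu.-integrable setT (EFin \o (fun z => B z * (tnth z i * tnth z j))).
Proof.
apply: (@ball_integrable _ (h ^+ 2)).
  by apply: measurable_funM; exact: measurable_tnth_fun.
move=> z zh; rewrite normrM expr2.
by apply: ler_pM; rewrite ?normr_ge0// (le_trans (abs_tnth_le _ _))// ltW.
Qed.

(** Off-diagonal moments change sign under the flip of one coordinate, which preserves the ball. *)
Lemma ball_cross i j : \int[mu]_z (B z * (tnth z i * tnth z j)) =
  (i == j)%:R * (bv d h * h ^+ 2 / (d%:R + 2)).
Proof.
have [<-|ij] := eqVneq i j.
  rewrite mul1r /Rintegral.
  have := @ball_moment R d i h h0; rewrite /bint => e.
  rewrite (_ : (\int[mu]_z _)%E = (h ^+ d.+2 * (bvol1 R d / d.+2%:R))%:E)%E; last first.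
    by rewrite -e; apply: eq_integral => z _; rewrite -expr2 EFinM.
  rewrite /= /bv !exprS expr0; have -> : d.+2%:R = d%:R + 2 :> R by rewrite -!natr1; ring.
  by ring.
rewrite mul0r; apply/eqP; rewrite -[_ == 0](mulrn_eq0 _ 2) mulr2n; apply/eqP.
have m : measurable_fun [set: pt] (fun z : pt => (B z * (tnth z i * tnth z j))%:E).
  by have /integrableP[] := ball_coord_integrable i j.
rewrite {1}/Rintegral -(int_vflip i m) -/(Rintegral _ _ _).
rewrite [X in X + _ = _](_ : _ = - \int[mu]_x (B x * (tnth x i * tnth x j))) ?addNr//.
rewrite -mulN1r -RintegralZl//; last exact: ball_coord_integrable.
by apply: eq_Rintegral => z _; rewrite tnorm_vflip !tnth_mktuple eqxx eq_sym (negPf ij); ring.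
Qed.

Lemma ball_dot_sq x : mu.-integrable setT (EFin \o (fun z => B z * dot x z ^+ 2)) /\
  \int[mu]_z (B z * dot x z ^+ 2) = tnorm x ^+ 2 * (bv d h * h ^+ 2 / (d%:R + 2)).
Proof.
have E z : B z * dot x z ^+ 2 = \sum_(p : 'I_d * 'I_d)
    tnth x p.1 * tnth x p.2 * (B z * (tnth z p.1 * tnth z p.2)).
  rewrite expr2 /dot big_distrlr/= pair_big/= mulr_sumr; apply: eq_bigr => -[i j] _ /=; ring.
have [|h1 h2] := @Rintegral_sum _ _ _ mu _ (index_enum _)
   (fun p z => tnth x p.1 * tnth x p.2 * (B z * (tnth z p.1 * tnth z p.2)) : R).
  move=> p; have := integrableZl measurableT (tnth x p.1 * tnth x p.2) (ball_coord_integrable p.1 p.2).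
  by apply: eq_integrable => // z _.
split; first by apply: eq_integrable h1 => // z _ /=; rewrite E.
under eq_Rintegral do rewrite E.
rewrite h2 (eq_bigr (fun p : 'I_d * 'I_d => tnth x p.1 * tnth x p.2 *
    ((p.1 == p.2)%:R * (bv d h * h ^+ 2 / (d%:R + 2))))); last first.
  by move=> p _; rewrite RintegralZl ?ball_cross//; exact: ball_coord_integrable.
rewrite -(pair_big xpredT xpredT (fun i j => tnth x i * tnth x j * ((i == j)%:R * (bv d h * h ^+ 2 / (d%:R + 2)))))/=.
rewrite tnorm_sqr mulr_suml; apply: eq_bigr => i _.
rewrite (bigD1 i)//= eqxx mul1r big1 ?addr0; first by ring.
by move=> j ji; rewrite eq_sym (negPf ji) mul0r mulr0.
Qed.

Definition vint x z : R := expR (- al * tnorm z ^+ 2) * expR (- (2 * al * dot x z)).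

Lemma measurable_vint x : measurable_fun [set: pt] (vint x).
Proof.
apply: measurable_funM; apply: measurableT_comp => //.
  by apply: measurable_funM => //; apply: measurable_funX; exact: measurable_tnorm.
by apply: measurableT_comp => //; apply: measurable_funM => //; exact: measurable_dot.
Qed.

Lemma vint_le x z : tnorm z < h -> vint x z <= \prod_i expR (2 * al * h * `|tnth x i|).
Proof.
move=> zh; rewrite -expR_sum -[leRHS]mul1r; apply: ler_pM; rewrite ?expR_ge0//.
  by rewrite -expR0 ler_expR mulNr oppr_le0 mulr_ge0 ?(ltW al0)// sqr_ge0.
rewrite ler_expR -mulr_sumr -(mulrA _ h) -mulrN.
apply: ler_wpM2l; first by rewrite mulr_ge0// ltW.
apply: le_trans (ler_norm _) _; rewrite normrN; apply: le_trans (dot_le _ _) _.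
rewrite mulrC; apply: ler_wpM2r; last exact: ltW.
by apply: sumr_ge0.
Qed.

Lemma vint_integrable x : mu.-integrable setT (EFin \o (fun z => B z * vint x z)).
Proof.
apply: (@ball_integrable _ (\prod_i expR (2 * al * h * `|tnth x i|))); first exact: measurable_vint.
by move=> z /vint_le h1; rewrite ger0_norm// /vint mulr_ge0 ?expR_ge0.
Qed.

Lemma vhE x : vh h x = \int[mu]_z (B z * vint x z).
Proof.
have mF : measurable_fun [set: pt] (fun y : pt => (bker h (tnorm (tsub y x)) * gam y)%:E).
  apply/measurable_EFinP; apply: measurable_funM; last exact: measurable_gam.
  have mb : measurable_fun [set: R] (bker h) by exact: measurable_lt_indic.
  exact: (measurableT_comp (@measurable_nker R d _ mb) (measurable_pair1 x)).
have E : ballop h gam x = gam x * \int[mu]_z (B z * vint x z).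
  rewrite /ballop /kint /ipm /nker /= {1}/Rintegral -(int_vadd x mF).
  rewrite -RintegralZl ?vint_integrable//.
  rewrite /Rintegral; congr fine; apply: eq_integral => z _; congr EFin.
  rewrite tsub_vadd /gam tnormD_sqr /vint mulrCA -!expRD; congr (_ * expR _); ring.
by rewrite /vh E mulrC mulKf// gt_eqF// gam_gt0.
Qed.

Lemma vh_le x : vh h x <= bv d h * \prod_i expR (2 * al * h * `|tnth x i|).
Proof.
rewrite vhE.
have Bi : mu.-integrable setT (EFin \o (fun z => B z * 1)).
  by apply: (@ball_integrable _ 1) => // z _; rewrite normr1.
have -> : bv d h = \int[mu]_z (B z * 1).
  by rewrite /Rintegral; under eq_integral do rewrite mulr1; rewrite ball_indic_int.
rewrite -RintegralZr//; apply: le_Rintegral => //; first exact: vint_integrable.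
  by have := integrableZr measurableT (\prod_i expR (2 * al * h * `|tnth x i|)) Bi; apply: eq_integrable => // z _.
move=> z _; rewrite mulr1 /bker; case: ltP => zh; last by rewrite !mul0r.
by rewrite !mul1r vint_le.
Qed.

Lemma vh_sym2 x : 2 * vh h x = \int[mu]_z (B z * (vint x z + vint x (vscale (-1) z))).
Proof.
have mF : measurable_fun [set: pt] (fun z : pt => (B z * vint x z)%:E).
  by have /integrableP[] := vint_integrable x.
have F0 z : (0 <= (B z * vint x z)%:E)%E.
  by rewrite lee_fin mulr_ge0 ?ball_indic_ge0// /vint mulr_ge0 ?expR_ge0.
have n1 : (-1 : R) != 0 by rewrite oppr_eq0 oner_eq0.
have e : (\int[mu]_z (B z * vint x (vscale (-1) z))%:E = \int[mu]_z (B z * vint x z)%:E)%E.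
  have := ge0_int_vscale n1 mF F0; rewrite normrN1 expr1n invr1 mul1e => <-.
  by apply: eq_integral => z _; rewrite tnorm_vscale normrN1 mul1r.
have i2 : mu.-integrable setT (EFin \o (fun z => B z * vint x (vscale (-1) z))).
  apply: (@ball_integrable _ (\prod_i expR (2 * al * h * `|tnth x i|))).
    exact: (measurableT_comp (measurable_vint x) (@measurable_vscale R d (-1))).
  move=> z zh; have zh' : tnorm (vscale (-1) z) < h by rewrite tnorm_vscale normrN1 mul1r.
  by rewrite ger0_norm ?vint_le// /vint mulr_ge0 ?expR_ge0.
have i1 := vint_integrable x.
under eq_Rintegral do rewrite mulrDr.
rewrite RintegralD// vhE [X in _ + X](_ : _ = \int[mu]_z (B z * vint x z)); first by ring.
by rewrite /Rintegral e.
Qed.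

(** Averaging [z] with [-z] turns the exponential of the scalar product into a hyperbolic cosine,
    which exceeds its second-order expansion for every [x]. The ball moments then bring out the
    potential [4 al^2 |x|^2 - 2 d al] of [L_rho], its quadratic part reduced by the factor
    [1 - al h^2]. *)
Lemma vh_ge x : al * h ^+ 2 <= 1 ->
  bv d h * (1 + (2 * (d%:R + 2))^-1 * h ^+ 2 *
     (4 * al ^+ 2 * (1 - al * h ^+ 2) * tnorm x ^+ 2 - 2 * d%:R * al)) <= vh h x.
Proof.
move=> ah; rewrite -(ler_pM2l (_ : 0 < 2))// vh_sym2.
have [id0 d2] := ball_dot_sq x.
pose c1 := 4 * al ^+ 2 * (1 - al * h ^+ 2).
have iB : mu.-integrable setT (EFin \o (fun z => B z * 2)).
  by apply: (@ball_integrable _ 2) => // z _; rewrite ger0_norm.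
have iN : mu.-integrable setT (EFin \o (fun z => \sum_i B z * (tnth z i * tnth z i))) /\
   \int[mu]_z (\sum_i B z * (tnth z i * tnth z i)) = d%:R * (bv d h * h ^+ 2 / (d%:R + 2)).
  have [|i1 i2] := @Rintegral_sum _ _ _ mu _ (index_enum 'I_d) (fun i z => B z * (tnth z i * tnth z i) : R).
    by move=> i; exact: ball_coord_integrable.
  split => //; rewrite i2; under eq_bigr do rewrite ball_cross eqxx mul1r.
  by rewrite sumr_const card_ord mulr_natl.
have [iN1 iN2] := iN.
have Zi (F : pt -> R) (a : R) : mu.-integrable setT (EFin \o F) -> mu.-integrable setT (EFin \o (fun x => a * F x)).
  by move=> /(integrableZl measurableT a); apply: eq_integrable => // z _.
have Di (F G : pt -> R) : mu.-integrable setT (EFin \o F) -> mu.-integrable setT (EFin \o G) ->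
    mu.-integrable setT (EFin \o (fun x => F x + G x)).
  by move=> i1 i2; have := integrableD measurableT i1 i2; apply: eq_integrable => // z _.
have j1 := Zi _ c1 id0; have j2 := Zi _ (- (2 * al)) iN1.
have j12 := Di _ _ j1 j2.
have -> : 2 * (bv d h * (1 + (2 * (d%:R + 2))^-1 * h ^+ 2 *
     (4 * al ^+ 2 * (1 - al * h ^+ 2) * tnorm x ^+ 2 - 2 * d%:R * al))) =
  \int[mu]_z (B z * 2 + (c1 * (B z * dot x z ^+ 2) + - (2 * al) * (\sum_i B z * (tnth z i * tnth z i)))).
  rewrite RintegralD// RintegralD// !RintegralZl// d2 iN2.
  have -> : \int[mu]_z (B z * 2) = 2 * bv d h.
    under eq_Rintegral do rewrite mulrC.
    rewrite RintegralZl//; last first.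
      have : mu.-integrable setT (EFin \o (fun z => B z * 1)).
        by apply: (@ball_integrable _ 1) => // z _; rewrite normr1.
      by apply: eq_integrable => // z _ /=; rewrite mulr1.
    by rewrite /Rintegral ball_indic_int.
  have h2 : d%:R + 2 != 0 :> R by rewrite gt_eqF// ltr_wpDl.
  by rewrite /c1; field.
apply: le_Rintegral => //; first exact: Di.
  have mF : measurable_fun [set: pt] (fun z : pt => vint x z + vint x (vscale (-1) z)).
    apply: measurable_funD; first exact: measurable_vint.
    exact: (measurableT_comp (measurable_vint x) (@measurable_vscale R d (-1))).
  apply: (@ball_integrable _ (2 * \prod_i expR (2 * al * h * `|tnth x i|))) => // z zh.
  have zh' : tnorm (vscale (-1) z) < h by rewrite tnorm_vscale normrN1 mul1r.
  have := vint_le x zh; have := vint_le x zh'.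
  rewrite ger0_norm; first by lin.
  by rewrite /vint addr_ge0// mulr_ge0 ?expR_ge0.
move=> z _; rewrite -mulr_sumr.
have -> : \sum_i tnth z i * tnth z i = tnorm z ^+ 2 by rewrite tnorm_sqr.
have -> : B z * 2 + (c1 * (B z * dot x z ^+ 2) + - (2 * al) * (B z * tnorm z ^+ 2)) =
   B z * (2 + c1 * dot x z ^+ 2 - 2 * al * tnorm z ^+ 2) by ring.
rewrite /bker; case: ltP => zh; last by rewrite !mul0r.
rewrite !mul1r /vint tnorm_vscale normrN1 mul1r dotN mulrN opprK -mulrDr.
have z2 : tnorm z ^+ 2 <= h ^+ 2 by rewrite lerXn2r ?nnegrE ?tnorm_ge0// ltW.
have e1 := expR_ge1Dx (- al * tnorm z ^+ 2).
have e2 := cosh_ge (2 * al * dot x z).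
have a0 := al0.
have p1 : 0 <= 1 + - al * tnorm z ^+ 2.
  have := ler_wpM2l (ltW a0) z2; lin.
have D0 := sqr_ge0 (dot x z).
have p2 : 0 <= 2 + (2 * al * dot x z) ^+ 2 by rewrite addr_ge0// sqr_ge0.
rewrite [X in _ <= _ * X]addrC; apply: le_trans (ler_pM p1 p2 e1 e2).
have hz : al * tnorm z ^+ 2 <= al * h ^+ 2 by apply: ler_wpM2l; rewrite ?(ltW a0).
have a2D : 0 <= 4 * al ^+ 2 * dot x z ^+ 2 by rewrite mulr_ge0// mulr_ge0// sqr_ge0.
have := ler_wpM2r a2D hz; rewrite /c1; move: (tnorm z ^+ 2) (dot x z) => N D; lra.
Qed.

End Ball.

Lemma vh_mono h h' x : 0 < h -> h <= h' -> vh h x <= vh h' x.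
Proof.
move=> h0 hh; have h'0 := lt_le_trans h0 hh; rewrite !vhE//; apply: le_Rintegral => //.
- exact: vint_integrable.
- exact: vint_integrable.
move=> z _; apply: ler_wpM2r; first by rewrite /vint mulr_ge0 ?expR_ge0.
rewrite /bker ler_nat; case: (ltP (tnorm z) h) => // zh.
by rewrite (lt_le_trans zh hh).
Qed.

(** [vh_ge] only covers small radii; since [vh] increases with the radius, it is enough to use it at
    some [h1 <= h] with [al * h1 ^ 2 <= 1/4]. *)
Lemma vh_coercive h : 0 < h -> exists2 c, 0 < c & forall x, c * (1 + tnorm x ^+ 2) <= vh h x.
Proof.
move=> h0.
have d2 : 0 < d%:R + 2 :> R by rewrite ltr_wpDl.
pose h1 := Num.min h (Num.sqrt (4 * (1 + al))^-1).
have a0 := al0.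
have h10 : 0 < h1 by rewrite lt_min h0 sqrtr_gt0 invr_gt0; lra.
have hh2 : h1 ^+ 2 <= (4 * (1 + al))^-1.
  rewrite -[leRHS]sqr_sqrtr; last by rewrite invr_ge0; lra.
  by rewrite lerXn2r ?nnegrE ?sqrtr_ge0 ?(ltW h10)// ge_min lexx orbT.
have ah : al * h1 ^+ 2 <= 1 / 4.
  apply: le_trans (ler_wpM2l (ltW a0) hh2) _; rewrite ler_pdivrMr; last by lra.
  lra.
(* With [al * h1 ^ 2 <= 1/4], the factor [4 (1 - al h1^2)] is at least 3 and the negative term of
   [vh_ge] costs at most 1/4. *)
pose c := bv d h1 * Num.min (3 / 4) ((2 * (d%:R + 2))^-1 * h1 ^+ 2 * (3 * al ^+ 2)).
have h1s : 0 < h1 ^+ 2 by rewrite exprn_gt0.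
have a2 : 0 < al ^+ 2 by rewrite exprn_gt0.
exists c.
  rewrite mulr_gt0 ?bv_gt0// lt_min; apply/andP; split; first by lra.
  by rewrite mulr_gt0 ?mulr_gt0 ?invr_gt0.
move=> x; apply: le_trans (vh_mono x h10 (_ : h1 <= h)); last by rewrite ge_min lexx.
apply: le_trans (vh_ge h10 x _); last by lra.
rewrite /c -(mulrA (bv d h1)); apply: ler_wpM2l; first exact: (ltW (bv_gt0 d h10)).
have N0 := sqr_ge0 (tnorm x).
rewrite mulrDr mulr1.
have m1 : Num.min (3 / 4) ((2 * (d%:R + 2))^-1 * h1 ^+ 2 * (3 * al ^+ 2)) <= 3 / 4 by rewrite ge_min lexx.
have m2 : Num.min (3 / 4) ((2 * (d%:R + 2))^-1 * h1 ^+ 2 * (3 * al ^+ 2)) <=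
   (2 * (d%:R + 2))^-1 * h1 ^+ 2 * (3 * al ^+ 2) by rewrite ge_min lexx orbT.
apply: le_trans (lerD m1 (ler_wpM2r N0 m2)) _.
have k0 : 0 <= (2 * (d%:R + 2))^-1 * h1 ^+ 2.
  by apply: mulr_ge0; [rewrite invr_ge0; apply: mulr_ge0 => //; exact: ltW|exact: ltW].
have p1 : (2 * (d%:R + 2))^-1 * h1 ^+ 2 * (2 * d%:R * al) <= 1 / 4.
  have -> : (2 * (d%:R + 2))^-1 * h1 ^+ 2 * (2 * d%:R * al) = d%:R / (d%:R + 2) * (al * h1 ^+ 2).
    by field; rewrite gt_eqF.
  rewrite -[leRHS]mul1r; apply: ler_pM; rewrite ?divr_ge0 ?ler0n ?(ltW d2)//.
  - by rewrite mulr_ge0 ?(ltW a0) ?(ltW h1s).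
  - by rewrite ler_pdivrMr// mul1r; lra.
have p2 : (2 * (d%:R + 2))^-1 * h1 ^+ 2 * (3 * al ^+ 2) * tnorm x ^+ 2 <=
   (2 * (d%:R + 2))^-1 * h1 ^+ 2 * (4 * al ^+ 2 * (1 - al * h1 ^+ 2) * tnorm x ^+ 2).
  rewrite -mulrA ler_wpM2l// ler_wpM2r//.
  have := ler_wpM2l (ltW a2) ah; lra.
move: p1 p2; rewrite mulrBr; lra.
Qed.

End Weight.

(** * Compactness *)

Lemma normB_lt_quarters (R : realType) (p q u v l e : R) : `|p - u| <= e / 4 -> `|q - v| <= e / 4 ->
  `|l - u| < e / 4 -> `|l - v| < e / 4 -> `|p - q| < e.
Proof.
rewrite !ler_norml !ltr_norml => /andP[? ?] /andP[? ?] /andP[? ?] /andP[? ?].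
by apply/andP; split; lra.
Qed.

Section Diagonal.
Variable R : realType.

Lemma increasing_ge (f : nat -> nat) : (forall n, (f n < f n.+1)%N) -> forall n, (n <= f n)%N.
Proof. by move=> fi; elim=> // n IH; exact: leq_ltn_trans IH (fi n). Qed.

Lemma increasing_lt (f : nat -> nat) : (forall n, (f n < f n.+1)%N) -> {homo f : m n / (m < n)%N}.
Proof. by move=> fi; apply: homo_ltn => //; exact: ltn_trans. Qed.

Lemma bounded_subseq (u : nat -> R) (K : R) : (forall n, `|u n| <= K) ->
  exists f : nat -> nat, (forall n, (f n < f n.+1)%N) /\ exists l : R, u \o f @ \oo --> l.
Proof.
move=> uK; have bu : bounded_fun u.
  exists K; split; first exact: num_real.
  by move=> M KM n _ /=; exact: le_trans (uK n) (ltW KM).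
have [f fi fc] := bolzano_weierstrass bu; exists f; split.
  move=> n; rewrite ltnNge; apply/negP => hh.
  have := fi n.+1 n; rewrite -[(f n.+1 <= f n)%O]/(f n.+1 <= f n)%N hh => /esym.
  by rewrite ltnn.
by exists (lim (u \o f @ \oo)).
Qed.

Lemma diagonal_subseq (b : nat -> nat -> R) (K : R) : (forall n j, `|b n j| <= K) ->
  exists phi : nat -> nat, (forall n, (phi n < phi n.+1)%N) /\
    forall j, exists l : R, (fun n => b (phi n) j) @ \oo --> l.
Proof.
move=> bK.
pose good (u : nat -> R) (f : nat -> nat) := (forall n, (f n < f n.+1)%N) /\ exists l : R, u \o f @ \oo --> l.
have /choice[F FP] : forall u : nat -> R, exists f, (forall n, `|u n| <= K) -> good u f.
  move=> u; have [h|h] := pselect (forall n, `|u n| <= K); last by exists id.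
  by have [f hf] := bounded_subseq h; exists f.
(* Nested extraction: column [j] converges along [psi j], and from rank [j] on the diagonal value
   [psi n n] equals [psi j] at an index at least [n]. *)
pose psi := fix psi (j : nat) : nat -> nat :=
  if j is j'.+1 then psi j' \o F (fun n => b (psi j' n) j) else F (fun n => b n 0%N).
have Fi u : (forall n, `|u n| <= K) -> forall n, (F u n < F u n.+1)%N by move=> h; have [] := FP u h.
have pi_ j n : (psi j n < psi j n.+1)%N.
  elim: j n => [|j IH] n /=; first by apply: Fi.
  by apply: (increasing_lt IH); apply: Fi.
have th j k : exists t : nat -> nat, (forall n, (t n < t n.+1)%N) /\ psi (j + k)%N = psi j \o t.
  elim: k => [|k [t [ti tE]]]; first by exists id; rewrite addn0.
  rewrite addnS; exists (t \o F (fun n => b (psi (j + k)%N n) (j + k).+1)); split.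
    by move=> n; apply: (increasing_lt ti); apply: Fi.
  by rewrite /= tE.
exists (fun n => psi n n); split.
  move=> n /=; apply: (@leq_trans (psi n n.+1)); first exact: pi_.
  have hF := increasing_ge (Fi (fun m => b (psi n m) n.+1) (fun m => bK _ _)) n.+1.
  by move: hF; rewrite leq_eqVlt => /orP[/eqP <-//|/(increasing_lt (pi_ n))/ltnW].
move=> j.
have [l hl] : exists l : R, (fun n => b (psi j n) j) @ \oo --> l.
  case: j => [|j]; first by have [_] := FP (fun n => b n 0%N) (fun n => bK _ _).
  by have [_] := FP (fun n => b (psi j n) j.+1) (fun n => bK _ _).
exists l; apply/cvgrPdist_lt => e e0; have /cvgrPdist_lt/(_ _ e0)[N _ NP] := hl.
exists (maxn N j) => // n /=; rewrite geq_max => /andP[Nn jn].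
have [t [ti tE]] := th j (n - j)%N; rewrite subnKC// in tE.
rewrite tE; apply: NP => /=; exact: leq_trans Nn (increasing_ge ti n).
Qed.

Lemma dense_rat_points d : exists D : nat -> d.-tuple R, forall x (e : R), 0 < e ->
  exists j, tnorm (tsub (D j) x) < e.
Proof.
pose D (j : nat) : d.-tuple R :=
  if @unpickle (d.-tuple rat) j is Some q then [tuple ratr (tnth q i) | i < d] else [tuple 0 | i < d].
exists D => x e e0.
have e1 : 0 < e / (d%:R + 1) by rewrite divr_gt0// ltr_wpDl.
have /choice[q qP] : forall i : 'I_d, exists q : rat, `|ratr q - tnth x i| < e / (d%:R + 1).
  move=> i; have : tnth x i < tnth x i + e / (d%:R + 1) by rewrite ltrDl.
  move=> /rat_in_itvoo[q]; rewrite in_itv/= => /andP[q1 q2]; exists q.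
  rewrite gtr0_norm ?subr_gt0//; lra.
exists (pickle [tuple q i | i < d]); rewrite /D pickleK.
have nle (z : d.-tuple R) : tnorm z <= \sum_i `|tnth z i|.
  rewrite -[leRHS]ger0_norm ?sumr_ge0// -sqrtr_sqr; apply: ler_wsqrtr.
  rewrite expr2 mulr_suml; apply: ler_sum => i _.
  rewrite -real_normK ?num_real// expr2 ler_wpM2l// (bigD1 i)//= lerDl sumr_ge0//.
apply: le_lt_trans (nle _) _.
apply: (@le_lt_trans _ _ (\sum_(i < d) e / (d%:R + 1))).
  by apply: ler_sum => i _; rewrite !tnth_mktuple ltW.
rewrite sumr_const card_ord -[X in X < _]mulr_natr -mulrA gtr_pMr// mulrC ltr_pdivrMr; last by rewrite ltr_wpDl.
by rewrite mul1r ltrDl.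
Qed.

End Diagonal.

Section WeightedBallOperator.
Variables (R : realType) (d : nat) (h : R).
Hypothesis h0 : 0 < h.
Notation pt := (d.-tuple R).
Notation mu := (vol R d).
Notation sq := (sqint (vol R d)).
Notation ip := (ipm (vol R d)).
Implicit Types (x : pt) (g : pt -> R).

Let sk := bker_sym_kernel d h0.

Lemma bker_sqr (t s : R) : bker t s ^+ 2 = bker t s.
Proof. by rewrite /bker; case: ltP; rewrite ?expr1n ?expr0n. Qed.

Lemma ballop_bound g x (M : R) : 0 <= M -> sq g -> ip g g <= M -> ballop h g x ^+ 2 <= bv d h * M.
Proof.
move=> M0 sg gM.
have := ipm_CS (sk_sq sk x) sg.
have -> : ip (fun y => nker (bker h) (x, y)) (fun y => nker (bker h) (x, y)) = bv d h.
  by rewrite -(sk_massR sk x); apply: eq_Rintegral => y _; rewrite -expr2 bker_sqr.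
move=> H; apply: le_trans H _; apply: ler_wpM2l => //; exact/ltW/bv_gt0.
Qed.

(** The balls of radius [h] about [x] and [x'] differ only inside the two shells of radii between
    [h - de] and [h]. Volume alone thus gives equicontinuity over bounded sets of [L^2]. *)
Lemma ballop_cont g x x' (M de : R) : 0 <= M -> sq g -> ip g g <= M -> 0 < de -> de < h ->
  tnorm (tsub x' x) <= de -> (ballop h g x - ballop h g x') ^+ 2 <= 2 * (bv d h - bv d (h - de)) * M.
Proof.
move=> M0 sg gM de0 deh xx.
have hd0 : 0 < h - de by lra.
have sk' := bker_sym_kernel d hd0.
have sx := sk_sq sk x; have sx' := sk_sq sk x'.
have sd := sqintB sx sx'.
have -> : ballop h g x - ballop h g x' = ip (fun y => nker (bker h) (x, y) - nker (bker h) (x', y)) g.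
  by rewrite ipmB.
apply: le_trans (ipm_CS sd sg) _; apply: ler_pM => //; rewrite ?ipm_ge0//.
have ki := sk_int sk; have ki' := sk_int sk'.
have Bi z : mu.-integrable setT (EFin \o (fun y => nker (bker h) (z, y) - nker (bker (h - de)) (z, y))).
  by have := integrableB measurableT (ki z) (ki' z); apply: eq_integrable => // y _.
have -> : 2 * (bv d h - bv d (h - de)) = \int[mu]_y ((nker (bker h) (x, y) - nker (bker (h - de)) (x, y)) +
    (nker (bker h) (x', y) - nker (bker (h - de)) (x', y))).
  by rewrite RintegralD// !RintegralB// !(sk_massR sk) !(sk_massR sk'); ring.
apply: le_Rintegral => //; first exact: sqint_mul.
  by have := integrableD measurableT (Bi x) (Bi x'); apply: eq_integrable => // y _.
move=> y _; rewrite /nker /bker /=.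
have t1 := tnormD (tsub y x) (tsub x x'); have t2 := tnormD (tsub y x') (tsub x' x).
have e1 : vadd (tsub y x) (tsub x x') = tsub y x'.
  by apply: eq_from_tnth => i; rewrite !tnth_mktuple; ring.
have e2 : vadd (tsub y x') (tsub x' x) = tsub y x.
  by apply: eq_from_tnth => i; rewrite !tnth_mktuple; ring.
rewrite e1 (tnorm_tsubC x x') in t1; rewrite e2 in t2.
case: (ltP (tnorm (tsub y x)) h) => a1; case: (ltP (tnorm (tsub y x')) h) => a2;
 case: (ltP (tnorm (tsub y x)) (h - de)) => a3; case: (ltP (tnorm (tsub y x')) (h - de)) => a4 /=; lra.
Qed.

Variables (a : pt -> R) (A : R).
Hypotheses (ma : measurable_fun [set: pt] a) (a0 : forall x, 0 <= a x) (aA : forall x, a x <= A).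
Hypothesis adecay : forall e : R, 0 < e -> exists2 rho : R, 0 < rho & forall x, rho <= tnorm x -> a x <= e.

Definition wop g x := a x * ballop h (fun y => a y * g y) x.

Lemma A_ge0 : 0 <= A. Proof. exact: le_trans (a0 [tuple 0 | i < d]) (aA _). Qed.

Lemma amul_sq g : sq g -> sq (fun y => a y * g y) /\ ip (fun y => a y * g y) (fun y => a y * g y) <= A ^+ 2 * ip g g.
Proof.
move=> sg; have [mg g2] := sg.
have s : sq (fun y => a y * g y).
  apply: (@sqint_dom _ _ _ mu _ (fun x => A * g x)); last exact: sqintZ.
    exact: measurable_funM.
  by move=> x; rewrite !normrM (ger0_norm (a0 x)) (ger0_norm A_ge0); apply: ler_wpM2r.
split => //.
have -> : A ^+ 2 * ip g g = \int[mu]_x (A ^+ 2 * (g x * g x)).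
  by rewrite RintegralZl//; exact: (sqint_mul sg sg).
apply: le_Rintegral => //; first exact: (sqint_mul s s).
  by have := integrableZl measurableT (A ^+ 2) (sqint_mul sg sg); apply: eq_integrable => // y _.
move=> x _; rewrite (_ : a x * g x * (a x * g x) = a x ^+ 2 * (g x * g x)); last by ring.
by apply: ler_wpM2r; [rewrite -expr2 sqr_ge0|rewrite lerXn2r ?nnegrE ?A_ge0].
Qed.

Lemma wop_sq g : sq g -> sq (wop g) /\ ip (wop g) (wop g) <= (A ^+ 2 * bv d h) ^+ 2 * ip g g.
Proof.
move=> sg; have [s1 b1] := amul_sq sg; have [s2 b2] := kint_sk_sq sk s1; have [s3 b3] := amul_sq s2.
split => //; apply: le_trans b3 _.
rewrite (_ : (A ^+ 2 * bv d h) ^+ 2 * ip g g = A ^+ 2 * (bv d h ^+ 2 * (A ^+ 2 * ip g g))); last by ring.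
apply: (ler_wpM2l (sqr_ge0 _)); apply: le_trans b2 _.
by apply: (ler_wpM2l (sqr_ge0 _)).
Qed.

Lemma wop_sym g g' : sq g -> sq g' -> ip (wop g) g' = ip g (wop g').
Proof.
move=> sg sg'; have [s1 _] := amul_sq sg; have [s1' _] := amul_sq sg'.
have := kint_sym sk s1 s1'; rewrite /ipm => e.
transitivity (\int[mu]_x (ballop h (fun y => a y * g y) x * (a x * g' x))).
  by apply: eq_Rintegral => x _; rewrite /wop; ring.
by rewrite e; apply: eq_Rintegral => x _; rewrite /wop /ballop; ring.
Qed.

Lemma wopP c f g x : sq f -> sq g -> wop (fun y => c * f y + g y) x = c * wop f x + wop g x.
Proof.
move=> sf sg; have [s1 _] := amul_sq sf; have [s2 _] := amul_sq sg.
rewrite /wop /ballop /kint ipmC.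
rewrite (_ : (fun y => a y * (c * f y + g y)) = fun y => c * (a y * f y) + a y * g y); last first.
  by apply/funext => y; ring.
rewrite (ipmP c s1 s2 (sk_sq sk x)).
by rewrite (ipmC _ (fun y => a y * f y)) (ipmC _ (fun y => a y * g y)); ring.
Qed.

(** Arzela-Ascoli by hand: the ball integrals are bounded and equicontinuous, so a diagonal
    subsequence converging at rational points converges everywhere. Inside a large ball dominated
    convergence applies; outside, [a] is small. Fatou makes the pointwise limit [L] square
    integrable, and [a L] is the limit. *)
Theorem wop_compact (u : nat -> pt -> R) (M : R) : (forall n, sq (u n)) -> (forall n, ip (u n) (u n) <= M) ->
  exists (phi : nat -> nat) (v : pt -> R), sq v /\ (forall n, (phi n < phi n.+1)%N) /\
    (fun n => ip (fun x => wop (u (phi n)) x - v x) (fun x => wop (u (phi n)) x - v x)) @ \oo --> (0 : R).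
Proof.
move=> su uM.
have M0 : 0 <= M := le_trans (ipm_ge0 _ _) (uM 0%N).
pose G n := fun y => a y * u n y.
pose M1 := A ^+ 2 * M.
have M10 : 0 <= M1 by rewrite mulr_ge0 ?sqr_ge0.
have sG n : sq (G n) by have [] := amul_sq (su n).
have GM n : ip (G n) (G n) <= M1.
  have [_ b] := amul_sq (su n); apply: le_trans b _; exact: (ler_wpM2l (sqr_ge0 A) (uM n)).
have bv0 : 0 < bv d h := bv_gt0 d h0.
pose K := Num.sqrt (bv d h * M1).
have K0 : 0 <= K by exact: sqrtr_ge0.
have SK n x : `|ballop h (G n) x| <= K.
  by rewrite -sqrtr_sqr; apply: ler_wsqrtr; exact: ballop_bound.
have [D Ddense] := dense_rat_points R d.
have [phi [phii phic]] := diagonal_subseq (fun n j => SK n (D j)).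
have equi e : 0 < e -> exists2 de : R, 0 < de & forall n x x', tnorm (tsub x' x) <= de ->
    `|ballop h (G n) x - ballop h (G n) x'| <= e.
  move=> e0; pose f (t : R) := 2 * (bv d h - bv d (h - t)) * M1.
  have fc : f t @[t --> (0 : R)] --> f 0.
    rewrite /f /bv; apply: cvgM; last exact: cvg_cst.
    apply: cvgM; first exact: cvg_cst.
    apply: cvgB; first exact: cvg_cst.
    apply: cvgM; last exact: cvg_cst.
    have p : (fun t : R => h - t) @ (0 : R) --> h - 0 by apply: cvgB; [exact: cvg_cst|exact: cvg_id].
    exact: (@cvg_comp _ _ _ (fun t : R => h - t) (fun t : R => t ^+ d) _ _ _ p (@exprn_continuous R d (h - 0))).
  have f0 : f 0 = 0 by rewrite /f subr0 subrr mulr0 mul0r.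
  rewrite f0 in fc.
  have e2 : 0 < e ^+ 2 by rewrite exprn_gt0.
  have /cvgrPdist_lt/(_ _ e2)/nbhs_ballP[r /= r0 rP] := fc.
  pose de := Num.min (r / 2) (h / 2).
  have hh := h0.
  have de0 : 0 < de by rewrite lt_min; apply/andP; split; lra.
  have de1 : de <= r / 2 by rewrite ge_min lexx.
  have de2 : de <= h / 2 by rewrite ge_min lexx orbT.
  exists de => // n x x' xx.
  have deh : de < h by lra.
  have := ballop_cont M10 (sG n) (GM n) de0 deh xx.
  have rd : ball_ Num.norm 0 r de by rewrite /ball_ /= sub0r normrN (gtr0_norm de0); lra.
  have := rP de rd; rewrite /= sub0r normrN => h1 h2.
  rewrite -[e]gtr0_norm// -[leLHS]sqrtr_sqr -[leRHS]sqrtr_sqr; apply: ler_wsqrtr.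
  by apply: le_trans h2 _; apply: le_trans (ler_norm _) (ltW h1).
have pc x : exists l : R, (fun n => ballop h (G (phi n)) x) @ \oo --> l.
  suff : cvgn (fun n => ballop h (G (phi n)) x) by move=> c; exists (lim ((fun n => ballop h (G (phi n)) x) @ \oo)).
  apply/cauchy_cvgP/cauchyP => e e0.
  have e4 : 0 < e / 4 by lra.
  have [de de0 deP] := equi _ e4.
  have [j jP] := Ddense x de de0.
  have [l /cvgrPdist_lt/(_ _ e4)[N _ NP]] := phic j.
  exists (ballop h (G (phi N)) x); exists N => // n /= Nn; rewrite /ball/=.
  have h1 := deP (phi N) x (D j) (ltW jP); have h2 := deP (phi n) x (D j) (ltW jP).
  exact: (normB_lt_quarters h1 h2 (NP N (leqnn N)) (NP n Nn)).
have [L Lc] := choice pc.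
have mS n : measurable_fun [set: pt] (ballop h (G (phi n))) by apply: measurable_ballop; have [] := sG (phi n).
have mL : measurable_fun [set: pt] L.
  by apply: (measurable_fun_cvg (h := fun n => ballop h (G (phi n)))) => // x _; exact: Lc.
have LK x : `|L x| <= K.
  have [//|lt] := leP `|L x| K.
  have e0 : 0 < `|L x| - K by lra.
  have /cvgrPdist_lt/(_ _ e0)[N _ /(_ N (leqnn N))/= H] := Lc x.
  have := ler_normD (L x - ballop h (G (phi N)) x) (ballop h (G (phi N)) x).
  by rewrite subrK; have := SK (phi N) x; lra.
have [SB SB0 SBP] : exists2 B : R, 0 <= B & forall n, ip (ballop h (G n)) (ballop h (G n)) <= B.
  exists (bv d h ^+ 2 * M1); first by rewrite mulr_ge0 ?sqr_ge0.
  move=> n; have [_ b] := kint_sk_sq sk (sG n); apply: le_trans b _.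
  exact: (ler_wpM2l (sqr_ge0 _) (GM n)).
have sS n : sq (ballop h (G n)) by have [] := kint_sk_sq sk (sG n).
have Lfat : (\int[mu]_x (L x ^+ 2)%:E <= SB%:E)%E.
  have mf n : measurable_fun [set: pt] (fun x => (ballop h (G (phi n)) x ^+ 2)%:E).
    by apply/measurable_EFinP; apply: measurable_funX.
  have mf0 n x : [set: pt] x -> (0 <= (ballop h (G (phi n)) x ^+ 2)%:E)%E by rewrite lee_fin sqr_ge0.
  have E x : limn_einf (fun n => (ballop h (G (phi n)) x ^+ 2)%:E) = (L x ^+ 2)%:E.
    have c : (fun n => (ballop h (G (phi n)) x ^+ 2)%:E) @ \oo --> (L x ^+ 2)%:E.
      apply: cvg_EFin; first by near=> n.
      exact: (@cvg_comp _ _ _ (fun n => ballop h (G (phi n)) x) (fun t : R => t ^+ 2) _ _ _ (Lc x) (@exprn_continuous R 2 (L x))).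
    by have [-> _] := cvg_limn_einf_sup c.
  have := fatou mu measurableT mf mf0; under eq_integral do rewrite E.
  move=> F; apply: le_trans F _; rewrite limn_einf_lim; apply: lime_le; first exact: is_cvg_einfs.
  exists 0%N => // n _; apply: (@le_trans _ _ (\int[mu]_x (ballop h (G (phi n)) x ^+ 2)%:E)%E).
    by apply: ereal_inf_lbound; exists n => /=.
  by rewrite -ipmE// lee_fin.
have sL : sq L.
  split => //; apply/integrableP; split; first by apply/measurable_EFinP; exact: measurable_funX.
  under eq_integral do rewrite /= ger0_norm ?sqr_ge0//.
  exact: le_lt_trans Lfat (ltry _).
have LB : ip L L <= SB by rewrite -lee_fin ipmE.
exists phi, (fun x => a x * L x).
have [sv _] := amul_sq sL.
split => //; split => //.
pose df n x := ballop h (G (phi n)) x - L x.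
have sdf n : sq (df n) by exact: sqintB (sS (phi n)) sL.
have dfB n : ip (df n) (df n) <= 4 * SB.
  apply: (@le_trans _ _ (2 * ip (ballop h (G (phi n))) (ballop h (G (phi n))) + 2 * ip L L)); last first.
    by have := SBP (phi n); move: LB; lin.
  rewrite /ipm -!RintegralZl//; [|exact: (sqint_mul sL sL)|exact: (sqint_mul (sS _) (sS _))].
  have i1 := integrableZl measurableT 2 (sqint_mul (sS (phi n)) (sS (phi n))).
  have i2 := integrableZl measurableT 2 (sqint_mul sL sL).
  rewrite -RintegralD//; apply: le_Rintegral => //; first exact: (sqint_mul (sdf n) (sdf n)).
    by have := integrableD measurableT i1 i2; apply: eq_integrable => // x _.
  by move=> x _; rewrite /df; have := sqr_ge0 (ballop h (G (phi n)) x + L x); rewrite !expr2; lin.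
have wE n x : wop (u (phi n)) x - a x * L x = a x * df n x by rewrite /wop /df /G mulrBr.
have wE' n : (fun x => wop (u (phi n)) x - a x * L x) = fun x => a x * df n x.
  by apply/funext => x; exact: wE.
rewrite (_ : (fun n => ip (fun x => wop (u (phi n)) x - a x * L x) (fun x => wop (u (phi n)) x - a x * L x)) =
    fun n => ip (fun x => a x * df n x) (fun x => a x * df n x)); last first.
  by apply/funext => n; rewrite wE'.
apply/cvgrPdist_le => e e0.
(* Threshold for [a] outside the ball of radius [rho]: its square times the bound [4 * SB] on the
   squared norms is at most [e / 2]. *)
have e1 : 0 < Num.sqrt (e / 2 / (4 * SB + 1)) by rewrite sqrtr_gt0 !divr_gt0//; lra.
have [rho rho0 rhoP] := adecay e1.
pose c x := bker rho (tnorm x).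
have mc : measurable_fun [set: pt] c by exact: measurable_B.
pose F n x := c x * (a x * df n x) ^+ 2.
have Fc : (fun n => \int[mu]_x F n x) @ \oo --> \int[mu]_x (fun=> 0 : R) x.
  apply: (@dominated_cvg_real _ _ _ mu F (fun=> 0) (fun x => c x * (A * (2 * K)) ^+ 2)) => //.
  - move=> n; apply: measurable_funM => //; apply: measurable_funX; apply: measurable_funM => //.
    by have [] := sdf n.
  - move=> x; rewrite /F.
    have c1 : (fun n => a x * df n x) @ \oo --> a x * 0.
      apply: cvgM; first exact: cvg_cst.
      by rewrite -(subrr (L x)); apply: cvgB; [exact: Lc|exact: cvg_cst].
    have c2 := @cvg_comp _ _ _ (fun n => a x * df n x) (fun t : R => t ^+ 2) _ _ _ c1 (@exprn_continuous R 2 (a x * 0)).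
    have := cvgM (cvg_cst (c x)) c2; rewrite mulr0 expr0n/= mulr0; exact.
  - move=> n x; rewrite /F normrM [X in X * _]ger0_norm /c ?ball_indic_ge0//.
    apply: ler_wpM2l; first exact: ball_indic_ge0.
    rewrite ger0_norm ?sqr_ge0// -real_normK ?num_real// lerXn2r ?nnegrE ?mulr_ge0 ?A_ge0//.
    rewrite normrM (ger0_norm (a0 x)); apply: ler_pM => //.
    rewrite /df; apply: le_trans (ler_normB _ _) _; have := SK (phi n) x; have := LK x; lin.
  - have Bi := @ball_integrable R d rho rho0 (fun=> (A * (2 * K)) ^+ 2) ((A * (2 * K)) ^+ 2) (measurable_cst _).
    by apply: Bi => z _; rewrite ger0_norm ?sqr_ge0.
have F0E : \int[mu]_x (fun=> 0 : R) x = 0 by rewrite /Rintegral integral0.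
rewrite F0E in Fc.
have e20 : 0 < e / 2 by lra.
have /cvgrPdist_lt/(_ _ e20)[N _ NP] := Fc.
exists N => // n /= Nn; have := NP n Nn; rewrite /= !sub0r !normrN => FN.
pose t := e / 2 / (4 * SB + 1).
have t0 : 0 < t by rewrite !divr_gt0//; lra.
have sad : sq (fun x => a x * df n x) by have [] := amul_sq (sdf n).
rewrite ger0_norm ?ipm_ge0//.
have Fi : mu.-integrable setT (EFin \o F n).
  have [_ i] := sad; apply: (integrable_le_real _ _ i).
    apply: measurable_funM => //; apply: measurable_funX; by have [] := sad.
  move=> x; rewrite /F normrM [X in X * _]ger0_norm /c ?ball_indic_ge0// ger0_norm ?sqr_ge0//.
  by apply: ler_piMl; rewrite ?sqr_ge0// /bker lern1 leq_b1.
have di := sqint_mul (sdf n) (sdf n).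
apply: (@le_trans _ _ (\int[mu]_x (F n x) + t * ip (df n) (df n))).
  rewrite /ipm -RintegralZl// -RintegralD//; last first.
    by have := integrableZl measurableT t di; apply: eq_integrable => // x _.
  apply: le_Rintegral => //; first exact: (sqint_mul sad sad).
    have := integrableD measurableT Fi (integrableZl measurableT t di); by apply: eq_integrable => // x _.
  move=> x _; rewrite /F /c /bker; case: ltP => xr.
    by rewrite mul1r expr2 lerDl mulr_ge0 ?(ltW t0)// -expr2 sqr_ge0.
  rewrite mul0r add0r (_ : _ * _ = a x ^+ 2 * (df n x * df n x)); last by ring.
  apply: ler_wpM2r; first by rewrite -expr2 sqr_ge0.
  rewrite -[t]sqr_sqrtr ?(ltW t0)// lerXn2r ?nnegrE ?sqrtr_ge0//; exact: rhoP.
have : t * ip (df n) (df n) <= e / 2.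
  apply: le_trans (ler_wpM2l (ltW t0) (dfB n)) _.
  rewrite /t mulrAC ler_pdivrMr; last by lra.
  by apply: ler_wpM2l; lra.
have := ler_norm (\int[mu]_x F n x); lra.
Unshelve. all: by end_near.
Qed.
End WeightedBallOperator.

(** * Conjugation of the random walk to a compact symmetric operator on [L^2(dx)] *)

Section SquareIntegrableSpace.
Variables (R : realType) (d : nat).
Notation pt := (d.-tuple R).

(** A submodule of functions, without quotient by a.e. equality; [lip] is then a semi-inner product,
    as the abstract spectral section allows. *)
Definition lsq_pred : {pred (pt -> R^o)} := fun g => `[< sqint (vol R d) g >].

Lemma lsq_submod : submod_closed lsq_pred.
Proof.
split; first by apply/asboolP; exact: sqint0.
move=> a f g /asboolP sf /asboolP sg; apply/asboolP.
exact: (@sqintP _ _ _ (vol R d) a f g sf sg).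
Qed.
HB.instance Definition _ := GRing.isSubmodClosed.Build R (pt -> R^o) lsq_pred lsq_submod.
Record lsq := Lsq { lsq_val :> pt -> R^o; lsq_prop : lsq_val \in lsq_pred }.
HB.instance Definition _ := [isSub for lsq_val].
HB.instance Definition _ := [Choice of lsq by <:].
HB.instance Definition _ := [SubChoice_isSubLmodule of lsq by <:].

Lemma lsqP (g : lsq) : sqint (vol R d) g.
Proof. by have /asboolP := lsq_prop g. Qed.

Lemma lsq_mem g : sqint (vol R d) g -> g \in lsq_pred.
Proof. by move=> sg; apply/asboolP. Qed.

Definition lsq_of g (sg : sqint (vol R d) g) : lsq := Lsq (lsq_mem sg).

Lemma lsq_eq (f g : lsq) : (forall x, f x = g x) -> f = g.
Proof. by move=> fg; apply: val_inj; apply/funext. Qed.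

Lemma lsq_linE (a : R) (f g : lsq) x : (a *: f + g) x = a * f x + g x.
Proof. by []. Qed.

Lemma lsq_scaleE (a : R) (f : lsq) x : (a *: f) x = a * f x.
Proof. by []. Qed.

Lemma lsq_subE (f g : lsq) x : (f - g) x = f x - g x.
Proof. by []. Qed.

Lemma lsq_sumE n (c : 'I_n -> R) (F : 'I_n -> lsq) x :
  (\sum_i c i *: F i) x = \sum_i c i * F i x.
Proof.
elim/big_rec2: _ => [//|i y1 y2 _ <-].
by rewrite lsq_linE.
Qed.

Definition lip (f g : lsq) : R := ipm (vol R d) f g.

Lemma lipC f g : lip f g = lip g f. Proof. exact: ipmC. Qed.

Lemma lipP a f g k : lip (a *: f + g) k = a * lip f k + lip g k.
Proof. exact: (ipmP a (lsqP f) (lsqP g) (lsqP k)). Qed.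

Lemma lip_ge0 f : 0 <= lip f f. Proof. exact: ipm_ge0. Qed.

End SquareIntegrableSpace.

(** Only zero sets matter for a nonnegative integrand with zero integral, so a vanishing weighted
    norm can be read without its weight. *)
Lemma int_eq0_congr d (T : measurableType d) (R : realType) (mu : {measure set T -> \bar R})
    (F G : T -> R) : measurable_fun [set: T] F -> measurable_fun [set: T] G ->
  (forall x, 0 <= F x) -> (forall x, 0 <= G x) -> (forall x, F x = 0 -> G x = 0) ->
  (\int[mu]_x (F x)%:E = 0)%E -> (\int[mu]_x (G x)%:E = 0)%E.
Proof.
move=> mF mG F0 G0 FG F00.
have mEF : measurable_fun [set: T] (EFin \o F) by exact/measurable_EFinP.
have mEG : measurable_fun [set: T] (EFin \o G) by exact/measurable_EFinP.
have : (\int[mu]_x `|(EFin \o F) x| = 0)%E by under eq_integral do rewrite gee0_abs ?lee_fin//.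
move/(ae_eq_integral_abs mu measurableT mEF) => aF.
transitivity (\int[mu]_x `|(EFin \o G) x|)%E.
  by apply: eq_integral => x _; rewrite gee0_abs ?lee_fin.
apply/(ae_eq_integral_abs mu measurableT mEG).
apply: filterS aF => x /= h xT; have := h xT => -[] /FG ->.
by [].
Qed.

Section RandomWalk.
Variables (R : realType) (d : nat) (al be h : R).
Hypotheses (al0 : 0 < al) (be0 : 0 < be) (h0 : 0 < h).
Notation pt := (d.-tuple R).
Notation mu := (vol R d).
Notation sq := (sqint (vol R d)).
Notation ip := (ipm (vol R d)).
Notation rho := (@gauss R d al be).
Notation v := (vh al h).
Notation gm := (@gam R d al).
Implicit Types (x : pt) (f g : pt -> R).

Lemma vh_gt0 x : 0 < v x.
Proof.
have [c c0 hc] := vh_coercive d al0 h0; apply: lt_le_trans (hc x).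
by rewrite mulr_gt0// ltr_wpDr// sqr_ge0.
Qed.

Definition wta x : R := (Num.sqrt (v x))^-1.

Lemma wta_gt0 x : 0 < wta x.
Proof. by rewrite invr_gt0 sqrtr_gt0 vh_gt0. Qed.

Lemma wta_sqrt x : wta x * Num.sqrt (v x) = 1.
Proof. by rewrite mulVf// gt_eqF// sqrtr_gt0 vh_gt0. Qed.

Lemma measurable_sqrt_vh : measurable_fun [set: pt] (fun x => Num.sqrt (v x)).
Proof.
apply: (measurableT_comp (f := fun u : R => Num.sqrt u)); last exact: measurable_vh.
by apply: continuous_measurable_fun; exact: sqrt_continuous.
Qed.

Lemma measurable_wta : measurable_fun [set: pt] wta.
Proof.
rewrite (_ : wta = fun x => v x `^ (- 2^-1)); last first.
  by apply/funext => x; rewrite powRN powR12_sqrt// ltW// vh_gt0.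
apply: (measurableT_comp (f := fun u : R => u `^ (- 2^-1))); last exact: measurable_vh.
exact: measurable_powR.
Qed.

Lemma wta_bound : exists A : R, forall x, wta x <= A.
Proof.
have [c c0 hc] := vh_coercive d al0 h0; exists (Num.sqrt c)^-1 => x.
rewrite lef_pV2 ?posrE ?sqrtr_gt0 ?vh_gt0//; apply: ler_wsqrtr; apply: le_trans (hc x).
by rewrite ler_peMr ?(ltW c0)// lerDl sqr_ge0.
Qed.

Lemma wta_decay (e : R) : 0 < e -> exists2 r : R, 0 < r & forall x, r <= tnorm x -> wta x <= e.
Proof.
move=> e0; have [c c0 hc] := vh_coercive d al0 h0.
have sc : 0 < Num.sqrt c by rewrite sqrtr_gt0.
exists (e * Num.sqrt c)^-1; first by rewrite invr_gt0 mulr_gt0.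
move=> x rx; rewrite -[e]invrK lef_pV2 ?posrE ?sqrtr_gt0 ?vh_gt0 ?invr_gt0//.
have tx : 0 <= tnorm x := tnorm_ge0 x.
have e1 : e^-1 <= Num.sqrt c * tnorm x.
  by move: rx; rewrite invfM ler_pdivrMr// mulrC.
apply: le_trans e1 _.
rewrite -[tnorm x]ger0_norm// -sqrtr_sqr -sqrtrM ?(ltW c0)//; apply: ler_wsqrtr.
apply: le_trans (hc x); rewrite ler_pM2l// lerDr//.
Qed.

Let wtaW x := ltW (wta_gt0 x).

Definition kapn : R := be ^+ 2 / Zh rho h.

Lemma mhE x : mh rho h x = be * (gm x * v x).
Proof.
have ik := sk_mul_int (bker_sym_kernel d h0) x (gam_sq d al0).
have /integrableP[mk _] := integrableZl measurableT be ik.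
rewrite /mh; have -> : (fun y : pt => (if tnorm (tsub y x) < h then rho y else 0)%:E) =
    fun y => (be%:E * (EFin \o (fun y => (nker (bker h) (x, y) * gm y)%R)) y)%E.
  apply/funext => y; rewrite /nker /bker /= /gauss /gam -EFinM; congr EFin.
  by case: ifP => _; rewrite ?mul1r ?mul0r ?mulr0.
rewrite leb_intE//; last first.
  by move=> y; rewrite -EFinM lee_fin mulr_ge0 ?(ltW be0)// mulr_ge0 ?expR_ge0// /nker /bker ler0n.
rewrite -[LHS]/(\int[mu]_y (be * (nker (bker h) (x, y) * gm y))) RintegralZl//.
congr (_ * _); rewrite /vh mulrC divfK//; exact: lt0r_neq0 (gam_gt0 _ _).
Qed.

Lemma vh_gam_integrable : mu.-integrable setT (EFin \o (fun x => v x * gm x ^+ 2)).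
Proof.
pose b0 : 'I_d -> nat := fun=> 0%N.
have e : psi al b0 = gm by exact: psi0E.
have := psi_exp_integrable al0 b0 (2 * al * h); rewrite e => i.
have := integrableZl measurableT (bv d h) i => {}i.
apply: (@integrable_le_real _ _ _ mu _ (fun x => bv d h * (gm x ^+ 2 * \prod_i expR (2 * al * h * `|tnth x i|)))) => //.
- apply: measurable_funM; first exact: measurable_vh.
  by apply: measurable_funX; exact: measurable_gam.
- move=> x; have := ler_wpM2r (sqr_ge0 (gm x)) (vh_le al0 h0 x).
  rewrite ger0_norm; first by rewrite -(mulrA (bv d h)) (mulrC (\prod_i _)).
  by apply: mulr_ge0; [exact: ltW (vh_gt0 x)|exact: sqr_ge0].
Qed.

Lemma ZhE : Zh rho h = be ^+ 2 * \int[mu]_x (v x * gm x ^+ 2).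
Proof.
have E x : mh rho h x * rho x = be ^+ 2 * (v x * gm x ^+ 2).
  by rewrite mhE /gauss /gam; ring.
rewrite /Zh; have -> : (fun x => (mh rho h x * rho x)%:E) = fun x : pt => (be ^+ 2 * (v x * gm x ^+ 2))%:E.
  by apply/funext => x; rewrite E.
have /integrableP[m _] := vh_gam_integrable.
rewrite leb_intE.
- by rewrite -RintegralZl//; exact: vh_gam_integrable.
- apply/measurable_EFinP; apply: measurable_funM => //; exact/measurable_EFinP.
- by move=> x; rewrite lee_fin mulr_ge0 ?sqr_ge0// mulr_ge0 ?sqr_ge0 ?(ltW (vh_gt0 x)).
Qed.

Lemma Zh_gt0 : 0 < Zh rho h.
Proof.
rewrite ZhE mulr_gt0 ?exprn_gt0//.
have [c c0 hc] := vh_coercive d al0 h0.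
have p0 : 0 < ip gm gm.
  have e : psi al (fun=> 0%N) = gm by exact: psi0E.
  by rewrite -e psi_norm// psi2_gt0.
apply: (@lt_le_trans _ _ (c * ip gm gm)); first exact: mulr_gt0.
have gi := sqint_mul (gam_sq d al0) (gam_sq d al0).
rewrite /ipm -RintegralZl//; apply: le_Rintegral => //.
- by have := integrableZl measurableT c gi; apply: eq_integrable => // x _.
- exact: vh_gam_integrable.
move=> x _; rewrite -expr2; apply: (ler_wpM2r (sqr_ge0 _)).
apply: le_trans (hc x); by rewrite ler_peMr ?(ltW c0)// lerDl sqr_ge0.
Qed.

Lemma kapn_gt0 : 0 < kapn.
Proof. by rewrite divr_gt0 ?exprn_gt0 ?Zh_gt0. Qed.

Lemma nu_wE x : nu_w rho h x = kapn * (v x * gm x ^+ 2).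
Proof. by rewrite /nu_w /kapn mhE /gauss /gam; ring. Qed.

(** The factor is the square root of [nu_w / kapn]: up to the constant [kapn], this is an isometry
    from [L^2(nu_h)] onto [L^2(dx)], with inverse [Ui]. *)
Definition Uf f x : R := Num.sqrt (v x) * gm x * f x.
Definition Ui g x : R := g x * wta x / gm x.

Lemma UiK g x : Uf (Ui g) x = g x.
Proof.
rewrite /Uf /Ui; have := wta_sqrt x; have gx := lt0r_neq0 (gam_gt0 al x).
move=> e; transitivity ((wta x * Num.sqrt (v x)) * g x); last by rewrite e mul1r.
by field.
Qed.

Lemma Uf_sqr f x : Uf f x ^+ 2 = v x * gm x ^+ 2 * f x ^+ 2.
Proof. by rewrite /Uf !exprMn sqr_sqrtr// ltW// vh_gt0. Qed.

Lemma measurable_Uf f : measurable_fun [set: pt] f -> measurable_fun [set: pt] (Uf f).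
Proof.
move=> mf; apply: measurable_funM => //; apply: measurable_funM; first exact: measurable_sqrt_vh.
exact: measurable_gam.
Qed.

Lemma measurable_Ui g : measurable_fun [set: pt] g -> measurable_fun [set: pt] (Ui g).
Proof.
move=> mg; rewrite (_ : Ui g = fun x => g x * wta x * expR (al * tnorm x ^+ 2)); last first.
  by apply/funext => x; rewrite /Ui /gam mulNr expRN invrK.
apply: measurable_funM; first by apply: measurable_funM => //; exact: measurable_wta.
apply: measurableT_comp => //; apply: measurable_funM => //; apply: measurable_funX; exact: measurable_tnorm.
Qed.

Lemma nu_leb_int f : measurable_fun [set: pt] f ->
  leb_int (fun x => (nu_w rho h x * f x ^+ 2)%:E) = (kapn%:E * \int[mu]_x (Uf f x ^+ 2)%:E)%E.
Proof.
move=> mf; have mU := measurable_Uf mf.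
have -> : (fun x => (nu_w rho h x * f x ^+ 2)%:E) = fun x : pt => (kapn * Uf f x ^+ 2)%:E.
  by apply/funext => x; rewrite nu_wE Uf_sqr; congr EFin; ring.
rewrite leb_intE.
- under eq_integral do rewrite EFinM.
  rewrite ge0_integralZl//.
  + by apply/measurable_EFinP; exact: measurable_funX.
  + by move=> x _; rewrite lee_fin sqr_ge0.
  + by rewrite lee_fin ltW// kapn_gt0.
- by apply/measurable_EFinP; apply: measurable_funM => //; exact: measurable_funX.
- by move=> x; rewrite lee_fin mulr_ge0 ?sqr_ge0// ltW// kapn_gt0.
Qed.

Lemma L2_sq f : L2 (nu_w rho h) f -> sq (Uf f).
Proof.
move=> [mf f2]; have mU := measurable_Uf mf; split => //; apply/integrableP; split.
  by apply/measurable_EFinP; exact: measurable_funX.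
under eq_integral do rewrite /= ger0_norm ?sqr_ge0//.
move: f2; rewrite nu_leb_int//; have k0 := kapn_gt0.
have I0 : (0 <= \int[mu]_x (Uf f x ^+ 2)%:E)%E.
  by apply: integral_ge0 => x _; rewrite lee_fin sqr_ge0.
case: (\int[mu]_x (Uf f x ^+ 2)%:E)%E I0 => [r _ _||].
- by rewrite ltry.
- by rewrite gt0_muley ?lte_fin.
- by rewrite leeNy_eq.
Qed.

Lemma sq_L2 f : measurable_fun [set: pt] f -> sq (Uf f) -> L2 (nu_w rho h) f.
Proof. by move=> mf s; split=> //; rewrite nu_leb_int// -ipmE// -EFinM ltry. Qed.

Lemma norm2E f : L2 (nu_w rho h) f -> norm2 (nu_w rho h) f = Num.sqrt (kapn * ip (Uf f) (Uf f)).
Proof. by move=> lf; have [mf _] := lf; rewrite /norm2 nu_leb_int// -ipmE//; exact: L2_sq. Qed.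

Lemma ae_zeroP f : L2 (nu_w rho h) f -> (ae_zero (nu_w rho h) f <-> ip (Uf f) (Uf f) = 0).
Proof.
move=> lf; have [mf _] := lf; have mU := measurable_Uf mf; have sU := L2_sq lf.
have nw x : 0 < nu_w rho h x.
  by rewrite nu_wE mulr_gt0 ?kapn_gt0// mulr_gt0 ?vh_gt0// exprn_gt0// gam_gt0.
have mw : measurable_fun [set: pt] (fun x => nu_w rho h x * `|f x|).
  under eq_fun do rewrite nu_wE.
  apply: measurable_funM; last exact: measurableT_comp.
  apply: measurable_funM => //; apply: measurable_funM; first exact: measurable_vh.
  by apply: measurable_funX; exact: measurable_gam.
have m2 : measurable_fun [set: pt] (fun x => Uf f x ^+ 2) by exact: measurable_funX.
have w0 x : 0 <= nu_w rho h x * `|f x| by rewrite mulr_ge0// ltW.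
have u0 x : 0 <= Uf f x ^+ 2 by exact: sqr_ge0.
rewrite /ae_zero leb_intE//; last by apply/measurable_EFinP.
split => [H|H].
  apply/eqP; rewrite -eqe ipmE//; apply/eqP; move: H; apply: int_eq0_congr => // x.
  move/eqP; rewrite mulf_eq0 gt_eqF//= normr_eq0 => /eqP fx.
  by rewrite /Uf fx mulr0 expr0n.
have : (\int[mu]_x (Uf f x ^+ 2)%:E = 0)%E by rewrite -ipmE// H.
apply: int_eq0_congr => // x /eqP; rewrite sqrf_eq0 /Uf !mulf_eq0 => /orP[|/eqP ->].
  by rewrite (gt_eqF (gam_gt0 _ _)) orbF sqrtr_eq0 leNgt vh_gt0.
by rewrite normr0 mulr0.
Qed.

Lemma RintE (F : pt -> R) : mu.-integrable setT (EFin \o F) -> Defs.Rint F = \int[mu]_x F x.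
Proof.
move=> iF; have /integrableP[/measurable_EFinP mF _] := iF.
rewrite /Defs.Rint !leb_intE; last 4 first.
- by apply/measurable_EFinP; apply: measurable_maxr => //; exact: measurableT_comp.
- by move=> x; rewrite lee_fin le_max lexx orbT.
- by apply/measurable_EFinP; apply: measurable_maxr.
- by move=> x; rewrite lee_fin le_max lexx orbT.
have ip' : mu.-integrable setT (EFin \o (fun x => Num.max (F x) 0)).
  apply: (integrable_le_real _ _ (integrable_abse iF)).
    exact: measurable_maxr.
  move=> x; have m0 : 0 <= Num.max (F x) 0 by rewrite le_max lexx orbT.
  by rewrite (ger0_norm m0) ge_max ler_norm normr_ge0.
have in' : mu.-integrable setT (EFin \o (fun x => Num.max (- F x) 0)).
  apply: (integrable_le_real _ _ (integrable_abse iF)).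
    by apply: measurable_maxr => //; exact: measurableT_comp.
  move=> x; have m0 : 0 <= Num.max (- F x) 0 by rewrite le_max lexx orbT.
  by rewrite (ger0_norm m0) ge_max normr_ge0 -normrN ler_norm.
rewrite -[LHS]/(\int[mu]_x (Num.max (F x) 0) - \int[mu]_x (Num.max (- F x) 0)) -RintegralB//.
apply: eq_Rintegral => x _.
by rewrite /Order.max; case: (ltP (F x) 0); case: (ltP (- F x) 0) => *; lra.
Qed.

Lemma gam_mulE f x : gm x * f x = wta x * Uf f x.
Proof. by rewrite /Uf mulrA mulrA wta_sqrt mul1r. Qed.

Lemma ThE f x : sq (Uf f) -> Th rho h f x = (gm x * v x)^-1 * ballop h (fun y => wta y * Uf f y) x.
Proof.
move=> sU; have [A wA] := wta_bound; have [s _] := amul_sq measurable_wta wtaW wA sU.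
have ik := sk_mul_int (bker_sym_kernel d h0) x s.
rewrite /Th mhE.
have E : (fun y => if tnorm (tsub y x) < h then f y * rho y else 0) =
   fun y => be * (nker (bker h) (x, y) * (wta y * Uf f y)).
  apply/funext => y; rewrite -gam_mulE /nker /bker /=.
  by case: ifP => _; rewrite ?mul0r ?mulr0// mul1r /gauss /gam; ring.
rewrite E RintE; last first.
  by have := integrableZl measurableT be ik; apply: eq_integrable => // y _.
rewrite RintegralZl// -/(ipm mu _ _) -/(kint mu _ _ _) -/(ballop h _ _).
by rewrite (invfM be) -mulrA mulrCA mulKf// gt_eqF.
Qed.

(** Since [gm * f = wta * U f], the integral sees [U f] only through one factor [wta]; the prefactor
    [sqrt v * gm / (gm * v)] is the other one, which restores symmetry. *)
Lemma Uf_Th f x : sq (Uf f) -> Uf (Th rho h f) x = wop h wta (Uf f) x.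
Proof.
move=> sU; rewrite /Uf ThE// /wop mulrA; congr (_ * _).
rewrite /wta; have g0 := gam_gt0 al x; have v0 := vh_gt0 x.
have s0 : 0 < Num.sqrt (v x) by rewrite sqrtr_gt0.
rewrite -{2}(sqr_sqrtr (ltW v0)); field.
by rewrite !gt_eqF.
Qed.

Lemma measurable_Th f : sq (Uf f) -> measurable_fun [set: pt] (Th rho h f).
Proof.
move=> sU; have [A wA] := wta_bound.
have [[mw _] _] := wop_sq h0 measurable_wta wtaW wA sU.
rewrite (_ : Th rho h f = Ui (wop h wta (Uf f))); first exact: measurable_Ui.
apply/funext => x; rewrite /Ui -Uf_Th// /Uf; have := wta_sqrt x.
have gx := lt0r_neq0 (gam_gt0 al x) => e.
transitivity ((wta x * Num.sqrt (v x)) * Th rho h f x); first by rewrite e mul1r.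
by field.
Qed.

Lemma Th_L2 f : L2 (nu_w rho h) f -> L2 (nu_w rho h) (Th rho h f).
Proof.
move=> lf; have sU := L2_sq lf; have [A wA] := wta_bound.
have [s _] := wop_sq h0 measurable_wta wtaW wA sU.
apply: sq_L2; first exact: measurable_Th.
rewrite (_ : Uf (Th rho h f) = wop h wta (Uf f))//.
by apply/funext => x; exact: Uf_Th.
Qed.

End RandomWalk.

Section RandomWalkSpectrum.
Variables (R : realType) (d : nat) (al be h : R).
Hypotheses (al0 : 0 < al) (be0 : 0 < be) (h0 : 0 < h).
Notation pt := (d.-tuple R).
Notation mu := (vol R d).
Notation ip := (ipm (vol R d)).
Notation rho := (@gauss R d al be).
Notation nu := (nu_w rho h).
Notation T := (Th rho h).
Notation a := (@wta R d al h).
Notation U := (@Uf R d al h).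
Notation vspc := (lsq R d).
Notation nr := (nrm (@lip R d)).

Let ma : measurable_fun [set: pt] a := measurable_wta al0 h0.
Let a0 (x : pt) : 0 <= a x := ltW (wta_gt0 al0 h0 x).

Lemma Tw_sq (g : vspc) : sqint mu (wop h a g).
Proof.
have [A wA] := wta_bound d al0 h0.
by have [] := wop_sq h0 ma a0 wA (lsqP g).
Qed.

Definition Tw (g : vspc) : vspc := lsq_of (Tw_sq g).

Lemma Tw_lin c (f g : vspc) : Tw (c *: f + g) = c *: Tw f + Tw g.
Proof.
have [A wA] := wta_bound d al0 h0.
by apply: lsq_eq => x; rewrite lsq_linE; exact: (wopP h0 ma a0 wA c x (lsqP f) (lsqP g)).
Qed.

Lemma Tw_sym (f g : vspc) : lip (Tw f) g = lip f (Tw g).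
Proof. have [A wA] := wta_bound d al0 h0; exact: (wop_sym h0 ma a0 wA (lsqP f) (lsqP g)). Qed.

Lemma Tw_bounded : exists2 K, 0 <= K & forall u : vspc, nr (Tw u) <= K * nr u.
Proof.
have [A wA] := wta_bound d al0 h0; exists (A ^+ 2 * bv d h).
  by rewrite mulr_ge0 ?sqr_ge0// ltW// bv_gt0.
move=> u; have k0 : 0 <= A ^+ 2 * bv d h by rewrite mulr_ge0 ?sqr_ge0// ltW// bv_gt0.
rewrite -[A ^+ 2 * bv d h]ger0_norm// -sqrtr_sqr -sqrtrM ?sqr_ge0//; apply: ler_wsqrtr.
by have [_] := wop_sq h0 ma a0 wA (lsqP u).
Qed.

Lemma Tw_compact (u : nat -> vspc) : (exists M, forall n, nr (u n) <= M) ->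
  exists (phi : nat -> nat) (v : vspc), (forall n, (phi n < phi n.+1)%N) /\
    forall e : R, 0 < e -> exists N : nat, forall n, (N <= n)%N -> nr (Tw (u (phi n)) - v) < e.
Proof.
move=> [M uM]; have [A wA] := wta_bound d al0 h0.
have uM2 n : ip (u n) (u n) <= M ^+ 2.
  rewrite -[leLHS]/(lip (u n) (u n)) -(nrm2 (@lip_ge0 R d)) lerXn2r ?nnegrE ?nrm_ge0//.
  exact: le_trans (nrm_ge0 _ _) (uM n).
have [phi [v [sv [phii c]]]] := wop_compact h0 ma a0 wA (wta_decay d al0 h0) (fun n => lsqP (u n)) uM2.
exists phi, (lsq_of sv); split => // e e0.
have e2 : 0 < e ^+ 2 by rewrite exprn_gt0.
have /cvgrPdist_lt/(_ _ e2)[N _ NP] := c.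
exists N => n Nn; have := NP n Nn; rewrite /= sub0r normrN ger0_norm ?ipm_ge0// => H.
rewrite -[e]ger0_norm ?(ltW e0)// -sqrtr_sqr ltr_sqrt//.
Qed.

Lemma Th_compact : compact_op nu T.
Proof.
split; first by move=> f; exact: Th_L2.
move=> u lu [M uM]; have k0 := kapn_gt0 d al0 be0 h0.
have sU n := L2_sq al0 be0 h0 (lu n).
have [|phi [v [phii c]]] := @Tw_compact (fun n => lsq_of (sU n)).
  exists (M / Num.sqrt (kapn d al be h)) => n; have := uM n; rewrite norm2E//.
  by rewrite sqrtrM ?(ltW k0)// mulrC -ler_pdivlMr ?sqrtr_gt0.
exists phi; split => // e e0; have e1 : 0 < e / Num.sqrt (kapn d al be h) / 2 by rewrite !divr_gt0// sqrtr_gt0.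
have [N NP] := c _ e1; exists N => m n Nm Nn.
have lT k := Th_L2 al0 be0 h0 (lu k).
have E x : U (fun x => T (u (phi m)) x - T (u (phi n)) x) x =
    (Tw (lsq_of (sU (phi m))) - Tw (lsq_of (sU (phi n)))) x.
  by rewrite lsq_subE /= -!(Uf_Th al0 be0 h0)// /Uf; ring.
have sd : sqint mu (U (fun x => T (u (phi m)) x - T (u (phi n)) x)).
  by rewrite (funext E); exact: lsqP.
have ld : L2 nu (fun x => T (u (phi m)) x - T (u (phi n)) x).
  apply: sq_L2 => //; apply: measurable_funB; exact: measurable_Th.
rewrite norm2E// (funext E) sqrtrM ?(ltW k0)// mulrC -ltr_pdivlMr ?sqrtr_gt0//.
set x1 := Tw _; set x2 := Tw _.
rewrite -[ltLHS]/(nr (x1 - x2)).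
have -> : x1 - x2 = (x1 - v) - (x2 - v) by rewrite opprB addrA subrK.
apply: le_lt_trans (nrmB (@lipC R d) (@lipP R d) (@lip_ge0 R d) _ _) _.
rewrite [ltRHS]splitr; exact: ltrD (NP m Nm) (NP n Nn).
Qed.

Lemma nr_eq0 (g : vspc) : nr g = 0 <-> ip g g = 0.
Proof.
split=> [/eqP|H]; first by rewrite nrm_eq0; [move/eqP|exact: lip_ge0].
by apply/eqP; rewrite nrm_eq0; [apply/eqP|exact: lip_ge0].
Qed.

(** The map [U] and its inverse carry eigenfunctions and independence across, a.e. equality for [nu]
    becoming zero seminorm by [ae_zeroP]. *)
Lemma ev_count_eigvec (S : set R) n : ev_count_ge nu (L2 nu) T S n <->
  exists (F : 'I_n -> vspc) (lam : 'I_n -> R),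
    (forall i, S (lam i) /\ eigvec (@lip R d) Tw (lam i) (F i)) /\ independent (@lip R d) F.
Proof.
split=> [[f [lam [fP findep]]]|[F [lam [FP Findep]]]].
  have sU i := L2_sq al0 be0 h0 (proj1 (fP i)).
  exists (fun i => lsq_of (sU i)), lam; split.
    move=> i; have [lf [Sl ae]] := fP i; split => //; apply/nr_eq0.
    have E x : U (fun x => T (f i) x - lam i * f i x) x = (Tw (lsq_of (sU i)) - lam i *: lsq_of (sU i)) x.
      by rewrite lsq_subE lsq_scaleE /= -(Uf_Th al0 be0 h0)// /Uf; ring.
    have sd : sqint mu (U (fun x => T (f i) x - lam i * f i x)) by rewrite (funext E); exact: lsqP.
    have [mf _] := lf.
    have ld : L2 nu (fun x => T (f i) x - lam i * f i x).
      apply: sq_L2 => //; apply: measurable_funB; first exact: measurable_Th.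
      exact: measurable_funM.
    by rewrite -(funext E); apply/(ae_zeroP al0 be0 h0 ld).
  move=> c /nr_eq0 H; apply: findep.
  have E x : U (fun x => \sum_(i < n) c i * f i x) x = (\sum_i c i *: lsq_of (sU i)) x.
    rewrite lsq_sumE /= /Uf mulr_sumr; apply: eq_bigr => i _; ring.
  have sd : sqint mu (U (fun x => \sum_(i < n) c i * f i x)) by rewrite (funext E); exact: lsqP.
  have ld : L2 nu (fun x => \sum_(i < n) c i * f i x).
    apply: sq_L2 => //; apply: measurable_sum => i; apply: measurable_funM => //.
    by have [[]] := fP i.
  by apply/(ae_zeroP al0 be0 h0 ld); rewrite (funext E).
have UK i : U (Ui al h (F i)) = F i :> (pt -> R) by apply/funext => x; exact: UiK.
have mF i : measurable_fun [set: pt] (Ui al h (F i)).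
  by apply: measurable_Ui => //; have [] := lsqP (F i).
have lF i : L2 nu (Ui al h (F i)) by apply: sq_L2 => //; rewrite UK; exact: lsqP.
exists (fun i => Ui al h (F i)), lam; split.
  move=> i; have [Sl /nr_eq0 ev] := FP i; split => //; split => //.
  have sU : sqint mu (U (Ui al h (F i))) by rewrite UK; exact: lsqP.
  have E x : U (fun x => T (Ui al h (F i)) x - lam i * Ui al h (F i) x) x = (Tw (F i) - lam i *: F i) x.
    rewrite lsq_subE lsq_scaleE -[in X in _ = _ - lam i * X](UK i) /= -[X in wop _ _ X](UK i) -(Uf_Th al0 be0 h0)// /Uf; ring.
  have ld : L2 nu (fun x => T (Ui al h (F i)) x - lam i * Ui al h (F i) x).
    apply: sq_L2 => //; last by rewrite (funext E); exact: lsqP.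
    apply: measurable_funB; first exact: measurable_Th.
    exact: measurable_funM.
  by apply/(ae_zeroP al0 be0 h0 ld); rewrite (funext E).
move=> c H; apply: Findep; apply/nr_eq0.
have E x : U (fun x => \sum_(i < n) c i * Ui al h (F i) x) x = (\sum_i c i *: F i) x.
  rewrite lsq_sumE /Uf mulr_sumr; apply: eq_bigr => i _; rewrite -[in RHS](UK i) /Uf; ring.
have ld : L2 nu (fun x => \sum_(i < n) c i * Ui al h (F i) x).
  apply: sq_L2 => //; last by rewrite (funext E); exact: lsqP.
  by apply: measurable_sum => i; apply: measurable_funM.
by rewrite -(funext E); apply/(ae_zeroP al0 be0 h0 ld).
Qed.

End RandomWalkSpectrum.

(** * Eigenvalue counts from above *)

Lemma sin_sqr_le (R : realType) (v : R) : sin v ^+ 2 <= v ^+ 2.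
Proof.
have sle (w : R) : 0 <= w -> `|sin w| <= w.
  rewrite le_eqVlt => /orP[/eqP <-|w0]; first by rewrite sin0 normr0.
  have [|c _] := @MVT R sin cos 0 w w0 (fun x _ => is_derive_sin x).
    by apply: continuous_subspaceT; exact: continuous_sin.
  rewrite sin0 !subr0 => ->; rewrite normrM (gtr0_norm w0) ler_piMl ?(ltW w0)//; exact: cos_max.
rewrite -[leLHS]real_normK ?num_real// -[leRHS]real_normK ?num_real// lerXn2r ?nnegrE//.
have [v0|v0] := leP 0 v; first by rewrite (ger0_norm v0) sle.
by rewrite (ltr0_norm v0) -normrN -sinN sle// oppr_ge0 ltW.
Qed.

(** From [expR (- y) <= 1 / (1 + y)]; the remaining inequality is [y^2 (1 + 2 y) >= 0]. *)
Lemma one_sub_expR_ge (R : realType) (y : R) : - (1 / 2) <= y -> y - 2 * y ^+ 2 <= 1 - expR (- y).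
Proof.
move=> y2; suff : expR (- y) <= 1 - y + 2 * y ^+ 2 by lra.
have p : 0 < 1 - - y by lra.
have : expR (- y) <= (1 - - y)^-1.
  rewrite -[expR (- y)]invrK -expRN opprK lef_pV2 ?posrE ?expR_gt0 ?opprK//.
    by have := expR_ge1Dx y; lra.
  by lra.
move=> h; apply: le_trans h _; rewrite -[leLHS]mul1r ler_pdivrMr//.
have H : 0 <= y ^+ 2 * (1 + 2 * y) by rewrite mulr_ge0 ?sqr_ge0//; lra.
by move: H; lra.
Qed.

Section MehlerParameters.
Variables (R : realType) (d : nat) (al s : R).
Hypotheses (al0 : 0 < al) (s0 : 0 < s) (s8 : s <= 1 / 8).
Notation r := (expR (- s)).

Lemma expRN_lt1 : r < 1.
Proof. by rewrite -expR0 ltr_expR oppr_lt0. Qed.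

(** With [r = exp (- s)] the precision [mq] is [al / sinh s], so [mq * s] tends to [al] and the
    width of the Gaussian is of order [sqrt s]. *)
Lemma mq_bounds : al * (1 - s) <= mq al r * s <= al * (1 + 8 * s).
Proof.
have a0 := al0; have s00 := s0; have s88 := s8.
have r0 : 0 < r := expR_gt0 _; have r1 := expRN_lt1.
have u0 := r2_lt1 r0 r1.
have e2 : r ^+ 2 = expR (- (2 * s)) by rewrite expr2 -expRD; congr expR; ring.
have u1 : 1 - r ^+ 2 <= 2 * s by rewrite e2; have := expR_ge1Dx (- (2 * s)); lra.
have u2 : 2 * s - 8 * s ^+ 2 <= 1 - r ^+ 2.
  by rewrite e2; have := @one_sub_expR_ge R (2 * s) (_ : _); rewrite exprMn => /(_ _)H; apply: le_trans (H _); lra.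
have rs : 1 - s <= r by have := expR_ge1Dx (- s); lra.
rewrite /mq mulrAC; move: (1 - r ^+ 2) u0 u1 u2 => u u0 u1 u2.
apply/andP; split.
  rewrite ler_pdivlMr//; apply: (@le_trans _ _ (al * (1 - s) * (2 * s))).
    by apply: ler_wpM2l => //; rewrite mulr_ge0; lra.
  have : 0 <= 2 * al * s * (r - (1 - s)) by rewrite mulr_ge0 ?mulr_ge0//; lra.
  by lra.
rewrite ler_pdivrMr//; apply: (@le_trans _ _ (2 * al * s)).
  have : 0 <= 2 * al * s * (1 - r) by rewrite !mulr_ge0; lra.
  by lra.
apply: (@le_trans _ _ (al * (1 + 8 * s) * (2 * s - 8 * s ^+ 2))); last first.
  by apply: ler_wpM2l => //; rewrite mulr_ge0; lra.
have : 0 <= 8 * al * s ^+ 2 * (1 - 8 * s) by rewrite !mulr_ge0 ?sqr_ge0//; lra.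
by lra.
Qed.

(** Here [mb] is [al * tanh (s / 2)], of order [al * s / 2]. *)
Lemma mb_bound : 2 * mb al r <= al * s * (1 + s).
Proof.
have a0 := al0; have s00 := s0; have s88 := s8.
have rs : 1 - s <= r by have := expR_ge1Dx (- s); lra.
have r0 : 0 < r := expR_gt0 _; have r1 := expRN_lt1.
rewrite /mb mulrA ler_pdivrMr; last by lra.
apply: (@le_trans _ _ (al * s * (1 + s) * (2 - s))); last first.
  by apply: ler_wpM2l; [rewrite !mulr_ge0; lra|lra].
have h1 : 0 <= 2 * al * (s - (1 - r)) by rewrite !mulr_ge0; lra.
have h2 : 0 <= al * s * s * (1 - s) by rewrite !mulr_ge0; lra.
by move: h1 h2; rewrite !mulrBr; lra.
Qed.

(** With levels one unit apart, [d / 2 + n + 1] is the oscillator energy of the lowest degree left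
    by orthogonality to degrees up to [n], and [s] is the time. *)
Lemma mehler_decayE n (X : R) : Num.sqrt r ^+ d * r ^+ n.+1 * expR (2 * mb al r * X) =
  expR (- (s * (d%:R / 2 + n.+1%:R) - 2 * mb al r * X)).
Proof.
have -> : Num.sqrt r = expR (- (s / 2)).
  have -> : r = expR (- (s / 2)) ^+ 2 by rewrite expr2 -expRD; congr expR; field.
  by rewrite sqrtr_sqr ger0_norm// expR_ge0.
rewrite -!expRM_natl -!expRD; congr expR; by move: (mb al r) => b; field.
Qed.

End MehlerParameters.

Section Counting.
Variables (R : realType) (d : nat) (al : R).
Hypothesis al0 : 0 < al.
Notation pt := (d.-tuple R).
Notation mu := (vol R d).
Notation ip := (ipm (vol R d)).
Notation vspc := (lsq R d).

Definition multi_index n : {set {ffun 'I_d -> 'I_n.+1}} := [set b : {ffun 'I_d -> 'I_n.+1} | (\sum_i (b i : nat) <= n)%N].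
Definition ndeg n : nat := #|multi_index n|.

Lemma ndeg_le n : (ndeg n <= n.+1 ^ d)%N.
Proof. by apply: leq_trans (max_card _) _; rewrite card_ffun !card_ord. Qed.

Lemma mem_multi_index n (c : 'I_d -> nat) : (\sum_i c i <= n)%N ->
  exists2 b, b \in multi_index n & c = bval b.
Proof.
move=> cn; have ci i : (c i < n.+1)%N.
  by rewrite ltnS; apply: leq_trans cn; rewrite (bigD1 i)//= leq_addr.
exists [ffun i => Ordinal (ci i)]; last by apply/funext => i; rewrite /bval ffunE.
by rewrite inE; under eq_bigr do rewrite ffunE.
Qed.

(** With more than [ndeg n] members, some non-null combination [u] would have its cut-off image
    orthogonal to all Hermite functions of degree at most [n]. The pointwise hypothesis then feeds
    [form_gap] with [g = a u] and weight [vh / bv], against the lower bound [lam] of the form on the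
    span. *)
Lemma count_le (h r Rr C lam e0 : R) (n m : nat) (F : 'I_m -> vspc) (ev : 'I_m -> R) (h0 : 0 < h) :
  0 < r -> r < 1 -> 0 < Rr -> 0 <= C -> 0 < e0 -> h <= mwidth al r ->
  (forall (h s : R) g, 0 < h -> h <= s -> sqint mu g ->
    ip g g - ip (kint mu (nker (gker d s)) g) g <=
    (d%:R + 2) * (1 + C * (h / s)) / (h / s) ^+ 2 *
    (ip g g - ip (kint mu (nker (bker h)) g) g / bv d h)) ->
  (forall x : pt, e0 <= lam * (vh al h x / bv d h) - 1 +
      (h / mwidth al r) ^+ 2 / ((d%:R + 2) * (1 + C * (h / mwidth al r))) * (cos (tht Rr x) ^+ 2 *
      (1 - Num.sqrt r ^+ d * r ^+ n.+1 * expR (2 * mb al r * tnorm x ^+ 2)) - d%:R * mwidth al r ^+ 2 / (2 * Rr ^+ 2))) ->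
  (forall i, lam <= ev i) -> (forall i, eigvec (@lip R d) (Tw al0 h0) (ev i) (F i)) ->
  independent (@lip R d) F -> (m <= ndeg n)%N.
Proof.
move=> r0 r1 Rr0 C0 e00 hs HC gap evl FP Find; rewrite leqNgt; apply/negP => lt.
pose a := @wta R d al h.
have a0 x : 0 <= a x := ltW (wta_gt0 al0 h0 x).
have ma : measurable_fun [set: pt] a := measurable_wta al0 h0.
have [A wA] := wta_bound d al0 h0.
pose gof (u : vspc) x := a x * u x.
have sgof u : sqint mu (gof u) by have [] := amul_sq ma a0 wA (lsqP u).
have sc u : sqint mu (cutg al r Rr (gof u)) := cutg_sq al0 r0 r1 Rr0 (sgof u).
pose l (j : 'I_(ndeg n)) (u : vspc) := ip (cutg al r Rr (gof u)) (psi al (bval (enum_val j))).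
have lin_l j c : l j (\sum_i c i *: F i) = \sum_i c i * l j (F i).
  rewrite /l (_ : cutg al r Rr (gof (\sum_i c i *: F i)) =
      fun x => \sum_i (c i * cutg al r Rr (gof (F i)) x)); last first.
    apply/funext => x; rewrite /cutg /gof lsq_sumE !mulr_sumr; apply: eq_bigr => i _; ring.
  rewrite ipm_sum; [|by move=> i; apply: sqintZ|exact: psi_sq].
  by apply: eq_bigr => i _; rewrite ipmZ//; exact: psi_sq.
have [c [nz ker]] := independent_kernel Find lin_l lt.
have := eig_form_ge (@lipC R d) (@lipP R d) (@lip_ge0 R d) (Tw_lin al0 h0) (Tw_sym al0 h0) c evl FP.
set u := \sum_i c i *: F i in nz ker *; move=> form.
have bv0 := bv_gt0 d h0.
(* Since [a ^ 2 * vh = 1], the weighted mass of [a u] is the mass of [u] divided by [bv d h]. *)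
have uE x : u x ^+ 2 = bv d h * (vh al h x / bv d h * gof u x ^+ 2).
  rewrite /gof exprMn mulrCA mulrA divfK ?gt_eqF//; have := wta_sqrt al0 h0 x.
  rewrite -/(a x) => e; rewrite mulrA -{1}(sqr_sqrtr (ltW (vh_gt0 al0 h0 x))) -exprMn mulrC.
  by rewrite (mulrC (Num.sqrt _)) e expr1n mulr1.
have wi : mu.-integrable setT (EFin \o (fun x => vh al h x / bv d h * gof u x ^+ 2)).
  have [_ i] := lsqP u; have := integrableZl measurableT (bv d h)^-1 i.
  by apply: eq_integrable => // x _; rewrite /= uE -EFinM mulKf// gt_eqF.
have ortho (b : 'I_d -> nat) : (\sum_i b i <= n)%N -> ip (psi al b) (cutg al r Rr (gof u)) = 0.
  move=> /mem_multi_index[b' b'in ->]; rewrite ipmC.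
  by have := ker (enum_rank_in b'in b'); rewrite /l enum_rankK_in.
have e1 : 0 < h / mwidth al r by rewrite divr_gt0// mwidth_gt0.
have vt0 : 0 <= (h / mwidth al r) ^+ 2 / ((d%:R + 2) * (1 + C * (h / mwidth al r))).
  move: (h / mwidth al r) e1 => e e1; apply: divr_ge0; first exact: sqr_ge0.
  apply: mulr_ge0; first by rewrite addr_ge0.
  by rewrite addr_ge0// mulr_ge0// ltW.
have vt1 : (h / mwidth al r) ^+ 2 / ((d%:R + 2) * (1 + C * (h / mwidth al r))) *
    ((d%:R + 2) * (1 + C * (h / mwidth al r)) / (h / mwidth al r) ^+ 2) <= 1.
  move: (h / mwidth al r) e1 => e e1.
  have d2 : 0 < d%:R + 2 :> R by rewrite ltr_wpDl.
  have c2 : 0 < 1 + C * e by rewrite ltr_wpDr// mulr_ge0// ltW.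
  rewrite (_ : _ * _ = 1)//; field; by rewrite !gt_eqF.
have HC' (s : R) g : h <= s -> sqint mu g -> _ := fun hs sg => HC h s g h0 hs sg.
have := form_gap al0 r0 r1 Rr0 HC' h0 hs vt0 vt1 (sgof u) wi ortho gap.
have E1 : lip u u = bv d h * \int[mu]_x (vh al h x / bv d h * gof u x ^+ 2).
  rewrite -RintegralZl//; apply: eq_Rintegral => x _; by rewrite -expr2 uE.
have E2 : lip (Tw al0 h0 u) u = ip (kint mu (nker (bker h)) (gof u)) (gof u).
  by apply: eq_Rintegral => x _; rewrite /= /wop /ballop /gof /a; ring.
rewrite -E2 => H.
have : e0 * ip (gof u) (gof u) <= 0.
  apply: le_trans H _; rewrite subr_le0 ler_pdivlMr//; move: form; rewrite E1.
  by rewrite mulrCA mulrC mulrA.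
rewrite pmulr_rle0// => g0.
have g00 : ip (gof u) (gof u) = 0 by apply/eqP; rewrite eq_le g0 ipm_ge0.
case/negP: nz; apply/eqP/nr_eq0.
have [mg _] := sgof u; have [mu' _] := lsqP u.
apply/eqP; rewrite -eqe ipmE; last exact: lsqP.
(* By [uE], [u] vanishes wherever [a u] does, so the null norm passes to [u]. *)
apply/eqP; apply: (@int_eq0_congr _ _ _ mu (fun x => gof u x ^+ 2)).
- exact: measurable_funX.
- exact: measurable_funX.
- by move=> x; exact: sqr_ge0.
- by move=> x; exact: sqr_ge0.
- by move=> x gx; rewrite uE gx mulr0 mulr0.
- by rewrite -ipmE ?g00.
Qed.
End Counting.

Ltac pos := repeat first [assumption | exact: ltr01 | exact: ler01 | exact: sqr_ge0 | by apply: ltW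
  | apply: addr_gt0 | apply: divr_gt0 | apply: mulr_gt0 | apply: exprn_gt0
  | apply: addr_ge0 | apply: divr_ge0 | apply: mulr_ge0 | apply: exprn_ge0 | by [] ].

(** * Number of eigenvalues above the midpoint between two levels *)

Section SharpCount.
Variables (R : realType) (d : nat) (al : R).
Hypothesis al0 : 0 < al.
Notation pt := (d.-tuple R).
Notation vspc := (lsq R d).

Lemma cos_tht_bounds (Rr : R) (x : pt) : 0 < Rr ->
  0 <= cos (tht Rr x) ^+ 2 /\ cos (tht Rr x) ^+ 2 <= 1 /\
  1 - tnorm x ^+ 2 / Rr ^+ 2 <= cos (tht Rr x) ^+ 2 /\
  (4 * Rr ^+ 2 <= tnorm x ^+ 2 -> cos (tht Rr x) ^+ 2 = 0).
Proof.
move=> Rr0; have pc := cos2Dsin2 (tht Rr x); have s0 := sqr_ge0 (sin (tht Rr x)).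
split; first exact: sqr_ge0.
split; first by lra.
split.
  have h1 := sin_sqr_le (tht Rr x).
  have t0 : 0 <= tht Rr x by rewrite /tht le_min divr_ge0 ?tnorm_ge0 ?(ltW Rr0)//= divr_ge0 ?pi_ge0.
  have h2 : tht Rr x ^+ 2 <= (tnorm x / Rr) ^+ 2.
    by rewrite lerXn2r ?nnegrE ?divr_ge0 ?tnorm_ge0 ?(ltW Rr0)// /tht ge_min lexx.
  by move: h2; rewrite expr_div_n; lra.
move=> h; have h1 : 2 * Rr <= tnorm x.
  rewrite -(@ler_pXn2r _ 2)// ?nnegrE ?tnorm_ge0 ?mulr_ge0 ?(ltW Rr0)//.
  by rewrite exprMn; have -> : 2 ^+ 2 = 4 :> R by ring.
rewrite tht_cos0 ?expr0n//; apply: le_trans h1; rewrite mulrC ler_wpM2r ?(ltW Rr0)//.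
by have /andP[_] := @pihalf_02 R; exact: ltW.
Qed.

(** Half the mean of a squared coordinate over the unit ball. *)
Definition cst_c : R := (2 * (d%:R + 2))^-1.

Lemma cst_c_gt0 : 0 < cst_c.
Proof. by rewrite invr_gt0 mulr_gt0// ltr_wpDl. Qed.

(* the localized gap, divided by [h^2 / (2 (d + 2))]; [kp] stands for [4 mq s / (1 + C h / sigma)] *)
Lemma sharp_gap_real (m n2 X co kp dl s b X0 D0 E : R) :
  0 < s -> 0 <= X -> 0 <= co <= 1 -> 0 <= kp -> 0 <= b -> b <= al * s * (1 + s) -> s <= 1 ->
  0 <= dl <= 1 / 2 -> 2 * m <= al * X0 -> 0 <= m -> (X0 <= X -> co = 0) -> s * D0 <= 1 / 2 ->
  m + 2 * al * X0 <= D0 -> `|kp - 4 * al| <= E -> kp <= 8 * al ->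
  (1 - co) * (4 * al * m) <= 1 / 4 * al + (1 - co) * (4 * al ^+ 2 * X) ->
  4 * al ^+ 2 * dl * X0 <= al / 4 ->
  4 * al ^+ 2 * s * X0 + E * D0 + 16 * al * s * D0 ^+ 2 <= al / 4 ->
  5 / 4 * al <= 4 * al ^+ 2 * (1 - dl) * X - 4 * al * m + 2 * al + kp / s * (co * (1 - expR (- (s * m - b * X)))).
Proof.
move=> s0 X0' /andP[co0 co1] kp0 b0 bs s1 /andP[dl0 dl1] mX m0 coX sD mD kE kp8 cm dX Es; have a0 := al0.
have a2 : 0 < al ^+ 2 by rewrite exprn_gt0.
have s1p : 0 <= 1 + s by pos.
have s1m : 0 <= 1 - s by rewrite subr_ge0.
have dlm : 0 <= 1 / 2 - dl by rewrite subr_ge0.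
have mXm : 0 <= al * X0 - 2 * m by rewrite subr_ge0.
(* Beyond [X0] the cut-off vanishes and the potential alone suffices: [2 * m <= al * X0] makes it
   absorb [4 * al * m]. *)
have [XX|XX] := leP X0 X.
  rewrite coX// mul0r mulr0 addr0; have XXm : 0 <= X - X0 by rewrite subr_ge0.
  have h1 : 0 <= 4 * al ^+ 2 * (1 / 2 - dl) * X by pos.
  have h2 : 0 <= 2 * al ^+ 2 * (X - X0) by pos.
  have h3 : 0 <= 2 * al * (al * X0 - 2 * m) by pos.
  by move: h1 h2 h3; rewrite expr2; lra.
have XXm : 0 <= X0 - X by rewrite subr_ge0 ltW.
(* [s * D] bounds the exponent [s * m - b * X] from below, and [|D| <= D0] in the near region, so
   that the exponential may be expanded to second order. *)
pose D := m - al * (1 + s) * X.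
have D1 : D <= D0.
  have : 0 <= al * (1 + s) * X by pos.
  have : 0 <= al * X0 by lra.
  by rewrite /D; lra.
have D2 : - D0 <= D.
  have h1 : 0 <= al * (1 - s) * X by pos.
  have h2 : 0 <= 2 * al * (X0 - X) by pos.
  by move: h1 h2; rewrite /D; lra.
have D0p : 0 <= D0 by lra.
have xi : s * D <= s * m - b * X.
  have := ler_wpM2r X0' bs; rewrite /D; lra.
have e1 : 1 - expR (- (s * D)) <= 1 - expR (- (s * m - b * X)).
  by rewrite lerD2l lerNl opprK ler_expR lerNl opprK.
have sDl : - (1 / 2) <= s * D.
  have : 0 <= s * (D + D0) by rewrite mulr_ge0 ?(ltW s0)// -lerBlDr sub0r.
  by move: sD; clear -al0 d; lra.
have e2 := one_sub_expR_ge sDl.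
have DD : D ^+ 2 <= D0 ^+ 2.
  have : 0 <= (D0 - D) * (D0 + D) by apply: mulr_ge0; rewrite ?subr_ge0// addrC -lerBlDr sub0r.
  by rewrite !expr2; lra.
have ks : 0 <= kp / s by rewrite divr_ge0// ltW.
have e3 : kp / s * (co * (s * D - 2 * (s * D) ^+ 2)) <= kp / s * (co * (1 - expR (- (s * m - b * X)))).
  by apply: ler_wpM2l => //; apply: ler_wpM2l => //; lra.
have e4 : kp / s * (co * (s * D - 2 * (s * D) ^+ 2)) = kp * co * D - 2 * kp * co * s * D ^+ 2.
  by field; rewrite gt_eqF.
have e5 : 4 * al * co * D - E * D0 <= kp * co * D.
  have : `|(kp - 4 * al) * (co * D)| <= E * D0.
    rewrite normrM; apply: ler_pM => //; rewrite normrM (ger0_norm co0).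
    apply: le_trans (_ : 1 * D0 <= _); last by rewrite mul1r.
    by apply: ler_pM => //; rewrite ler_norml; apply/andP; split.
  by rewrite ler_norml => /andP[h _]; move: h; clear -al0 d; lra.
have e6 : 2 * kp * co * s * D ^+ 2 <= 16 * al * s * D0 ^+ 2.
  have -> : 2 * kp * co * s * D ^+ 2 = (2 * s) * (kp * co * D ^+ 2) by ring.
  have -> : 16 * al * s * D0 ^+ 2 = (2 * s) * (8 * al * D0 ^+ 2) by ring.
  apply: ler_wpM2l; first by pos.
  apply: ler_pM => //; [by rewrite mulr_ge0|exact: sqr_ge0|].
  by apply: le_trans (_ : kp * 1 <= _); [apply: ler_wpM2l|lra].
have e7 : 4 * al * co * D = co * (4 * al * m) - co * (4 * al ^+ 2 * X) - 4 * al ^+ 2 * s * (co * X).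
  by rewrite /D; ring.
have e8 : 4 * al ^+ 2 * s * (co * X) <= 4 * al ^+ 2 * s * X0.
  apply: ler_wpM2l; first by pos.
  by apply: le_trans (_ : 1 * X <= _); [apply: ler_wpM2r|rewrite mul1r ltW].
have e9 : 4 * al ^+ 2 * dl * X <= 4 * al ^+ 2 * dl * X0.
  by apply: ler_wpM2l; [pos|exact: ltW].
rewrite e4 in e3; rewrite e7 in e5.
move: e3 e5 e6 e8 e9 cm dX Es; lra.
Qed.

Lemma kp_bounds (q s t : R) : 0 < s -> s <= 1 / 8 -> 0 <= t -> al * (1 - s) <= q -> q <= al * (1 + 8 * s) ->
  [/\ 0 <= 4 * q / (1 + t), `|4 * q / (1 + t) - 4 * al| <= 4 * al * (8 * s + t) & 4 * q / (1 + t) <= 8 * al].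
Proof.
move=> s0 s8 t0 q1 q2; have a0 := al0.
have t1 : 0 < 1 + t by rewrite ltr_wpDr.
have q0 : 0 <= q by apply: le_trans q1; rewrite mulr_ge0//; lra.
have kp0 : 0 <= 4 * q / (1 + t) by pos.
have k1 : 4 * q / (1 + t) <= 4 * q by rewrite ler_pdivrMr// ler_peMr//; lra.
have k2 : 4 * q * (1 - t) <= 4 * q / (1 + t).
  rewrite ler_pdivlMr//.
  have : 0 <= 4 * q * t ^+ 2 by pos.
  by rewrite expr2; lra.
move: (4 * q / (1 + t)) kp0 k1 k2 => kp kp0 k1 k2.
have j1 : 0 <= al * t by pos.
have j4 : 0 <= al * s by pos.
split => //.
  rewrite ler_norml; apply/andP; split; last by lra.
  have [ge1|lt1] := leP 1 t.
    have : 0 <= al * (t - 1) by rewrite mulr_ge0// ?subr_ge0// ltW.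
    by lra.
  have j2 : 0 <= (q - al * (1 - s)) * (1 - t) by rewrite mulr_ge0; lra.
  have j3 : 0 <= al * s * t by pos.
  by lra.
have : 0 <= al * (1 / 8 - s) by rewrite mulr_ge0; lra.
by lra.
Qed.

(** The cut-off forfeits the fraction [1 - co] of the gain [4 * al * m]. Where [al * X >= m] the
    potential pays for it; elsewhere the fraction is at most [X / R2], made small by the choice of
    [R2]. *)
Lemma cm_bound (m R2 D X co : R) : 0 < m -> 0 <= D -> 0 < R2 -> 0 <= X -> al * R2 = 16 * (m ^+ 2 + m + D) ->
  co <= 1 -> 1 - X / R2 <= co -> (1 - co) * (4 * al * m) <= 1 / 4 * al + (1 - co) * (4 * al ^+ 2 * X).
Proof.
move=> m0 D0 R20 X0 E co1 coX; have a0 := al0.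
have [XX|XX] := leP (m / al) X.
  have : m <= al * X by move: XX; rewrite ler_pdivrMr// mulrC.
  move=> mX; have : 0 <= (1 - co) * (4 * al * (al * X - m)) by rewrite !mulr_ge0//; lra.
  by lra.
have mX : al * X <= m by apply: ltW; move: XX; rewrite ltr_pdivlMr// mulrC.
have k1 : 1 - co <= X / R2 by lra.
have k2 : (1 - co) * (4 * al * m) <= X / R2 * (4 * al * m) by apply: ler_wpM2r => //; pos.
have k3 : X / R2 * (4 * al * m) <= 1 / 4 * al.
  rewrite mulrAC ler_pdivrMr//.
  have -> : 1 / 4 * al * R2 = 4 * (m ^+ 2 + m + D) by rewrite -(mulrA _ al) E; field.
  by have := ler_wpM2r (ltW m0) mX; rewrite expr2; lra.
have : 0 <= (1 - co) * (4 * al ^+ 2 * X) by apply: mulr_ge0; [lra|pos].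
by lra.
Qed.

(** [n + 1/2] lies midway between two levels, so the losses only have to stay below half a spacing.
    The radius is chosen first, then the time [s], and only then the range of [h]. *)
Theorem sharp_count (n : nat) : exists2 h1 : R, 0 < h1 & forall h (h0 : 0 < h), h <= h1 ->
  forall (m : nat) (F : 'I_m -> vspc) (ev : 'I_m -> R),
  (forall i, 1 - cst_c * h ^+ 2 * (4 * al * (n%:R + 1 / 2)) <= ev i) ->
  (forall i, eigvec (@lip R d) (Tw al0 h0) (ev i) (F i)) ->
  independent (@lip R d) F -> (m <= ndeg d n)%N.
Proof.
have a0 := al0; have c0 := cst_c_gt0; have a2 : 0 < al ^+ 2 by rewrite exprn_gt0.
have [C C0 HC] := gauss_ball_form R d.
have [m0 m0E] : exists m0 : R, m0 = d%:R / 2 + n.+1%:R by eexists.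
have m0p : 0 < m0 by rewrite m0E ltr_wpDl// divr_ge0.
have dR : 0 <= d%:R :> R by [].
(* Large enough for [cm_bound], and for the localization error [d / R2] to be at most [al / 8]. *)
have [R2 R2D] : exists R2, R2 = 16 * (m0 ^+ 2 + m0 + d%:R) / al by eexists.
have R2p : 0 < R2 by rewrite R2D divr_gt0// mulr_gt0// ltr_wpDr// addr_gt0// exprn_gt0.
pose Rr := Num.sqrt R2.
have Rr0 : 0 < Rr by rewrite sqrtr_gt0.
have RrE : Rr ^+ 2 = R2 by rewrite sqr_sqrtr// ltW.
have [X0 X0E] : exists X0, X0 = 4 * R2 by eexists.
have X0p : 0 < X0 by rewrite X0E mulr_gt0.
have [D0 D0E] : exists D0, D0 = m0 + 2 * al * X0 by eexists.
have D0p : 0 < D0 by rewrite D0E addr_gt0// mulr_gt0// mulr_gt0.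
pose K := 4 * al ^+ 2 * X0 + 32 * al * D0 + 16 * al * D0 ^+ 2.
have Kp : 0 < K by rewrite /K; pos.
(* [s * D0 <= 1/2] allows the expansion of the exponential; [s * K] collects the errors proportional
   to [s] in [sharp_gap_real]. *)
have [s [s0 s8 sD sK]] : exists s, [/\ 0 < s, s <= 1 / 8, s * D0 <= 1 / 2 & s * K <= al / 8].
  exists (Num.min (1 / 8) (Num.min (1 / (2 * D0)) (al / (8 * K)))); split.
  - by rewrite !lt_min; apply/and3P; split; rewrite divr_gt0// mulr_gt0.
  - by rewrite ge_min lexx.
  - set s := Num.min _ _; have : s <= 1 / (2 * D0) by rewrite !ge_min lexx orbT.
    by rewrite ler_pdivlMr; [clear -al0 d; lra|pos].
  - set s := Num.min _ _; have : s <= al / (8 * K) by rewrite !ge_min lexx !orbT.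
    by rewrite ler_pdivlMr; [clear -al0 d; lra|pos].
pose r := expR (- s).
have r0 : 0 < r := expR_gt0 _; have r1 : r < 1 := expRN_lt1 s0.
have sg0 := mwidth_gt0 al0 r0 r1; set sg := mwidth al r in sg0.
pose L := cst_c * (4 * al * (n%:R + 1 / 2)).
have L0 : 0 < L by rewrite /L; apply: mulr_gt0 => //; apply: mulr_gt0; [pos|rewrite ltr_wpDl].
pose P := 4 * al ^+ 2 * (al + L) * X0.
have Pp : 0 < P by rewrite /P; pos.
pose Q := (32 * al * C + 1) * D0.
have Qp : 0 < Q by rewrite /Q; apply: mulr_gt0 => //; apply: ltr_wpDl => //; pos.
pose h2 := Num.min 1 (Num.min (1 / (2 * (al + L))) (al / (4 * P))).
have h2p : 0 < h2.
  by rewrite !lt_min; apply/and3P; split; rewrite ?ltr01// divr_gt0// mulr_gt0// addr_gt0.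
pose h1 := Num.min h2 (sg * Num.min 1 (al / (8 * Q))).
have h1p : 0 < h1.
  rewrite lt_min h2p/= mulr_gt0// lt_min ltr01/= divr_gt0// mulr_gt0//.
exists h1 => // h h0 hh m F ev evl FP Find.
have hh2 : h <= h2 by apply: le_trans hh _; rewrite ge_min lexx.
have hsg : h <= sg * Num.min 1 (al / (8 * Q)) by apply: le_trans hh _; rewrite ge_min lexx orbT.
have h11 : h <= 1 by apply: le_trans hh2 _; rewrite ge_min lexx.
have hsq : h ^+ 2 <= h by rewrite expr2 ger_pMl.
have h2p' : 0 < h ^+ 2 by rewrite exprn_gt0.
have hAL : h ^+ 2 * (al + L) <= 1 / 2.
  have : h <= 1 / (2 * (al + L)) by apply: le_trans hh2 _; rewrite !ge_min lexx orbT.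
  have aL : 0 < al + L by rewrite addr_gt0.
  rewrite ler_pdivlMr; last by pos.
  move=> H.
  by have := ler_wpM2r (ltW aL) hsq; move: H; clear -al0 d; lra.
have hP : h ^+ 2 * P <= al / 4.
  have : h <= al / (4 * P) by apply: le_trans hh2 _; rewrite !ge_min lexx !orbT.
  rewrite ler_pdivlMr; last by pos.
  move=> H.
  by have := ler_wpM2r (ltW Pp) hsq; move: H; clear -al0 d; lra.
have [eta etaE] : exists eta, eta = h / sg by eexists.
have eta0 : 0 < eta by rewrite etaE divr_gt0.
have etam : eta <= Num.min 1 (al / (8 * Q)) by rewrite etaE ler_pdivrMr// mulrC.
have eta1 : eta <= 1 by apply: le_trans etam _; rewrite ge_min lexx.
have etaQ : eta * Q <= al / 8.
  have : eta <= al / (8 * Q) by apply: le_trans etam _; rewrite ge_min lexx orbT.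
  by rewrite ler_pdivlMr; [clear -al0 d; lra|pos].
have hs : h <= sg by move: eta1; rewrite etaE ler_pdivrMr// mul1r.
(* The gap [5/4 al] of [sharp_gap_real], less the localization error [al / 8], still exceeds the
   [al] asked for here. *)
apply: (@count_le R d al al0 h r Rr C _ (cst_c * h ^+ 2 * al) n m F ev h0 r0 r1 Rr0 C0 _ hs HC _ evl FP Find).
  by rewrite !mulr_gt0.
move=> x; rewrite mehler_decayE -m0E RrE mwidth_sqr// -/sg -etaE.
have [co0 [co1 [coX coz]]] := cos_tht_bounds x Rr0.
set co := cos _ ^+ 2 in co0 co1 coX coz *; rewrite RrE in coX coz.
set X := tnorm x ^+ 2 in coX coz *; have Xp : 0 <= X := sqr_ge0 _.
have /andP[q1 q2] := mq_bounds al0 s0 s8; rewrite -/r in q1 q2.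
have q0 : 0 < mq al r := mq_gt0 al0 r0 r1.
have bb := mb_bound al0 s0 s8; rewrite -/r in bb.
have b0 : 0 < mb al r := mb_gt0 al0 r0 r1.
pose ce := 1 + C * eta.
have ce1 : 1 <= ce by rewrite lerDl mulr_ge0// ltW.
have ce0 : 0 < ce := lt_le_trans ltr01 ce1.
have [kp kpE] : exists kp, kp = 4 * (mq al r * s) / ce by eexists.
have d2 : 0 < d%:R + 2 :> R by rewrite ltr_wpDl.
have eta2 : eta ^+ 2 = h ^+ 2 * (2 * mq al r).
  by rewrite etaE expr_div_n mwidth_sqr// invrK.
have vtE : eta ^+ 2 / ((d%:R + 2) * (1 + C * eta)) = cst_c * h ^+ 2 * (kp / s).
  rewrite eta2 kpE /cst_c -/ce; move: (mq al r) q0 => q q0'; field.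
  by rewrite !gt_eqF.
rewrite vtE.
have [lam lamD] : exists lam, lam = 1 - cst_c * h ^+ 2 * (4 * al * (n%:R + 1 / 2)) by eexists.
have lamE : lam = 1 - h ^+ 2 * L by rewrite lamD /L; ring.
have lam0 : 0 <= lam by rewrite lamE; move: hAL; have := mulr_ge0 (ltW h2p') (ltW a0); clear -al0 d; lra.
have lam1 : lam <= 1 by rewrite lamE; have := mulr_ge0 (ltW h2p') (ltW L0); clear -al0 d; lra.
rewrite -lamD.
have [dl dlE] : exists dl, dl = h ^+ 2 * (al + L) by eexists.
have ah : al * h ^+ 2 <= 1 by move: hAL; have := mulr_ge0 (ltW h2p') (ltW L0); clear -al0 d; lra.
have vge := vh_ge al0 h0 x ah; rewrite -/X -/cst_c in vge.
have bv0 := bv_gt0 d h0.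
have wge : lam * (1 + cst_c * h ^+ 2 * (4 * al ^+ 2 * (1 - al * h ^+ 2) * X - 2 * d%:R * al)) <=
   lam * (vh al h x / bv d h).
  by apply: ler_wpM2l => //; rewrite ler_pdivlMr// mulrC.
have lw : cst_c * h ^+ 2 * (4 * al ^+ 2 * (1 - dl) * X - 2 * d%:R * al - 4 * al * (n%:R + 1 / 2)) <=
    lam * (vh al h x / bv d h) - 1.
  apply: le_trans (_ : lam * (1 + cst_c * h ^+ 2 * (4 * al ^+ 2 * (1 - al * h ^+ 2) * X - 2 * d%:R * al)) - 1 <= _); last first.
    by rewrite lerD2r.
  have -> : lam * (1 + cst_c * h ^+ 2 * (4 * al ^+ 2 * (1 - al * h ^+ 2) * X - 2 * d%:R * al)) - 1 =
    cst_c * h ^+ 2 * (lam * (1 - al * h ^+ 2) * (4 * al ^+ 2 * X) - lam * (2 * d%:R * al) - 4 * al * (n%:R + 1 / 2)).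
    have key (l t q : R) : l - 1 = - t -> l * (1 + cst_c * h ^+ 2 * q) - 1 = cst_c * h ^+ 2 * (l * q) - t.
      by move=> e; rewrite mulrDr mulr1 addrAC e; ring.
    rewrite (key _ (cst_c * h ^+ 2 * (4 * al * (n%:R + 1 / 2)))); last by rewrite lamD; ring.
    ring.
  apply: ler_wpM2l; first by pos.
  have g1 : 1 - dl <= lam * (1 - al * h ^+ 2).
    rewrite dlE lamE.
    have : 0 <= (h ^+ 2 * L) * (al * h ^+ 2) by pos.
    by clear -al0 d; lra.
  have g2 : 0 <= 4 * al ^+ 2 * X by pos.
  have g3 := ler_wpM2r g2 g1.
  have g4 : lam * (2 * d%:R * al) <= 2 * d%:R * al.
    by apply: ler_piMl => //; pos.
  by move: g3 g4; clear -al0 d; lra.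
have Ceta0 : 0 <= C * eta by pos.
have [kp0 kpb kp8] := kp_bounds s0 s8 Ceta0 q1 q2.
rewrite -/ce -kpE in kp0 kpb kp8.
have m2 : 0 < m0 ^+ 2 by rewrite exprn_gt0.
have R2E : al * R2 = 16 * (m0 ^+ 2 + m0 + d%:R) by rewrite R2D mulrC divfK// gt_eqF.
have g := @sharp_gap_real m0 0 X co kp dl s (2 * mb al r) X0 D0 (4 * al * (8 * s + C * eta)) s0 Xp.
have {}g : 5 / 4 * al <= 4 * al ^+ 2 * (1 - dl) * X - 4 * al * m0 + 2 * al + kp / s * (co * (1 - expR (- (s * m0 - 2 * mb al r * X)))).
  apply: g => //.
  - by apply/andP.
  - by pos.
  - by move: s8; clear -al0 d; lra.
  - by apply/andP; split; [rewrite dlE; pos|rewrite dlE].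
  - by rewrite X0E; move: R2E m2 m0p dR; clear -al0 d; lra.
  - exact: ltW.
  - by rewrite X0E.
  - by rewrite D0E.
  - exact: (cm_bound m0p dR R2p Xp R2E co1 coX).
  - by rewrite dlE; move: hP; rewrite /P; clear -al0 d; lra.
  - have u1 : 0 <= eta * D0 by pos.
    have u2 : 0 <= al * (C * eta) * D0 by pos.
    by move: sK etaQ u1 u2; rewrite /K /Q; clear -al0 d; lra.
have h3 : d%:R / R2 <= al / 8.
  rewrite ler_pdivrMr// -mulrA [X in _ <= X](_ : _ = al * R2 / 8); last by ring.
  by rewrite R2E; move: m2 m0p dR; clear -al0 d; lra.
(* The energy splits into the constant term of the potential, the half-integer level and a surplus
   [2 * al]. *)
have mE : 4 * al * m0 = 2 * d%:R * al + 4 * al * (n%:R + 1 / 2) + 2 * al.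
  by rewrite m0E -natr1; field.
have E3 : cst_c * h ^+ 2 * (kp / s) * (d%:R * (2 * mq al r)^-1 / (2 * R2)) <= cst_c * h ^+ 2 * (d%:R / R2).
  rewrite -[X in X <= _]mulrA; apply: ler_wpM2l; first by pos.
  have -> : kp / s * (d%:R * (2 * mq al r)^-1 / (2 * R2)) = (d%:R / R2) / ce.
    rewrite kpE; move: (mq al r) q0 => q q0'; field; by rewrite !gt_eqF.
  by rewrite ler_pdivrMr// ler_peMr//; pos.
have ch : 0 <= cst_c * h ^+ 2 by pos.
have g' := ler_wpM2l ch g.
have h3' := ler_wpM2l ch h3.
move: lw g' h3' E3; rewrite mE.
move: (lam * _ - 1) (kp / s) (1 - expR _) (d%:R * (2 * mq al r)^-1 / (2 * R2)) (d%:R / R2) => t1 t2 t3 t4 t5.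
move: ch; move: (cst_c * h ^+ 2) => t6 ch; have := mulr_ge0 ch (ltW a0).
by clear -al0 d; lra.
Qed.
End SharpCount.

(** * Polynomial bound on the number of eigenvalues near 1 *)

Section WeylCount.
Variables (R : realType) (d : nat) (al : R).
Hypothesis al0 : 0 < al.
Notation pt := (d.-tuple R).
Notation vspc := (lsq R d).

(** Constants are given away here. Beyond [X = B * tau] the potential outweighs the energy; below,
    the cut-off and the factor [ex] are both at least 1/2, and the Mehler gain [ks] is proportional
    to [tau]. *)
Lemma weyl_gap_real (c h2 E X co ks t4 lam lw ex B R2 tau k0 : R) :
  0 < c -> 0 < h2 -> 0 <= X -> E = tau * h2 -> h2 <= E -> 0 < k0 ->
  c * h2 * (2 * al ^+ 2 * X) - (1 + al) * E <= lw ->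
  4 + al <= 2 * c * al ^+ 2 * B -> R2 = 2 * B * tau -> 0 < B -> 0 < tau ->
  7 / 4 * al * tau / k0 <= ks -> k0 = c * al / (8 * (3 + al)) ->
  0 <= co -> 1 - X / R2 <= co -> (co = 0 \/ 1 / 2 <= ex) ->
  c * h2 * ks * t4 <= E ->
  E <= lw + c * h2 * ks * (co * ex - t4).
Proof.
move=> c0 h20 X0 EE hE k00 hlw BE R2E B0 tau0 hks kE co0 coX hex ht4; have a0 := al0.
have E0 : 0 < E by rewrite EE mulr_gt0.
have a2 : 0 < al ^+ 2 by rewrite exprn_gt0.
have R20 : 0 < R2 by rewrite R2E; pos.
have ks0 : 0 <= ks by apply: le_trans hks; pos.
have cex : 0 <= co * ex by case: hex => [->|h]; [rewrite mul0r|apply: mulr_ge0 => //; lra].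
have chk : 0 <= c * h2 * ks by pos.
have aE : 0 < al * E by pos.
rewrite mulrBr; have := mulr_ge0 chk cex => t0.
have [XB|XB] := leP (B * tau) X.
  have : c * h2 * (2 * al ^+ 2 * (B * tau)) <= c * h2 * (2 * al ^+ 2 * X).
    by apply: ler_wpM2l; [pos|apply: ler_wpM2l => //; pos].
  have -> : c * h2 * (2 * al ^+ 2 * (B * tau)) = (2 * c * al ^+ 2 * B) * E by rewrite EE; ring.
  by have := ler_wpM2r (ltW E0) BE; lra.
have co2 : 1 / 2 <= co.
  apply: le_trans coX; have : X / R2 <= 1 / 2.
    by rewrite ler_pdivrMr// R2E; lra.
  lra.
have ex2 : 1 / 2 <= ex by case: hex => // ez; lra.
have ce4 : 1 / 4 <= co * ex.
  apply: le_trans (_ : 1 / 2 * (1 / 2) <= _); first by lra.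
  by apply: ler_pM.
have k3 : 14 * (3 + al) * E <= c * h2 * ks.
  apply: le_trans (_ : c * h2 * (7 / 4 * al * tau / k0) <= _); last by apply: ler_wpM2l => //; pos.
  rewrite EE kE; have a3 : 0 < 3 + al by lra.
  by rewrite le_eqVlt; apply/orP; left; apply/eqP; field; rewrite !gt_eqF.
have k4 : 14 * (3 + al) * E * (1 / 4) <= c * h2 * ks * (co * ex).
  by apply: ler_pM => //; pos; lra.
have X2 : 0 <= c * h2 * (2 * al ^+ 2 * X) by pos.
by move: k4; lra.
Qed.

(** Scales: [tau = 1 + lam / h^2] is the energy, the squared localization radius and the degree [n]
    are of order [tau], the time [s] is of order [1 / tau]. The Gaussian width is then of order
    [tau^(-1/2)], and it stays above [h] because [h^2 tau = lam + h^2] is at most [E1]; hence [de]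
    and [h1]. *)
Theorem weyl_count : exists (de Cw h1 : R), [/\ 0 < de, 0 < Cw, 0 < h1 &
  forall h (h0 : 0 < h), h <= h1 -> forall lam : R, 0 <= lam <= de ->
  forall (m : nat) (F : 'I_m -> vspc) (ev : 'I_m -> R),
  (forall i, 1 - lam <= ev i) ->
  (forall i, eigvec (@lip R d) (Tw al0 h0) (ev i) (F i)) ->
  independent (@lip R d) F -> m%:R <= Cw * (1 + lam / h ^+ 2) ^+ d].
Proof.
have a0 := al0; have c0 := @cst_c_gt0 R d; have a2 : 0 < al ^+ 2 by rewrite exprn_gt0.
have [C C0 HC] := gauss_ball_form R d.
have d2 : 0 < d%:R + 2 :> R by rewrite ltr_wpDl.
have cE : @cst_c R d = (2 * (d%:R + 2))^-1 by [].
have cd : @cst_c R d * d%:R <= 1 / 2.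
  rewrite cE mulrC ler_pdivrMr; last by pos.
  by rewrite mulrA mul1r mulVf// mul1r lerDl.
have c4 : @cst_c R d <= 1 / 4.
  rewrite cE -[_^-1]mul1r ler_pdivrMr; last by pos.
  by have : 0 <= d%:R :> R by []; lra.
move: (@cst_c R d) cE c0 cd c4 => c cE c0 cd c4.
have a3 : 0 < 3 + al by lra.
have [k0 k0E] : exists k0, k0 = c * al / (8 * (3 + al)) by eexists.
have k00 : 0 < k0 by rewrite k0E; pos.
have k08 : k0 <= 1 / 8.
  rewrite k0E ler_pdivrMr; last by pos.
  have := ler_wpM2r (ltW a0) c4; lra.
have [B BD] : exists B, B = (4 + al) / (2 * c * al ^+ 2) + 1 by eexists.
have a4 : 0 < 4 + al by lra.
have B1 : 1 <= B by rewrite BD lerDr; pos.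
have B0 : 0 < B by lra.
have BE : 4 + al <= 2 * c * al ^+ 2 * B.
  have -> : 2 * c * al ^+ 2 * B = 4 + al + 2 * c * al ^+ 2 by rewrite BD; field; rewrite !gt_eqF.
  by rewrite lerDl; pos.
(* Chosen so that [s * (tau * M) = 1 + 8 * al * s * R2]: with [n.+1 > tau * M], the decay exponent
   is at least 1 on the region [X < 4 * R2], outside of which the cut-off vanishes. *)
have [M ME] : exists M, M = (1 + 16 * al * k0 * B) / k0 by eexists.
have M0 : 0 < M by rewrite ME; pos.
have C1 : 0 < 1 + C by lra.
(* The condition containing [(1 + C) ^+ 2] yields [eta * (1 + C) <= 1]: both [h <= sigma] and a
   comparison factor [1 + C * eta <= 2]. *)
have [E1 [E10 E1a E1b E1c]] : exists E1, [/\ 0 < E1, E1 <= 1 / (2 * (1 + al)), E1 * (4 * al * (1 + C) ^+ 2) <= k0 & E1 <= 1].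
  exists (Num.min 1 (Num.min (1 / (2 * (1 + al))) (k0 / (4 * al * (1 + C) ^+ 2)))); split.
  - by rewrite !lt_min ltr01/=; apply/andP; split; pos.
  - by rewrite !ge_min lexx orbT.
  - by rewrite -ler_pdivlMr; [rewrite !ge_min lexx !orbT|pos].
  - by rewrite ge_min lexx.
exists (E1 / 2), ((M + 1) ^+ d), (E1 / 2); split.
- by pos.
- by rewrite exprn_gt0// addr_gt0.
- by pos.
move=> h h0 hh lam /andP[lam0 lamd] m F ev evl FP Find.
have h1 : h <= 1 by lra.
have h20 : 0 < h ^+ 2 by rewrite exprn_gt0.
have hsq : h ^+ 2 <= h by rewrite expr2 ger_pMl.
have [tau tauE] : exists tau, tau = 1 + lam / h ^+ 2 by eexists.
have tau1 : 1 <= tau by rewrite tauE lerDl divr_ge0// ltW.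
have tau0 : 0 < tau := lt_le_trans ltr01 tau1.
have [E EE] : exists E, E = tau * h ^+ 2 by eexists.
have Elh : E = lam + h ^+ 2 by rewrite EE tauE; field; rewrite gt_eqF.
have EE1 : E <= E1 by move: lamd hh hsq; rewrite Elh; clear -al0 d; lra.
have hE1 : h ^+ 2 <= E1 by move: EE1 lam0; rewrite Elh; clear -al0 d; lra.
have E0 : 0 < E by rewrite EE mulr_gt0.
have [s sE] : exists s, s = k0 / tau by eexists.
have s0 : 0 < s by rewrite sE; pos.
have al1 : 0 <= 1 + al by move: a0; clear -al0 d; lra.
have s8 : s <= 1 / 8.
  by apply: le_trans k08; rewrite sE ler_pdivrMr// ler_peMr// ltW.
have s8m : 0 <= 1 / 8 - s by rewrite subr_ge0.
have s1m : 0 <= 1 - s by move: s8; clear -al0 d; lra.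
pose r := expR (- s).
have r0 : 0 < r := expR_gt0 _; have r1 : r < 1 := expRN_lt1 s0.
have sg0 := mwidth_gt0 al0 r0 r1; set sg := mwidth al r in sg0.
have /andP[q1 q2] := mq_bounds al0 s0 s8; rewrite -/r in q1 q2.
have q0 : 0 < mq al r := mq_gt0 al0 r0 r1.
have bb := mb_bound al0 s0 s8; rewrite -/r in bb.
have b0 : 0 < mb al r := mb_gt0 al0 r0 r1.
have [eta etaE] : exists eta, eta = h / sg by eexists.
have eta0 : 0 < eta by rewrite etaE divr_gt0.
have eta2 : eta ^+ 2 = h ^+ 2 * (2 * mq al r).
  by rewrite etaE expr_div_n mwidth_sqr// invrK.
have etaC : eta * (1 + C) <= 1.
  rewrite -(@ler_pXn2r _ 2)// ?nnegrE; [|by pos|by []].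
  rewrite exprMn eta2 expr1n.
  have k1 : mq al r * k0 <= 2 * al * tau.
    have -> : k0 = s * tau by rewrite sE divfK// gt_eqF.
    rewrite mulrA; apply: ler_wpM2r; first exact: ltW.
    apply: le_trans q2 _; have : 0 <= al * (1 / 8 - s) by pos.
    by clear -al0 d; lra.
  have k2 : h ^+ 2 * (2 * mq al r) * (1 + C) ^+ 2 * k0 <= 1 * k0.
    rewrite mul1r; apply: le_trans E1b.
    have -> : h ^+ 2 * (2 * mq al r) * (1 + C) ^+ 2 * k0 = (2 * h ^+ 2 * (1 + C) ^+ 2) * (mq al r * k0) by ring.
    apply: le_trans (ler_wpM2l _ k1) _; first by pos.
    have -> : 2 * h ^+ 2 * (1 + C) ^+ 2 * (2 * al * tau) = E * (4 * al * (1 + C) ^+ 2) by rewrite EE; ring.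
    by apply: ler_wpM2r => //; pos.
  by move: k2; rewrite ler_pM2r.
have Ceta0 : 0 <= C * eta by pos.
have Ceta1 : C * eta <= 1 by move: etaC; rewrite mulrDr mulr1 (mulrC eta); move: eta0; clear -al0 d; lra.
have eta1 : eta <= 1 by move: etaC Ceta0; rewrite mulrDr mulr1 (mulrC eta); clear -al0 d; lra.
have hs : h <= sg by move: eta1; rewrite etaE ler_pdivrMr// mul1r.
have [R2 R2E] : exists R2, R2 = 2 * B * tau by eexists.
have R20 : 0 < R2 by rewrite R2E; pos.
pose Rr := Num.sqrt R2.
have Rr0 : 0 < Rr by rewrite sqrtr_gt0.
have RrE : Rr ^+ 2 = R2 by rewrite sqr_sqrtr// ltW.
(* Then [n.+1 <= tau * (M + 1)], which explains [Cw = (M + 1) ^ d]. *)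
pose n := Num.truncn (tau * M).
have /andP[n1 n2] : n%:R <= tau * M < n.+1%:R by apply: truncn_itv; pos.
have mn : (m <= ndeg d n)%N.
  apply: (@count_le R d al al0 h r Rr C (1 - lam) E n m F ev h0 r0 r1 Rr0 C0 E0 hs HC _ evl FP Find).
  move=> x; rewrite mehler_decayE RrE mwidth_sqr// -/sg -etaE.
  have [co0 [co1 [coX coz]]] := cos_tht_bounds x Rr0.
  set co := cos _ ^+ 2 in co0 co1 coX coz *; rewrite RrE in coX coz.
  set X := tnorm x ^+ 2 in coX coz *; have Xp : 0 <= X := sqr_ge0 _.
  have [ce ceE] : exists ce, ce = 1 + C * eta by eexists.
  have ce0 : 0 < ce by rewrite ceE ltr_wpDr.
  have [ks ksE] : exists ks, ks = 4 * mq al r / ce by eexists.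
  have vtE : eta ^+ 2 / ((d%:R + 2) * (1 + C * eta)) = c * h ^+ 2 * ks.
    rewrite eta2 ksE cE -ceE; move: (mq al r) => q; field.
    by rewrite !gt_eqF.
  rewrite vtE.
  have ah : al * h ^+ 2 <= 1.
    move: E1a; rewrite ler_pdivlMr; last by pos.
    move=> E1a; have : h ^+ 2 * (1 + al) <= E1 * (1 + al) by exact: ler_wpM2r.
    by move: E1a h20; clear -al0 d; lra.
  have vge := vh_ge al0 h0 x ah; rewrite -/X -cE in vge.
  have bv0 := bv_gt0 d h0.
  have lam1 : 0 <= 1 - lam by move: lamd E1c E10; clear -al0 d; lra.
  have wge : (1 - lam) * (1 + c * h ^+ 2 * (4 * al ^+ 2 * (1 - al * h ^+ 2) * X - 2 * d%:R * al)) <=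
     (1 - lam) * (vh al h x / bv d h).
    by apply: ler_wpM2l => //; rewrite ler_pdivlMr// mulrC.
  apply: (@weyl_gap_real c (h ^+ 2) E X co ks _ lam _ _ B R2 tau k0) => //.
  - by move: Elh lam0; clear -al0 d; lra.
  - have lah : 1 / 2 <= (1 - lam) * (1 - al * h ^+ 2).
      have u1 : E * (1 + al) <= 1 / 2.
        apply: le_trans (_ : E1 * (1 + al) <= _); first by exact: ler_wpM2r.
        by move: E1a; rewrite ler_pdivlMr; [clear -al0 d; lra|pos].
      have u2 : 0 <= lam * (al * h ^+ 2) by pos.
      have u3 : 0 <= al * lam by pos.
      by move: u1 u2 u3 h20; rewrite Elh; clear -al0 d; lra.
    have g2 : 0 <= c * h ^+ 2 * (4 * al ^+ 2 * X) by pos.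
    have g3 := ler_wpM2r g2 lah.
    have g4 : (1 - lam) * (2 * (c * d%:R) * al * h ^+ 2) <= al * h ^+ 2.
      apply: le_trans (_ : 1 * (al * h ^+ 2) <= _); last by rewrite mul1r.
      apply: ler_pM => //; [by pos|by rewrite gerBl|].
      rewrite -mulrA; apply: ler_piMl; first by pos.
      by move: cd; clear -al0 d; lra.
    have g5 : 0 <= al * lam by pos.
    rewrite lerBrDr; apply: le_trans wge.
    by move: g3 g4 g5 h20; rewrite Elh; clear -al0 d; lra.
  - rewrite ksE ler_pdivlMr// mulrAC ler_pdivrMr//.
    have e1 : mq al r * k0 = (mq al r * s) * tau by rewrite sE; field; rewrite gt_eqF.
    have e2 : 7 / 8 * al <= mq al r * s.
      apply: le_trans q1; have : 0 <= al * (1 / 8 - s) by pos.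
      by clear -al0 d; lra.
    have e3 := ler_wpM2r (ltW tau0) e2.
    have e4 : 7 / 4 * al * tau * ce <= 7 / 4 * al * tau * 2.
      by apply: ler_wpM2l; [pos|rewrite ceE; move: Ceta1; clear -al0 d; lra].
    rewrite -(mulrA 4) e1; move: e3 e4; clear -al0 d; lra.
  - have [X4|X4] := leP (4 * R2) X; first by left; exact: coz.
    right; suff : 1 <= s * (d%:R / 2 + n.+1%:R) - 2 * mb al r * X.
      move=> y1; have : expR (- (s * (d%:R / 2 + n.+1%:R) - 2 * mb al r * X)) <= expR (-1) by rewrite ler_expR lerN2.
      have : expR (-1 : R) <= 1 / 2.
        rewrite expRN -[_^-1]mul1r; apply: ler_wpM2l => //; rewrite lef_pV2 ?posrE ?expR_gt0//.
        by have := @expR_ge1Dx R 1; clear -al0 d; lra.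
      by clear -al0 d; lra.
    have v1 : 2 * mb al r * X <= 2 * al * s * (4 * R2).
      apply: ler_pM => //; [by pos| |exact: ltW].
      apply: le_trans bb _; have : 0 <= al * s * (1 - s) by pos.
      by clear -al0 d; lra.
    have v2 : s * (tau * M) <= s * (d%:R / 2 + n.+1%:R).
      apply: ler_wpM2l; first exact: ltW.
      by apply: le_trans (ltW n2) _; rewrite lerDr divr_ge0.
    have v3 : s * (tau * M) = 1 + 2 * al * s * (4 * R2).
      by rewrite sE ME R2E; field; rewrite !gt_eqF.
    by move: v1 v2; rewrite v3; clear -al0 d; lra.
  - have -> : c * h ^+ 2 * ks * (d%:R / (2 * mq al r) / (2 * R2)) = c * d%:R * h ^+ 2 / (R2 * ce).
      rewrite ksE; move: (mq al r) q0 => q q0; field; by rewrite !gt_eqF.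
    have R21 : 1 <= R2.
      rewrite R2E; apply: le_trans tau1 _; apply: ler_peMl; first exact: ltW.
      by move: B1; clear -al0 d; lra.
    rewrite ler_pdivrMr; last by pos.
    have w1 : c * d%:R * h ^+ 2 <= h ^+ 2 by apply: ler_piMl; [exact: ltW|move: cd; clear -al0 d; lra].
    apply: le_trans w1 _; rewrite Elh; apply: le_trans (_ : h ^+ 2 * 1 <= _); first by rewrite mulr1.
    apply: ler_pM => //; [exact: ltW|by rewrite lerDr|].
    apply: le_trans R21 _; apply: ler_peMr; first exact: ltW.
    by rewrite ceE lerDl.
apply: (@le_trans _ _ ((ndeg d n)%:R)); first by rewrite ler_nat.
apply: (@le_trans _ _ ((n.+1 ^ d)%N%:R)); first by rewrite ler_nat ndeg_le.
rewrite natrX -exprMn lerXn2r ?nnegrE ?ler0n//; first by rewrite -tauE mulr_ge0 ?(ltW tau0)// addr_ge0// ltW.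
rewrite -tauE -natr1; move: n1 tau1; clear -al0 d; lra.
Qed.
End WeylCount.

(** * Quasimodes *)

Section EvenTaylor.
Variable R : realType.

Lemma mvt_bound (F F' : R -> R) (K z : R) : (forall t, is_derive t (1 : R) F (F' t)) -> F 0 = 0 ->
  0 <= z -> (forall t, 0 <= t <= z -> `|F' t| <= K) -> `|F z| <= K * z.
Proof.
move=> dF F0 z0 FK; move: z0; rewrite le_eqVlt => /orP[/eqP z0|z0].
  by rewrite -z0 F0 normr0 mulr0.
have [|c cz] := @MVT R F F' 0 z z0 (fun x _ => dF x).
  apply: continuous_subspaceT => x; apply: differentiable_continuous; apply/derivable1_diffP.
  by have [] := dF x.
rewrite F0 !subr0 => ->; rewrite normrM (gtr0_norm z0); apply: ler_wpM2r; first exact: ltW.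
by apply: FK; move: cz; rewrite in_itv/= => /andP[c0 c1]; rewrite !ltW.
Qed.

Lemma is_derive_shift (f f' : R -> R) x t : (forall y, is_derive y (1 : R) f (f' y)) ->
  is_derive t (1 : R) (fun s => f (x + s)) (f' (x + t)).
Proof.
move=> df; have -> : (fun s => f (x + s)) = f \o horner (x%:P + 'X).
  by apply/funext => s; rewrite /= !hornerE.
have h := df (x%:P + 'X).[t].
apply: trigger_derive (is_derive1_comp h (is_derive_poly (x%:P + 'X) t)) _.
by rewrite derivD derivC derivX add0r !hornerE ?mulr1.
Qed.

Lemma is_derive_reflect (f f' : R -> R) x t : (forall y, is_derive y (1 : R) f (f' y)) ->
  is_derive t (1 : R) (fun s => f (x - s)) (- f' (x - t)).
Proof.
move=> df; have -> : (fun s => f (x - s)) = f \o horner (x%:P - 'X).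
  by apply/funext => s; rewrite /= !hornerE.
have h := df (x%:P - 'X).[t].
apply: trigger_derive (is_derive1_comp h (is_derive_poly (x%:P - 'X) t)) _.
by rewrite derivB derivC derivX sub0r !hornerE mulrN1.
Qed.

(** Four successive mean value estimates starting from the fourth derivative, odd orders cancelling
    by symmetry. The constant is far from optimal, but only the order [z ^ 4] matters. *)
Lemma taylor_even (f f1 f2 f3 f4 : R -> R) (x M z : R) :
  (forall y, is_derive y (1 : R) f (f1 y)) -> (forall y, is_derive y (1 : R) f1 (f2 y)) ->
  (forall y, is_derive y (1 : R) f2 (f3 y)) -> (forall y, is_derive y (1 : R) f3 (f4 y)) ->
  (forall t, `|t| <= 1 -> `|f4 (x + t)| <= M) -> 0 <= z <= 1 ->
  `|f (x + z) + f (x - z) - 2 * f x - z ^+ 2 * f2 x| <= 2 * M * z ^+ 4.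
Proof.
move=> d0 d1 d2 d3 fM /andP[z0 z1].
have S3 t : 0 <= t <= z -> `|f3 (x + t) - f3 (x - t)| <= 2 * M * z.
  move=> /andP[t0 tz]; apply: le_trans (_ : 2 * M * t <= _).
    apply: (@mvt_bound (fun s => f3 (x + s) - f3 (x - s)) (fun s => f4 (x + s) + f4 (x - s))) => //.
    - move=> s; apply: trigger_derive (is_deriveB (is_derive_shift x s d3) (is_derive_reflect x s d3)) _.
      by rewrite opprK.
    - by rewrite addr0 subr0 subrr.
    - move=> s /andP[s0 st]; apply: le_trans (ler_normD _ _) _.
      have s1 : `|s| <= 1 by rewrite ger0_norm//; lra.
      have s2 : `|- s| <= 1 by rewrite normrN.
      by have := fM _ s1; have := fM _ s2; lra.
  apply: ler_wpM2l => //; have : `|0 : R| <= 1 by rewrite normr0.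
  by move=> /fM; have := normr_ge0 (f4 (x + 0)); lra.
have S2 t : 0 <= t <= z -> `|f2 (x + t) + f2 (x - t) - 2 * f2 x| <= 2 * M * z * z.
  move=> /andP[t0 tz]; apply: le_trans (_ : 2 * M * z * t <= _).
    apply: (@mvt_bound (fun s => f2 (x + s) + f2 (x - s) - 2 * f2 x) (fun s => f3 (x + s) - f3 (x - s))) => //.
    - move=> s.
      apply: trigger_derive (is_deriveB (is_deriveD (is_derive_shift x s d2) (is_derive_reflect x s d2)) (is_derive_cst (2 * f2 x) s 1)) _.
      by rewrite subr0.
    - by rewrite addr0 subr0; ring.
    - by move=> s /andP[s0 st]; apply: S3; rewrite s0 (le_trans st tz).
  apply: ler_wpM2l => //; apply: le_trans (S3 0 _); first exact: normr_ge0.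
  by rewrite lexx z0.
have S1 t : 0 <= t <= z -> `|f1 (x + t) - f1 (x - t) - 2 * t * f2 x| <= 2 * M * z * z * z.
  move=> /andP[t0 tz]; apply: le_trans (_ : 2 * M * z * z * t <= _).
    apply: (@mvt_bound (fun s => f1 (x + s) - f1 (x - s) - 2 * s * f2 x) (fun s => f2 (x + s) + f2 (x - s) - 2 * f2 x)) => //.
    - move=> s.
      have hp : is_derive s (1 : R) (fun s => 2 * s * f2 x) (2 * f2 x).
        have -> : (fun s => 2 * s * f2 x) = horner ((2 * f2 x) *: 'X) by apply/funext => u; rewrite !hornerE; ring.
        by apply: trigger_derive (is_derive_poly _ s) _; rewrite derivZ derivX !hornerE ?mulr1.
      apply: trigger_derive (is_deriveB (is_deriveB (is_derive_shift x s d1) (is_derive_reflect x s d1)) hp) _.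
      by rewrite opprK.
    - by rewrite addr0 subr0; ring.
    - by move=> s /andP[s0 st]; apply: S2; rewrite s0 (le_trans st tz).
  apply: ler_wpM2l => //; apply: le_trans (S2 0 _); first exact: normr_ge0.
  by rewrite lexx z0.
have -> : 2 * M * z ^+ 4 = 2 * M * z * z * z * z by ring.
apply: (@mvt_bound (fun s => f (x + s) + f (x - s) - 2 * f x - s ^+ 2 * f2 x) (fun s => f1 (x + s) - f1 (x - s) - 2 * s * f2 x)) => //.
- move=> s.
  have hp : is_derive s (1 : R) (fun s => s ^+ 2 * f2 x) (2 * s * f2 x).
    have -> : (fun s => s ^+ 2 * f2 x) = horner (f2 x *: 'X^2) by apply/funext => u; rewrite hornerZ hornerXn mulrC.
    by apply: trigger_derive (is_derive_poly _ s) _; rewrite derivZ derivXn hornerZ hornerMn hornerXn expr1 -mulr_natl; ring.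
  apply: trigger_derive (is_deriveB (is_deriveB (is_deriveD (is_derive_shift x s d0) (is_derive_reflect x s d0)) (is_derive_cst (2 * f x) s 1)) hp) _.
  by rewrite subr0.
- by rewrite addr0 subr0; ring.
Qed.

(** Induction on the number of factors; the first-order bound is carried along because the
    second-order step multiplies it by the increment of the factor peeled off. *)
Lemma prod_expand n (a e E M : 'I_n -> R) (hh : R) : 0 <= hh ->
  (forall i, `|a i| <= M i) -> (forall i, `|E i| <= M i) -> (forall i, `|e i| <= hh * M i) ->
  (forall i, `|E i - a i| <= hh * M i) -> (forall i, `|E i - a i - e i| <= hh ^+ 2 * M i) ->
  `|\prod_i E i - \prod_i a i| <= n%:R * hh * \prod_i M i /\
  `|\prod_i E i - \prod_i a i - \sum_i \prod_j (if j == i then e j else a j)| <= n%:R ^+ 2 * hh ^+ 2 * \prod_i M i.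
Proof.
move=> hh0; elim: n a e E M => [|n IH] a e E M aM EM eM dM rM.
  by rewrite !big_ord0 subrr subr0 normr0 expr0n/= !mul0r.
have [I1 I2] := IH (a \o lift ord0) (e \o lift ord0) (E \o lift ord0) (M \o lift ord0)
  (fun i => aM _) (fun i => EM _) (fun i => eM _) (fun i => dM _) (fun i => rM _).
rewrite !big_ord_recl/=.
set PE := \prod_(i < n) E (lift ord0 i); set Pa := \prod_(i < n) a (lift ord0 i); set PM := \prod_(i < n) M (lift ord0 i).
rewrite -/PE -/Pa -/PM in I1 I2.
have PEM : `|PE| <= PM by rewrite normr_prod; apply: ler_prod => i _; rewrite normr_ge0/= EM.
have -> : \sum_(i < n) \prod_(j < n.+1) (if j == lift ord0 i then e j else a j) =
    a ord0 * \sum_(i < n) \prod_(j < n) (if j == i then e (lift ord0 j) else a (lift ord0 j)).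
  rewrite mulr_sumr; apply: eq_bigr => i _; rewrite big_ord_recl/=; congr (_ * _).
move: I2 => /=; set S := \sum_(i < n) _ => I2.
have M0 i : 0 <= M i := le_trans (normr_ge0 _) (aM i).
have PM0 : 0 <= PM := le_trans (normr_ge0 _) PEM.
have nS : n.+1%:R = n%:R + 1 :> R by rewrite -natr1.
have n0 : 0 <= n%:R :> R by [].
split.
  have -> : E ord0 * PE - a ord0 * Pa = (E ord0 - a ord0) * PE + a ord0 * (PE - Pa) by ring.
  apply: le_trans (ler_normD _ _) _; rewrite !normrM nS.
  have := ler_pM (normr_ge0 _) (normr_ge0 _) (dM ord0) PEM.
  have := ler_pM (normr_ge0 _) (normr_ge0 _) (aM ord0) I1; lra.
have -> : E ord0 * PE - a ord0 * Pa - (e ord0 * Pa + a ord0 * S) =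
  (E ord0 - a ord0 - e ord0) * PE + e ord0 * (PE - Pa) + a ord0 * (PE - Pa - S) by ring.
apply: le_trans (ler_normD _ _) _; apply: le_trans (lerD (ler_normD _ _) (lexx _)) _; rewrite !normrM nS.
have t1 := ler_pM (normr_ge0 _) (normr_ge0 _) (rM ord0) PEM.
have t2 := ler_pM (normr_ge0 _) (normr_ge0 _) (eM ord0) I1.
have t3 := ler_pM (normr_ge0 _) (normr_ge0 _) (aM ord0) I2.
have t4 : 0 <= n%:R * (hh ^+ 2 * (M ord0 * PM)) by rewrite mulr_ge0// mulr_ge0 ?sqr_ge0// mulr_ge0.
move: t1 t2 t3 t4; rewrite sqrrD expr1n mulr1; lra.
Qed.

End EvenTaylor.

Section ProductExpansion.
Variables (R : realType) (d : nat) (h : R).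
Hypotheses (h0 : 0 < h) (h1 : h <= 1).
Notation pt := (d.-tuple R).
Notation mu := (vol R d).
Notation B := (fun z : pt => bker h (tnorm z)).
Variables (f : 'I_d -> R -> R) (x : pt) (M : 'I_d -> R).
Hypothesis mf : forall i, measurable_fun [set: R] (f i).
Hypothesis fM : forall i t, `|t| <= 1 -> `|f i (tnth x i + t)| <= M i.

Definition evp i (t : R) : R := (f i (tnth x i + t) + f i (tnth x i - t)) / 2.

Lemma evp_le i t : `|t| <= 1 -> `|evp i t| <= M i.
Proof.
move=> t1; have t2 : `|- t| <= 1 by rewrite normrN.
rewrite /evp normrM (ger0_norm (_ : 0 <= 2^-1))// ler_pdivrMr//.
by apply: le_trans (ler_normD _ _) _; have := fM i t1; have := fM i t2; lra.
Qed.

Lemma measurable_shiftr (g : R -> R) (c s : R) : measurable_fun [set: R] g ->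
  measurable_fun [set: R] (fun t => g (s + c * t)).
Proof.
move=> mg; have m : measurable_fun [set: R] (fun t : R => c * t + s) by exact: measurable_affine.
by have := measurableT_comp mg m; apply: eq_measurable_fun => t _ /=; rewrite addrC.
Qed.

Lemma measurable_evp i : measurable_fun [set: R] (evp i).
Proof.
apply: measurable_funM => //; apply: measurable_funD.
  by have := measurable_shiftr 1 (tnth x i) (mf i); apply: eq_measurable_fun => t _; rewrite mul1r.
by have := measurable_shiftr (-1) (tnth x i) (mf i); apply: eq_measurable_fun => t _; rewrite mulN1r.
Qed.

(** Interpolates from the product of translated factors at [k = 0] to the product of their even
    parts at [k = d]; each step uses one coordinate flip of the ball. *)
Let Phi (k : nat) (z : pt) : R := \prod_(i < d) (if (i < k)%N then evp i (tnth z i) else f i (tnth x i + tnth z i)).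

Let zle (z : pt) i : tnorm z < h -> `|tnth z i| <= 1.
Proof. by move=> zh; apply: le_trans (abs_tnth_le z i) _; apply: le_trans (ltW zh) h1. Qed.

Let Phi_int k : mu.-integrable setT (EFin \o (fun z => B z * Phi k z)).
Proof.
apply: (@ball_integrable R d h h0 _ (\prod_i M i)).
  apply: (measurable_prod_tnth (g := fun i t => if (i < k)%N then evp i t else f i (tnth x i + t))) => i.
  case: (i < k)%N; first exact: measurable_evp.
  by have := measurable_shiftr 1 (tnth x i) (mf i); apply: eq_measurable_fun => t _; rewrite mul1r.
move=> z zh; rewrite normr_prod; apply: ler_prod => i _; rewrite normr_ge0/=.
by case: ifP => _; [apply: evp_le|apply: fM]; exact: zle.
Qed.

Let Phi_step k : (k < d)%N -> \int[mu]_z (B z * Phi k z) = \int[mu]_z (B z * Phi k.+1 z).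
Proof.
move=> kd; pose i0 := Ordinal kd.
have /integrableP[m _] := Phi_int k.
have fl : \int[mu]_z (B z * Phi k z) = \int[mu]_z (B z * Phi k (vflip i0 z)).
  rewrite [in LHS]/Rintegral -(int_vflip i0 m) /Rintegral; congr fine.
  by apply: eq_integral => z _ /=; rewrite tnorm_vflip.
have i2 : mu.-integrable setT (EFin \o (fun z => B z * Phi k (vflip i0 z))).
  apply: (@ball_integrable R d h h0 _ (\prod_i M i)).
    have mP : measurable_fun [set: pt] (Phi k).
      apply: (measurable_prod_tnth (g := fun i t => if (i < k)%N then evp i t else f i (tnth x i + t))) => i.
      case: (i < k)%N; first exact: measurable_evp.
      by have := measurable_shiftr 1 (tnth x i) (mf i); apply: eq_measurable_fun => t _; rewrite mul1r.
    exact: (measurableT_comp mP (@measurable_vflip R d i0)).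
  move=> z zh; have zh' : tnorm (vflip i0 z) < h by rewrite tnorm_vflip.
  rewrite normr_prod; apply: ler_prod => i _; rewrite normr_ge0/=.
  by case: ifP => _; [apply: evp_le|apply: fM]; exact: zle.
transitivity ((\int[mu]_z (B z * Phi k z) + \int[mu]_z (B z * Phi k (vflip i0 z))) / 2).
  by rewrite -fl; field.
rewrite -RintegralD// mulrC -RintegralZl//; last first.
  by have := integrableD measurableT (Phi_int k) i2; apply: eq_integrable => // z _.
apply: eq_Rintegral => z _; rewrite -mulrDr mulrCA; congr (_ * _).
rewrite /Phi (bigD1 i0)//= [in X in _ + X](bigD1 i0)//= [in RHS](bigD1 i0)//= !ltnn ltnSn.
have E1 : \prod_(i < d | i != i0) (if (i < k)%N then evp i (tnth (vflip i0 z) i) else f i (tnth x i + tnth (vflip i0 z) i)) =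
   \prod_(i < d | i != i0) (if (i < k)%N then evp i (tnth z i) else f i (tnth x i + tnth z i)).
  by apply: eq_bigr => i ii; rewrite tnth_mktuple (negPf ii).
have E2 : \prod_(i < d | i != i0) (if (i < k.+1)%N then evp i (tnth z i) else f i (tnth x i + tnth z i)) =
   \prod_(i < d | i != i0) (if (i < k)%N then evp i (tnth z i) else f i (tnth x i + tnth z i)).
  apply: eq_bigr => i ii; rewrite ltnS leq_eqVlt.
  by have -> : ((i : nat) == k) = false by apply/negP => /eqP e; case/negP: ii; apply/eqP/val_inj.
rewrite E1 E2 -mulrDl mulrA tnth_mktuple eqxx /evp; congr (_ * _).
by rewrite mulrC.
Qed.

Lemma ballop_prod_even : ballop h (fun y => \prod_i f i (tnth y i)) x =
  \int[mu]_z (B z * \prod_i evp i (tnth z i)).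
Proof.
have E k : (k <= d)%N -> \int[mu]_z (B z * Phi 0 z) = \int[mu]_z (B z * Phi k z).
  elim: k => [//|k IH] kd; rewrite IH ?(ltnW kd)//; exact: Phi_step.
have -> : \int[mu]_z (B z * \prod_i evp i (tnth z i)) = \int[mu]_z (B z * Phi d z).
  by apply: eq_Rintegral => z _; congr (_ * _); apply: eq_bigr => i _; rewrite ltn_ord.
rewrite -E// /ballop /kint /ipm [in LHS]/Rintegral.
have mF : measurable_fun [set: pt] (fun y : pt => (nker (bker h) (x, y) * \prod_i f i (tnth y i))%:E).
  apply/measurable_EFinP; apply: measurable_funM; last exact: measurable_prod_tnth.
  have mb : measurable_fun [set: R] (bker h) by exact: measurable_lt_indic.
  exact: (measurableT_comp (@measurable_nker R d _ mb) (measurable_pair1 x)).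
rewrite -(int_vadd x mF) /Rintegral; congr fine; apply: eq_integral => z _.
rewrite /nker /= tsub_vadd; congr (_ * _)%:E; apply: eq_bigr => i _.
by rewrite tnth_mktuple addrC.
Qed.

Variable f2 : 'I_d -> R.
Hypothesis f2M : forall i, `|f2 i| <= M i.
Hypothesis taylor : forall i t, 0 <= t <= 1 ->
  `|f i (tnth x i + t) + f i (tnth x i - t) - 2 * f i (tnth x i) - t ^+ 2 * f2 i| <= 2 * M i * t ^+ 4.

(** Once the odd parts are removed, each factor expands in the square of its coordinate, and the
    second moments of the ball produce the Laplacian with the factor [h^2 / (2 (d + 2))]. *)
Theorem ballop_prod_expand :
  `|ballop h (fun y => \prod_i f i (tnth y i)) x - bv d h * (\prod_i f i (tnth x i) +
     (2 * (d%:R + 2))^-1 * h ^+ 2 * \sum_i \prod_j (if j == i then f2 j else f j (tnth x j)))| <=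
  bv d h * (4 * d%:R ^+ 2 * h ^+ 4 * \prod_i M i).
Proof.
pose a i := f i (tnth x i).
pose e i (t : R) := t ^+ 2 / 2 * f2 i.
have aM i : `|a i| <= M i by have := fM i (_ : `|0 : R| <= 1); rewrite addr0; apply; rewrite normr0.
have M0 i : 0 <= M i := le_trans (normr_ge0 _) (aM i).
have ta (t : R) i : `|t| <= 1 -> `|evp i t - a i - e i t| <= t ^+ 4 * M i.
  move=> t1; wlog t0 : t t1 / 0 <= t => [H|].
    have [t0|t0] := leP 0 t; first exact: H.
    have := H (- t); rewrite normrN /evp /e opprK sqrrN (_ : (- t) ^+ 4 = t ^+ 4); last by ring.
    by rewrite (addrC (f i (tnth x i - t))); apply => //; rewrite oppr_ge0 ltW.
  have t01 : 0 <= t <= 1 by rewrite t0 -(ger0_norm t0).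
  have := taylor i t01.
  have -> : evp i t - a i - e i t = (f i (tnth x i + t) + f i (tnth x i - t) - 2 * f i (tnth x i) - t ^+ 2 * f2 i) / 2.
    by rewrite /evp /e /a; field.
  rewrite normrM (ger0_norm (_ : 0 <= 2^-1))// ler_pdivrMr//; lra.
have e2h : 0 <= 2 * h ^+ 2 by rewrite mulr_ge0// sqr_ge0.
have pe z : tnorm z < h -> `|\prod_i evp i (tnth z i) - \prod_i a i -
    \sum_i \prod_j (if j == i then e j (tnth z j) else a j)| <= 4 * d%:R ^+ 2 * h ^+ 4 * \prod_i M i.
  move=> zh.
  have z1 i : `|tnth z i| <= 1 by exact: zle.
  have z2 i : tnth z i ^+ 2 <= h ^+ 2.
    rewrite -real_normK ?num_real// lerXn2r ?nnegrE ?(ltW h0)//.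
    exact: le_trans (abs_tnth_le z i) (ltW zh).
  have h21 : h ^+ 2 <= 1 by rewrite expr_le1// ltW.
  have z4 i : tnth z i ^+ 4 <= h ^+ 4.
    have -> : tnth z i ^+ 4 = (tnth z i ^+ 2) ^+ 2 by ring.
    have -> : h ^+ 4 = (h ^+ 2) ^+ 2 by ring.
    by rewrite lerXn2r ?nnegrE ?sqr_ge0.
  have h42 : h ^+ 4 <= h ^+ 2.
    have -> : h ^+ 4 = h ^+ 2 * h ^+ 2 by ring.
    by apply: ler_piMl => //; exact: sqr_ge0.
  have eM i : `|e i (tnth z i)| <= h ^+ 2 * M i.
    rewrite /e normrM; apply: ler_pM => //.
    by rewrite ger0_norm ?divr_ge0 ?sqr_ge0//; have := z2 i; have := sqr_ge0 (tnth z i); lra.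
  have rM i : `|evp i (tnth z i) - a i - e i (tnth z i)| <= h ^+ 4 * M i.
    by apply: le_trans (ta _ _ (z1 i)) _; apply: ler_wpM2r.
  (* The small parameter is [2 * h ^+ 2]: the 2 absorbs the fourth-order remainder, and its square
     gives the factor [4 * h ^+ 4]. *)
  have [||||_] := @prod_expand R d a (fun i => e i (tnth z i)) (fun i => evp i (tnth z i)) M (2 * h ^+ 2) e2h aM.
  - by move=> i; exact: evp_le.
  - by move=> i; apply: le_trans (eM i) _; apply: ler_wpM2r => //; have := sqr_ge0 h; lra.
  - move=> i; have -> : evp i (tnth z i) - a i = (evp i (tnth z i) - a i - e i (tnth z i)) + e i (tnth z i) by ring.
    apply: le_trans (ler_normD _ _) _; have := eM i; have := rM i; have := ler_wpM2r (M0 i) h42; lra.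
  - move=> i; apply: le_trans (rM i) _; apply: ler_wpM2r => //.
    by have := exprn_ge0 4 (ltW h0); rewrite exprMn -exprM; lra.
  by rewrite [(2 * h ^+ 2) ^+ 2](_ : _ = 4 * h ^+ 4); [rewrite mulrA (mulrC _ 4)|ring].
have c2 i : \int[mu]_z (B z * (tnth z i * tnth z i)) = bv d h * h ^+ 2 / (d%:R + 2).
  by rewrite ball_cross// eqxx mul1r.
pose L i := \prod_j (if j == i then f2 j else a j).
have eL z i : \prod_j (if j == i then e j (tnth z j) else a j) = L i / 2 * (tnth z i * tnth z i).
  rewrite /L (bigD1 i)//= [in RHS](bigD1 i)//= !eqxx /e.
  have -> : \prod_(i0 < d | i0 != i) (if i0 == i then tnth z i0 ^+ 2 / 2 * f2 i0 else a i0) =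
      \prod_(i0 < d | i0 != i) (if i0 == i then f2 i0 else a i0).
    by apply: eq_bigr => j /negPf ->.
  by rewrite expr2; field.
have Bi1 : mu.-integrable setT (EFin \o (fun z => B z * \prod_i a i)) by apply: (ball_integrable h0).
have Li : mu.-integrable setT (EFin \o (fun z => \sum_i L i / 2 * (B z * (tnth z i * tnth z i)))) /\
   \int[mu]_z (\sum_i L i / 2 * (B z * (tnth z i * tnth z i))) = bv d h * ((2 * (d%:R + 2))^-1 * h ^+ 2 * \sum_i L i).
  have [|j1 j2] := @Rintegral_sum _ _ _ mu _ (index_enum 'I_d) (fun i z => L i / 2 * (B z * (tnth z i * tnth z i)) : R).
    by move=> i; have := integrableZl measurableT (L i / 2) (ball_coord_integrable h0 i i); apply: eq_integrable => // z _.
  split => //; rewrite j2 !mulr_sumr; apply: eq_bigr => i _.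
  rewrite RintegralZl//; last exact: ball_coord_integrable.
  by rewrite c2; field; rewrite gt_eqF// ltr_wpDl.
have [Li1 Li2] := Li.
have Ei : mu.-integrable setT (EFin \o (fun z => B z * \prod_i evp i (tnth z i))).
  have := Phi_int d; apply: eq_integrable => // z _ /=; congr (_ * _)%:E.
  by apply: eq_bigr => i _; rewrite ltn_ord.
rewrite ballop_prod_even mulrDr -Li2.
have -> : bv d h * \prod_i f i (tnth x i) = \int[mu]_z (B z * \prod_i a i).
  rewrite -[LHS]mulrC; transitivity (\int[mu]_z (\prod_i a i * (B z * 1))).
    have B1 : mu.-integrable setT (EFin \o (fun z => B z * 1)) by apply: (@ball_integrable _ _ _ h0 _ 1) => // z _; rewrite normr1.
    rewrite RintegralZl//; congr (_ * _).
    by rewrite /Rintegral; under eq_integral do rewrite mulr1; rewrite ball_indic_int.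
  by apply: eq_Rintegral => z _; rewrite mulr1 mulrC.
have Ii := integrableD measurableT Bi1 Li1.
rewrite -RintegralD// -RintegralB//.
have -> : bv d h * (4 * d%:R ^+ 2 * h ^+ 4 * \prod_i M i) = \int[mu]_z (B z * (4 * d%:R ^+ 2 * h ^+ 4 * \prod_i M i)).
  transitivity (\int[mu]_z ((4 * d%:R ^+ 2 * h ^+ 4 * \prod_i M i) * (B z * 1))).
    have B1 : mu.-integrable setT (EFin \o (fun z => B z * 1)) by apply: (@ball_integrable _ _ _ h0 _ 1) => // z _; rewrite normr1.
    rewrite RintegralZl// mulrC; congr (_ * _).
    by rewrite /Rintegral; under eq_integral do rewrite mulr1; rewrite ball_indic_int.
  by apply: eq_Rintegral => z _; rewrite mulr1 mulrC.
have Di : mu.-integrable setT (EFin \o (fun z => B z * \prod_i evp i (tnth z i) -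
    (B z * \prod_i a i + \sum_i L i / 2 * (B z * (tnth z i * tnth z i))))).
  by have := integrableB measurableT Ei Ii; apply: eq_integrable => // z _.
apply: le_trans (le_normr_Rintegral measurableT Di) _.
apply: le_Rintegral => //.
- by have := integrable_abse Di; apply: eq_integrable => // z _.
- exact: ball_integrable.
move=> z _.
have -> : B z * \prod_i evp i (tnth z i) - (B z * \prod_i a i + \sum_i L i / 2 * (B z * (tnth z i * tnth z i))) =
   B z * (\prod_i evp i (tnth z i) - \prod_i a i - \sum_i \prod_j (if j == i then e j (tnth z j) else a j)).
  have -> : \sum_i L i / 2 * (B z * (tnth z i * tnth z i)) = B z * \sum_i \prod_j (if j == i then e j (tnth z j) else a j).
    by rewrite mulr_sumr; apply: eq_bigr => i _; rewrite eL; ring.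
  ring.
rewrite /bker; case: ltP => zh; last by rewrite !mul0r normr0.
by rewrite !mul1r; exact: pe.
Qed.

End ProductExpansion.

Section HermiteResidual.
Variables (R : realType) (d : nat) (al : R).
Hypothesis al0 : 0 < al.
Notation pt := (d.-tuple R).
Notation mu := (vol R d).
Notation sq := (sqint (vol R d)).
Notation ip := (ipm (vol R d)).
Notation cc := (@cst_c R d).
Notation gm := (@gam R d al).

Lemma gs_le (a b x : R) : b <= a -> gs a x <= gs b x.
Proof. by move=> ba; rewrite /gs ler_expR !mulNr lerN2 ler_wpM2r ?sqr_ge0. Qed.

(** Half of the exponent pays for the polynomial and half of what is left for the shift, hence
    [al / 4]. *)
Lemma shifted_gs_bound (p : {poly R}) : exists2 K, 0 <= K & forall x t, `|t| <= 1 ->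
  `|p.[x + t] * gs al (x + t)| <= K * gs (al / 4) x.
Proof.
have [K K0 HK] := horner_gs_bound p 0 al0; exists (K * expR (al / 2)); first by rewrite mulr_ge0 ?expR_ge0.
move=> x t t1; have := HK (x + t); rewrite mul0r expR0 mulr1 normrM (ger0_norm (gs_ge0 _ _)) => H.
apply: le_trans H _; rewrite -mulrA; apply: ler_wpM2l => //.
rewrite /gs -expRD ler_expR.
have t2 : t ^+ 2 <= 1 by rewrite -real_normK ?num_real// expr_le1.
have h1 : x ^+ 2 / 2 - t ^+ 2 <= (x + t) ^+ 2.
  by have := sqr_ge0 (x / 2 + t); rewrite !sqrrD; have := sqr_ge0 (x / 2); rewrite !expr2; lra.
have a0 := al0.
have h2 := ler_wpM2l (ltW a0) h1; have h3 := ler_wpM2l (ltW a0) t2; lra.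
Qed.

(** Differentiation of [p] times [gs al], read on the polynomial factor. *)
Definition dgs (p : {poly R}) : {poly R} := p^`() - (2 * al) *: ('X * p).

Lemma dgs2_hpoly n x : (dgs (dgs (hpoly al n))).[x] =
  (4 * al ^+ 2 * x ^+ 2 - 2 * al - 4 * al * n%:R) * (hpoly al n).[x].
Proof.
have := congr1 (horner ^~ x) (hpoly_ode al n).
rewrite /dgs derivB derivZ derivM derivX mul1r !(hornerD, hornerN, hornerZ, hornerM, hornerX) => e.
transitivity (((hpoly al n)^`()^`()).[x] - 4 * al * (x * ((hpoly al n)^`()).[x]) +
  (4 * al ^+ 2 * x ^+ 2 - 2 * al) * (hpoly al n).[x]); first by ring.
by rewrite e; ring.
Qed.

Definition wgt (a : R) (x : pt) : R := \prod_i gs a (tnth x i).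

Lemma wgt_sq (a : R) : 0 < a -> sq (wgt a).
Proof.
move=> a0; split; first exact: (measurable_prod_tnth (fun i => @measurable_gs R a)).
have a2 : 0 < 2 * a by rewrite mulr_gt0.
have [h _] := @int_prod_tnth R d (fun i x => gs (2 * a) x) (fun i => integrable_gs a2).
apply: eq_integrable h => // x _ /=; congr EFin; rewrite /wgt -prodrXl; apply: eq_bigr => i _.
by rewrite expr2 -gsD [2 * a]mulr_natl mulr2n.
Qed.

(** [lev b] will be the eigenvalue of [L_rho] at [psi al b], and [qpot] is its potential [V]. *)
Definition lev (b : 'I_d -> nat) : R := 4 * al * (\sum_i b i)%:R.
Definition qpot (x : pt) : R := 4 * al ^+ 2 * tnorm x ^+ 2 - 2 * d%:R * al.

Lemma prod_bound (F : 'I_d -> R) (K a : R) (x : pt) : 0 <= K ->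
  (forall i, `|F i| <= K * gs a (tnth x i)) -> `|\prod_i F i| <= K ^+ d * wgt a x.
Proof.
move=> K0 H; rewrite normr_prod.
have -> : K ^+ d * wgt a x = \prod_i (K * gs a (tnth x i)).
  by rewrite big_split/= prodr_const card_ord.
by apply: ler_prod => i _; rewrite normr_ge0/=.
Qed.

Lemma sum_ub (F : 'I_d -> R) : (forall i, 0 <= F i) -> exists2 K, 0 <= K & forall i, F i <= K.
Proof.
move=> F0; exists (\sum_i F i); first exact: sumr_ge0.
by move=> i; rewrite (bigD1 i)//= lerDl sumr_ge0.
Qed.

Lemma ballop_psi b : exists2 K, 0 <= K & forall h x, 0 < h -> h <= 1 ->
  `|ballop h (psi al b) x - bv d h * (1 + cc * h ^+ 2 * (qpot x - lev b)) * psi al b x| <=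
  bv d h * (K * h ^+ 4 * wgt (al / 4) x).
Proof.
have D p (x : R) : is_derive x (1 : R) (fun y => p.[y] * gs al y) ((dgs p).[x] * gs al x).
  exact: is_derive_horner_gs.
pose p i := hpoly al (b i).
have /choice[K1 HK1] : forall i, exists K, 0 <= K /\ forall x t, `|t| <= 1 -> `|(p i).[x + t] * gs al (x + t)| <= K * gs (al / 4) x.
  by move=> i; have [K] := shifted_gs_bound (p i); exists K.
have /choice[K2 HK2] : forall i, exists K, 0 <= K /\ forall x t, `|t| <= 1 -> `|(dgs (dgs (p i))).[x + t] * gs al (x + t)| <= K * gs (al / 4) x.
  by move=> i; have [K] := shifted_gs_bound (dgs (dgs (p i))); exists K.
have /choice[K4 HK4] : forall i, exists K, 0 <= K /\ forall x t, `|t| <= 1 -> `|(dgs (dgs (dgs (dgs (p i))))).[x + t] * gs al (x + t)| <= K * gs (al / 4) x.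
  by move=> i; have [K] := shifted_gs_bound (dgs (dgs (dgs (dgs (p i))))); exists K.
have [K K0 HK] := @sum_ub (fun i => K1 i + K2 i + K4 i)
  (fun i => addr_ge0 (addr_ge0 (proj1 (HK1 i)) (proj1 (HK2 i))) (proj1 (HK4 i))).
have g0 x : 0 <= gs (al / 4) x := gs_ge0 _ _.
have k1 i x : K1 i * gs (al / 4) x <= K * gs (al / 4) x.
  by apply: ler_wpM2r => //; have := HK i; have [? _] := HK2 i; have [? _] := HK4 i; lra.
have k2 i x : K2 i * gs (al / 4) x <= K * gs (al / 4) x.
  by apply: ler_wpM2r => //; have := HK i; have [? _] := HK1 i; have [? _] := HK4 i; lra.
have k4 i x : K4 i * gs (al / 4) x <= K * gs (al / 4) x.
  by apply: ler_wpM2r => //; have := HK i; have [? _] := HK1 i; have [? _] := HK2 i; lra.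
exists (4 * d%:R ^+ 2 * K ^+ d); first by rewrite mulr_ge0 ?exprn_ge0// mulr_ge0// sqr_ge0.
move=> h x h0 h1.
have := @ballop_prod_expand R d h h0 h1 (fun i => hfun al (b i)) x (fun i => K * gs (al / 4) (tnth x i))
  (fun i => measurable_hfun al (b i)) _ (fun i => (dgs (dgs (p i))).[tnth x i] * gs al (tnth x i)) _ _.
have -> : \prod_i (K * gs (al / 4) (tnth x i)) = K ^+ d * wgt (al / 4) x.
  by rewrite big_split/= prodr_const card_ord.
have -> : \sum_i \prod_j (if j == i then (dgs (dgs (p j))).[tnth x j] * gs al (tnth x j) else hfun al (b j) (tnth x j)) =
    (qpot x - lev b) * psi al b x.
  transitivity (\sum_i (4 * al ^+ 2 * tnth x i ^+ 2 - 2 * al - 4 * al * (b i)%:R) * psi al b x).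
    apply: eq_bigr => i _; rewrite /psi (bigD1 i)//= [in RHS](bigD1 i)//= eqxx /hfun dgs2_hpoly -!mulrA.
    by congr (_ * (_ * (_ * _))); apply: eq_bigr => j /negPf ->.
  rewrite -mulr_suml; congr (_ * _); rewrite !sumrB -!mulr_sumr sumr_const card_ord.
  by rewrite /qpot /lev tnorm_sqr natr_sum -mulr_natl; ring.
rewrite -/(psi al b x) -/(psi al b).
have -> : bv d h * (psi al b x + (2 * (d%:R + 2))^-1 * h ^+ 2 * ((qpot x - lev b) * psi al b x)) =
   bv d h * (1 + cc * h ^+ 2 * (qpot x - lev b)) * psi al b x by rewrite /cst_c; ring.
have -> : 4 * d%:R ^+ 2 * h ^+ 4 * (K ^+ d * wgt (al / 4) x) = 4 * d%:R ^+ 2 * K ^+ d * h ^+ 4 * wgt (al / 4) x by ring.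
apply.
- by move=> i t t1; have [_ H] := HK1 i; apply: le_trans (H _ _ t1) _.
- move=> i; have [_ H] := HK2 i; have := H (tnth x i) 0; rewrite addr0 normr0 => /(_ ler01) H'.
  exact: le_trans H' _.
- move=> i t t01.
  apply: (@taylor_even R (hfun al (b i)) (fun y => (dgs (p i)).[y] * gs al y) (fun y => (dgs (dgs (p i))).[y] * gs al y)
    (fun y => (dgs (dgs (dgs (p i)))).[y] * gs al y) (fun y => (dgs (dgs (dgs (dgs (p i))))).[y] * gs al y)) => //.
  by move=> s s1; have [_ H] := HK4 i; apply: le_trans (H _ _ s1) _.
Qed.

Definition hprod (b : 'I_d -> nat) (x : pt) : R := \prod_i (hpoly al (b i)).[tnth x i].

Lemma psi_hprod b x : psi al b x = hprod b x * gm x.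
Proof. by rewrite /psi /hfun big_split/= /hprod; congr (_ * _); rewrite gauss_prod /gam mulNr. Qed.

Lemma hprod_wgt b : exists2 K, 0 <= K & forall x, `|hprod b x| * wgt (al / 4) x <= K * wgt (al / 16) x.
Proof.
have a4 : 0 < al / 4 by rewrite divr_gt0.
have /choice[K1 HK1] : forall i, exists K, 0 <= K /\ forall x, `|(hpoly al (b i)).[x]| * expR (0 * `|x|) * gs (al / 4) x <= K * gs (al / 4 / 2) x.
  by move=> i; have [K] := horner_gs_bound (hpoly al (b i)) 0 a4; exists K.
have [K K0 HK] := sum_ub (fun i => proj1 (HK1 i)).
exists (K ^+ d); first exact: exprn_ge0.
move=> x; have -> : `|hprod b x| * wgt (al / 4) x = `|\prod_i ((hpoly al (b i)).[tnth x i] * gs (al / 4) (tnth x i))|.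
  rewrite big_split/= normrM; congr (_ * _); rewrite ger0_norm//; apply: prodr_ge0 => i _; exact: gs_ge0.
apply: prod_bound => // i; rewrite normrM (ger0_norm (gs_ge0 _ _)).
have [_ H] := HK1 i; have := H (tnth x i); rewrite mul0r expR0 mulr1 => {}H.
apply: le_trans H _; apply: ler_pM => //; [by have [] := HK1 i|exact: gs_ge0|].
by apply: gs_le; have := al0; lra.
Qed.

Lemma qpot_psi b : exists2 K, 0 <= K & forall x, `|qpot x * psi al b x| <= K * wgt (al / 4) x.
Proof.
pose p i := hpoly al (b i).
pose p2 i := (4 * al ^+ 2) *: ('X^2 * p i) - (2 * al) *: p i.
have /choice[K1 HK1] : forall i, exists K, 0 <= K /\ forall x t, `|t| <= 1 -> `|(p i).[x + t] * gs al (x + t)| <= K * gs (al / 4) x.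
  by move=> i; have [K] := shifted_gs_bound (p i); exists K.
have /choice[K2 HK2] : forall i, exists K, 0 <= K /\ forall x t, `|t| <= 1 -> `|(p2 i).[x + t] * gs al (x + t)| <= K * gs (al / 4) x.
  by move=> i; have [K] := shifted_gs_bound (p2 i); exists K.
have [K K0 HK] := @sum_ub (fun i => K1 i + K2 i) (fun i => addr_ge0 (proj1 (HK1 i)) (proj1 (HK2 i))).
have g0 x : 0 <= gs (al / 4) x := gs_ge0 _ _.
exists (d%:R * K ^+ d); first by rewrite mulr_ge0// exprn_ge0.
move=> x; have -> : qpot x * psi al b x = \sum_i \prod_j (if j == i then (p2 j).[tnth x j] * gs al (tnth x j) else hfun al (b j) (tnth x j)).
  transitivity (\sum_i (4 * al ^+ 2 * tnth x i ^+ 2 - 2 * al) * psi al b x).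
    rewrite -mulr_suml; congr (_ * _); rewrite sumrB -mulr_sumr sumr_const card_ord /qpot tnorm_sqr -mulr_natl; ring.
  apply: eq_bigr => i _; rewrite /psi [in LHS](bigD1 i)//= [in RHS](bigD1 i)//= eqxx /hfun /p2 !(hornerD, hornerN, hornerZ, hornerM, hornerXn, hornerX).
  rewrite [LHS]mulrA; congr (_ * _); last by apply: eq_bigr => j /negPf ->.
  by rewrite /p; ring.
apply: le_trans (ler_norm_sum _ _ _) _.
apply: (@le_trans _ _ (\sum_(i < d) K ^+ d * wgt (al / 4) x)); last by rewrite sumr_const card_ord -[_ *+ d]mulr_natl mulrA.
apply: ler_sum => i _; apply: prod_bound => // j.
have [K10 H1] := HK1 j; have [K20 H2] := HK2 j; have := HK j => HKj.
have l01 : `|0 : R| <= 1 by rewrite normr0.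
case: ifP => _.
  have := H2 (tnth x j) 0 l01; rewrite addr0 => H; apply: le_trans H _.
  by apply: ler_wpM2r => //; lra.
have := H1 (tnth x j) 0 l01; rewrite addr0 => H; apply: le_trans H _.
by apply: ler_wpM2r => //; lra.
Qed.

(** The expansions of [B_h psi] and of [vh * psi = hprod * B_h gam] share the potential term of
    order [h^2], which cancels and leaves only the level. Dividing by [gam] costs no exponential,
    since [psi / gam] is the polynomial [hprod]. *)
Theorem hermite_residual b : exists2 K, 0 <= K & forall h x, 0 < h -> h <= 1 ->
  `|ballop h (psi al b) x - (1 - cc * h ^+ 2 * lev b) * (vh al h x * psi al b x)| <=
  bv d h * (K * h ^+ 4 * wgt (al / 16) x).
Proof.
have [K1 K10 H1] := ballop_psi b; have [K2 K20 H2] := ballop_psi (fun=> 0%N).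
have [K3 K30 H3] := hprod_wgt b; have [K4 K40 H4] := qpot_psi b.
have c0 := @cst_c_gt0 R d.
have l0 : 0 <= lev b by rewrite mulr_ge0// mulr_ge0// ltW.
have g00 : psi al (fun=> 0%N) = gm by exact: psi0E.
exists (K1 + (1 + cc * lev b) * (K2 * K3) + cc ^+ 2 * lev b * K4).
  by have c0' := ltW c0; pos.
move=> h x h0 h1; have := H1 h x h0 h1; have := H2 h x h0 h1; rewrite g00.
have -> : lev (fun=> 0%N) = 0 by rewrite /lev big1// mulr0.
rewrite subr0; set e2 := ballop h gm x - _; set e1 := ballop h (psi al b) x - _ => E2 E1.
have w16 : wgt (al / 4) x <= wgt (al / 16) x.
  by apply: ler_prod => i _; rewrite gs_ge0/=; apply: gs_le; have := al0; lra.
have w0 : 0 <= wgt (al / 4) x by apply: prodr_ge0 => i _; exact: gs_ge0.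
have w160 := le_trans w0 w16.
have bv0 := bv_gt0 d h0; have h40 : 0 <= h ^+ 4 by rewrite exprn_ge0// ltW.
have gx := lt0r_neq0 (gam_gt0 al x).
have -> : ballop h (psi al b) x - (1 - cc * h ^+ 2 * lev b) * (vh al h x * psi al b x) =
   e1 - (1 - cc * h ^+ 2 * lev b) * (hprod b x * e2) + bv d h * (cc ^+ 2 * h ^+ 4 * lev b) * (qpot x * psi al b x).
  rewrite /e1 /e2 /vh psi_hprod; move: (cc) (lev b) (qpot x) (hprod b x) (gm x) gx => c l q H g g0; field.
  exact: g0.
have h21 : h ^+ 2 <= 1 by rewrite expr_le1// ltW.
have t1 : `|1 - cc * h ^+ 2 * lev b| <= 1 + cc * lev b.
  apply: le_trans (ler_normB _ _) _; rewrite normr1 lerD2l ger0_norm; last by rewrite !mulr_ge0 ?sqr_ge0// ltW.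
  by rewrite mulrAC ler_piMr// mulr_ge0// ltW.
apply: le_trans (ler_normD _ _) _; apply: le_trans (lerD (ler_normB _ _) (lexx _)) _.
have u1 : `|e1| <= bv d h * (K1 * h ^+ 4 * wgt (al / 16) x).
  apply: le_trans E1 _; apply: ler_wpM2l; first exact: ltW.
  by apply: ler_wpM2l => //; rewrite mulr_ge0.
have u2 : `|(1 - cc * h ^+ 2 * lev b) * (hprod b x * e2)| <= (1 + cc * lev b) * (bv d h * (K2 * h ^+ 4 * (K3 * wgt (al / 16) x))).
  rewrite normrM; apply: ler_pM => //; rewrite normrM.
  apply: le_trans (ler_wpM2l (normr_ge0 _) E2) _.
  have -> : `|hprod b x| * (bv d h * (K2 * h ^+ 4 * wgt (al / 4) x)) = bv d h * (K2 * h ^+ 4) * (`|hprod b x| * wgt (al / 4) x) by ring.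
  have -> : bv d h * (K2 * h ^+ 4 * (K3 * wgt (al / 16) x)) = bv d h * (K2 * h ^+ 4) * (K3 * wgt (al / 16) x) by ring.
  by apply: ler_wpM2l; [have bv0' := ltW bv0; pos|exact: H3].
have u3 : `|bv d h * (cc ^+ 2 * h ^+ 4 * lev b) * (qpot x * psi al b x)| <= bv d h * (cc ^+ 2 * h ^+ 4 * lev b) * (K4 * wgt (al / 16) x).
  have n0 : 0 <= bv d h * (cc ^+ 2 * h ^+ 4 * lev b) by have bv0' := ltW bv0; pos.
  rewrite normrM (ger0_norm n0); apply: ler_wpM2l => //; apply: le_trans (H4 x) _.
  exact: ler_wpM2l.
move: u1 u2 u3; lra.
Qed.

End HermiteResidual.

Section Quasimodes.
Variables (R : realType) (d : nat) (al : R).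
Hypothesis al0 : 0 < al.
Notation pt := (d.-tuple R).
Notation mu := (vol R d).
Notation sq := (sqint (vol R d)).
Notation ip := (ipm (vol R d)).
Notation cc := (@cst_c R d).
Notation vspc := (lsq R d).
Notation lp := (@lip R d).
Notation nr := (nrm lp).
Implicit Types b : 'I_d -> nat.

Lemma vh_half h (x : pt) : 0 < h -> al * h ^+ 2 <= 1 / 2 -> bv d h / 2 <= vh al h x.
Proof.
move=> h0 ah; have a0 := al0; have bv0 := bv_gt0 d h0.
apply: le_trans (vh_ge al0 h0 x _); last by lra.
rewrite ler_pM2l//.
have d0 : 0 <= d%:R :> R by [].
have c1 : (2 * (d%:R + 2))^-1 * (2 * d%:R) <= 1 :> R.
  by rewrite mulrC ler_pdivrMr; lra.
have c0 : 0 <= (2 * (d%:R + 2))^-1 :> R by rewrite invr_ge0; lra.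
have h20 : 0 <= h ^+ 2 := sqr_ge0 h.
have e1 : 0 <= (2 * (d%:R + 2))^-1 * h ^+ 2 * (4 * al ^+ 2 * (1 - al * h ^+ 2) * tnorm x ^+ 2).
  have : 0 <= 1 - al * h ^+ 2 by lra.
  by have := ltW a0; move=> *; pos.
have e2 := ler_wpM2r (mulr_ge0 (ltW a0) h20) c1.
move: e1 e2 ah; clear; lra.
Qed.

(** Multiplied by [a = vh^(-1/2)] it gives back [psi], so the conjugated operator sends it to
    [a * B_h psi]. *)
Definition quasi h b (x : pt) : R := Num.sqrt (vh al h x) * psi al b x.

Lemma quasi_sq h b : 0 < h -> sq (quasi h b).
Proof.
move=> h0; have m : measurable_fun [set: pt] (quasi h b).
  by apply: measurable_funM; [exact: measurable_sqrt_vh|exact: measurable_psi].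
split => //; have i := integrableZl measurableT (bv d h) (psi_exp_integrable al0 b (2 * al * h)).
apply: (@integrable_le_real _ _ _ mu _ (fun x => bv d h * (psi al b x ^+ 2 * \prod_i expR (2 * al * h * `|tnth x i|)))) => //.
  exact: measurable_funX.
move=> x; rewrite ger0_norm ?sqr_ge0// /quasi exprMn sqr_sqrtr ?(ltW (vh_gt0 al0 h0 x))//.
have := ler_wpM2r (sqr_ge0 (psi al b x)) (vh_le al0 h0 x).
by rewrite -(mulrA (bv d h)) (mulrC (\prod_i _)).
Qed.

Definition qvec h (h0 : 0 < h) b : vspc := lsq_of (quasi_sq b h0).

(** The factor [sqrt (bv d h)] is the scale of the quasimode itself, as [qvec_comb_ge] shows; the
    relative residual is of order [h^4]. *)
Lemma quasi_residual b : exists2 M, 0 <= M & forall h (h0 : 0 < h), h <= 1 -> al * h ^+ 2 <= 1 / 2 ->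
  nr (Tw al0 h0 (qvec h0 b) - (1 - cc * h ^+ 2 * lev al b) *: qvec h0 b) <=
  Num.sqrt (bv d h) * (M * h ^+ 4).
Proof.
have [K K0 HK] := hermite_residual al0 b.
have a16 : 0 < al / 16 by rewrite divr_gt0.
have sw := wgt_sq d a16; have w0 := ipm_ge0 mu (wgt (d := d) (al / 16)).
set W := ip _ _ in w0.
exists (K * Num.sqrt (2 * W)); first by rewrite mulr_ge0 ?sqrtr_ge0.
move=> h h0 h1 ah; set tau := 1 - _; set r := _ - _ : vspc.
have bv0 := bv_gt0 d h0.
have e x : `|r x| <= wta al h x * (bv d h * (K * h ^+ 4 * wgt (al / 16) x)).
  have -> : r x = wta al h x * (ballop h (psi al b) x - tau * (vh al h x * psi al b x)).
    rewrite /r lsq_subE lsq_scaleE /= /wop mulrBr; congr (_ * _ - _).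
      by congr (ballop _ _ _); apply/funext => y; rewrite /quasi mulrA wta_sqrt// mul1r.
    rewrite /quasi -{2}(sqr_sqrtr (ltW (vh_gt0 al0 h0 x))) expr2.
    by rewrite -!mulrA (mulrCA (wta _ _ _)) (mulrA (wta _ _ _)) wta_sqrt// mul1r.
  by rewrite normrM ger0_norm ?(ltW (wta_gt0 al0 h0 x))//; apply: ler_wpM2l; [exact: ltW (wta_gt0 _ _ _)|exact: HK].
have e2 x : r x ^+ 2 <= 2 * bv d h * K ^+ 2 * h ^+ 8 * wgt (al / 16) x ^+ 2.
  have a2 : wta al h x ^+ 2 * bv d h <= 2.
    have sv := vh_half x h0 ah; have v0 := vh_gt0 al0 h0 x.
    have -> : wta al h x ^+ 2 = (vh al h x)^-1 by rewrite /wta exprVn sqr_sqrtr// ltW.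
    by rewrite mulrC ler_pdivrMr//; lra.
  have w20 : 0 <= bv d h * K ^+ 2 * h ^+ 8 * wgt (al / 16) x ^+ 2.
    by have bv0' := ltW bv0; have h0' := ltW h0; pos.
  rewrite -real_normK ?num_real//.
  apply: (@le_trans _ _ ((wta al h x * (bv d h * (K * h ^+ 4 * wgt (al / 16) x))) ^+ 2)).
    by rewrite ler_sqr ?nnegrE ?normr_ge0//; apply: le_trans (e x).
  have := ler_wpM2r w20 a2; move: (wta al h x) (wgt (al / 16) x) => p q; lra.
rewrite /nrm.
have -> : Num.sqrt (bv d h) * (K * Num.sqrt (2 * W) * h ^+ 4) = Num.sqrt (2 * bv d h * K ^+ 2 * h ^+ 8 * W).
  have -> : 2 * bv d h * K ^+ 2 * h ^+ 8 * W = bv d h * ((2 * W) * (K * h ^+ 4) ^+ 2) by ring.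
  have W2 : 0 <= 2 * W by rewrite mulr_ge0.
  rewrite [in RHS]sqrtrM ?(ltW bv0)// [X in _ = _ * X]sqrtrM// sqrtr_sqr ger0_norm; first by ring.
  by rewrite mulr_ge0// exprn_ge0// ltW.
apply: ler_wsqrtr; rewrite /lip /ipm /W /ipm -RintegralZl//; last exact: sqint_mul.
apply: le_Rintegral => //.
- by apply: sqint_mul; exact: lsqP.
- by have := integrableZl measurableT (2 * bv d h * K ^+ 2 * h ^+ 8) (sqint_mul sw sw); apply: eq_integrable.
by move=> x _; rewrite -!expr2; exact: e2.
Qed.

Lemma psi_comb_norm p (bb : 'I_p -> 'I_d -> nat) (c : 'I_p -> R) : injective bb ->
  ip (fun x => \sum_i c i * psi al (bb i) x) (fun x => \sum_i c i * psi al (bb i) x) =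
  \sum_i c i ^+ 2 * psi2 al (bb i).
Proof.
move=> bi; have sp i : sq (fun x => c i * psi al (bb i) x) by apply: sqintZ; exact: psi_sq.
have sS : sq (fun x => \sum_i c i * psi al (bb i) x) by exact: sqint_sum.
rewrite ipm_sum//; apply: eq_bigr => i _; rewrite ipmC ipm_sum// (bigD1 i)//= big1 ?addr0; last first.
  move=> j ji; rewrite ipmZ; [|exact: psi_sq|exact: sp]; rewrite ipmC ipmZ; [|exact: psi_sq..].
  rewrite (psi_orth_neq al0); first by rewrite !mulr0.
  by move/bi => ij; rewrite ij eqxx in ji.
rewrite ipmZ; [|exact: psi_sq|exact: sp]; rewrite ipmC ipmZ; [|exact: psi_sq..].
by rewrite psi_norm// expr2 mulrA.
Qed.

(** The quasimodes are not orthogonal, but the bound [vh >= bv / 2] transfers the orthogonality of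
    the [psi] into a lower bound uniform in [h]. *)
Lemma qvec_comb_ge p (bb : 'I_p -> 'I_d -> nat) h (h0 : 0 < h) (c : 'I_p -> R) i :
  injective bb -> al * h ^+ 2 <= 1 / 2 ->
  `|c i| * Num.sqrt (bv d h) <= Num.sqrt (2 / psi2 al (bb i)) * nr (\sum_i c i *: qvec h0 (bb i)).
Proof.
move=> bi ah; have bv0 := bv_gt0 d h0; have p0 := psi2_gt0 al0 (bb i).
rewrite /nrm -sqrtrM ?divr_ge0 ?(ltW p0)// -sqrtr_sqr -sqrtrM ?sqr_ge0//; apply: ler_wsqrtr.
have sp j : sq (fun x => c j * psi al (bb j) x) by apply: sqintZ; exact: psi_sq.
have sS : sq (fun x => \sum_i c i * psi al (bb i) x) by exact: sqint_sum.
have L : bv d h / 2 * \sum_i c i ^+ 2 * psi2 al (bb i) <= lp (\sum_i c i *: qvec h0 (bb i)) (\sum_i c i *: qvec h0 (bb i)).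
  rewrite -psi_comb_norm// /lip /ipm -RintegralZl//; last exact: sqint_mul.
  apply: le_Rintegral => //.
  - by have := integrableZl measurableT (bv d h / 2) (sqint_mul sS sS); apply: eq_integrable.
  - by apply: sqint_mul; exact: lsqP.
  move=> x _; rewrite lsq_sumE.
  have -> : \sum_i0 c i0 * qvec h0 (bb i0) x = Num.sqrt (vh al h x) * \sum_i c i * psi al (bb i) x.
    by rewrite mulr_sumr; apply: eq_bigr => j _; rewrite /= /quasi mulrCA.
  rewrite -!expr2 exprMn sqr_sqrtr ?(ltW (vh_gt0 al0 h0 x))//; apply: ler_wpM2r; first exact: sqr_ge0.
  exact: vh_half.
have L2 : c i ^+ 2 * psi2 al (bb i) <= \sum_i c i ^+ 2 * psi2 al (bb i).
  rewrite (bigD1 i)//= lerDl; apply: sumr_ge0 => j _.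
  by rewrite mulr_ge0 ?sqr_ge0// ltW// psi2_gt0.
rewrite -(ler_pM2l (_ : 0 < psi2 al (bb i) / 2)) ?divr_gt0//.
have -> X : psi2 al (bb i) / 2 * (2 / psi2 al (bb i) * X) = X.
  by have := lt0r_neq0 p0 => q; field.
apply: le_trans L; have := ler_wpM2l (ltW bv0) L2; lra.
Qed.

(** Multi-indices of equal degree share the same approximate eigenvalue, so residuals add up
    linearly and [qvec_comb_ge] controls the coefficients. *)
Theorem level_quasimodes p (bb : 'I_p -> 'I_d -> nat) (n : nat) : injective bb ->
  (forall i, \sum_j bb i j = n)%N ->
  exists2 C, 0 < C & forall h (h0 : 0 < h), h <= 1 -> al * h ^+ 2 <= 1 / 2 ->
    exists2 F : 'I_p -> vspc, independent lp F &
    forall c, nr (Tw al0 h0 (\sum_i c i *: F i) - (1 - cc * h ^+ 2 * (4 * al * n%:R)) *: \sum_i c i *: F i) <=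
      C * h ^+ 4 * nr (\sum_i c i *: F i).
Proof.
move=> bi bn.
have /choice[M HM] : forall i, exists M, 0 <= M /\ forall h (h0 : 0 < h), h <= 1 -> al * h ^+ 2 <= 1 / 2 ->
  nr (Tw al0 h0 (qvec h0 (bb i)) - (1 - cc * h ^+ 2 * lev al (bb i)) *: qvec h0 (bb i)) <=
  Num.sqrt (bv d h) * (M * h ^+ 4).
  by move=> i; have [M M0 HM] := quasi_residual (bb i); exists M.
pose N i := M i * Num.sqrt (2 / psi2 al (bb i)).
have N0 i : 0 <= N i by rewrite mulr_ge0 ?sqrtr_ge0//; case: (HM i).
exists (1 + \sum_i N i); first by rewrite ltr_pwDl// sumr_ge0.
move=> h h0 h1 ah; exists (fun i => qvec h0 (bb i)).
  move=> c c0 i; have := qvec_comb_ge h0 c i bi ah; rewrite c0 mulr0 pmulr_lle0 ?sqrtr_gt0 ?bv_gt0//.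
  by rewrite normr_le0 => /eqP.
move=> c; set S := \sum_i _.
set tau := 1 - _.
have -> : Tw al0 h0 S - tau *: S = \sum_i c i *: (Tw al0 h0 (qvec h0 (bb i)) - tau *: qvec h0 (bb i)).
  rewrite (op_sum (Tw_lin al0 h0)) scaler_sumr -sumrB; apply: eq_bigr => i _.
  by rewrite (opZ (Tw_lin al0 h0)) scalerBr !scalerA (mulrC tau).
have tri (F : 'I_p -> vspc) : nr (\sum_i F i) <= \sum_i nr (F i).
  elim/big_rec2: _ => [|i y1 y2 _ IH].
    by rewrite /nrm (ip0l (@lipP R d)) sqrtr0.
  by apply: le_trans (nrmD (@lipC R d) (@lipP R d) (@lip_ge0 R d) _ _) _; rewrite lerD2l.
apply: le_trans (tri _) _.
apply: (@le_trans _ _ (\sum_i N i * h ^+ 4 * nr S)); last first.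
  rewrite -!mulr_suml; apply: ler_wpM2r; first exact: nrm_ge0.
  by apply: ler_wpM2r; rewrite ?exprn_ge0 ?(ltW h0)// lerDr.
apply: ler_sum => i _; rewrite (nrmZ (@lipC R d) (@lipP R d)).
have [M0 H] := HM i; have := H h h0 h1 ah.
have -> : 1 - cc * h ^+ 2 * lev al (bb i) = tau by rewrite /tau /lev bn.
move=> H1; apply: le_trans (ler_wpM2l (normr_ge0 _) H1) _.
have g := qvec_comb_ge h0 c i bi ah; rewrite -/S in g.
have k0 : 0 <= M i * h ^+ 4 by rewrite mulr_ge0 ?exprn_ge0 ?(ltW h0).
have := ler_wpM2r k0 g; rewrite /N; lra.
Qed.

Definition level n : {set {ffun 'I_d -> 'I_n.+1}} := [set b : {ffun 'I_d -> 'I_n.+1} | (\sum_i (b i : nat) == n)%N].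

Lemma ndeg0 : ndeg d 0 = #|level 0|.
Proof. by apply: eq_card => b; rewrite !inE leqn0. Qed.

Lemma ndegS n : ndeg d n.+1 = (ndeg d n + #|level n.+1|)%N.
Proof.
pose w (b : {ffun 'I_d -> 'I_n.+1}) : {ffun 'I_d -> 'I_n.+2} := [ffun i => widen_ord (leqnSn n.+1) (b i)].
have wi : injective w.
  by move=> b c /ffunP e; apply/ffunP => i; apply: val_inj; have := e i; rewrite !ffunE => /(congr1 val).
rewrite /ndeg -(card_imset (multi_index d n) wi) -cardsUI [X in (_ = _ + X)%N](_ : _ = 0%N); last first.
  apply/eqP; rewrite cards_eq0; apply/eqP/setP => b; rewrite !inE; apply/negP => /andP[/imsetP[c cn ->]].
  rewrite inE in cn; under eq_bigr do rewrite ffunE /=.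
  by move/eqP => e; rewrite e ltnn in cn.
rewrite addn0; apply: eq_card => b; rewrite !inE leq_eqVlt orbC; congr (_ || _).
apply/idP/imsetP => [bn|[c cn ->]]; last first.
  by rewrite inE in cn; under eq_bigr do rewrite ffunE /=.
have [c cn e] := mem_multi_index (c := fun i => b i : nat) (bn : (_ <= n)%N); exists c => //.
by apply/ffunP => i; apply: val_inj; rewrite ffunE /=; have := congr1 (@^~ i) e.
Qed.

Lemma level_gt0 n : (0 < d)%N -> (0 < #|level n|)%N.
Proof.
move=> d0; apply/card_gt0P; exists [ffun i : 'I_d => if i == Ordinal d0 then ord_max else ord0].
rewrite inE (bigD1 (Ordinal d0))//= ffunE eqxx big1 ?addn0//.
by move=> i /negPf ii; rewrite ffunE ii.
Qed.

Lemma ndeg_gt n : (0 < d)%N -> (n < ndeg d n)%N.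
Proof.
move=> d0; elim: n => [|n IH]; first by rewrite ndeg0 level_gt0.
rewrite ndegS; apply: leq_ltn_trans IH _; rewrite -[X in (X < _)%N]addn0 ltn_add2l; exact: level_gt0.
Qed.

Lemma level_quasi n : exists2 C, 0 < C & forall h (h0 : 0 < h), h <= 1 -> al * h ^+ 2 <= 1 / 2 ->
    exists2 F : 'I_(#|level n|) -> vspc, independent lp F &
    forall c, nr (Tw al0 h0 (\sum_i c i *: F i) - (1 - cc * h ^+ 2 * (4 * al * n%:R)) *: \sum_i c i *: F i) <=
      C * h ^+ 4 * nr (\sum_i c i *: F i).
Proof.
apply: (@level_quasimodes _ (fun i : 'I_(#|level n|) => fun j => (enum_val i : {ffun 'I_d -> 'I_n.+1}) j : nat)).
  move=> i j e; apply: enum_val_inj; apply/ffunP => k; apply: val_inj; exact: (congr1 (@^~ k) e).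
by move=> i; have := enum_valP i; rewrite inE => /eqP.
Qed.

End Quasimodes.

Lemma small_sq (R : realType) (D : R) : 0 < D ->
  exists2 h1 : R, 0 < h1 & forall h, 0 < h -> h <= h1 -> h <= 1 /\ h ^+ 2 <= D.
Proof.
move=> D0; exists (Num.min 1 D); first by rewrite lt_min ltr01 D0.
move=> h h0; rewrite le_min => /andP[h1 hD]; split => //; apply: le_trans hD.
by rewrite expr2 ler_piMl// ltW.
Qed.

(** * Eigenvalues of the random walk up to order [h^4] *)

Section EigenvalueAsymptotics.
Variables (R : realType) (d : nat) (al be : R).
Hypotheses (al0 : 0 < al) (be0 : 0 < be).
Notation cc := (@cst_c R d).
Notation vspc := (lsq R d).
Notation lp := (@lip R d).
Notation rho := (@gauss R d al be).

Definition many_eigvec h (h0 : 0 < h) N (t : R) := exists (e : 'I_N -> vspc) (lam : 'I_N -> R),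
  orthonormal lp e /\ forall i, t <= lam i /\ eigvec lp (Tw al0 h0) (lam i) (e i).

Definition tau (n : nat) (h : R) : R := 1 - cc * h ^+ 2 * (4 * al * n%:R).

Lemma many_eigvec_step n : exists2 C, 0 < C & exists2 h1 : R, 0 < h1 & forall h (h0 : 0 < h), h <= h1 ->
  0 < tau n h - 3 * (C * h ^+ 4) /\
  forall N, many_eigvec h0 N (tau n h + 2 * (C * h ^+ 4)) ->
    many_eigvec h0 (N + #|level d n|) (tau n h - 3 * (C * h ^+ 4)).
Proof.
have a0 := al0; have c0 := @cst_c_gt0 R d; have [C C0 HC] := level_quasi d al0 n; exists C => //.
have n0 : 0 <= n%:R :> R by [].
pose B := 2 * al + cc * (4 * al * n%:R) + 3 * C + 1.
have B1 : 0 < B by rewrite /B; have := ltW c0; have := ltW a0; have := ltW C0 => *; apply: ltr_wpDl; pos.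
have Bi : 0 < B^-1 by rewrite invr_gt0.
have [h1 h10 H] := small_sq Bi.
exists h1 => // h h0 hh; have [hle1 hB] := H h h0 hh.
have h2 : 0 < h ^+ 2 by rewrite exprn_gt0.
have hB1 : h ^+ 2 * B <= 1 by move: hB; rewrite -[B^-1]mul1r ler_pdivlMr.
have h4 : h ^+ 4 <= h ^+ 2.
  have -> : h ^+ 4 = h ^+ 2 * h ^+ 2 by ring.
  by rewrite ler_piMr ?(ltW h2)// expr_le1 ?(ltW h0).
have p1 : 0 <= h ^+ 2 * (cc * (4 * al * n%:R)) by have := ltW c0; have := ltW a0; have := ltW h2 => *; pos.
have p2 : 0 <= h ^+ 2 * C by have := ltW C0; have := ltW h2 => *; pos.
have p3 : 0 <= h ^+ 2 * al by have := ltW a0; have := ltW h2 => *; pos.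
have ah : al * h ^+ 2 <= 1 / 2 by move: hB1 p1 p2 h2; rewrite /B; clear; lra.
have p4 := ler_wpM2l (ltW C0) h4.
have t0 : 0 < tau n h - 3 * (C * h ^+ 4) by move: hB1 p1 p2 p3 p4 h2; rewrite /tau /B; clear; lra.
split => // N [e [lam [eo eP]]].
have [F Fi FP] := HC h h0 hle1 ah.
have eps0 : 0 < C * h ^+ 4 by rewrite mulr_gt0 ?exprn_gt0.
have [e' [lam' [eo' eP']]] := quasimode_eigvec (@lipC R d) (@lipP R d) (@lip_ge0 R d) (Tw_lin al0 h0) (Tw_sym al0 h0)
  (Tw_bounded d al0 h0) (@Tw_compact R d al h al0 h0) eps0 t0 eo eP Fi FP.
by exists e', lam'.
Qed.

Lemma many_eigvec_weaken h (h0 : 0 < h) N s t : s <= t -> many_eigvec h0 N t -> many_eigvec h0 N s.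
Proof.
move=> st [e [lam [eo eP]]]; exists e, lam; split => // i; have [t1 ev] := eP i; split => //.
exact: le_trans t1.
Qed.

(** Levels are added in increasing degree: consecutive [tau] differ by order [h^2], so for small [h]
    the eigenvectors of the previous levels clear the margin of order [h^4] demanded by the next
    step. *)
Lemma many_eigvec_ndeg n : exists2 C, 0 < C & exists2 h1 : R, 0 < h1 & forall h (h0 : 0 < h), h <= h1 ->
  many_eigvec h0 (ndeg d n) (tau n h - C * h ^+ 4).
Proof.
elim: n => [|n [C C0 [h1 h10 IH]]].
  have [C C0 [h1 h10 H]] := many_eigvec_step 0; exists (3 * C); first by rewrite mulr_gt0.
  exists h1 => // h h0 hh; have [_ Hs] := H h h0 hh; rewrite -mulrA ndeg0; apply: (Hs 0%N).
  exists (fun=> 0), (fun=> 0); split; first by case.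
  by case.
have [C' C'0 [h1' h1'0 H]] := many_eigvec_step n.+1; exists (3 * C'); first by rewrite mulr_gt0.
have c0 := @cst_c_gt0 R d; have a0 := al0.
have D0 : 0 < cc * (4 * al) / (C + 2 * C') by pos.
have [h2 h20 Hs] := small_sq D0.
exists (Num.min h1 (Num.min h1' h2)); first by rewrite !lt_min h10 h1'0 h20.
move=> h h0; rewrite !le_min => /and3P[hh1 hh1' hh2].
have [_ hD] := Hs h h0 hh2; have [_ step] := H h h0 hh1'.
rewrite -mulrA ndegS; apply: step; apply: many_eigvec_weaken (IH h h0 hh1).
move: hD; rewrite ler_pdivlMr; last by pos.
have h2p : 0 <= h ^+ 2 := sqr_ge0 _.
move=> hD; have := ler_wpM2l h2p hD.
by rewrite /tau -natr1; clear; lra.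
Qed.

Lemma many_eigvec_count h (h0 : 0 < h) N k t : (k <= N)%N -> many_eigvec h0 N t ->
  ev_count_ge (nu_w rho h) (L2 (nu_w rho h)) (Th rho h) [set s | t <= s] k.
Proof.
move=> kN [e [lam [eo eP]]]; apply/(ev_count_eigvec d al0 be0 h0).
exists (fun i => e (widen_ord kN i)), (fun i => lam (widen_ord kN i)); split; first by move=> i; exact: eP.
apply: (orthonormal_independent (@lipC R d) (@lipP R d) (@lip_ge0 R d)) => i j.
by rewrite eo; congr (_%:R); apply/eqP/eqP => [/(congr1 val)/= ij|->//]; exact: val_inj.
Qed.

Lemma count_many_eigvec h (h0 : 0 < h) k t : 0 < t ->
  ev_count_ge (nu_w rho h) (L2 (nu_w rho h)) (Th rho h) [set s | t <= s] k -> many_eigvec h0 k t.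
Proof.
move=> t0 /(ev_count_eigvec d al0 be0 h0)[F [lam [FP Fi]]].
have [e [lam' [eo eP]]] := orthonormal_eigvec (@lipC R d) (@lipP R d) (@lip_ge0 R d) (Tw_lin al0 h0) (Tw_sym al0 h0)
  (Tw_bounded d al0 h0) (@Tw_compact R d al h al0 h0) t0 Fi FP.
by exists e, lam'.
Qed.

(** With [k] counted from 0, this range of [k] is level [n + 1]. For the upper bound, [k + 1]
    eigenvectors above [tau + 2 C h^4] could be completed by the quasimodes of that level, and
    [sharp_count] at [n + 1] would give [k + 1 <= ndeg n]. *)
Theorem lamT_asymptotics n k : (ndeg d n <= k)%N -> (k < ndeg d n.+1)%N ->
  exists2 C, 0 < C & exists2 h1 : R, 0 < h1 & forall h, 0 < h -> h <= h1 ->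
  `|tau n.+1 h - lamT rho h k| <= C * h ^+ 4.
Proof.
move=> nk kn.
have [C1 C10 [h1 h10 H1]] := many_eigvec_ndeg n.+1.
have [C2 C20 [h2 h20 H2]] := many_eigvec_step n.+1.
have [h3 h30 H3] := sharp_count d al0 n.+1.
have c0 := @cst_c_gt0 R d; have a0 := al0.
have D0 : 0 < cc * (2 * al) / (3 * C2) by pos.
have [h4 h40 H4] := small_sq D0.
exists (C1 + 2 * C2); first by pos.
exists (Num.min h1 (Num.min h2 (Num.min h3 h4))); first by rewrite !lt_min h10 h20 h30 h40.
move=> h h0; rewrite !le_min => /and4P[hh1 hh2 hh3 hh4].
have [_ hD] := H4 h h0 hh4; have [t0 step] := H2 h h0 hh2.
have h4p : 0 < h ^+ 4 by rewrite exprn_gt0.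
pose S := [set t | ev_count_ge (nu_w rho h) (L2 (nu_w rho h)) (Th rho h) [set s | t <= s] k.+1].
have SC : S (tau n.+1 h - C1 * h ^+ 4) by exact: many_eigvec_count kn (H1 h h0 hh1).
have Sub t : S t -> t <= tau n.+1 h + 2 * (C2 * h ^+ 4).
  move=> St; rewrite leNgt; apply/negP => lt.
  have tp : 0 < t by apply: lt_trans lt; move: t0 (mulr_gt0 C20 h4p); clear; lra.
  have [e [lam [eo eP]]] := step _ (many_eigvec_weaken (ltW lt) (count_many_eigvec h0 tp St)).
  suff /(H3 h h0 hh3 _ e lam)/(_ (fun i => proj2 (eP i)))/(_ (orthonormal_independent (@lipC R d) (@lipP R d) (@lip_ge0 R d) eo)) :
      forall i, 1 - cc * h ^+ 2 * (4 * al * (n.+1%:R + 1 / 2)) <= lam i.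
    by rewrite ndegS leq_add2r ltnNge nk.
  move=> i; have [l _] := eP i; apply: le_trans l.
  move: hD; rewrite ler_pdivlMr; last by pos.
  have h2p : 0 <= h ^+ 2 := sqr_ge0 _.
  move=> hD; have := ler_wpM2l h2p hD.
  by rewrite /tau; clear; lra.
have Sb : has_ubound S by exists (tau n.+1 h + 2 * (C2 * h ^+ 4)) => t /Sub.
have l1 : tau n.+1 h - C1 * h ^+ 4 <= lamT rho h k by exact: (ub_le_sup Sb SC).
have l2 : lamT rho h k <= tau n.+1 h + 2 * (C2 * h ^+ 4).
  by apply: ge_sup; [exists (tau n.+1 h - C1 * h ^+ 4)|move=> t /Sub].
have p1 := mulr_gt0 C10 h4p; have p2 := mulr_gt0 C20 h4p.
by rewrite ler_norml; apply/andP; split; move: l1 l2 p1 p2; clear; lra.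
Qed.

End EigenvalueAsymptotics.

(** * The Schrodinger operator *)

Section PointwiseContinuity.
Variables (R : realType) (d : nat).
Notation pt := (d.-tuple R).
Implicit Types (f g : pt -> R).

(** A filter for the Euclidean norm in which [tcont] is stated, so that the limit rules for sums and
    products apply. *)
Definition tnbhs (x : pt) : set_system pt :=
  filter_from [set del : R | 0 < del] (fun del => [set y | tnorm (tsub y x) < del]).

Lemma tnbhs_filter x : Filter (tnbhs x).
Proof.
apply: filter_from_filter; first by exists 1; exact: ltr01.
move=> i j /= i0 j0; exists (Num.min i j) => /=; first by rewrite lt_min i0 j0.
by move=> y /=; rewrite lt_min => /andP[].
Qed.
#[local] Existing Instance tnbhs_filter.

Lemma tcontP f : tcont f <-> forall x, f @ tnbhs x --> f x.
Proof.
split=> [cf x|cf x e e0].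
  apply/cvgrPdist_lt => e e0; have [del [d0 H]] := cf x e e0.
  by exists del => // y /= /H; rewrite distrC.
have /cvgrPdist_lt/(_ _ e0)[del d0 H] := cf x.
by exists del; split => // y /H /=; rewrite distrC.
Qed.

Lemma tcont_cst (c : R) : tcont (fun _ : pt => c).
Proof. by apply/tcontP => x; exact: cvg_cst. Qed.

Lemma tcontD f g : tcont f -> tcont g -> tcont (fun x => f x + g x).
Proof. by move=> /tcontP cf /tcontP cg; apply/tcontP => x; exact: cvgD. Qed.

Lemma tcontM f g : tcont f -> tcont g -> tcont (fun x => f x * g x).
Proof. by move=> /tcontP cf /tcontP cg; apply/tcontP => x; exact: cvgM. Qed.

Lemma tcont_sum (I : Type) (s : seq I) (F : I -> pt -> R) : (forall i, tcont (F i)) ->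
  tcont (fun x => \sum_(i <- s) F i x).
Proof.
move=> cF; elim: s => [|i s IH].
  by under eq_fun do rewrite big_nil; exact: tcont_cst.
by under eq_fun do rewrite big_cons; exact: tcontD.
Qed.

Lemma tcont_prod (I : Type) (s : seq I) (F : I -> pt -> R) : (forall i, tcont (F i)) ->
  tcont (fun x => \prod_(i <- s) F i x).
Proof.
move=> cF; elim: s => [|i s IH].
  by under eq_fun do rewrite big_nil; exact: tcont_cst.
by under eq_fun do rewrite big_cons; exact: tcontM.
Qed.

Lemma tcont_tnth (F : R -> R) i : continuous F -> tcont (fun x : pt => F (tnth x i)).
Proof.
move=> cF; apply/tcontP => x.
suff H : (fun y : pt => tnth y i) @ tnbhs x --> tnth x i by apply: (cvg_comp _ _ H); exact: cF.
apply/cvgrPdist_lt => e e0; exists e => // y /=.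
apply: le_lt_trans; rewrite distrC.
by have := abs_tnth_le (tsub y x) i; rewrite tnth_mktuple.
Qed.

End PointwiseContinuity.

Section GaussianPolynomials.
Variables (R : realType) (d : nat) (al : R).
Hypothesis al0 : 0 < al.
Notation pt := (d.-tuple R).

(** A class that contains the Hermite functions and is stable under partial derivatives, each of
    which acts on one polynomial by [dgs]. *)
Definition polygs (c : R) (p : 'I_d -> {poly R}) (x : pt) : R :=
  c * \prod_j ((p j).[tnth x j] * gs al (tnth x j)).

Definition updp (p : 'I_d -> {poly R}) i (q : {poly R}) : 'I_d -> {poly R} :=
  fun j => if j == i then q else p j.

Lemma polygs_tshift c p x i s : polygs c p (tshift x i s) =
  c * \prod_(j | j != i) ((p j).[tnth x j] * gs al (tnth x j)) *
  ((p i).[tnth x i + s] * gs al (tnth x i + s)).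
Proof.
rewrite /polygs (bigD1 i)//= tnth_mktuple eqxx [RHS]mulrAC [LHS]mulrA; congr (_ * _).
by apply: eq_bigr => j /negPf ji; rewrite tnth_mktuple ji.
Qed.

Lemma is_derive_polygs c p x i :
  is_derive (0 : R) (1 : R) (fun s : R => polygs c p (tshift x i s)) (polygs c (updp p i (dgs al (p i))) x).
Proof.
under eq_fun do rewrite polygs_tshift.
have D := is_derive_shift (tnth x i) 0 (@is_derive_horner_gs R (p i) al).
apply: trigger_derive (is_deriveZ (c * \prod_(j | j != i) ((p j).[tnth x j] * gs al (tnth x j))) D) _.
rewrite addr0 /polygs [in RHS](bigD1 i)//= /updp eqxx /dgs.
rewrite [RHS]mulrCA [LHS]mulrC; congr (_ * _); congr (_ * _).
by apply: eq_bigr => j /negPf ->.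
Qed.

Lemma pd_polygs c p i : pd i (polygs c p) = polygs c (updp p i (dgs al (p i))).
Proof. by apply/funext => x; rewrite /pd derive1E; exact: (@derive_val _ _ _ _ _ _ _ (is_derive_polygs c p x i)). Qed.

Lemma tcont_polygs c p : tcont (polygs c p).
Proof.
apply: tcontM; first exact: tcont_cst.
apply: tcont_prod => i; apply: (@tcont_tnth R d (fun t => (p i).[t] * gs al t)) => t.
apply: differentiable_continuous; apply/derivable1_diffP.
by have [] := is_derive_horner_gs (p i) al t.
Qed.

Lemma C2_polygs c p : C2 (polygs c p).
Proof.
split; first exact: tcont_polygs.
split; first by move=> i x; have [] := is_derive_polygs c p x i.
split; first by move=> i; rewrite pd_polygs; exact: tcont_polygs.
split; first by move=> i j x; rewrite pd_polygs; have [] := is_derive_polygs c (updp p j (dgs al (p j))) x i.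
by move=> i j; rewrite !pd_polygs; exact: tcont_polygs.
Qed.

Lemma lap_psi c b (x : pt) : lap (fun x => c * psi al b x) x = (qpot al x - lev al b) * (c * psi al b x).
Proof.
have -> : (fun x => c * psi al b x) = polygs c (fun i => hpoly al (b i)) by [].
rewrite /lap; under eq_bigr do rewrite !pd_polygs /polygs.
transitivity (\sum_i (4 * al ^+ 2 * tnth x i ^+ 2 - 2 * al - 4 * al * (b i)%:R) * (c * psi al b x)).
  apply: eq_bigr => i _; rewrite /psi (bigD1 i)//= [in RHS](bigD1 i)//= /updp !eqxx dgs2_hpoly /hfun -!mulrA.
  rewrite [LHS]mulrCA; congr (_ * (_ * (_ * (_ * _)))).
  by apply: eq_bigr => j /negPf ->.
rewrite -mulr_suml; congr (_ * _); rewrite !sumrB -!mulr_sumr sumr_const card_ord.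
by rewrite /qpot /lev tnorm_sqr natr_sum -[_ *+ d]mulr_natl; ring.
Qed.

Lemma gaussE be : @gauss R d al be = fun x => be * psi al (fun=> 0%N) x.
Proof. by rewrite psi0E. Qed.

(** The density is a multiple of the ground state, so its potential is read off [lap_psi] at degree
    0. *)
Lemma LrhoE be f x : 0 < be -> Lrho (@gauss R d al be) f x = - lap f x + qpot al x * f x.
Proof.
move=> be0; rewrite /Lrho gaussE lap_psi; congr (_ + _ * _).
have -> : @lev R d al (fun=> 0%N) = 0 by rewrite /lev big1// mulr0.
rewrite subr0 mulfK// gt_eqF// mulr_gt0// psi0E; exact: gam_gt0.
Qed.

Lemma Lrho_psi be b (x : pt) : 0 < be -> Lrho (@gauss R d al be) (psi al b) x = lev al b * psi al b x.
Proof.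
move=> be0; rewrite LrhoE//.
have e : psi al b = (fun x => 1 * psi al b x) :> (pt -> R) by apply/funext => y; rewrite mul1r.
by rewrite [in lap _ x]e lap_psi; ring.
Qed.

Lemma C2_psi b : C2 (@psi R d al b).
Proof.
have -> : psi al b = polygs 1 (fun i => hpoly al (b i)) by apply/funext => y; rewrite /polygs mul1r.
exact: C2_polygs.
Qed.

End GaussianPolynomials.

(** * Completeness of the Hermite functions among continuous square integrable functions *)

Section HermiteCompleteness.
Variables (R : realType) (d : nat) (al : R).
Hypothesis al0 : 0 < al.
Notation pt := (d.-tuple R).
Notation mu := (vol R d).
Notation sq := (sqint (vol R d)).
Notation ip := (ipm (vol R d)).
Notation gm := (@gam R d al).

(** Used at [n = d], where it beats the factor [q ^ d] in front of the Mehler kernel by one power of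
    [q]. *)
Lemma expRN_le_pow (u : R) n : 0 < u -> expR (- u) <= (n.+1%:R / u) ^+ n.+1.
Proof.
move=> u0; rewrite expRN -[leRHS]invrK -exprVn invf_div lef_pV2 ?posrE ?expR_gt0 ?exprn_gt0 ?divr_gt0//.
have -> : expR u = expR (u / n.+1%:R) ^+ n.+1 by rewrite -expRM_natr divfK// pnatr_eq0.
apply: lerXn2r; rewrite ?nnegrE ?expR_ge0 ?divr_ge0 ?(ltW u0)//.
by apply: le_trans (expR_ge1Dx _); rewrite lerDr.
Qed.

Lemma Km_le (r : R) (x y : pt) : 1 / 2 <= r -> r < 1 -> 1 <= mq al r ->
  Km al r (x, y) <= (3 * mq al r) ^+ d * expR (- (mq al r * tnorm (tsub y x) ^+ 2)).
Proof.
move=> r2 r1 q1; have r0 : 0 < r by lra.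
have b0 := ltW (mb_gt0 al0 r0 r1); set q := mq al r in q1 *.
have -> : expR (- (q * tnorm (tsub y x) ^+ 2)) = \prod_i gs q (tnth x i - tnth y i).
  rewrite tnorm_sqr mulr_sumr -sumrN expR_sum; apply: eq_bigr => i _.
  by rewrite /gs tnth_mktuple -[in RHS]sqrrN opprB mulNr.
have -> : (3 * q) ^+ d = \prod_(i < d) (3 * q) by rewrite prodr_const card_ord.
rewrite -big_split/=; apply: ler_prod => i _; rewrite mk_ge0/=.
apply: ler_pM; rewrite ?sqrtr_ge0 ?expR_ge0//.
  have B2 : mB al r / pi <= 2 * q.
    have BE : mB al r = q / r.
      by rewrite /mB /q /mq [RHS]mulrAC mulfK// gt_eqF.
    have q0 : 0 <= q by lra.
    have p1 : 1 <= pi :> R by apply: le_trans (pi_ge2 R); lra.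
    rewrite ler_pdivrMr ?pi_gt0// BE ler_pdivrMr//.
    have := ler_wpM2l q0 r2; have qr : 0 <= 2 * (q * r) by rewrite mulr_ge0// mulr_ge0// ltW.
    have := ler_wpM2l qr p1; lra.
  have p0 : 0 <= mB al r / pi by rewrite divr_ge0 ?pi_ge0// ltW// mB_gt0.
  have s0 := sqrtr_ge0 (mB al r / pi); have s2 := sqr_sqrtr p0.
  have := sqr_ge0 (Num.sqrt (mB al r / pi) - 1); rewrite sqrrB s2; lra.
rewrite ler_expR -/q; have : 0 <= mb al r * (tnth x i ^+ 2 + tnth y i ^+ 2).
  by rewrite mulr_ge0// addr_ge0// sqr_ge0.
lra.
Qed.

(** Half of the Gaussian exponent provides smallness in [mq], the other half an integrable weight in
    [y] that does not depend on [r]. *)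
Lemma Km_far (x : pt) (del : R) : 0 < del -> exists2 D : R, 0 <= D & forall r, 1 / 2 <= r -> r < 1 ->
  1 <= mq al r -> forall y : pt, del <= tnorm (tsub y x) -> Km al r (x, y) <= D / mq al r * wgt (1 / 4) y.
Proof.
move=> d0; pose E := expR (tnorm x ^+ 2 / 2).
pose D := 3 ^+ d * (d.+1%:R / (del ^+ 2 / 2)) ^+ d.+1 * E.
exists D; first by have := expR_ge0 (tnorm x ^+ 2 / 2); rewrite /D -/E => ?; pos.
move=> r r2 r1 q1 y dy; apply: le_trans (Km_le x y r2 r1 q1) _; set q := mq al r in q1 *.
have q0 : 0 < q by lra.
set t := tnorm (tsub y x) in dy *.
have t0 : del ^+ 2 <= t ^+ 2 by apply: lerXn2r; rewrite ?nnegrE ?(ltW d0)// /t tnorm_ge0.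
have wE : wgt (1 / 4) y = expR (- (1 / 4 * tnorm y ^+ 2)) by rewrite /wgt gauss_prod.
have tri : tnorm y ^+ 2 <= 2 * t ^+ 2 + 2 * tnorm x ^+ 2.
  have := tnormD (tsub y x) x; rewrite vadd_tsub -/t => h.
  have ty := tnorm_ge0 y; have tx := tnorm_ge0 x; have tt0 : 0 <= t := tnorm_ge0 _.
  have : tnorm y ^+ 2 <= (t + tnorm x) ^+ 2 by apply: lerXn2r; rewrite ?nnegrE// addr_ge0.
  by have := sqr_ge0 (t - tnorm x); rewrite sqrrB sqrrD; lra.
have e1 : expR (- (q * t ^+ 2)) <= expR (- (q * (del ^+ 2 / 2))) * (E * wgt (1 / 4) y).
  rewrite wE -!expRD ler_expR; have qt := ler_wpM2l (ltW q0) t0.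
  have : t ^+ 2 * 1 <= t ^+ 2 * q by apply: ler_wpM2l q1; exact: sqr_ge0.
  by move: tri qt; clear; lra.
have u0 : 0 < q * (del ^+ 2 / 2) by rewrite mulr_gt0// divr_gt0// exprn_gt0.
have e2 := expRN_le_pow d u0.
have w0 : 0 <= E * wgt (1 / 4) y by rewrite wE mulr_ge0 ?expR_ge0.
have e3 := le_trans e1 (ler_wpM2r w0 e2).
have q3 : 0 <= (3 * q) ^+ d by pos.
apply: le_trans (ler_wpM2l q3 e3) _; rewrite le_eqVlt; apply/orP; left; apply/eqP.
rewrite /D; have q' := lt0r_neq0 q0; have d' := lt0r_neq0 d0.
have -> : d.+1%:R / (q * (del ^+ 2 / 2)) = d.+1%:R / (del ^+ 2 / 2) / q.
  by field; rewrite q' d'.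
rewrite [(_ / q) ^+ _]exprMn exprMn exprVn [q ^+ d.+1]exprS.
move: (_ ^+ d.+1) => X; field; rewrite q'/=; exact: lt0r_neq0 (exprn_gt0 _ q0).
Qed.

(** Subtracting the multiple of the ground state with the same value at [x] leaves a function [Phi]
    vanishing there, and the ground state is fixed by the Mehler operator. The total mass of the
    kernel never has to be computed. *)
Lemma mehler_approx (G : pt -> R) (x : pt) (e : R) : tcont G -> sq G -> 0 < e ->
  exists2 C : R, 0 <= C & forall r, 1 / 2 <= r -> r < 1 -> 1 <= mq al r ->
  `|mehler al r G x - G x| <= e * gm x + C / mq al r.
Proof.
move=> cG sG e0; pose H := G x / gm x.
have gx := gam_gt0 al x; have HE : H * gm x = G x by rewrite /H divfK// gt_eqF.
have g00 : psi al (fun=> 0%N) = gm by exact: psi0E.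
have sg : sq gm by exact: gam_sq.
have cg : tcont gm by rewrite -g00; have [] := @C2_psi R d al (fun=> 0%N).
pose Phi y := G y + - H * gm y.
have cP : tcont Phi by apply: tcontD => //; apply: tcontM => //; exact: tcont_cst.
have near (s : R) : `|s| <= 1 -> exists2 del, 0 < del & forall y, tnorm (tsub y x) < del -> s * Phi y <= e * gm y.
  move=> s1; have c1 : tcont (fun y => e * gm y + - s * Phi y).
    by apply: tcontD; apply: tcontM => //; exact: tcont_cst.
  have [del [d0 hd]] := c1 x (e * gm x) (mulr_gt0 e0 gx).
  exists del => // y /hd; rewrite ltr_norml => /andP[+ _].
  have -> : Phi x = 0 by rewrite /Phi mulNr HE subrr.
  by rewrite mulr0 addr0 mulNr; lra.
have [|d1 d10 n1] := near 1; first by rewrite normr1.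
have [|d2 d20 n2] := near (-1); first by rewrite normrN normr1.
have dl0 : 0 < Num.min d1 d2 by rewrite lt_min d10 d20.
have [D D0 HD] := Km_far x dl0.
have sw : sq (wgt (d := d) (1 / 4)) by apply: wgt_sq; lra.
have sN (F : pt -> R) : sq F -> sq (fun y => `|F y|).
  move=> [mF iF]; split; first exact: measurableT_comp.
  by apply: eq_integrable iF => // y _; rewrite /= real_normK ?num_real.
have sT : sq (fun y => `|G y| + `|H| * gm y) by apply: sqintD; [exact: sN|exact: sqintZ].
have I0 : 0 <= ip (wgt (1 / 4)) (fun y => `|G y| + `|H| * gm y).
  apply: Rintegral_ge0 => y _; rewrite mulr_ge0//; first by apply: prodr_ge0 => i _; exact: gs_ge0.
  by rewrite addr_ge0// mulr_ge0// ltW// gam_gt0.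
set I := ip _ _ in I0.
exists (D * I); first exact: mulr_ge0.
move=> r r2 r1 q1; have r0 : 0 < r by lra.
have sK := Km_sq al0 r0 r1 x.
have E1 : ip (fun y => Km al r (x, y)) gm = gm x.
  by rewrite -g00 Km_psi// big1// expr0 mul1r.
have sP : sq Phi by apply: sqintD => //; exact: sqintZ.
have -> : mehler al r G x - G x = ip (fun y => Km al r (x, y)) Phi.
  rewrite -HE -E1 /mehler /kint.
  have sg' : sq (fun y => - H * gm y) by exact: sqintZ.
  by rewrite [RHS]ipmC ipmD// ipmZ// ![ip _ (fun y => Km al r (x, y))]ipmC mulNr.
have q0 : 0 < mq al r by lra.
have iL := sqint_mul sK sP.
have iR : mu.-integrable setT (EFin \o (fun y => e * (Km al r (x, y) * gm y) + D / mq al r * (wgt (1 / 4) y * (`|G y| + `|H| * gm y)))).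
  have := integrableD measurableT (integrableZl measurableT e (sqint_mul sK sg))
    (integrableZl measurableT (D / mq al r) (sqint_mul sw sT)).
  by apply: eq_integrable.
apply: le_trans (le_normr_Rintegral measurableT iL) _.
have -> : e * gm x + D * I / mq al r =
    \int[mu]_y (e * (Km al r (x, y) * gm y) + D / mq al r * (wgt (1 / 4) y * (`|G y| + `|H| * gm y))).
  rewrite RintegralD//; last 2 first.
  - by have := integrableZl measurableT e (sqint_mul sK sg); apply: eq_integrable.
  - by have := integrableZl measurableT (D / mq al r) (sqint_mul sw sT); apply: eq_integrable.
  rewrite RintegralZl//; last exact: sqint_mul.
  rewrite RintegralZl//; last exact: sqint_mul.
  by rewrite -/(ip _ _) E1 -/(ip _ _) -/I mulrAC.
apply: le_Rintegral => //.
  by have := integrable_norm iL; apply: eq_integrable.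
move=> y _; have K0 := Km_ge0 al r (x, y); have g0 := ltW (gam_gt0 al y).
have w0 : 0 <= wgt (1 / 4) y by apply: prodr_ge0 => i _; exact: gs_ge0.
have T0 : 0 <= `|G y| + `|H| * gm y by rewrite addr_ge0// mulr_ge0.
have Dq : 0 <= D / mq al r by rewrite divr_ge0// ltW.
rewrite normrM ger0_norm//.
have [le|lt] := leP (Num.min d1 d2) (tnorm (tsub y x)).
  have P1 : `|Phi y| <= `|G y| + `|H| * gm y.
    by apply: le_trans (ler_normD _ _) _; rewrite normrM normrN (ger0_norm g0).
  have := ler_pM K0 (normr_ge0 _) (HD r r2 r1 q1 y le) P1.
  have : 0 <= e * (Km al r (x, y) * gm y) by rewrite mulr_ge0 ?(ltW e0)// mulr_ge0.
  rewrite -(mulrA (D / mq al r)); lra.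
move: lt; rewrite lt_min => /andP[l1 l2].
have P1 : `|Phi y| <= e * gm y.
  by rewrite ler_norml; have := n1 y l1; have := n2 y l2; rewrite mul1r mulN1r => *; apply/andP; split; lra.
have := ler_wpM2l K0 P1; have : 0 <= D / mq al r * (wgt (1 / 4) y * (`|G y| + `|H| * gm y)).
  by rewrite mulr_ge0// mulr_ge0.
lra.
Qed.

Lemma mehler_zero (G : pt -> R) (x : pt) : tcont G -> sq G ->
  (forall n : nat, mehler al (1 - n.+2%:R^-1) G x = 0) -> G x = 0.
Proof.
move=> cG sG M0; apply/eqP; rewrite -normr_le0; apply/ler_addgt0Pr => e e0; rewrite add0r.
have gx := gam_gt0 al x; have a0 := al0.
have e20 : 0 < e / 2 / gm x by rewrite !divr_gt0.
have [C C0 HC] := mehler_approx x cG sG e20.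
(* Makes [mq al r], which is at least [al * n.+2%:R / 2], exceed both 1 and [2 * C / e]. *)
pose B := 2 / al + 4 * C / (al * e).
have B0 : 0 <= B by rewrite /B; have := ltW a0; have := ltW e0 => *; pos.
have := archi_boundP B0; set n := Num.bound B => Bn.
have n2 : 0 < n.+2%:R :> R by [].
have nB : B <= n.+2%:R by apply: le_trans (ltW Bn) _; rewrite ler_nat (leq_trans (leqnSn n)).
pose r : R := 1 - n.+2%:R^-1.
have i2 : n.+2%:R^-1 <= 1 / 2 :> R by rewrite div1r lef_pV2 ?posrE// ler_nat.
have i0 : 0 < n.+2%:R^-1 :> R by rewrite invr_gt0.
have r2 : 1 / 2 <= r by rewrite /r; move: i2; move: (n.+2%:R^-1 : R) => u; lra.
have r1 : r < 1 by rewrite /r ltrBlDr ltrDl.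
have r0 : 0 < r by lra.
have qge : al * n.+2%:R / 2 <= mq al r.
  rewrite /mq ler_pdivlMr ?r2_lt1//.
  have -> : al * n.+2%:R / 2 * (1 - r ^+ 2) = al * (1 + r) / 2.
    by rewrite /r; have := lt0r_neq0 n2; move: (n.+2%:R : R) => u u0; field.
  have := ler_wpM2l (ltW a0) r2; have := ler_wpM2l (ltW a0) (ltW r1); lra.
have an : al * B <= al * n.+2%:R by rewrite ler_pM2l.
have aB : al * B = 2 + 4 * C / e.
  by rewrite /B; have := lt0r_neq0 a0; have := lt0r_neq0 e0 => *; field; apply/andP.
have Ce : 0 <= 4 * C / e by rewrite divr_ge0 ?(ltW e0)// mulr_ge0.
have q1 : 1 <= mq al r by move: qge an aB Ce; clear; lra.
have q0 : 0 < mq al r by lra.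
have := HC r r2 r1 q1; rewrite /r M0 sub0r normrN -/r divfK ?gt_eqF// => h.
apply: le_trans h _; rewrite [leRHS]splitr lerD2l ler_pdivrMr//.
have qC : 2 * C / e <= mq al r by move: qge an aB; clear; lra.
by move: qC; rewrite ler_pdivrMr//; clear; lra.
Qed.

(** By [mehler_orth] the Mehler image vanishes a.e. for each parameter; countably many parameters
    tending to 1 keep the exceptional set null, and continuity of [G] identifies the limit. *)
Theorem hermite_complete (G : pt -> R) : tcont G -> sq G -> (forall b, ip (psi al b) G = 0) -> ip G G = 0.
Proof.
move=> cG sG G0.
have ri n : 0 < 1 - n.+2%:R^-1 :> R /\ 1 - n.+2%:R^-1 < 1 :> R.
  have i2 : n.+2%:R^-1 <= 1 / 2 :> R by rewrite div1r lef_pV2 ?posrE// ler_nat.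
  have i0 : 0 < n.+2%:R^-1 :> R by rewrite invr_gt0.
  by split; move: i2 i0; move: (n.+2%:R^-1 : R) => u; lra.
have ae n : {ae mu, forall x, mehler al (1 - n.+2%:R^-1) G x = 0}.
  have [r0 r1] := ri n; have sM := mehler_sq al0 r0 r1 sG.
  have := ipm_eq0 sM (mehler_orth al0 r0 r1 sG G0).
  have mM : measurable_fun [set: pt] (EFin \o mehler al (1 - n.+2%:R^-1) G) by apply/measurable_EFinP; case: sM.
  move/(ae_eq_integral_abs mu measurableT mM); apply: filterS => x /(_ I)/=.
  by move=> [].
have aG : {ae mu, forall x, G x = 0} by move/ae_foralln: ae; apply: filterS => x; exact: mehler_zero.
rewrite /ipm /Rintegral; have [mG _] := sG.
rewrite (ae_eq_integral (cst 0%E))//= ?integral0//.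
- by apply/measurable_EFinP; exact: measurable_funM.
by apply: filterS aG => x -> _; rewrite /= mulr0.
Qed.

End HermiteCompleteness.

(** * Integration by parts through second differences and cut-offs *)

Section SecondDifferences.
Variable R : realType.

Lemma is_derive_unshift (phi : R -> R) (s D : R) :
  is_derive (0 : R) (1 : R) (fun u => phi (s + u)) D -> is_derive s (1 : R) phi D.
Proof.
move=> h; have -> : phi = (fun u => phi (s + u)) \o horner ('X - s%:P).
  by apply/funext => t; rewrite /= !(hornerD, hornerN, hornerX, hornerC) [s + _]addrC subrK.
have e : ('X - s%:P : {poly R}).[s] = 0 by rewrite !hornerE subrr.
have h' : is_derive ('X - s%:P : {poly R}).[s] (1 : R) (fun u => phi (s + u)) D by rewrite e.
apply: trigger_derive (is_derive1_comp h' (is_derive_poly ('X - s%:P) s)) _.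
by rewrite derivB derivC derivX subr0 !hornerE ?mulr1.
Qed.

(** For a function that is merely [C2] the error is measured by the oscillation [M] of the second
    derivative about [c], not by higher derivatives. *)
Lemma second_difference (f f1 f2 : R -> R) (c M z : R) :
  (forall y, is_derive y (1 : R) f (f1 y)) -> (forall y, is_derive y (1 : R) f1 (f2 y)) ->
  (forall t, `|t| <= z -> `|f2 t - c| <= M) -> 0 <= z ->
  `|f z + f (- z) - 2 * f 0 - z ^+ 2 * c| <= 2 * M * z ^+ 2.
Proof.
move=> d0 d1 fM z0.
have dsub (g g' : R -> R) s : (forall y, is_derive y (1 : R) g (g' y)) ->
    is_derive s (1 : R) (fun s => g (- s)) (- g' (- s)).
  move=> dg; have := is_derive_reflect 0 s dg; rewrite !sub0r.
  by under eq_fun do rewrite sub0r.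
have S1 t : 0 <= t <= z -> `|f1 t - f1 (- t) - 2 * t * c| <= 2 * M * z.
  move=> /andP[t0 tz]; apply: le_trans (_ : 2 * M * t <= _).
    apply: (@mvt_bound R (fun s => f1 s - f1 (- s) - 2 * s * c) (fun s => f2 s + f2 (- s) - 2 * c)) => //.
    - move=> s.
      have hp : is_derive s (1 : R) (fun s => 2 * s * c) (2 * c).
        have -> : (fun s => 2 * s * c) = horner ((2 * c) *: 'X) by apply/funext => u; rewrite !hornerE; ring.
        by apply: trigger_derive (is_derive_poly _ s) _; rewrite derivZ derivX !hornerE ?mulr1.
      apply: trigger_derive (is_deriveB (is_deriveB (d1 s) (dsub _ _ s d1)) hp) _.
      by rewrite opprK.
    - by rewrite oppr0; ring.
    - move=> s /andP[s0 st].
      have s1 : `|s| <= z by rewrite ger0_norm//; lra.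
      have s2 : `|- s| <= z by rewrite normrN.
      have -> : f2 s + f2 (- s) - 2 * c = (f2 s - c) + (f2 (- s) - c) by ring.
      by apply: le_trans (ler_normD _ _) _; have := fM _ s1; have := fM _ s2; lra.
  apply: ler_wpM2l => //; have : `|0 : R| <= z by rewrite normr0.
  by move=> /fM; have := normr_ge0 (f2 0 - c); lra.
rewrite expr2 mulrA.
apply: (@mvt_bound R (fun s => f s + f (- s) - 2 * f 0 - s * s * c) (fun s => f1 s - f1 (- s) - 2 * s * c)) => //.
- move=> s.
  have hp : is_derive s (1 : R) (fun s => 2 * f 0 + s * s * c) (2 * s * c).
    have -> : (fun s => 2 * f 0 + s * s * c) = horner ((2 * f 0)%:P + c *: 'X^2).
      by apply/funext => u; rewrite !(hornerD, hornerC, hornerZ, hornerXn); ring.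
    apply: trigger_derive (is_derive_poly _ s) _.
    by rewrite derivD derivC derivZ derivXn add0r !(hornerZ, hornerMn, hornerXn) -mulr_natl/=; ring.
  have -> : (fun s => f s + f (- s) - 2 * f 0 - s * s * c) = (fun s => f s + f (- s)) - (fun s => 2 * f 0 + s * s * c).
    by apply/funext => u; rewrite !fctE; ring.
  exact: (is_deriveB (is_deriveD (d0 s) (dsub _ _ s d0)) hp).
- by rewrite oppr0; ring.
Qed.

Lemma first_difference (f f1 : R -> R) (M z : R) : (forall y, is_derive y (1 : R) f (f1 y)) ->
  (forall t, `|t| <= z -> `|f1 t| <= M) -> 0 <= z ->
  `|f z - f 0| <= M * z /\ `|f (- z) - f 0| <= M * z.
Proof.
move=> d0 fM z0; split.
  apply: (@mvt_bound R (fun s => f s - f 0) f1) => //; last 2 first.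
  - by rewrite subrr.
  - by move=> t /andP[t0 tz]; apply: fM; rewrite ger0_norm.
  by move=> s; apply: trigger_derive (is_deriveB (d0 s) (is_derive_cst (f 0) s 1)) _; rewrite subr0.
apply: (@mvt_bound R (fun s => f (- s) - f 0) (fun s => - f1 (- s))) => //; last 2 first.
- by rewrite oppr0 subrr.
- by move=> t /andP[t0 tz]; rewrite normrN; apply: fM; rewrite normrN ger0_norm.
move=> s; have := is_derive_reflect 0 s d0; rewrite sub0r.
under eq_fun do rewrite sub0r; move=> h.
by apply: trigger_derive (is_deriveB h (is_derive_cst (f 0) s 1)) _; rewrite subr0.
Qed.

End SecondDifferences.

Section CoordinateShifts.
Variables (R : realType) (d : nat).
Notation pt := (d.-tuple R).
Notation mu := (vol R d).
Notation sq := (sqint (vol R d)).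
Notation ip := (ipm (vol R d)).
Implicit Types (f g : pt -> R).

Definition evec (i : 'I_d) (s : R) : pt := [tuple (if j == i then s else 0) | j < d].

Lemma tshift_vadd (x : pt) i s : tshift x i s = vadd x (evec i s).
Proof. by apply: eq_from_tnth => j; rewrite !tnth_mktuple; case: ifP => _ //; rewrite addr0. Qed.

Lemma tshiftD (x : pt) i s u : tshift (tshift x i s) i u = tshift x i (s + u).
Proof. by apply: eq_from_tnth => j; rewrite !tnth_mktuple; case: (j == i); rewrite ?addrA. Qed.

Lemma tshift0 (x : pt) i : tshift x i 0 = x.
Proof. by apply: eq_from_tnth => j; rewrite !tnth_mktuple addr0; case: ifP. Qed.

Lemma tnorm_evec i s : tnorm (evec i s) = `|s|.
Proof.
rewrite /tnorm (bigD1 i)//= big1 ?addr0; last by move=> j /negPf ji; rewrite tnth_mktuple ji expr0n.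
by rewrite tnth_mktuple eqxx sqrtr_sqr.
Qed.

Lemma tshift_dist (x : pt) i s : tnorm (tsub (tshift x i s) x) = `|s|.
Proof. by rewrite tshift_vadd vaddC tsub_vadd tnorm_evec. Qed.

Lemma tshift_norm (x : pt) i s : tnorm (tshift x i s) <= tnorm x + `|s|.
Proof. by rewrite tshift_vadd; apply: le_trans (tnormD _ _) _; rewrite tnorm_evec. Qed.

Lemma measurable_tshift i s : measurable_fun [set: pt] (fun x : pt => tshift x i s).
Proof.
rewrite (_ : (fun _ => _) = fun x => vadd x (evec i s)); last by apply/funext => x; rewrite tshift_vadd.
exact: measurable_vadd_r.
Qed.

Lemma int_tshift i s f : measurable_fun [set: pt] f ->
  \int[mu]_x f (tshift x i s) = \int[mu]_x f x.
Proof.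
move=> mf; rewrite /Rintegral -(@int_vadd R d (evec i s) (EFin \o f)); last exact/measurable_EFinP.
by congr fine; apply: eq_integral => x _; rewrite /= tshift_vadd.
Qed.

Lemma sq_tshift i s f : sq f -> sq (fun x => f (tshift x i s)).
Proof.
move=> [mf /integrableP[m2 i2]]; have ms := measurable_tshift i s; split.
  exact: (measurableT_comp mf ms).
apply/integrableP; split.
  exact: (measurableT_comp m2 ms).
move: i2; rewrite -(@int_vadd R d (evec i s) (fun x => `|(EFin \o (fun x => (f x ^+ 2)%R)) x|)%E); last exact: measurableT_comp.
by congr (_ < _)%E; apply: eq_integral => x _; rewrite /= tshift_vadd.
Qed.

Definition diff2 i (s : R) f (x : pt) : R := f (tshift x i s) + f (tshift x i (- s)) - 2 * f x.

Lemma diff2_sq i s f : sq f -> sq (diff2 i s f).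
Proof. by move=> sf; apply: sqintB; [apply: sqintD; exact: sq_tshift|exact: sqintZ]. Qed.

(** Translation invariance of the volume: an integration by parts in which no derivative of [f] is
    integrated. *)
Lemma diff2_sym i s f g : sq f -> sq g -> ip (diff2 i s f) g = ip f (diff2 i s g).
Proof.
move=> sf sg; have S t : ip (fun x => f (tshift x i t)) g = ip f (fun x => g (tshift x i (- t))).
  rewrite /ipm -[RHS](@int_tshift i t (fun x => f x * g (tshift x i (- t)))).
    by apply: eq_Rintegral => x _; rewrite tshiftD addrN tshift0.
  by have [mf _] := sf; have [mg _] := sq_tshift i (- t) sg; exact: measurable_funM.
have sft t : sq (fun x => f (tshift x i t)) by exact: sq_tshift.
have sgt t : sq (fun x => g (tshift x i t)) by exact: sq_tshift.
have s2 t h : sq h -> sq (fun x => h (tshift x i t) + h (tshift x i (- t))).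
  by move=> sh; apply: sqintD; exact: sq_tshift.
rewrite /diff2 ipmB//; [|exact: s2|exact: sqintZ]; rewrite ipmD//.
rewrite [RHS]ipmC ipmB//; [|exact: s2|exact: sqintZ]; rewrite ipmD//.
by rewrite !ipmZ// !S opprK [RHS]addrC ![ip f _]ipmC; rewrite [RHS]addrC (addrC (ip (fun x => g (tshift x i (- s))) f)).
Qed.

(** Sequential compactness of the ball, by diagonal extraction on the coordinates. *)
Lemma tcont_bounded f (r : R) : tcont f -> exists M : R, forall x, tnorm x <= r -> `|f x| <= M.
Proof.
move=> cf; apply: contrapT => /forallNP H.
have /choice[u uP] : forall n : nat, exists x : pt, tnorm x <= r /\ n%:R < `|f x|.
  move=> n; apply: contrapT => /forallNP Hn; apply: (H n%:R) => x xr.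
  by rewrite leNgt; apply/negP => lt; apply: (Hn x).
(* The default value 0 extends the coordinates to all indices, as [diagonal_subseq] expects. *)
have bu n j : `|nth 0 (u n) j| <= `|r|.
  have [ur _] := uP n; have [jd|jd] := ltnP j d.
    have := abs_tnth_le (u n) (Ordinal jd); rewrite (tnth_nth 0)/= => h.
    by apply: le_trans h _; apply: le_trans ur _; exact: ler_norm.
  by rewrite nth_default ?size_tuple// normr0.
have [phi [phii phic]] := diagonal_subseq bu.
have /choice[l lP] := phic.
pose x : pt := [tuple l i | i < d].
have c0 : tnorm (tsub (u (phi n)) x) @[n --> \oo] --> (0 : R).
  have ci i : (fun n => tnth (tsub (u (phi n)) x) i ^+ 2) @ \oo --> (0 : R).
    have -> : (fun n => tnth (tsub (u (phi n)) x) i ^+ 2) = fun n => (nth 0 (u (phi n)) i - l i) * (nth 0 (u (phi n)) i - l i).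
      by apply/funext => n; rewrite !tnth_mktuple (tnth_nth 0) expr2.
    have e : (0 : R) = (l i - l i) * (l i - l i) by rewrite subrr mulr0.
    rewrite [X in _ --> X]e.
    by apply: cvgM; (apply: cvgB; [exact: lP|exact: cvg_cst]).
  have cs (s : seq 'I_d) : (fun n => \sum_(i <- s) tnth (tsub (u (phi n)) x) i ^+ 2) @ \oo --> (0 : R).
    elim: s => [|i s IH].
      by rewrite (_ : (fun _ => _) = cst 0); [exact: cvg_cst|apply/funext => n; rewrite big_nil].
    rewrite (_ : (fun _ => _) = fun n => tnth (tsub (u (phi n)) x) i ^+ 2 + \sum_(i <- s) tnth (tsub (u (phi n)) x) i ^+ 2).
      have e : (0 : R) = 0 + 0 by rewrite addr0.
      rewrite [X in _ --> X]e; exact: (cvgD (ci i) IH).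
    by apply/funext => n; rewrite big_cons.
  rewrite -(@sqrtr0 R); apply: (cvg_comp _ Num.sqrt); last exact: sqrt_continuous.
  exact: cs.
have [del [d0 hd]] := cf x 1 ltr01.
have /cvgrPdist_lt/(_ _ d0)[N _ HN] := c0.
have m0 : 0 <= `|f x| + 1 by rewrite addr_ge0.
have := archi_boundP m0; set m := Num.bound _ => mB.
have := hd (u (phi (maxn N m))); have := HN _ (leq_maxl N m : (N <= maxn N m)%N).
rewrite /= sub0r normrN ger0_norm ?tnorm_ge0// => lt /(_ lt) h.
have [_ lt2] := uP (phi (maxn N m)).
have phige k : (k <= phi k)%N by elim: k => // k IH; exact: leq_ltn_trans IH (phii k).
have m2 : m%:R <= (phi (maxn N m))%:R :> R by rewrite ler_nat; exact: leq_trans (leq_maxr N m) (phige _).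
have := ler_normD (f (u (phi (maxn N m))) - f x) (f x); rewrite subrK => h3.
by move: h lt2 mB m2 h3; clear; lra.
Qed.

End CoordinateShifts.

Section Cutoff.
Variables (R : realType) (d : nat).
Notation pt := (d.-tuple R).
Notation mu := (vol R d).
Notation sq := (sqint (vol R d)).

Lemma pos_sqr_lip (u y : R) : u <= 1 -> y <= 1 ->
  `|Num.max y 0 ^+ 2 - Num.max u 0 ^+ 2| <= 2 * `|y - u|.
Proof.
move=> u1 y1; have [yp|yn] := leP 0 y; have [up|un] := leP 0 u.
- rewrite subr_sqr normrM mulrC; apply: ler_wpM2r => //.
  by rewrite ger0_norm ?addr_ge0//; lra.
- have -> : `|y - u| = y - u by rewrite ger0_norm//; lra.
  rewrite expr0n subr0 ger0_norm ?sqr_ge0//.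
  by have := ler_wpM2l yp y1; rewrite expr2; lra.
- have -> : `|y - u| = u - y by rewrite distrC ger0_norm//; lra.
  rewrite expr0n sub0r normrN ger0_norm ?sqr_ge0//.
  by have := ler_wpM2l up u1; rewrite expr2; lra.
- by rewrite expr0n subrr normr0 mulr_ge0.
Qed.

Lemma pos_sqr_taylor (u y : R) :
  `|Num.max y 0 ^+ 2 - Num.max u 0 ^+ 2 - 2 * Num.max u 0 * (y - u)| <= (y - u) ^+ 2.
Proof.
have [yp|yn] := leP 0 y; have [up|un] := leP 0 u.
- have -> : y ^+ 2 - u ^+ 2 - 2 * u * (y - u) = (y - u) ^+ 2 by ring.
  by rewrite ger0_norm ?sqr_ge0.
- rewrite expr0n subr0 mulr0 mul0r subr0 ger0_norm ?sqr_ge0//.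
  apply: lerXn2r; rewrite ?nnegrE//; lra.
- have -> : 0 ^+ 2 - u ^+ 2 - 2 * u * (y - u) = u ^+ 2 + 2 * (u * - y) by ring.
  have h : 0 <= u * - y by rewrite mulr_ge0//; lra.
  have u2 := sqr_ge0 u; have y2 := sqr_ge0 y.
  by rewrite ger0_norm; [rewrite sqrrB; lra|lra].
- by rewrite expr0n subrr mulr0 mul0r subr0 normr0 sqr_ge0.
Qed.

(** Squaring the positive part removes the corner at the edge of the support, so that second
    differences are of the order of the squared step. *)
Definition cutoff (r : R) (x : pt) : R := Num.max (1 - tnorm x ^+ 2 / r ^+ 2) 0 ^+ 2.

Lemma cutoff_ge0 r x : 0 <= cutoff r x. Proof. exact: sqr_ge0. Qed.

Lemma cutoff_arg r (x : pt) : 1 - tnorm x ^+ 2 / r ^+ 2 <= 1.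
Proof. by rewrite gerBl divr_ge0// sqr_ge0. Qed.

Lemma cutoff_le1 r x : cutoff r x <= 1.
Proof. by rewrite /cutoff expr_le1 ?le_max ?lexx ?orbT// ge_max cutoff_arg ler01. Qed.

Lemma cutoff_eq0 r x : 0 < r -> r <= tnorm x -> cutoff r x = 0.
Proof.
move=> r0 rx; rewrite /cutoff (_ : Num.max _ _ = 0) ?expr0n//; apply/max_idPr.
by rewrite subr_le0 ler_pdivlMr ?exprn_gt0// mul1r lerXn2r ?nnegrE ?tnorm_ge0// ltW.
Qed.

Lemma measurable_cutoff r : measurable_fun [set: pt] (cutoff r).
Proof.
apply: measurable_funX; apply: measurable_maxr => //; apply: measurable_funB => //.
by apply: measurable_funM => //; apply: measurable_funX; exact: measurable_tnorm.
Qed.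

Lemma cutoff_sq r : 0 < r -> sq (cutoff r).
Proof.
move=> r0; have sw := wgt_sq d (@ltr01 R).
apply: (@sqint_dom _ _ _ mu (cutoff r) (fun x => expR (r ^+ 2) * wgt 1 x)) => //.
- exact: measurable_cutoff.
- move=> x; rewrite ger0_norm ?cutoff_ge0// /wgt gauss_prod mul1r -expRD.
have [lt|le] := ltP (tnorm x) r; last by rewrite cutoff_eq0// normr_ge0.
apply: le_trans (cutoff_le1 _ _) _; rewrite ger0_norm ?expR_ge0//.
rewrite -expR0 ler_expR subr_ge0 lerXn2r ?nnegrE ?tnorm_ge0//; exact: ltW.
- exact: sqintZ.
Qed.

Lemma tnorm_tshift_sqr (x : pt) i s : tnorm (tshift x i s) ^+ 2 = tnorm x ^+ 2 + 2 * s * tnth x i + s ^+ 2.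
Proof.
rewrite !tnorm_sqr (bigD1 i)//= [in RHS](bigD1 i)//= tnth_mktuple eqxx.
rewrite (eq_bigr (fun j => tnth x j ^+ 2)); first by ring.
by move=> j /negPf ji; rewrite tnth_mktuple ji.
Qed.

Lemma cutoff_far (r s : R) x i : 1 <= r -> `|s| <= 1 -> 2 * r < `|tnth x i| -> cutoff r (tshift x i s) = 0.
Proof.
move=> r1 s1 xr; apply: cutoff_eq0; first by lra.
apply: le_trans (abs_tnth_le (tshift x i s) i); rewrite tnth_mktuple eqxx.
by have := ler_normB (tnth x i + s) s; rewrite addrK; lra.
Qed.

(** With [a = s / r] and a coordinate of size at most [2 r], the argument moves by at most
    [4 |a| + a^2 <= 5 |a|]; [pos_sqr_lip] doubles this. For a larger coordinate both values
    vanish. *)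
Lemma cutoff_diff (r s : R) (x : pt) i : 1 <= r -> `|s| <= 1 ->
  `|cutoff r (tshift x i s) - cutoff r x| <= 10 * (`|s| / r).
Proof.
move=> r1 s1; have r0 : 0 < r by lra.
have sr : 0 <= `|s| / r by rewrite divr_ge0// ltW.
have sr1 : `|s| / r <= 1 by rewrite ler_pdivrMr//; lra.
have [xr|xr] := leP `|tnth x i| (2 * r); last first.
  have := cutoff_far (s := 0) r1 _ xr; rewrite tshift0 normr0 => -> //.
  by rewrite cutoff_far// subr0 normr0 mulr_ge0.
apply: le_trans (pos_sqr_lip (cutoff_arg _ _) (cutoff_arg _ _)) _.
have -> : 1 - tnorm (tshift x i s) ^+ 2 / r ^+ 2 - (1 - tnorm x ^+ 2 / r ^+ 2) =
    - (2 * (s / r) * (tnth x i / r) + (s / r) ^+ 2).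
  by rewrite tnorm_tshift_sqr; field; rewrite gt_eqF.
rewrite normrN.
have xr' : `|tnth x i / r| <= 2 by rewrite normrM normfV (gtr0_norm r0) ler_pdivrMr.
have sE : `|s / r| = `|s| / r by rewrite normrM normfV (gtr0_norm r0).
rewrite -sE; rewrite -sE in sr sr1; clear sE.
move: (s / r) (tnth x i / r) xr' sr sr1 => a b b2 a0 a1.
have := ler_normD (2 * a * b) (a ^+ 2); rewrite normrX 2!normrM (ger0_norm (ler0n R 2)).
have := ler_wpM2l a0 b2; have := ler_wpM2l a0 a1; rewrite expr2.
by move: (`|_ + _|) => N; lra.
Qed.

(** [54 = 25 + 25 + 4]: two remainders of [pos_sqr_taylor], each at most [(5 a)^2], and the term
    [4 m a^2] left by the first-order parts. *)
Lemma cutoff_diff2 (r s : R) (x : pt) i : 1 <= r -> 0 <= s <= 1 ->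
  `|diff2 i s (cutoff r) x| <= 54 * (s ^+ 2 / r).
Proof.
move=> r1 /andP[s0 s1]; have r0 : 0 < r by lra.
have sn1 : `|s| <= 1 by rewrite ger0_norm.
have sN1 : `|- s| <= 1 by rewrite normrN.
have s2r : 0 <= s ^+ 2 / r by rewrite divr_ge0 ?sqr_ge0// ltW.
have [xr|xr] := leP `|tnth x i| (2 * r); last first.
  have := cutoff_far (s := 0) r1 _ xr; rewrite tshift0 normr0 => z.
  by rewrite /diff2 !cutoff_far// z// mulr0 subr0 addr0 normr0 mulr_ge0.
set a := s / r; set b := tnth x i / r.
have a0 : 0 <= a by rewrite divr_ge0// ltW.
have a1 : a <= 1 by rewrite ler_pdivrMr//; lra.
have b2 : `|b| <= 2 by rewrite normrM normfV (gtr0_norm r0) ler_pdivrMr.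
have ar : a ^+ 2 <= s ^+ 2 / r.
  rewrite /a expr_div_n; apply: ler_wpM2l; first exact: sqr_ge0.
  by rewrite lef_pV2 ?posrE ?exprn_gt0// expr2 ler_peMr// ltW.
set u := 1 - tnorm x ^+ 2 / r ^+ 2.
have E t : 1 - tnorm (tshift x i t) ^+ 2 / r ^+ 2 - u = - (2 * (t / r) * b + (t / r) ^+ 2).
  by rewrite /u /b tnorm_tshift_sqr; field; rewrite gt_eqF.
have ep := E s; have em := E (- s); rewrite -/a in ep; rewrite mulNr -/a sqrrN in em.
have t1 := pos_sqr_taylor u (1 - tnorm (tshift x i s) ^+ 2 / r ^+ 2).
have t2 := pos_sqr_taylor u (1 - tnorm (tshift x i (- s)) ^+ 2 / r ^+ 2).
rewrite ep in t1; rewrite em in t2.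
rewrite /diff2 /cutoff -/u; set m1 := Num.max (1 - tnorm (tshift x i s) ^+ 2 / r ^+ 2) 0 in t1 *.
set m2 := Num.max (1 - tnorm (tshift x i (- s)) ^+ 2 / r ^+ 2) 0 in t2 *.
set m := Num.max u 0 in t1 t2 *.
have m0 : 0 <= m by rewrite le_max lexx orbT.
have m1' : m <= 1 by rewrite ge_max ler01 andbT; exact: cutoff_arg.
have ab : `|a * b| <= 2 * a by rewrite normrM (ger0_norm a0) mulrC; apply: ler_wpM2r.
have sqb (w : R) : `|w| <= 2 * a -> (- (2 * w + a ^+ 2)) ^+ 2 <= 25 * a ^+ 2.
  move=> w2; have a2a : a ^+ 2 <= a by rewrite expr2 ler_piMr.
  have -> : 25 * a ^+ 2 = (5 * a) ^+ 2 by ring.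
  rewrite sqrrN -[leLHS]real_normK ?num_real//; apply: lerXn2r; rewrite ?nnegrE ?normr_ge0 ?(mulr_ge0 (ler0n R 5) a0)//.
  apply: le_trans (ler_normD _ _) _; rewrite normrM (ger0_norm (ler0n R 2)) (ger0_norm (sqr_ge0 a)); lra.
have q1 := sqb _ ab; have q2 : (- (2 * - (a * b) + a ^+ 2)) ^+ 2 <= 25 * a ^+ 2 by apply: sqb; rewrite normrN.
have ma : m * a ^+ 2 <= a ^+ 2 by rewrite ler_piMl ?sqr_ge0.
have ma0 : 0 <= m * a ^+ 2 by rewrite mulr_ge0 ?sqr_ge0.
have -> : m1 ^+ 2 + m2 ^+ 2 - 2 * m ^+ 2 = (m1 ^+ 2 - m ^+ 2 - 2 * m * - (2 * a * b + a ^+ 2)) +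
   (m2 ^+ 2 - m ^+ 2 - 2 * m * - (2 * - a * b + a ^+ 2)) - 4 * (m * a ^+ 2) by ring.
apply: le_trans (ler_normB _ _) _; apply: le_trans (lerD (ler_normD _ _) (lexx _)) _.
have n4 : `|4 * (m * a ^+ 2)| <= 4 * a ^+ 2 by rewrite ger0_norm; [apply: ler_wpM2l|apply: mulr_ge0].
have e1 : 2 * a * b = 2 * (a * b) by ring.
have e2 : 2 * - a * b = 2 * - (a * b) by ring.
by move: t1 t2 n4 q1 q2 ar; rewrite e1 e2; clear; lra.
Qed.

Lemma cutoff_cvg (x : pt) : (fun n : nat => cutoff n.+1%:R x) @ \oo --> (1 : R).
Proof.
have h : (fun n : nat => 1 - tnorm x ^+ 2 / n.+1%:R ^+ 2) @ \oo --> (1 : R).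
  rewrite -[X in _ --> X]subr0; apply: cvgB; first exact: cvg_cst.
  rewrite -[X in _ --> X](mulr0 (tnorm x ^+ 2)); apply: cvgM; first exact: cvg_cst.
  rewrite (_ : (fun _ => _) = fun n => n.+1%:R^-1 * n.+1%:R^-1); last first.
    by apply/funext => n; rewrite -invfM -expr2.
  by rewrite -[X in _ --> X](mulr0 0); apply: cvgM; exact: cvg_harmonic.
apply/cvgrPdist_lt => e e0; have e20 : 0 < e / 2 by rewrite divr_gt0.
have /cvgrPdist_lt/(_ _ e20) := h; apply: filterS => n /= hn.
have := pos_sqr_lip (cutoff_arg n.+1%:R x) (lexx 1); rewrite [X in X ^+ 2 - _](_ : _ = 1) ?expr1n; last by apply/max_idPl.
by move=> h2; apply: le_lt_trans h2 _; rewrite mulrC -ltr_pdivlMr.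
Qed.

End Cutoff.

Section IntegrationByParts.
Variables (R : realType) (d : nat) (al : R).
Hypothesis al0 : 0 < al.
Notation pt := (d.-tuple R).
Notation mu := (vol R d).
Notation sq := (sqint (vol R d)).
Notation ip := (ipm (vol R d)).
Implicit Types (f g : pt -> R).

Lemma C2_line f i (x : pt) s : (forall y, derivable (fun s => f (tshift y i s)) 0 1) ->
  is_derive s (1 : R) (fun s => f (tshift x i s)) (pd i f (tshift x i s)).
Proof.
move=> df; apply: is_derive_unshift.
have -> : (fun u => f (tshift x i (s + u))) = (fun u => f (tshift (tshift x i s) i u)).
  by apply/funext => u; rewrite tshiftD.
by apply: DeriveDef; [exact: df|rewrite /pd derive1E].
Qed.

Lemma C2_diff2 f i (x : pt) (c M e : R) : C2 f -> 0 <= e ->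
  (forall t, `|t| <= e -> `|pd i (pd i f) (tshift x i t) - c| <= M) ->
  `|diff2 i e f x - e ^+ 2 * c| <= 2 * M * e ^+ 2.
Proof.
move=> [_ [d1 [_ [d2 _]]]] e0 hM.
have := second_difference (fun y => C2_line x y (d1 i)) (fun y => C2_line x y (d2 i i)) hM e0.
by rewrite tshift0.
Qed.

Lemma C2_diff1 f i (x : pt) (M e : R) : C2 f -> 0 <= e ->
  (forall t, `|t| <= e -> `|pd i f (tshift x i t)| <= M) ->
  `|f (tshift x i e) - f x| <= M * e /\ `|f (tshift x i (- e)) - f x| <= M * e.
Proof.
move=> [_ [d1 _]] e0 hM.
by have := first_difference (fun y => C2_line x y (d1 i)) hM e0; rewrite tshift0.
Qed.

Let eps (n : nat) : R := n.+1%:R^-1.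

Lemma eps_gt0 n : 0 < eps n. Proof. by rewrite invr_gt0. Qed.
Lemma eps_le1 n : eps n <= 1. Proof. by rewrite invf_le1// ler1n. Qed.

Lemma C2_diff2_cvg f i x : C2 f -> (fun n => diff2 i (eps n) f x / eps n ^+ 2) @ \oo --> pd i (pd i f) x.
Proof.
move=> cf; have [_ [_ [_ [_ c2]]]] := cf; apply/cvgrPdist_lt => e e0.
have e4 : 0 < e / 4 by rewrite divr_gt0.
have [del [d0 hd]] := c2 i i x _ e4.
have /cvgrPdist_lt/(_ _ d0) := @cvg_harmonic R; apply: filterS => n /=.
rewrite sub0r normrN gtr0_norm ?invr_gt0// -/(eps n) => nd.
have p0 := eps_gt0 n; have p2 : 0 < eps n ^+ 2 by rewrite exprn_gt0.
have h : `|diff2 i (eps n) f x - eps n ^+ 2 * pd i (pd i f) x| <= 2 * (e / 4) * eps n ^+ 2.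
  apply: C2_diff2 => //; first exact: ltW.
  by move=> t tn; apply/ltW/hd; rewrite tshift_dist; exact: le_lt_trans nd.
rewrite distrC -(ltr_pM2r p2); apply: le_lt_trans (_ : 2 * (e / 4) * eps n ^+ 2 < _); last first.
  by rewrite ltr_pM2r//; lra.
apply: le_trans h; rewrite -[X in _ * X]gtr0_norm// -normrM mulrBl divfK ?gt_eqF//.
by rewrite [X in _ - X]mulrC.
Qed.

Lemma measurable_pd2 f i : C2 f -> measurable_fun [set: pt] f -> measurable_fun [set: pt] (pd i (pd i f)).
Proof.
move=> cf mf; apply: (measurable_fun_cvg (h := fun n x => diff2 i (eps n) f x / eps n ^+ 2)).
  move=> n; apply: measurable_funM => //; apply: measurable_funB.
    by apply: measurable_funD; apply: (measurableT_comp mf); exact: measurable_tshift.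
  exact: measurable_funM.
by move=> x _; exact: C2_diff2_cvg.
Qed.

Lemma polygs_bound (p : 'I_d -> {poly R}) : exists2 K, 0 <= K & forall x i t, `|t| <= 1 ->
  `|polygs al 1 p (tshift x i t)| <= K * wgt (al / 4) x.
Proof.
have /choice[K1 HK1] : forall i, exists K, 0 <= K /\ forall x t, `|t| <= 1 -> `|(p i).[x + t] * gs al (x + t)| <= K * gs (al / 4) x.
  by move=> i; have [K] := shifted_gs_bound al0 (p i); exists K.
have [K K0 HK] := sum_ub (fun i => proj1 (HK1 i)).
exists (K ^+ d); first exact: exprn_ge0.
move=> x i t t1; rewrite /polygs mul1r; apply: prod_bound => // j.
rewrite tnth_mktuple; have [K10 H] := HK1 j.
have l : K1 j * gs (al / 4) (tnth x j) <= K * gs (al / 4) (tnth x j) by apply: ler_wpM2r => //; exact: gs_ge0.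
apply: le_trans l; case: ifP => _; first exact: H.
by have := H (tnth x j) 0; rewrite addr0 normr0; apply; exact: ler01.
Qed.

Lemma psi_bounds b i : exists2 K, 0 <= K & forall (x : pt) t, `|t| <= 1 ->
  [/\ `|psi al b (tshift x i t)| <= K * wgt (al / 4) x,
      `|pd i (psi al b) (tshift x i t)| <= K * wgt (al / 4) x &
      `|pd i (pd i (psi al b)) (tshift x i t)| <= K * wgt (al / 4) x].
Proof.
have E : psi al b = polygs al 1 (fun i => hpoly al (b i)) :> (pt -> R) by apply/funext => y; rewrite /polygs mul1r.
rewrite E !pd_polygs.
have [K0 K00 H0] := polygs_bound (fun i => hpoly al (b i)).
have [K1 K10 H1] := polygs_bound (updp (fun i => hpoly al (b i)) i (dgs al (hpoly al (b i)))).
set p2 := updp _ _ (dgs al _) in H1 *.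
have [K2 K20 H2] := polygs_bound (updp p2 i (dgs al (p2 i))).
exists (K0 + K1 + K2); first by rewrite !addr_ge0.
move=> x t t1; have w0 : 0 <= wgt (al / 4) x by apply: prodr_ge0 => j _; exact: gs_ge0.
have := H0 x i t t1; have := H1 x i t t1; have := H2 x i t t1.
have := mulr_ge0 K00 w0; have := mulr_ge0 K10 w0; have := mulr_ge0 K20 w0.
by move=> *; split; lra.
Qed.

Lemma product_diff2 i e f g (x : pt) : diff2 i e (fun y => f y * g y) x =
  g x * diff2 i e f x + (f x * diff2 i e g x +
  (f (tshift x i e) - f x) * (g (tshift x i e) - g x) +
  (f (tshift x i (- e)) - f x) * (g (tshift x i (- e)) - g x)).
Proof. by rewrite /diff2; ring. Qed.

(** Nothing is known about the derivatives of [f] at infinity. Second differences are therefore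
    moved onto [psi * cutoff] before the step tends to 0; every term that differences the cut-off is
    of order [1 / r] with a Gaussian weight. *)
Lemma cutoff_ibp f b i : C2 f -> sq f -> exists2 C, 0 <= C & forall r, 1 <= r ->
  `|\int[mu]_x (pd i (pd i f) x * (psi al b x * cutoff r x)) -
    \int[mu]_x (f x * (cutoff r x * pd i (pd i (psi al b)) x))| <= C / r.
Proof.
move=> cf sf; have [K K0 HK] := psi_bounds b i.
have sw : sq (wgt (d := d) (al / 4)) by apply: wgt_sq; rewrite divr_gt0.
have cp := @C2_psi R d al b; have sp : sq (psi al b) := psi_sq al0 b.
have [mf _] := sf; have [mp _] := sp.
have nf : sq (fun x => `|f x|).
  split; first exact: measurableT_comp.
  by have [_ iF] := sf; apply: eq_integrable iF => // y _; rewrite /= real_normK ?num_real.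
have iw := sqint_mul nf sw.
have I0 : 0 <= ip (fun x => `|f x|) (wgt (al / 4)).
  by apply: Rintegral_ge0 => y _; rewrite mulr_ge0//; apply: prodr_ge0 => j _; exact: gs_ge0.
(* [74 = 54 + 10 + 10]: the second difference of the cut-off and two products of first differences,
   from [product_diff2]. *)
exists (74 * K * ip (fun x => `|f x|) (wgt (al / 4))); first by rewrite !mulr_ge0.
move=> r r1; have r0 : 0 < r by lra.
have sc := cutoff_sq d r0.
have w0 (x : pt) : 0 <= wgt (al / 4) x by apply: prodr_ge0 => j _; exact: gs_ge0.
have psiw x : `|psi al b x| <= K * wgt (al / 4) x.
  by have := HK x 0; rewrite normr0 tshift0 => /(_ ler01)[].
pose g x := psi al b x * cutoff r x.
have sg : sq g.
  apply: (@sqint_dom _ _ _ mu g (psi al b)) => //; first by apply: measurable_funM => //; exact: measurable_cutoff.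
  by move=> x; rewrite /g normrM (ger0_norm (cutoff_ge0 _ _)) ler_piMr ?normr_ge0 ?cutoff_le1.
pose A n := \int[mu]_x (diff2 i (eps n) f x / eps n ^+ 2 * g x).
pose B n := \int[mu]_x (f x * (cutoff r x * (diff2 i (eps n) (psi al b) x / eps n ^+ 2))).
have p2 n : 0 < eps n ^+ 2 by rewrite exprn_gt0// eps_gt0.
have scaled h : sq h -> forall n, sq (fun x => diff2 i (eps n) h x / eps n ^+ 2).
  move=> sh n; have := sqintZ (eps n ^+ 2)^-1 (diff2_sq i (eps n) sh).
  by congr (sqint _ _); apply/funext => x; rewrite mulrC.
have bnd h x M n : C2 h -> (forall t, `|t| <= eps n -> `|pd i (pd i h) (tshift x i t)| <= M) ->
    `|diff2 i (eps n) h x / eps n ^+ 2| <= 2 * M.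
  move=> ch hM; rewrite normrM normfV (gtr0_norm (p2 n)) ler_pdivrMr//.
  have := @C2_diff2 h i x 0 M (eps n) ch (ltW (eps_gt0 n)).
  by rewrite mulr0 subr0; apply => t tn; rewrite subr0; exact: hM.
have cA : A @ \oo --> \int[mu]_x (pd i (pd i f) x * g x).
  have [_ [_ [_ [_ c2]]]] := cf; have [M HM] := tcont_bounded (r + 1) (c2 i i).
  have sg1 : sq (fun x => `|g x|).
    split; first by apply: measurableT_comp => //; case: sg.
    by have [_ iF] := sg; apply: eq_integrable iF => // y _; rewrite /= real_normK ?num_real.
  apply: (@dominated_cvg_real _ _ _ mu _ _ (fun x => 2 * (`|M| * expR (r ^+ 2)) * (wgt 1 x * `|g x|))).
  - move=> n; apply: measurable_funM; [by have [] := scaled f sf n|by case: sg].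
  - by apply: measurable_funM; [exact: measurable_pd2|case: sg].
  - by move=> x; apply: cvgM; [exact: C2_diff2_cvg|exact: cvg_cst].
  - move=> n x; have [lt|le] := ltP (tnorm x) r; last first.
      by rewrite /g cutoff_eq0// !mulr0 normr0 !mulr0.
    rewrite normrM [X in _ <= X]mulrA; apply: ler_wpM2r => //.
    have M0 : 0 <= `|M| by [].
    have ww : 1 <= expR (r ^+ 2) * wgt 1 x.
      rewrite /wgt gauss_prod mul1r -expRD -expR0 ler_expR subr_ge0.
      by rewrite lerXn2r ?nnegrE ?tnorm_ge0// ltW.
    apply: le_trans (bnd f x `|M| n cf _) _; last first.
      by have := ler_wpM2l M0 ww; rewrite mulr1 !mulrA -!(mulrA 2); lra.
    move=> t tn; apply: le_trans (ler_norm M); apply: HM; apply: le_trans (tshift_norm _ _ _) _.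
    by have := eps_le1 n; lra.
  - have := integrableZl measurableT (2 * (`|M| * expR (r ^+ 2))) (sqint_mul (wgt_sq d (@ltr01 R)) sg1).
    by apply: eq_integrable.
have cB : B @ \oo --> \int[mu]_x (f x * (cutoff r x * pd i (pd i (psi al b)) x)).
  apply: (@dominated_cvg_real _ _ _ mu _ _ (fun x => 2 * K * (`|f x| * wgt (al / 4) x))).
  - move=> n; apply: measurable_funM => //; apply: measurable_funM; first exact: measurable_cutoff.
    by have [] := scaled _ sp n.
  - apply: measurable_funM => //; apply: measurable_funM; first exact: measurable_cutoff.
    exact: measurable_pd2.
  - move=> x; apply: cvgM; first exact: cvg_cst.
    by apply: cvgM; [exact: cvg_cst|exact: C2_diff2_cvg].
  - move=> n x; rewrite 2!normrM (ger0_norm (cutoff_ge0 _ _)).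
    have h : `|diff2 i (eps n) (psi al b) x / eps n ^+ 2| <= 2 * (K * wgt (al / 4) x).
      by apply: bnd => // t tn; have [] := HK x t (le_trans tn (eps_le1 n)).
    have := ler_pM (cutoff_ge0 r x) (normr_ge0 _) (cutoff_le1 r x) h.
    by rewrite mul1r => h2; have := ler_wpM2l (normr_ge0 (f x)) h2; lra.
  - by have := integrableZl measurableT (2 * K) iw; apply: eq_integrable.
have AB n : `|A n - B n| <= 74 * K * ip (fun x => `|f x|) (wgt (al / 4)) / r.
  have e0 := eps_gt0 n; have e1 := eps_le1 n.
  have gc : sq (fun x => cutoff r x * (diff2 i (eps n) (psi al b) x / eps n ^+ 2)).
    apply: (@sqint_dom _ _ _ mu _ (fun x => diff2 i (eps n) (psi al b) x / eps n ^+ 2)).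
    - by apply: measurable_funM; [exact: measurable_cutoff|have [] := scaled _ sp n].
    - by move=> x; rewrite normrM (ger0_norm (cutoff_ge0 _ _)) ler_piMl ?normr_ge0 ?cutoff_le1.
    - exact: scaled.
  have AE : A n = ip (fun x => diff2 i (eps n) g x / eps n ^+ 2) f.
    transitivity ((eps n ^+ 2)^-1 * ip (diff2 i (eps n) f) g).
      rewrite -ipmZ//; last exact: diff2_sq.
      by apply: eq_Rintegral => x _; rewrite (mulrC _ (_^-1)).
    rewrite diff2_sym// ipmC -ipmZ//; last exact: diff2_sq.
    by apply: eq_Rintegral => x _; rewrite (mulrC _ (_^-1)).
  have BE : B n = ip (fun x => cutoff r x * (diff2 i (eps n) (psi al b) x / eps n ^+ 2)) f by rewrite ipmC.
  rewrite AE BE -ipmB//; last exact: scaled.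
  have sD : sq (fun x => diff2 i (eps n) g x / eps n ^+ 2 - cutoff r x * (diff2 i (eps n) (psi al b) x / eps n ^+ 2)).
    by apply: sqintB => //; exact: scaled.
  apply: le_trans (le_normr_Rintegral measurableT (sqint_mul sD sf)) _.
  have -> : 74 * K * ip (fun x => `|f x|) (wgt (al / 4)) / r = \int[mu]_x (74 * K / r * (`|f x| * wgt (al / 4) x)).
    by rewrite RintegralZl// -/(ip _ _) mulrAC.
  apply: le_Rintegral => //.
  - by have := integrable_norm (sqint_mul sD sf); apply: eq_integrable.
  - by have := integrableZl measurableT (74 * K / r) iw; apply: eq_integrable.
  move=> x _; rewrite normrM mulrC [X in _ <= X]mulrCA; apply: ler_wpM2l => //.
  rewrite (mulrA (cutoff r x)) -mulrBl normrM normfV (gtr0_norm (p2 n)) ler_pdivrMr//.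
  rewrite /g product_diff2 addrC addKr.
  have [t1 t2] := C2_diff1 cp (ltW e0) (fun t tn => let: And3 _ h _ := HK x t (le_trans tn e1) in h).
  have en : `|eps n| <= 1 by rewrite gtr0_norm.
  have eN : `|- eps n| <= 1 by rewrite normrN.
  have c1 := cutoff_diff x i r1 en; have c2 := cutoff_diff x i r1 eN.
  rewrite normrN in c2; rewrite (gtr0_norm e0) in c1 c2.
  have c3 : `|diff2 i (eps n) (cutoff r) x| <= 54 * (eps n ^+ 2 / r) by apply: cutoff_diff2; rewrite ?(ltW e0).
  apply: le_trans (ler_normD _ _) _; apply: le_trans (lerD (ler_normD _ _) (lexx _)) _; rewrite 3!normrM.
  have := ler_pM (normr_ge0 _) (normr_ge0 _) (psiw x) c3.
  have := ler_pM (normr_ge0 _) (normr_ge0 _) t1 c1.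
  have := ler_pM (normr_ge0 _) (normr_ge0 _) t2 c2.
  have -> : K * wgt (al / 4) x * (54 * (eps n ^+ 2 / r)) = 54 * (K / r * wgt (al / 4) x * eps n ^+ 2) by ring.
  have -> : K * wgt (al / 4) x * eps n * (10 * (eps n / r)) = 10 * (K / r * wgt (al / 4) x * eps n ^+ 2) by ring.
  have -> : 74 * K / r * wgt (al / 4) x * eps n ^+ 2 = 74 * (K / r * wgt (al / 4) x * eps n ^+ 2) by ring.
  by clear; lra.
apply: (ler_cvg_to (cvg_norm (cvgB cA cB)) (cvg_cst (74 * K * ip (fun x => `|f x|) (wgt (al / 4)) / r))).
by apply: nearW => n; exact: AB.
Qed.

End IntegrationByParts.

(** * Eigenvalues of the Schrodinger operator *)

Section SchrodingerEigenvalues.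
Variables (R : realType) (d : nat) (al be : R).
Hypotheses (al0 : 0 < al) (be0 : 0 < be).
Notation pt := (d.-tuple R).
Notation mu := (vol R d).
Notation sq := (sqint (vol R d)).
Notation ip := (ipm (vol R d)).
Notation rho := (@gauss R d al be).
Notation one := (fun _ : pt => 1 : R).
Implicit Types (f g : pt -> R).

Lemma L2_oneP f : L2 one f <-> sq f.
Proof.
have E : (fun x => (1 * f x ^+ 2)%:E) = (fun x => (f x ^+ 2)%:E) :> (pt -> \bar R).
  by apply/funext => x; rewrite mul1r.
split=> -[mf f2]; split => //.
  move: f2; rewrite E leb_intE; last 2 first.
  - by apply/measurable_EFinP; exact: measurable_funX.
  - by move=> x; rewrite lee_fin sqr_ge0.
  move=> f2; apply/integrableP; split; first by apply/measurable_EFinP; exact: measurable_funX.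
  by under eq_integral do rewrite /= ger0_norm ?sqr_ge0//.
by rewrite E leb_intE; [rewrite -ipmE ?ltry|apply/measurable_EFinP; exact: measurable_funX|move=> x; rewrite lee_fin sqr_ge0].
Qed.

Lemma ae_zero_oneP f : measurable_fun [set: pt] f -> ae_zero one f <-> {ae mu, forall x, f x = 0}.
Proof.
move=> mf; have mE : measurable_fun [set: pt] (EFin \o f) by exact/measurable_EFinP.
have E : (fun x => (1 * `|f x|)%:E) = (fun x => (`|f x|)%:E) :> (pt -> \bar R).
  by apply/funext => x; rewrite mul1r.
rewrite /ae_zero E leb_intE; last 2 first.
- by apply/measurable_EFinP; exact: measurableT_comp.
- by move=> x; rewrite lee_fin.
have := ae_eq_integral_abs mu measurableT mE; rewrite /= => H.
split=> [/H|h]; first by apply: filterS => x /(_ I)[].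
by apply/H; apply: filterS h => x fx _ /=; rewrite fx.
Qed.

Lemma ae_zero_sq f : sq f -> ae_zero one f <-> ip f f = 0.
Proof.
move=> sf; have [mf _] := sf; split.
  move/(ae_zero_oneP mf) => a; rewrite /ipm /Rintegral (ae_eq_integral (cst 0%E))//= ?integral0//.
    by apply/measurable_EFinP; exact: measurable_funM.
  by apply: filterS a => x -> _; rewrite /= mulr0.
move/(ipm_eq0 sf) => h; have E : (fun x => (1 * `|f x|)%:E) = (fun x => (`|f x|)%:E) :> (pt -> \bar R).
  by apply/funext => x; rewrite mul1r.
by rewrite /ae_zero E leb_intE//; apply/measurable_EFinP; exact: measurableT_comp.
Qed.

Lemma tcont_cutoff_sq (F : pt -> R) r : 0 < r -> tcont F -> measurable_fun [set: pt] F ->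
  sq (fun x => F x * cutoff r x).
Proof.
move=> r0 cF mF; have [M HM] := tcont_bounded r cF; have sw := wgt_sq d (@ltr01 R).
apply: (@sqint_dom _ _ _ mu _ (fun x => `|M| * expR (r ^+ 2) * wgt 1 x)); last exact: sqintZ.
  by apply: measurable_funM => //; exact: measurable_cutoff.
move=> x; have w0 : 0 <= wgt 1 x by apply: prodr_ge0 => j _; exact: gs_ge0.
rewrite [X in _ <= X]ger0_norm; last by rewrite mulr_ge0// mulr_ge0// expR_ge0.
have [lt|le] := ltP (tnorm x) r; last by rewrite cutoff_eq0// mulr0 normr0 !mulr_ge0// expR_ge0.
rewrite normrM (ger0_norm (cutoff_ge0 _ _)) -mulrA; apply: ler_pM => //; first exact: cutoff_ge0.
  by apply: le_trans (ler_norm M); apply: HM; exact: ltW.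
apply: le_trans (cutoff_le1 _ _) _; rewrite /wgt gauss_prod mul1r -expRD -expR0 ler_expR subr_ge0.
by rewrite lerXn2r ?nnegrE ?tnorm_ge0// ltW.
Qed.

(** The potential cancels between [f] and [psi al b]. What remains is [lev al b - m] times a
    truncated scalar product, equal to a sum of integration by parts errors that vanish as the
    cut-off radius grows. *)
Lemma eigenfunction_orth f b (m : R) : C2 f -> sq f -> ae_zero one (fun x => Lrho rho f x - m * f x) ->
  (lev al b - m) * ip f (psi al b) = 0.
Proof.
move=> cf sf ae; have [mf _] := sf; have sp := psi_sq al0 b; have [mp _] := sp.
have cp := @C2_psi R d al b.
have mq : measurable_fun [set: pt] (qpot al : pt -> R).
  apply: measurable_funB => //; apply: measurable_funM => //; apply: measurable_funX; exact: measurable_tnorm.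
have ml : measurable_fun [set: pt] (lap f) by apply: measurable_sum => i; exact: measurable_pd2.
have {}ae : {ae mu, forall x, lap f x = (qpot al x - m) * f x}.
  have mL : measurable_fun [set: pt] (fun x => Lrho rho f x - m * f x).
    under eq_fun do rewrite LrhoE//.
    apply: measurable_funB; last exact: measurable_funM.
    by apply: measurable_funD; [exact: measurableT_comp|exact: measurable_funM].
  have /(ae_zero_oneP mL) := ae; apply: filterS => x; rewrite LrhoE// => h.
  by move: h; move: (lap f x) (qpot al x) => u v; lra.
have lapp x : \sum_i pd i (pd i (psi al b)) x = (qpot al x - lev al b) * psi al b x.
  have := @lap_psi R d al 1 b x; rewrite /lap mul1r => <-.
  by apply: eq_bigr => i _; congr (pd i (pd i _) x); apply/funext => y; rewrite mul1r.
have /choice[C HC] : forall i, exists C, 0 <= C /\ forall r, 1 <= r ->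
  `|\int[mu]_x (pd i (pd i f) x * (psi al b x * cutoff r x)) -
    \int[mu]_x (f x * (cutoff r x * pd i (pd i (psi al b)) x))| <= C / r.
  by move=> i; have [C C0 H] := cutoff_ibp al0 b i cf sf; exists C.
pose J n := \int[mu]_x (f x * psi al b x * cutoff n.+1%:R x).
have cJ : J @ \oo --> ip f (psi al b).
  apply: (@dominated_cvg_real _ _ _ mu _ _ (fun x => `|f x * psi al b x|)).
  - by move=> n; apply: measurable_funM; [exact: measurable_funM|exact: measurable_cutoff].
  - exact: measurable_funM.
  - by move=> x; rewrite -[X in _ --> X]mulr1; apply: cvgM; [exact: cvg_cst|exact: cutoff_cvg].
  - move=> n x; rewrite normrM (ger0_norm (cutoff_ge0 _ _)).
    by rewrite ler_piMr ?normr_ge0 ?cutoff_le1.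
  - by have := integrable_norm (sqint_mul sf sp); apply: eq_integrable.
have key n : `|(lev al b - m) * J n| <= (\sum_i C i) * n.+1%:R^-1.
  have r1 : 1 <= n.+1%:R :> R by rewrite ler1n.
  have r0 : 0 < n.+1%:R :> R by [].
  set r : R := n.+1%:R in r1 r0 *.
  have [_ [_ [_ [_ cf2]]]] := cf; have [_ [_ [_ [_ cp2]]]] := cp; have [cp0 _] := cp.
  have sfc i : sq (fun x => pd i (pd i f) x * cutoff r x) by apply: tcont_cutoff_sq => //; exact: measurable_pd2.
  have spc i : sq (fun x => pd i (pd i (psi al b)) x * cutoff r x) by apply: tcont_cutoff_sq => //; exact: measurable_pd2.
  pose Q c x := (qpot al x - c) * psi al b x * cutoff r x.
  have sQ c : sq (Q c).
    have -> : Q c = fun x => (\sum_i pd i (pd i (psi al b)) x + (lev al b - c) * psi al b x) * cutoff r x.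
      by apply/funext => x; rewrite lapp /Q; ring.
    apply: tcont_cutoff_sq => //.
      by apply: tcontD; [exact: tcont_sum|apply: tcontM => //; exact: tcont_cst].
    apply: measurable_funD; last exact: measurable_funM.
    by apply: measurable_sum => i; exact: measurable_pd2.
  have EU : \sum_i \int[mu]_x (pd i (pd i f) x * (psi al b x * cutoff r x)) = ip (Q m) f.
    transitivity (\sum_i ip (fun x => pd i (pd i f) x * cutoff r x) (psi al b)).
      by apply: eq_bigr => i _; apply: eq_Rintegral => x _; ring.
    rewrite -(ipm_sum _ sfc sp) /ipm /Rintegral; congr fine; apply: ae_eq_integral => //.
    - apply/measurable_EFinP; apply: measurable_funM => //.
      by have [] := sqint_sum (index_enum _) sfc.
    - by apply/measurable_EFinP; apply: measurable_funM => //; have [] := sQ m.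
    apply: filterS ae => x e _; congr EFin; rewrite -mulr_suml /Q.
    by rewrite -[\sum_i _]/(lap f x) e; ring.
  have EW : \sum_i \int[mu]_x (f x * (cutoff r x * pd i (pd i (psi al b)) x)) = ip (Q (lev al b)) f.
    transitivity (\sum_i ip (fun x => pd i (pd i (psi al b)) x * cutoff r x) f).
      by apply: eq_bigr => i _; apply: eq_Rintegral => x _; ring.
    rewrite -(ipm_sum _ spc sf); apply: eq_Rintegral => x _.
    by rewrite -mulr_suml lapp.
  have -> : (lev al b - m) * J n = \sum_i (\int[mu]_x (pd i (pd i f) x * (psi al b x * cutoff r x)) -
      \int[mu]_x (f x * (cutoff r x * pd i (pd i (psi al b)) x))).
    rewrite sumrB EU EW -ipmB// /J.
    have sc : sq (fun x => psi al b x * cutoff r x) by apply: tcont_cutoff_sq.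
    rewrite -RintegralZl//; last by have := sqint_mul sf sc; apply: eq_integrable => // x _ /=; rewrite mulrA.
    by apply: eq_Rintegral => x _; rewrite /Q -/r; ring.
  apply: le_trans (ler_norm_sum _ _ _) _; rewrite mulr_suml; apply: ler_sum => i _.
  by have [_ H] := HC i; exact: H.
have c1 : (fun n => `|(lev al b - m) * J n|) @ \oo --> `|(lev al b - m) * ip f (psi al b)|.
  by apply: cvg_norm; apply: cvgM => //; exact: cvg_cst.
have c2 : (fun n => (\sum_i C i) * n.+1%:R^-1) @ \oo --> (\sum_i C i) * 0.
  by apply: cvgM; [exact: cvg_cst|exact: cvg_harmonic].
apply/eqP; rewrite -normr_le0 -(mulr0 (\sum_i C i)); apply: (ler_cvg_to c1 c2).
by apply: nearW => n; exact: key.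
Qed.

(** Hermite functions of degree at most [n + 1] show that the value is attained. Below it, a
    combination of the [k + 1 > ndeg n] eigenfunctions is orthogonal to degrees up to [n] by a
    dimension count and to higher degrees by [eigenfunction_orth], so completeness makes it null. *)
Theorem muL_eq n k : (ndeg d n <= k)%N -> (k < ndeg d n.+1)%N -> muL rho k = 4 * al * n.+1%:R.
Proof.
move=> nk kn; have a0 := al0.
pose S := [set t | ev_count_ge one (fun f => L2 one f /\ C2 f) (Lrho rho) [set s | s <= t] k.+1].
have Sin : S (4 * al * n.+1%:R).
  pose bb (i : 'I_k.+1) : 'I_d -> nat := bval (enum_val (widen_ord kn i)).
  have bi : injective bb.
    move=> i j e; have : enum_val (widen_ord kn i) = enum_val (widen_ord kn j).
      by apply/ffunP => l; apply: val_inj; exact: (congr1 (@^~ l) e).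
    by move/enum_val_inj/(congr1 val) => /= h; exact: val_inj.
  exists (fun i => psi al (bb i)), (fun i => lev al (bb i)); split.
    move=> i; split; first by split; [apply/L2_oneP; exact: psi_sq|exact: C2_psi].
    split.
      rewrite /= /lev ler_pM2l ?mulr_gt0// ler_nat.
      by have := enum_valP (widen_ord kn i); rewrite inE.
    have -> : (fun x => Lrho rho (psi al (bb i)) x - lev al (bb i) * psi al (bb i) x) = (fun=> 0).
      by apply/funext => x; rewrite Lrho_psi// subrr.
    by apply/ae_zero_sq; [exact: sqint0|exact: ipm0].
  move=> c; have sS : sq (fun x => \sum_(i < k.+1) c i * psi al (bb i) x).
    by apply: sqint_sum => i; apply: sqintZ; exact: psi_sq.
  move/(ae_zero_sq sS); rewrite psi_comb_norm// => h i.
  have p0 j : 0 <= c j ^+ 2 * psi2 al (bb j) by rewrite mulr_ge0 ?sqr_ge0// ltW// psi2_gt0.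
  have := psumr_eq0P (fun j _ => p0 j) h; move=> /(_ i isT)/eqP.
  by rewrite mulf_eq0 (gt_eqF (psi2_gt0 al0 _)) orbF sqrf_eq0 => /eqP.
have Slb t : S t -> 4 * al * n.+1%:R <= t.
  move=> [f [lam [fP fi]]]; rewrite leNgt; apply/negP => lt.
  have sf i : sq (f i) by apply/L2_oneP; have [[]] := fP i.
  have cf i : C2 (f i) by have [[]] := fP i.
  have [c [[i0 ci0] cL]] := kernel_combination
    (fun (i : 'I_k.+1) (j : 'I_(ndeg d n)) => ip (f i) (psi al (bval (enum_val j)))) (nk : (_ < k.+1)%N).
  pose G x := \sum_(i < k.+1) c i * f i x.
  have sG : sq G by apply: sqint_sum => i; exact: sqintZ.
  have GE b : ip G (psi al b) = \sum_i c i * ip (f i) (psi al b).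
    rewrite ipm_sum; [|by move=> i; exact: sqintZ|exact: psi_sq].
    by apply: eq_bigr => i _; rewrite ipmZ//; exact: psi_sq.
  have G0 b : ip (psi al b) G = 0.
    rewrite ipmC GE; have [bn|bn] := leqP (\sum_i b i) n.
      have [b' b'n ->] := mem_multi_index bn.
      have := cL (enum_rank_in b'n b'); rewrite enum_rankK_in//.
    apply: big1 => i _; have [_ [le ae]] := fP i.
    have := eigenfunction_orth b (cf i) (sf i) ae => /eqP; rewrite mulf_eq0 => /orP[|/eqP -> //]; last by rewrite mulr0.
    (* Equality is impossible: [lev al b] is at least [4 * al * n.+1%:R] for degrees above [n],
       while the eigenvalue is at most [t], which is smaller. *)
    rewrite subr_eq0 => /eqP e; exfalso.
    have : 4 * al * n.+1%:R <= lev al b by rewrite /lev ler_pM2l ?mulr_gt0// ler_nat.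
    by rewrite e => /le_trans/(_ le)/(lt_le_trans lt); rewrite ltxx.
  have cG : tcont G by apply: tcont_sum => i; apply: tcontM; [exact: tcont_cst|case: (cf i)].
  have GG := hermite_complete al0 cG sG G0.
  have := fi c; rewrite -/G => /(_ _ i0) h.
  by move/eqP: ci0; apply; apply: h; apply/(ae_zero_sq sG).
rewrite /muL -/S; apply/eqP; rewrite eq_le; apply/andP; split.
  by apply: (ge_inf _ Sin); exists (4 * al * n.+1%:R) => t /Slb.
by apply: lb_le_inf; [exists (4 * al * n.+1%:R)|move=> t /Slb].
Qed.

End SchrodingerEigenvalues.

(** * Matching the two spectra level by level *)

Lemma ndeg_bracket d k : (0 < d)%N -> (0 < k)%N -> exists n, (ndeg d n <= k)%N /\ (k < ndeg d n.+1)%N.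
Proof.
move=> d0 k0; have ex : exists n, (k < ndeg d n)%N by exists k; exact: ndeg_gt.
have [[|n] kn least] := find_ex_minn ex.
  move: kn; rewrite ndeg0 => kn; exfalso.
  have : (#|level d 0| <= 1)%N.
    apply: leq_trans (max_card _) _; by rewrite card_ffun !card_ord exp1n.
  by move/(leq_trans kn); rewrite ltnS leqNgt k0.
exists n; split => //; rewrite leqNgt; apply/negP => /least; by rewrite ltnn.
Qed.

Theorem theorem1p2 (R : realType) (d : nat) (alpha beta : R) :
  (1 <= d)%N -> 0 < alpha -> 0 < beta ->
  leb_int (fun x : d.-tuple R => (gauss alpha beta x)%:E) = 1%:E ->
  (forall h : R, 0 < h -> compact_op (nu_w (@gauss R d alpha beta) h) (Th (@gauss R d alpha beta) h))
  /\
  (forall K : nat, exists C h0 : R, 0 < C /\ 0 < h0 /\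
     forall h : R, 0 < h <= h0 -> forall k : nat, (1 <= k <= K)%N ->
       `|1 - (2 * (d%:R + 2))^-1 * muL (@gauss R d alpha beta) k * h ^+ 2
          - lamT (@gauss R d alpha beta) h k| <= C * h ^+ 4)
  /\
  (exists delta0 C h0 : R, 0 < delta0 /\ 0 < C /\ 0 < h0 /\
     forall h lam : R, 0 < h <= h0 -> 0 <= lam <= delta0 ->
       NT_le (@gauss R d alpha beta) h lam (C * (1 + lam / h ^+ 2) ^+ d)).
Proof.
move=> d0 al0 be0 _; split; first by move=> h h0; exact: Th_compact.
split; last first.
  have [de [Cw [h1 [de0 Cw0 h10 H]]]] := weyl_count d al0.
  exists de, Cw, h1; split => //; split => //; split => // h lam /andP[h0 hh] lamde n.
  move=> /(ev_count_eigvec d al0 be0 h0)[F [ev [FP Fi]]].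
  apply: (H h h0 hh lam lamde n F ev) => // i; have [/= /andP[] // _] := FP i.
(* The constants depend on the level; induction on [K] makes them uniform, adding the constants and
   taking the smaller threshold. *)
elim=> [|K [C [h1 [C0 [h10 IH]]]]].
  by exists 1, 1; split => //; split => // h _ k /andP[k1]; rewrite leqNgt k1.
have [n [nk kn]] := ndeg_bracket d0 (ltn0Sn K).
have [C' C'0 [h1' h1'0 H]] := lamT_asymptotics al0 be0 nk kn.
exists (C + C'), (Num.min h1 h1'); split; first exact: addr_gt0.
split; first by rewrite lt_min h10 h1'0.
move=> h /andP[h0]; rewrite le_min => /andP[hh hh'] k /andP[k1].
have h4 : 0 <= h ^+ 4 by rewrite exprn_ge0// ltW.
rewrite [leRHS]mulrDl leq_eqVlt => /orP[/eqP ->|kK].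
  have := H h h0 hh'; rewrite (muL_eq al0 be0 nk kn) /tau /cst_c [X in 1 - X]mulrAC => h2.
  by apply: le_trans h2 _; rewrite lerDr mulr_ge0// ltW.
have := IH h _ k; rewrite h0 hh k1 => /(_ isT kK) h2.
by apply: le_trans h2 _; rewrite lerDl mulr_ge0// ltW.
Qed.
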